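(* Fix $0<\alpha<1$ and let $H\in C^1_K((0,\infty))$. Then, for all $\ell\ge1$, $$\limsup_{\delta\to0}\limsup_{T\to\infty}\frac{\log T}{T}\log\mathbb P_\alpha\big[W^H_{T,\delta}\ge\ell\big]\le-(\ell-1),$$ where $$W^H_{T,\delta}=2\pi\Big\{-\int_{\mathbb R_+}H'(r)\,\bar\mu^T(\psi_{r,\delta})\,dr-2\int_{\mathbb R_+}H(r)^2\,\sigma\big(\overline m_{\delta,T}(r)\big)\,dr\Big\},$$ and $\overline m_{\delta,T}(r)=\bar\mu^T(\psi_{r,\delta})$ if $r<1/2$, $\overline m_{\delta,T}(r)=\alpha$ if $r\ge1/2$.
   Context: Process. For $T>1$, the speeded-up symmetric simple exclusion process on $\mathbb Z^2$ is the continuous-time Markov process $(\eta_s)_{s\ge0}$ on $\{0,1\}^{\mathbb Z^2}$ whose generator acts on functions $f$ depending on finitely many coordinates as $(L_Tf)(\eta)=\frac T2\sum_{j=1}^2\sum_{x\in\mathbb Z^2}\{f(\sigma^{x,x+e_j}\eta)-f(\eta)\}$, where $\{e_1,e_2\}$ is the canonical basis of $\mathbb R^2$ and $\sigma^{x,y}\eta$ is obtained from $\eta$ by exchanging $\eta(x)$ and $\eta(y)$. $\nu_\alpha$ is the Bernoulli product measure on $\{0,1\}^{\mathbb Z^2}$ with $\nu_\alpha\{\eta(x)=1\}=\alpha$ for all $x$. $\mathbb P_\alpha=\mathbb P_{T,\alpha}$ is the law on $D(\mathbb R_+,\{0,1\}^{\mathbb Z^2})$ (right-continuous paths with left limits,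 Skorohod topology) of the process with generator $L_T$ started from $\nu_\alpha$. Polar empirical measure. $\mathbb Z^2_*=\mathbb Z^2\setminus\{0\}$, $|x|$ is the Euclidean norm, $\sigma_T(x)=\log|x|/\log T$ for $x\in\mathbb Z^2_*$. For a configuration $\eta$, $\mu^{1,T}(\eta)=\frac1{2\pi\log T}\sum_{x\in\mathbb Z^2_*}\eta(x)\frac1{|x|^2}\delta_{\sigma_T(x)}$, viewed as a measure on $(0,\infty)$, and $\bar\mu^T=\int_0^1\mu^{1,T}(\eta_s)\,ds$. Notation. $\sigma(a)=a(1-a)$. $C^1_K((0,\infty))$ is the set of compactly supported continuously differentiable functions $(0,\infty)\to\mathbb R$. For a measure $\mu$ on $(0,\infty)$, $\mu(f)=\int f\,d\mu$. For $0<\delta<1$, $\psi_\delta:\mathbb R\to[0,1/(2\delta)]$ is a fixed continuous function equal to $1/(2\delta)$ on $[-(\delta-\delta^2),\delta-\delta^2]$ and supported in $[-(\delta+\delta^2),\delta+\delta^2]$; $\psi_{r,\delta}(s)=\psi_\delta(s-r)$. *)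

(* Defs.v *)
From HB Require Import structures.
From mathcomp Require Import all_boot all_order all_algebra.
From mathcomp Require Import all_classical all_reals all_analysis.

Set Implicit Arguments.
Unset Strict Implicit.
Unset Printing Implicit Defensive.

Import Order.TTheory GRing.Theory Num.Theory.
Import numFieldNormedType.Exports.

Local Open Scope classical_set_scope.
Local Open Scope ring_scope.

Notation site := (int * int)%type.

(* {0,1}^{Z^2} with the product topology. *)
Notation config := {ptws site -> bool}.

Definition unit_vec (j : 'I_2) : site := if j == 0 then (1, 0) else (0, 1).

Definition exchange (x y : site) (eta : config) : config :=
  fun z => if z == x then eta y else if z == y then eta x else eta z.

Definition local_function (R : realType) (f : config -> R) : Prop :=
  exists A : seq site, forall eta xi : config,
    {in A, forall x, eta x = xi x} -> f eta = f xi.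

(* For a local f only finitely many terms of the sum over sites are nonzero,
   so the finitely supported sum is the full sum. *)
Definition exclusion_generator (R : realType) (T : R) (f : config -> R)
    (eta : config) : R :=
  T / 2 * \sum_(j < 2) \sum_(x \in [set: site])
    (f (exchange x (x + unit_vec j) eta) - f eta).

(* Markov semigroup on C({0,1}^{Z^2}); the values of S on discontinuous
   functions or at negative times are irrelevant. *)
Record markov_semigroup (R : realType)
    (S : R -> (config -> R) -> (config -> R)) : Prop := MarkovSemigroup {
  msg_continuous : forall (t : R) (f : config -> R),
    0 <= t -> continuous f -> continuous (S t f) ;
  msg_linear : forall (t a : R) (f g : config -> R),
    0 <= t -> continuous f -> continuous g ->
    S t (fun eta => a * f eta + g eta) = (fun eta => a * S t f eta + S t g eta) ;
  msg_id : forall f : config -> R, continuous f -> S 0 f = f ;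
  msg_comp : forall (s t : R) (f : config -> R),
    0 <= s -> 0 <= t -> continuous f -> S (s + t) f = S s (S t f) ;
  msg_right_continuous : forall (f : config -> R) (t e : R),
    continuous f -> 0 <= t -> 0 < e ->
    \forall u \near t^'+, forall eta : config, `|S u f eta - S t f eta| <= e ;
  msg_one : forall t : R, 0 <= t -> S t (cst 1) = cst 1 ;
  msg_pos : forall (t : R) (f : config -> R),
    0 <= t -> continuous f -> (forall eta, 0 <= f eta) ->
    forall eta, 0 <= S t f eta }.

(* f is in the domain of the generator of S, with image g: the difference
   quotients at time 0 converge to g in the supremum norm. *)
Definition generator_at (R : realType)
    (S : R -> (config -> R) -> (config -> R)) (f g : config -> R) : Prop :=
  forall e : R, 0 < e ->
    \forall h \near (0 : R)^'+, forall eta : config,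
      `|h^-1 * (S h f eta - f eta) - g eta| <= e.

(* D(R_+, {0,1}^{Z^2}). Trajectories are indexed by all of R and normalized to
   be constant on (-oo, 0], so that they are determined by their values on
   R_+ and no condition is added at times t <= 0. *)
Record trajectory (R : realType) := Trajectory {
  traj :> R -> config ;
  traj_neg : forall t, t <= 0 -> traj t = traj 0 ;
  traj_right_continuous : forall t, traj u @[u --> t^'+] --> traj t ;
  traj_left_limits : forall t, exists l : config, traj u @[u --> t^'-] --> l }.

Section trajectory_space.
Variable R : realType.

Let empty_traj : R -> config := fun=> (fun=> false).

Fact empty_traj_neg t : t <= 0 -> empty_traj t = empty_traj 0.
Proof. by []. Qed.

Fact empty_traj_right t : empty_traj u @[u --> t^'+] --> empty_traj t.
Proof. exact: cvg_cst. Qed.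

Fact empty_traj_left t : exists l : config, empty_traj u @[u --> t^'-] --> l.
Proof. by exists (fun=> false); exact: cvg_cst. Qed.

HB.instance Definition _ := gen_eqMixin (trajectory R).
HB.instance Definition _ := gen_choiceMixin (trajectory R).
HB.instance Definition _ := isPointed.Build (trajectory R)
  (Trajectory empty_traj_neg empty_traj_right empty_traj_left).

Definition coordinate_events (I : set R) : set (set (trajectory R)) :=
  [set E | exists (u : R) (x : site), I u /\ E = [set w : trajectory R | w u x]].

(* The Borel sigma-algebra of the Skorohod topology is the one generated by
   the coordinates. *)
Let G := coordinate_events [set u | 0 <= u].

HB.instance Definition _ := @isMeasurable.Build (sigma_display G)
  (trajectory R) <<s G >> (@sigma_algebra0 _ setT G) (@sigma_algebraC _ G)
  (@sigma_algebra_bigcup _ setT G).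

Definition past (s : R) : set (set (trajectory R)) :=
  <<s coordinate_events [set u | 0 <= u <= s] >>.

End trajectory_space.

Definition bernoulli_product (R : realType) (alpha : R)
    (nu : set config -> \bar R) : Prop :=
  forall (A : seq site) (zeta : config), uniq A ->
    nu [set eta | {in A, forall x, eta x = zeta x}] =
    (\prod_(x <- A) (if zeta x then alpha else 1 - alpha))%:E.

(* P is the law of the Markov process with generator L_T started from the
   Bernoulli product measure of density alpha. The semigroup S is unique: the
   closure of L_T on local functions is a Markov generator, and no Markov
   generator properly extends another one. *)
Definition exclusion_law (R : realType) (T alpha : R)
    (P : probability (trajectory R) R) : Prop :=
  bernoulli_product alpha (fun B => P [set w : trajectory R | B (w 0)]) /\
  exists S : R -> (config -> R) -> (config -> R),
    [/\ markov_semigroup S,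
        forall f, local_function f ->
          generator_at S f (exclusion_generator T f)
      & forall (s t : R) (f : config -> R) (A : set (trajectory R)),
          0 <= s -> 0 <= t -> continuous f -> past s A ->
          \int[P]_(w in A) f (w (s + t)) = \int[P]_(w in A) S t f (w s)].

Definition euclid_norm (R : realType) (x : site) : R :=
  Num.sqrt (x.1%:~R ^+ 2 + x.2%:~R ^+ 2).

Definition log_radius (R : realType) (T : R) (x : site) : R :=
  ln (euclid_norm R x) / ln T.

(* mu^{1,T}(eta), as a set function on R; it is a measure for T > 1. It is seen
   as a measure on (0, +oo) by integrating over that set only, which discards
   the atoms |x| = 1, located at 0. *)
Definition polar_measure (R : realType) (T : R) (eta : config)
    (A : set R) : \bar R :=
  (((2 * pi * ln T)^-1)%:E *
   \esum_(x in [set x : site | x != 0%R])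
     (((eta x)%:R / euclid_norm R x ^+ 2)%:E * \d_(log_radius T x) A))%E.

Definition mean_polar_measure (R : realType) (T : R) (w : trajectory R)
    (A : set R) : \bar R :=
  (\int[lebesgue_measure]_(s in `[0%R, 1%R]) polar_measure T (w s) A)%E.

(* mu(f), for a measure mu on (0, +oo) given as a set function. *)
Definition pairing (R : realType) (mu : set R -> \bar R) (f : R -> R) : R :=
  fine (integral mu `]0, +oo[ (fun u => (f u)%:E)).

(* C^1_K((0, +oo)); the values of H outside (0, +oo) are irrelevant. *)
Definition C1K (R : realType) (H : R -> R) : Prop :=
  [/\ forall r : R, 0 < r -> derivable H r 1,
      forall r : R, 0 < r -> {for r, continuous (H^`())%classic}
    & exists K : set R, [/\ compact K, K `<=` `]0, +oo[
        & forall r : R, 0 < r -> ~ K r -> H r = 0]].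

Definition cutoff (R : realType) (delta : R) (psi : R -> R) : Prop :=
  [/\ continuous psi,
      forall s, 0 <= psi s <= (2 * delta)^-1,
      forall s, `|s| <= delta - delta ^+ 2 -> psi s = (2 * delta)^-1
    & forall s, delta + delta ^+ 2 < `|s| -> psi s = 0].

Definition mobility (R : realType) (a : R) : R := a * (1 - a).

Definition smoothed_density (R : realType) (psi : R -> R -> R) (delta T : R)
    (w : trajectory R) (r : R) : R :=
  pairing (mean_polar_measure T w) (fun s => psi delta (s - r)).

Definition truncated_density (R : realType) (psi : R -> R -> R)
    (alpha delta T : R) (w : trajectory R) (r : R) : R :=
  if r < 2^-1 then smoothed_density psi delta T w r else alpha.

Definition W (R : realType) (psi : R -> R -> R) (alpha : R) (H : R -> R)
    (T delta : R) (w : trajectory R) : R :=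
  2 * pi *
  (- (\int[lebesgue_measure]_(r in `]0, +oo[)
        ((H^`())%classic r * smoothed_density psi delta T w r))
   - 2 * \int[lebesgue_measure]_(r in `]0, +oo[)
        (H r ^+ 2 * mobility (truncated_density psi alpha delta T w r))).

(* Main.v *)
(** Write L = log T.  For a positive local function u and V = - L_T u / u,
    reversibility and a Schur test for the symmetric operators
    e^{hV/2} S_h e^{hV/2}, for which e^{-hV/2} u is almost a positive
    eigenfunction of eigenvalue 1, give E[exp int_0^1 V(eta_s) ds] <= 1, hence
    P[int_0^1 V >= a] <= e^{-a}.

    This is used with u = exp (2 Z - (2 / L^2) (Q_0 + Q_1)), where
    Z = sum_x h(sigma_T(x)) eta(x) and h is the primitive of H that vanishes at
    infinity.  Discrete calculus turns the generator applied to Z into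
    sum_x eta(x) H'(sigma_T(x)) / |x|^2, and the square of its gradient into
    sums of H^2 x_j^2 / |x|^4 times squared discrete gradients of eta.  The
    quadratic forms Q_j have a truncated Green function of the random walk as
    kernel, with an anisotropic correction that lets Q_j see the gradients in
    direction j only.  They replace these squares by 2 (hbar - hbar^2), where
    hbar is eta averaged by m steps of the walk, up to an error that vanishes as
    T and then m tend to infinity.  So (L / T) int V dominates the functional W,
    except that the local mobility must be compared with the mobility of the
    smoothed density.  For r < 1/2 this is Jensen's inequality.  For r >= 1/2
    the tangent of the mobility at alpha leaves a linear functional of
    eta - alpha supported in |x| >= sqrt T.  By stationarity its exponential
    moments are those of a Bernoulli product measure, and it exceeds 1/4 with
    probability of order e^{- ell T / L} only. *)
Require Import Defs.
From HB Require Import structures.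
From mathcomp Require Import all_boot all_order all_algebra.
From mathcomp Require Import all_classical all_reals all_analysis.
From mathcomp Require Import measurable_realfun.
From mathcomp Require Import zify ring lra.
Set Implicit Arguments.
Unset Strict Implicit.
Unset Printing Implicit Defensive.
Import Order.TTheory GRing.Theory Num.Theory.
Import numFieldNormedType.Exports.
Local Open Scope classical_set_scope.
Local Open Scope ring_scope.

(** * Configurations and local functions *)

(** The comparison of W with the time integral of V holds for every trajectory; chance enters only
    through two exponential moments. This is possible because H lives on [e0, K]: the sums of
    1/|x|^2 over the support of the weights are of order L, those of 1/|x|^3 of order T^(-e0). The
    kernels of the Q_j have bounded range, so an exchange at x changes (2 / L^2) Q_j by O(1 / (L^2
    |x|^2)), against O(1 / (L |x|)) for 2 Z. In the second-order expansion of the exponential the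
    square and the cross terms of the Q_j therefore cost sums of 1/|x|^3 only, and the Q_j can be
    inserted for free. The factor 2 before Z gives the linear term and the quadratic one, (2 grad
    Z)^2 / 2, the same ratio as in W; the factor 2 / L^2 is the one that cancels the squared
    gradients. The threshold is split as ell = (ell - 1/2) + 1/4 + 1/4: for V, for the linear tail
    and for all errors. Both events then have probability at most exp (- (ell - 1/2) T / L), and
    going down to ell - 1 absorbs the factor 2 of the union bound. The parameters are fixed in the
    order delta, m, modulus of psi_delta, T. *)

Definition agree (A : seq site) (eta xi : config) := {in A, forall x, eta x = xi x}.

Lemma cylinder_nbhs (A : seq site) (eta : config) : \forall xi \near eta, agree A xi eta.
Proof.
elim: A => [|a A IHA]; first by apply: filterS filterT => xi _ x.
have : \forall xi \near eta, xi a = eta a.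
  have /(_ [set eta a]) := @proj_continuous site (fun=> bool) a eta.
  by apply; exact: discrete_set1.
move: IHA; apply: filterS2 => xi h1 h2 x; rewrite inE => /orP[/eqP ->|] //.
exact: h1.
Qed.

(** The sets containing a cylinder around [eta] form a filter. It converges to [eta] in each
    coordinate, hence in the product topology, which is a supremum of initial topologies. *)
Lemma nbhs_cylinder (eta : config) (U : set config) :
  nbhs eta U -> exists A : seq site, forall xi, agree A xi eta -> U xi.
Proof.
pose F : set_system config := [set U | exists A, forall xi, agree A xi eta -> U xi].
have FF : Filter F.
  split; first by exists [::].
  - move=> P Q [A hA] [B hB]; exists (A ++ B) => xi h; split.
      by apply: hA => x xA; apply: h; rewrite mem_cat xA.
    by apply: hB => x xB; apply: h; rewrite mem_cat xB orbT.
  - by move=> P Q PQ [A hA]; exists A => xi /hA/PQ.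
suff : F --> eta by apply.
apply/cvg_sup => i; apply/cvg_image.
  by apply/seteqP; split=> // b _; exists (fun=> b).
move=> V /= /nbhs_singleton Vi; rewrite /= nbhs_simpl /=.
exists [set xi : config | V (xi i)]; first by exists [:: i] => xi /(_ i (mem_head _ _)) /= ->.
apply/seteqP; split=> [b [xi h <-]//|b Vb].
by exists (fun=> b).
Qed.

Lemma local_continuous (R : realType) (f : config -> R) :
  local_function f -> continuous f.
Proof.
move=> [A hA] eta; apply: (cvg_near_cst (f eta)).
by apply: filterS (cylinder_nbhs A eta) => xi h; apply: hA.
Qed.

Definition box (n : nat) : seq site :=
  [seq (i, j) | i <- [seq k%:Z - n%:Z | k <- iota 0 (2 * n).+1],
                j <- [seq k%:Z - n%:Z | k <- iota 0 (2 * n).+1]].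

Lemma mem_box n (x : site) : (x \in box n) = (`|x.1| <= n)%N && (`|x.2| <= n)%N.
Proof.
have H (i : int) : (i \in [seq k%:Z - n%:Z | k <- iota 0 (2 * n).+1]) = (`|i| <= n)%N.
  apply/mapP/idP => [[k]|h]; first by rewrite mem_iota => /andP[_ h] ->; lia.
  by exists `|(i + n%:Z)%R|%N; rewrite ?mem_iota; lia.
apply/allpairsP/andP => [[[i j] /= [h1 h2 ->]]|[h1 h2]].
  by rewrite -!H.
by exists x; rewrite !H; split=> //; case: x {h1 h2}.
Qed.

Lemma box_uniq n : uniq (box n).
Proof.
have H : uniq [seq k%:Z - n%:Z | k <- iota 0 (2 * n).+1].
  by rewrite map_inj_uniq ?iota_uniq// => a b; lia.
by apply: allpairs_uniq => // -[a b] [c d].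
Qed.

Lemma sub_box m n x : (m <= n)%N -> x \in box m -> x \in box n.
Proof. by rewrite !mem_box; lia. Qed.

Lemma seq_sub_box (A : seq site) : exists n, {subset A <= box n}.
Proof.
elim: A => [|a A [n hn]]; first by exists 0%N.
exists (maxn n (maxn `|a.1| `|a.2|)) => x; rewrite inE => /orP[/eqP ->|/hn].
  by rewrite mem_box; lia.
by apply: sub_box; lia.
Qed.

Definition trunc (n : nat) (eta : config) : config := fun x => (x \in box n) && eta x.

Lemma trunc_agree n eta : agree (box n) (trunc n eta) eta.
Proof. by move=> x xn; rewrite /trunc xn. Qed.

(** Continuity at one configuration supplies a finite set of sites; compactness of the configuration
    space (Tychonoff) supplies one that serves for all. *)
Lemma continuous_approx (R : realType) (f : config -> R) (e : R) :
  continuous f -> 0 < e -> exists n, forall eta, `|f eta - f (trunc n eta)| <= e.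
Proof.
move=> cf e0.
have cpt : compact [set: config].
  have /= := @tychonoff site (fun=> bool) (fun=> setT) (fun=> bool_compact).
  by congr compact; apply/seteqP; split.
pose P n (eta : config) := forall xi, agree (box n) xi eta -> `|f eta - f xi| <= e.
have /compact_near_coveringP := cpt.
move=> /(_ nat \oo P _) H.
have [|N _ HN] := H.
  move=> eta _.
  have [A hA] : exists A, forall xi, agree A xi eta -> `|f eta - f xi| < e / 2.
    apply: nbhs_cylinder.
    by have /cvgrPdist_lt/(_ (e/2)) := cf eta; apply; rewrite divr_gt0.
  have [n hn] := seq_sub_box A.
  near=> xi m.
  have xieta : agree (box n) xi eta by near: xi; exact: cylinder_nbhs.
  have nm : (n <= m)%N by near: m; exact: nbhs_infty_ge.
  move=> xi' h'.
  have /hA h1 : agree A xi eta by move=> x /hn; exact: xieta.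
  have /hA h2 : agree A xi' eta.
    move=> x /hn xn; rewrite h'; first exact: xieta.
    exact: sub_box xn.
  rewrite (le_trans (ler_distD (f eta) _ _))// distrC [leRHS]splitr.
  by rewrite lerD// ltW.
exists N => eta; apply: (HN N) => //=.
exact: trunc_agree.
Unshelve. all: by end_near.
Qed.

Lemma trunc_local (R : realType) (f : config -> R) n : local_function (fun eta => f (trunc n eta)).
Proof.
exists (box n) => eta xi h; congr f; apply/funext => x; rewrite /trunc.
by case: (boolP (x \in box n)) => //= /h ->.
Qed.

Lemma continuous_bounded (R : realType) (f : config -> R) :
  continuous f -> exists M, 0 <= M /\ forall eta, `|f eta| <= M.
Proof.
move=> cf; have [n hn] := continuous_approx cf ltr01.
(* After truncation [f] depends only on a pattern in the box; the sum over the finitely many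
   patterns dominates every value. *)
pose M := \sum_(s : {ffun seq_sub (box n) -> bool})
  `|f (fun x => if insub x is Some y then s y else false)|.
exists (1 + M); split; first by rewrite addr_ge0// sumr_ge0.
move=> eta; rewrite -[f eta](subrK (f (trunc n eta))) (le_trans (ler_normD _ _))// lerD//.
have -> : trunc n eta = fun x =>
    if insub x is Some y then [ffun y : seq_sub (box n) => eta (val y)] y else false.
  apply/funext => x; rewrite /trunc; case: insubP => [u -> /= <-|/negbTE -> //].
  by rewrite ffunE.
by rewrite /M (bigD1 [ffun y : seq_sub (box n) => eta (val y)])//= lerDl sumr_ge0.
Qed.

Lemma eq_ler (R : realType) (x y : R) : x = y -> x <= y.
Proof. by move=> ->. Qed.

(** From 1 - y <= exp (-y): the product (1 + y + 2 y^2)(1 - y) exceeds 1 by y^2 (1 - 2 y). *)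
Lemma expR_quad (R : realType) (y : R) : `|y| <= 2^-1 -> expR y <= 1 + y + 2 * y ^+ 2.
Proof.
move=> y1; have y2 : y <= 2^-1 by apply: le_trans y1; exact: ler_norm.
have h0 : 0 < 1 - y by lra.
have h1 : 1 - y <= expR (- y) by exact: expR_ge1Dx.
rewrite -[expR y]invrK -expRN; apply: (@le_trans _ _ (1 - y)^-1).
  by rewrite lef_pV2 ?posrE ?expR_gt0.
rewrite -[leLHS]mul1r ler_pdivrMr// -subr_ge0.
rewrite (_ : _ - _ = y ^+ 2 * (1 - 2 * y)); last by ring.
by rewrite mulr_ge0 ?sqr_ge0//; lra.
Qed.

(** * Exchanges and the generator on local functions *)

Definition dep (R : realType) (A : seq site) (f : config -> R) :=
  forall eta xi : config, agree A eta xi -> f eta = f xi.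

Definition swap (x y z : site) : site := if z == x then y else if z == y then x else z.

Lemma exchangeE x y (eta : config) : exchange x y eta = eta \o swap x y.
Proof. by apply/funext => z; rewrite /exchange /swap /=; case: eqP => // _; case: eqP. Qed.

Lemma swapK x y : involutive (swap x y).
Proof.
move=> z; rewrite /swap; case: (eqVneq z x) => [->|zx].
  by rewrite eqxx; case: eqVneq.
case: (eqVneq z y) => [->|zy]; first by rewrite eqxx.
by rewrite (negbTE zx) (negbTE zy).
Qed.

Lemma swap_notin x y (A : seq site) (eta : config) :
  x \notin A -> y \notin A -> agree A (exchange x y eta) eta.
Proof.
move=> xA yA z zA; rewrite /exchange; case: eqVneq => [zx|_]; first by rewrite -zx zA in xA.
by case: eqVneq => [zy|_] //; rewrite -zy zA in yA.
Qed.

Lemma unit_vec_box n j (x : site) : x + unit_vec j \in box n -> x \in box n.+1.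
Proof. by case: x => a b; rewrite !mem_box /unit_vec; case: eqP => _ /=; lia. Qed.

Lemma sum_supp (R : nmodType) (f : site -> R) (s1 s2 : seq site) :
  uniq s1 -> uniq s2 -> (forall x, x \notin s1 -> f x = 0) ->
  (forall x, x \notin s2 -> f x = 0) -> \sum_(x <- s1) f x = \sum_(x <- s2) f x.
Proof.
move=> u1 u2 h1 h2.
rewrite (bigID (mem s2))/= addrC big1 ?add0r; last by move=> x /h2.
rewrite [RHS](bigID (mem s1))/= [X in _ + X]big1 ?addr0; last by move=> x /h1.
rewrite -big_filter -[RHS]big_filter; apply: perm_big.
by apply: uniq_perm; rewrite ?filter_uniq// => x; rewrite !mem_filter andbC.
Qed.

(** A bond can change [f] only if it meets [A]; its starting point may then lie one step outside
    [box n]. *)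
Lemma generator_box (R : realType) (T : R) (f : config -> R) A n eta :
  dep A f -> {subset A <= box n} ->
  exclusion_generator T f eta = T / 2 * \sum_(j < 2) \sum_(x <- box n.+1)
    (f (exchange x (x + unit_vec j) eta) - f eta).
Proof.
move=> fA An; rewrite /exclusion_generator; congr (_ * _); apply: eq_bigr => j _.
rewrite (fsbig_seq _ _ (box_uniq n.+1)); symmetry; apply: fsbig_widen => // x [_ /negP xn].
apply/eqP; rewrite subr_eq0; apply/eqP; apply: fA; apply: swap_notin; apply/negP => /An.
  by move=> /(sub_box (leqnSn n)) h; rewrite h in xn.
by move=> /unit_vec_box h; rewrite h in xn.
Qed.

Lemma dep_sub (R : realType) A B (f : config -> R) : {subset A <= B} -> dep A f -> dep B f.
Proof. by move=> AB fA eta xi h; apply: fA => x /AB/h. Qed.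

Lemma local_box (R : realType) (f : config -> R) : local_function f -> exists n, dep (box n) f.
Proof. by move=> [A fA]; have [n An] := seq_sub_box A; exists n; exact: dep_sub fA. Qed.

Lemma box_local (R : realType) n (f : config -> R) : dep (box n) f -> local_function f.
Proof. by exists (box n). Qed.

Lemma local2_box (R : realType) (f g : config -> R) : local_function f -> local_function g ->
  exists n, dep (box n) f /\ dep (box n) g.
Proof.
move=> /local_box[n fn] /local_box[m gm]; exists (maxn n m).
by split; [apply: dep_sub fn => x|apply: dep_sub gm => x]; apply: sub_box; lia.
Qed.

Lemma dep_op2 (R : realType) A (F : R -> R -> R) (f g : config -> R) :
  dep A f -> dep A g -> dep A (fun eta => F (f eta) (g eta)).
Proof. by move=> fA gA eta xi h; rewrite (fA _ _ h) (gA _ _ h). Qed.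

Lemma local_op2 (R : realType) (F : R -> R -> R) (f g : config -> R) :
  local_function f -> local_function g -> local_function (fun eta => F (f eta) (g eta)).
Proof. by move=> lf lg; have [n [fn gn]] := local2_box lf lg; exists (box n); exact: dep_op2. Qed.

Lemma local_op1 (R : realType) (F : R -> R) (f : config -> R) :
  local_function f -> local_function (fun eta => F (f eta)).
Proof. by move=> lf; exact: (local_op2 (fun a _ => F a) lf lf). Qed.

Lemma local_cst (R : realType) (a : R) : local_function (fun _ : config => a).
Proof. by exists [::]. Qed.

Lemma local_sum (R : realType) (I : eqType) (s : seq I) (f : I -> config -> R) :
  (forall i, i \in s -> local_function (f i)) ->
  local_function (fun eta => \sum_(i <- s) f i eta).
Proof.
elim: s => [|i s IHs] h.
  by under eq_fun do rewrite big_nil; exact: local_cst.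
under eq_fun do rewrite big_cons; apply: (local_op2 (fun a b => a + b)).
  by apply: h; rewrite mem_head.
by apply: IHs => k ks; apply: h; rewrite inE ks orbT.
Qed.

Lemma local_exchange (R : realType) (f : config -> R) x y :
  local_function f -> local_function (fun eta => f (exchange x y eta)).
Proof.
move=> [A fA]; exists (map (swap x y) A) => eta xi h; apply: fA => z zA.
by rewrite !exchangeE /= h// map_f.
Qed.

Lemma local_coord (R : realType) (x : site) (F : bool -> R) :
  local_function (fun eta => F (eta x)).
Proof. by exists [:: x] => eta xi h; rewrite h// mem_head. Qed.

Lemma local_generator (R : realType) (T : R) (f : config -> R) :
  local_function f -> local_function (exclusion_generator T f).
Proof.
move=> lf; have [n fn] := local_box lf.
rewrite (_ : exclusion_generator T f = fun eta => T / 2 * \sum_(j <- enum 'I_2)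
  \sum_(x <- box n.+1) (f (exchange x (x + unit_vec j) eta) - f eta)); last first.
  by apply/funext => eta; rewrite (generator_box T eta fn (fun=> id)) big_enum.
apply: (local_op1 (fun a => T / 2 * a)); apply: local_sum => j _; apply: local_sum => x _.
by apply: (local_op2 (fun a b => a - b)) => //; exact: local_exchange.
Qed.

Lemma generator_linear (R : realType) (T a : R) (f g : config -> R) eta :
  local_function f -> local_function g ->
  exclusion_generator T (fun eta => a * f eta + g eta) eta =
  a * exclusion_generator T f eta + exclusion_generator T g eta.
Proof.
move=> lf lg; have [n [fn gn]] := local2_box lf lg.
rewrite (generator_box T eta fn (fun=> id)) (generator_box T eta gn (fun=> id)) (@generator_box _ _ _ (box n) n)//.
  rewrite mulrCA -mulrDr; congr (_ * _); rewrite mulr_sumr -big_split/=; apply: eq_bigr => j _.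
  by rewrite mulr_sumr -big_split/=; apply: eq_bigr => x _; ring.
by move=> xi xi' h; rewrite (fn _ _ h) (gn _ _ h).
Qed.

(** * Polynomials in the occupation variables *)

Definition mono (R : realType) (A : seq site) (eta : config) : R :=
  \prod_(x <- A) (eta x)%:R.

Lemma dep_mono (R : realType) A : dep A (@mono R A).
Proof. by move=> eta xi h; rewrite /mono; apply: eq_big_seq => x /h ->. Qed.

Lemma mono_exchange (R : realType) A x y eta :
  mono R A (exchange x y eta) = mono R (map (swap x y) A) eta.
Proof. by rewrite /mono big_map exchangeE. Qed.

Lemma mono01 (R : realType) A eta : 0 <= mono R A eta <= 1.
Proof.
rewrite /mono; elim: A => [|a A]; first by rewrite big_nil ler01 lexx.
rewrite big_cons => /andP[h1 h2]; rewrite mulr_ge0//= -[leRHS]mul1r ler_pM//.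
by case: (eta a).
Qed.

(* The generator maps [polb n M] to [polb n (4 * n * T * M)], so on these functions
   Euler's scheme converges to any semigroup extending it. *)
Definition polb (R : realType) (n : nat) (M : R) (f : config -> R) :=
  exists l : seq (R * seq site), [/\ {in l, forall p, (size p.2 <= n)%N},
    \sum_(p <- l) `|p.1| <= M & f = fun eta => \sum_(p <- l) p.1 * mono R p.2 eta].

Lemma polbW (R : realType) n (M M' : R) f : M <= M' -> polb n M f -> polb n M' f.
Proof. by move=> MM [l [h1 h2 h3]]; exists l; split=> //; exact: le_trans MM. Qed.

Lemma polb_size (R : realType) n m (M : R) f : (n <= m)%N -> polb n M f -> polb m M f.
Proof.
by move=> nm [l [h1 h2 h3]]; exists l; split=> // p /h1 h; exact: leq_trans nm.
Qed.

Lemma polb0 (R : realType) n (M : R) : 0 <= M -> polb n M (fun=> 0 : R).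
Proof. by move=> M0; exists [::]; rewrite big_nil; split=> //; apply/funext => ?; rewrite big_nil. Qed.

Lemma polbD (R : realType) n (M M' : R) f g : polb n M f -> polb n M' g ->
  polb n (M + M') (fun eta => f eta + g eta).
Proof.
move=> [l [h1 h2 ->]] [l' [h1' h2' ->]]; exists (l ++ l'); split.
- by move=> p; rewrite mem_cat => /orP[/h1|/h1'].
- by rewrite big_cat lerD.
- by apply/funext => eta; rewrite big_cat.
Qed.

Lemma polbZ (R : realType) n (M a : R) f : polb n M f -> polb n (`|a| * M) (fun eta => a * f eta).
Proof.
move=> [l [h1 h2 ->]]; exists [seq (a * p.1, p.2) | p <- l]; split.
- by move=> _ /mapP[p /h1 h ->].
- by rewrite big_map /=; under eq_bigr do rewrite normrM; rewrite -mulr_sumr ler_wpM2l.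
- by apply/funext => eta; rewrite big_map mulr_sumr; apply: eq_bigr => p _; rewrite mulrA.
Qed.

Lemma polb_sum (R : realType) n (M : R) (I : eqType) (s : seq I) (f : I -> config -> R) :
  (forall i, i \in s -> polb n M (f i)) ->
  polb n ((size s)%:R * M) (fun eta => \sum_(i <- s) f i eta).
Proof.
elim: s => [|i s IHs] h.
  by rewrite mul0r; under eq_fun do rewrite big_nil; exact: polb0.
under eq_fun do rewrite big_cons.
rewrite /= -add1n natrD mulrDl mul1r; apply: polbD; first by apply: h; rewrite mem_head.
by apply: IHs => k ks; apply: h; rewrite inE ks orbT.
Qed.

Lemma polb_mono (R : realType) A : polb (size A) 1 (mono R A).
Proof.
exists [:: (1, A)]; split; first by move=> p; rewrite inE => /eqP ->.
  by rewrite big_seq1 normr1.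
by apply/funext => eta; rewrite big_seq1 mul1r.
Qed.

Lemma polb_local (R : realType) n (M : R) f : polb n M f -> local_function f.
Proof.
move=> [l [_ _ ->]]; apply: (@local_sum _ _ l (fun p eta => p.1 * mono R p.2 eta)) => p _.
by apply: (local_op1 (fun a => p.1 * a)); exists p.2; exact: dep_mono.
Qed.

Lemma polb_bound (R : realType) n (M : R) f eta : polb n M f -> `|f eta| <= M.
Proof.
move=> [l [_ h ->]]; apply: le_trans h; rewrite (le_trans (ler_norm_sum _ _ _))//.
apply: ler_sum => p _; rewrite normrM -[leRHS]mulr1 ler_wpM2l//.
by have /andP[m0 m1] := mono01 R p.2 eta; rewrite ger0_norm.
Qed.

(** An exchange permutes sites, so the degree is kept. In each of the two directions at most 2 |A|
    bonds meet [A], and each yields two monomials: T/2 * 2 * 2|A| * 2. *)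
Lemma polb_generator_mono (R : realType) (T : R) A : 0 <= T ->
  polb (size A) (4 * (size A)%:R * T) (exclusion_generator T (mono R A)).
Proof.
move=> T0; have [n An] := seq_sub_box A.
pose s (j : 'I_2) := [seq x <- box n.+1 | (x \in A) || (x + unit_vec j \in A)].
have ss j : (size (s j) <= size A + size A)%N.
  rewrite -[X in (_ <= _ + X)%N](size_map (fun x => x - unit_vec j)) -size_cat.
  apply: uniq_leq_size; first by rewrite filter_uniq// box_uniq.
  move=> x; rewrite mem_filter => /andP[/orP h _]; rewrite mem_cat; apply/orP.
  case: h => h; first by left.
  right.
  by apply/mapP; exists (x + unit_vec j) => //; rewrite addrK.
rewrite (_ : exclusion_generator T (mono R A) = fun eta => T / 2 * \sum_(j <- enum 'I_2)
  \sum_(x <- s j) (mono R (map (swap x (x + unit_vec j)) A) eta + (-1) * mono R A eta)); last first.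
  apply/funext => eta; rewrite (generator_box _ _ (@dep_mono R A) An) big_enum/=; congr (_ * _).
  apply: eq_bigr => j _; rewrite big_filter [LHS](bigID (fun x => (x \in A) || (x + unit_vec j \in A)))/=.
  rewrite [X in _ + X]big1 ?addr0.
    by apply: eq_bigr => x _; rewrite mono_exchange mulN1r.
  move=> x; rewrite negb_or => /andP[h1 h2]; apply/eqP; rewrite subr_eq0; apply/eqP.
  exact/dep_mono/swap_notin.
apply: (@polbW _ _ (`|T / 2| * ((size (enum 'I_2))%:R * ((size A + size A)%:R * (1 + `|-1| * 1))))).
  rewrite size_enum_ord normrN1 ger0_norm ?divr_ge0// natrD.
  by rewrite le_eqVlt; apply/orP; left; apply/eqP; field.
apply: polbZ; apply: polb_sum => j _.
apply: (@polbW _ _ ((size (s j))%:R * (1 + `|-1| * 1))); first by rewrite ler_wpM2r// ?ler_nat.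
apply: polb_sum => x _; apply: polbD; last exact/polbZ/polb_mono.
by have := polb_mono R (map (swap x (x + unit_vec j)) A); rewrite size_map.
Qed.

Lemma polb_generator (R : realType) n (T M : R) f : 0 <= T -> polb n M f ->
  polb n (4 * n%:R * T * M) (exclusion_generator T f).
Proof.
move=> T0 [l [h1 h2 ->]].
apply: (@polbW _ _ (\sum_(p <- l) `|p.1| * (4 * n%:R * T))).
  by rewrite -mulr_suml mulrC ler_wpM2l// !mulr_ge0.
elim: l h1 {h2} => [|p l IHl] h1.
  rewrite big_nil (_ : exclusion_generator _ _ = fun=> 0); first exact: polb0.
  apply/funext => eta; rewrite (@generator_box _ _ _ [::] 0)//.
    by rewrite big1 ?mulr0// => j _; rewrite big1// => x _; rewrite !big_nil subrr.
  by move=> xi xi' _; rewrite !big_nil.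
have lp q : local_function (mono R q) by exists q; exact: dep_mono.
rewrite (_ : exclusion_generator _ _ = fun eta => p.1 * exclusion_generator T (mono R p.2) eta
   + exclusion_generator T (fun eta => \sum_(q <- l) q.1 * mono R q.2 eta) eta); last first.
  apply/funext => eta; rewrite -generator_linear//.
    by congr exclusion_generator; apply/funext => xi; rewrite big_cons.
  by apply: (local_sum (f := fun q eta => q.1 * mono R q.2 eta)) => q _; apply: (local_op1 (fun a => q.1 * a)).
rewrite big_cons; apply: polbD; last by apply: IHl => q ql; apply: h1; rewrite inE ql orbT.
have sp : (size p.2 <= n)%N by apply: h1; rewrite mem_head.
apply: polbZ; apply: (polb_size sp); apply: (polbW _ (polb_generator_mono p.2 T0)).
by rewrite ler_wpM2r// ler_wpM2l// ler_nat.
Qed.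

(** Induction on the sites: with f0 and f1 the restrictions to eta(a) = 0 and eta(a) = 1, f = f0 +
    eta(a) (f1 - f0). *)
Lemma local_polb (R : realType) (f : config -> R) : local_function f ->
  exists n M, polb n M f.
Proof.
move=> [A fA]; elim: A f fA => [|a A IHA] f fA.
  exists 0%N, `|f (fun=> false)|, [:: (f (fun=> false), [::])]; split.
  - by move=> p; rewrite inE => /eqP ->.
  - by rewrite big_seq1.
  - by apply/funext => eta; rewrite big_seq1 /mono big_nil mulr1; apply: fA.
pose up b (eta : config) : config := fun x => if x == a then b else eta x.
have H b : exists n M, polb n M (fun eta => f (up b eta)).
  apply: IHA => eta xi h; apply: fA => x; rewrite inE /up.
  by case: eqVneq => //= _ /h.
have [n [M h0]] := H false; have [m [N h1]] := H true.
have mulc k (K : R) g : polb k K g -> polb k.+1 K (fun eta => (eta a)%:R * g eta).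
  move=> [l [l1 l2 ->]]; exists [seq (p.1, a :: p.2) | p <- l]; split.
  - by move=> _ /mapP[p /l1 h ->].
  - by rewrite big_map.
  - apply/funext => eta; rewrite big_map mulr_sumr; apply: eq_bigr => p _ /=.
    by rewrite /mono big_cons mulrCA.
exists (maxn n m).+1, (M + (`|-1| * M + N)).
rewrite (_ : f = fun eta => f (up false eta) + ((-1) * ((eta a)%:R * f (up false eta)) + (eta a)%:R * f (up true eta))).
  apply: polbD; first by apply: (polb_size _ h0); lia.
  apply: polbD; first by apply: polbZ; apply: (polb_size _ (mulc _ _ _ h0)); lia.
  by apply: (polb_size _ (mulc _ _ _ h1)); lia.
apply/funext => eta.
have -> : f eta = f (up (eta a) eta).
  by congr f; apply/funext => x; rewrite /up; case: eqVneq => // ->.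
by case: (eta a); rewrite /= ?mul0r ?mul1r; ring.
Qed.

(** * Semigroup and reversibility *)

Section continuity.
Variables (R : realType).
Implicit Types f g : config -> R.

Lemma continuous_lin (a : R) f g : continuous f -> continuous g ->
  continuous (fun eta => a * f eta + g eta).
Proof.
move=> cf cg x; apply: (@cvgD _ R^o); last exact: cg.
by apply: cvgM; [exact: cvg_cst|exact: cf].
Qed.

Lemma continuous_mul f g : continuous f -> continuous g ->
  continuous (fun eta => f eta * g eta).
Proof. by move=> cf cg x; apply: cvgM; [exact: cf|exact: cg]. Qed.

Lemma continuous_sqr f : continuous f -> continuous (fun eta => f eta ^+ 2).
Proof.
move=> cf; have -> : (fun eta => f eta ^+ 2) = fun eta => f eta * f eta.
  by apply/funext => eta; rewrite expr2.
exact: continuous_mul.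
Qed.

Lemma continuous_const (a : R) : continuous (fun _ : config => a).
Proof. by move=> x; exact: cvg_cst. Qed.

Lemma continuous_sub f g : continuous f -> continuous g ->
  continuous (fun eta => f eta - g eta).
Proof.
move=> cf cg; rewrite (_ : (fun _ => _) = fun eta => (-1) * g eta + f eta).
  exact: continuous_lin.
by apply/funext => eta; rewrite mulN1r addrC.
Qed.

Lemma continuous_sum (I : eqType) (s : seq I) (F : I -> config -> R) :
  (forall i, i \in s -> continuous (F i)) -> continuous (fun eta => \sum_(i <- s) F i eta).
Proof.
elim: s => [|i s IHs] h.
  rewrite (_ : (fun _ => _) = fun=> 0); first exact: continuous_const.
  by apply/funext => eta; rewrite big_nil.
rewrite (_ : (fun _ => _) = fun eta => 1 * F i eta + \sum_(i <- s) F i eta).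
  apply: continuous_lin; first by apply: h; rewrite mem_head.
  by apply: IHs => k ks; apply: h; rewrite inE ks orbT.
by apply/funext => eta; rewrite big_cons mul1r.
Qed.

End continuity.

(** * Taylor bounds and Euler's scheme for a semigroup extending the generator *)

Section semigroup.
Variables (R : realType) (T : R) (S : R -> (config -> R) -> (config -> R)).
Hypothesis T0 : 0 <= T.
Hypothesis hS : markov_semigroup S.
Hypothesis gS : forall f, local_function f -> generator_at S f (exclusion_generator T f).
Local Notation L := (exclusion_generator T).
Implicit Types f g : config -> R.

Lemma semigroup_lin t a f g eta : 0 <= t -> continuous f -> continuous g ->
  S t (fun eta => a * f eta + g eta) eta = a * S t f eta + S t g eta.
Proof. by move=> t0 cf cg; rewrite (msg_linear hS a t0 cf cg). Qed.

Lemma semigroup_cst t a : 0 <= t -> S t (fun=> a) = fun=> a.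
Proof.
move=> t0; apply/funext => eta.
have c1 := @continuous_const R 1.
have z : S t (fun=> 0) eta = 0.
  rewrite (_ : (fun=> 0) = fun eta : config => (-1) * (fun=> 1) eta + (fun=> 1) eta).
    by rewrite semigroup_lin//; ring.
  by apply/funext => xi; ring.
rewrite (_ : (fun=> a) = fun eta : config => a * (fun=> 1) eta + (fun=> 0) eta); last first.
  by apply/funext => xi; ring.
rewrite semigroup_lin//; last exact: continuous_const.
by rewrite z (msg_one hS t0) /=; ring.
Qed.

Lemma semigroup_sub t f g eta : 0 <= t -> continuous f -> continuous g ->
  S t (fun eta => f eta - g eta) eta = S t f eta - S t g eta.
Proof.
move=> t0 cf cg; rewrite (_ : (fun _ => _) = fun eta => (-1) * g eta + f eta).
  by rewrite semigroup_lin//; ring.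
by apply/funext => xi; ring.
Qed.

Lemma semigroup_mono t f g eta : 0 <= t -> continuous f -> continuous g ->
  (forall xi, f xi <= g xi) -> S t f eta <= S t g eta.
Proof.
move=> t0 cf cg fg; rewrite -subr_ge0 -semigroup_sub//.
apply: (msg_pos hS t0); first exact: continuous_sub.
by move=> xi; rewrite subr_ge0.
Qed.

Lemma semigroup_contraction t f (M : R) eta : 0 <= t -> continuous f ->
  (forall xi, `|f xi| <= M) -> `|S t f eta| <= M.
Proof.
move=> t0 cf fM; rewrite ler_norml; apply/andP; split.
  rewrite -[- M]/((fun _ : config => - M) eta) -(semigroup_cst (- M) t0).
  apply: semigroup_mono => //; first exact: continuous_const.
  by move=> xi; have := fM xi; rewrite ler_norml => /andP[].
rewrite -[leRHS]/((fun _ : config => M) eta) -(semigroup_cst M t0).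
apply: semigroup_mono => //; first exact: continuous_const.
by move=> xi; have := fM xi; rewrite ler_norml => /andP[].
Qed.

Lemma semigroup_step f e : local_function f -> 0 < e ->
  exists2 h0, 0 < h0 & forall h, 0 < h < h0 ->
    forall eta, `|S h f eta - f eta - h * L f eta| <= h * e.
Proof.
move=> lf e0; have := gS lf e0.
move=> [h0 /= h00 H]; exists h0 => // h /andP[hp hh0] eta.
have /= := H h; rewrite sub0r normrN gtr0_norm// => /(_ hh0 hp eta).
have -> : S h f eta - f eta - h * L f eta = h * (h^-1 * (S h f eta - f eta) - L f eta).
  by rewrite mulrBr mulVKf// gt_eqF.
by rewrite normrM (gtr0_norm hp) ler_pM2l.
Qed.

Lemma semigroup_iter k h f : 0 <= h -> continuous f ->
  S (k.+1%:R * h) f = S (k%:R * h) (S h f).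
Proof.
move=> h0 cf; rewrite -(msg_comp hS _ h0 cf) ?mulr_ge0//.
by rewrite -natr1 mulrDl mul1r.
Qed.

Lemma small_step (t h0 : R) : 0 < t -> 0 < h0 -> exists2 n : nat, (0 < n)%N & 0 < t / n%:R < h0.
Proof.
move=> t0 h00; have := archi_boundP (ltW (divr_gt0 t0 h00)); set n := Num.bound _ => hn.
have n0 : (0 < n)%N.
  by rewrite lt0n; apply/eqP => n0; move: hn; rewrite n0 ltNge divr_ge0// ltW.
exists n => //; rewrite divr_gt0 ?ltr0n//= ltr_pdivrMr ?ltr0n// mulrC -ltr_pdivrMr//.
Qed.

(** The derivative is known at time 0 only. The interval is cut into n steps of length h = t / n; by
    the semigroup property and contraction each costs at most h (M + e / t). *)
Lemma semigroup_lipschitz t f M eta : 0 <= t -> local_function f ->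
  (forall xi, `|L f xi| <= M) -> `|S t f eta - f eta| <= t * M.
Proof.
move=> t0 lf LM; have cf := local_continuous lf.
have [->|tn0] := eqVneq t 0; first by rewrite (msg_id hS cf) subrr normr0 mul0r.
have tp : 0 < t by rewrite lt_neqAle eq_sym tn0.
apply/ler_addgt0Pr => e e0.
have [h0 h00 Hh] := semigroup_step lf (divr_gt0 e0 tp).
have [n n0 nh] := small_step tp h00.
set h := t / n%:R in nh.
have hp : 0 < h by case/andP: nh.
have Sc k : 0 <= k%:R * h by rewrite mulr_ge0// ltW.
have H k eta' : `|S (k%:R * h) f eta' - f eta'| <= k%:R * h * (M + e / t).
  elim: k => [|k IHk]; first by rewrite !mul0r (msg_id hS cf) subrr normr0.
  rewrite semigroup_iter ?(ltW hp)//.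
  have -> : S (k%:R * h) (S h f) eta' - f eta' =
     S (k%:R * h) (fun eta => S h f eta - f eta) eta' + (S (k%:R * h) f eta' - f eta').
    rewrite semigroup_sub//; last exact: (msg_continuous hS (ltW hp) cf).
    by ring.
  rewrite (le_trans (ler_normD _ _))// -natr1 mulrDl mul1r mulrDl addrC lerD//.
  apply: semigroup_contraction => //.
    by apply: continuous_sub => //; exact: (msg_continuous hS (ltW hp) cf).
  move=> xi; rewrite -[S h f xi - f xi](subrK (h * L f xi)) (le_trans (ler_normD _ _))//.
  by rewrite mulrDr addrC lerD ?Hh// normrM gtr0_norm// ler_pM2l.
have := H n eta; rewrite /h mulrC divfK ?pnatr_eq0 -?lt0n//.
by rewrite mulrDr [t * (e / t)]mulrC divfK.
Qed.

(** Same subdivision: the increment over one step is S_{kh} (S_h f - f - h L f) + h S_{kh} L f, and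
    [semigroup_lipschitz] for L f compares the last term with h L f. *)
Lemma semigroup_taylor t f M eta : 0 <= t -> local_function f ->
  (forall xi, `|L (L f) xi| <= M) -> `|S t f eta - f eta - t * L f eta| <= t ^+ 2 * M.
Proof.
move=> t0 lf LM; have cf := local_continuous lf.
have lLf := local_generator T lf; have cLf := local_continuous lLf.
have [->|tn0] := eqVneq t 0.
  by rewrite (msg_id hS cf) subrr !mul0r subr0 normr0 expr2 !mul0r.
have tp : 0 < t by rewrite lt_neqAle eq_sym tn0.
have M0 : 0 <= M by apply: le_trans (LM eta).
apply/ler_addgt0Pr => e e0.
have [h0 h00 Hh] := semigroup_step lf (divr_gt0 e0 tp).
have [n n0 nh] := small_step tp h00.
set h := t / n%:R in nh.
have hp : 0 < h by case/andP: nh.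
have nht : n%:R * h = t by rewrite /h mulrC divfK ?pnatr_eq0 -?lt0n.
have Sc k : 0 <= k%:R * h by rewrite mulr_ge0// ltW.
have H k eta' : (k <= n)%N ->
    `|S (k%:R * h) f eta' - f eta' - k%:R * h * L f eta'| <= k%:R * h * (e / t + t * M).
  elim: k eta' => [|k IHk] eta' kn; first by rewrite !mul0r (msg_id hS cf) subrr subr0 normr0.
  rewrite semigroup_iter ?(ltW hp)//.
  have cSh := msg_continuous hS (ltW hp) cf.
  have -> : S (k%:R * h) (S h f) eta' - f eta' - k.+1%:R * h * L f eta' =
     S (k%:R * h) (fun eta => (S h f eta - f eta) - (h * L f eta + (fun=> 0) eta)) eta' +
     h * (S (k%:R * h) (L f) eta' - L f eta') +
     (S (k%:R * h) f eta' - f eta' - k%:R * h * L f eta').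
    rewrite semigroup_sub//; [|exact: continuous_sub|apply: continuous_lin => //; exact: continuous_const].
    rewrite semigroup_lin//; last exact: continuous_const.
    by rewrite semigroup_cst// semigroup_sub// -natr1; ring.
  rewrite (le_trans (ler_normD _ _))// -natr1 mulrDl mul1r mulrDl addrC lerD ?IHk// 1?ltnW//.
  rewrite (le_trans (ler_normD _ _))// [leRHS]mulrDr lerD//.
    apply: semigroup_contraction => //.
      apply: continuous_sub; first exact: continuous_sub.
      by apply: continuous_lin => //; exact: continuous_const.
    by move=> xi; rewrite addr0 Hh.
  rewrite normrM gtr0_norm// ler_pM2l// (le_trans (semigroup_lipschitz _ _ lLf LM))//.
  by rewrite ler_wpM2r// -[leRHS]nht ler_pM2r// ler_nat ltnW.
have := H n eta (leqnn n); rewrite nht mulrDr [t * (e / t)]mulrC divfK//.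
by move=> h1; apply: (le_trans h1); rewrite expr2 mulrA addrC.
Qed.

Definition euler (h : R) f : config -> R := fun eta => f eta + h * L f eta.

Lemma polb_euler n M h f : 0 <= h -> polb n M f ->
  polb n ((1 + h * (4 * n%:R * T)) * M) (euler h f).
Proof.
move=> h0 fM; rewrite mulrDl mul1r; apply: polbD => //.
by rewrite -mulrA -[in X in X * _](ger0_norm h0); apply: polbZ; exact: polb_generator.
Qed.

(** With C = 4 n T, one step has error h^2 C^2 times the norm, which contraction carries to the
    final time. The Euler iterates stay in [polb n], and their norm grows by 1 + h C per step. *)
Lemma euler_error k n M h f eta : 0 <= h -> polb n M f ->
  `|S (k%:R * h) f eta - iter k (euler h) f eta| <=
  k%:R * (h ^+ 2 * (4 * n%:R * T) ^+ 2 * ((1 + h * (4 * n%:R * T)) ^+ k * M)).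
Proof.
set C := 4 * n%:R * T => h0; have C0 : 0 <= C by rewrite !mulr_ge0.
elim: k f M => [|k IHk] f M fM.
  rewrite !mul0r (msg_id hS) ?subrr ?normr0//; exact/local_continuous/(polb_local fM).
have lf := polb_local fM; have cf := local_continuous lf.
have eM : polb n ((1 + h * C) * M) (euler h f) := polb_euler h0 fM; have lE := polb_local eM; have cE := local_continuous lE.
have M0 : 0 <= M by rewrite (le_trans _ (polb_bound eta fM)).
have Sc : 0 <= k%:R * h by rewrite mulr_ge0.
have cSh := msg_continuous hS h0 cf.
rewrite semigroup_iter// iterSr.
have -> : S (k%:R * h) (S h f) eta - iter k (euler h) (euler h f) eta =
  S (k%:R * h) (fun eta => S h f eta - euler h f eta) eta +
  (S (k%:R * h) (euler h f) eta - iter k (euler h) (euler h f) eta).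
  by rewrite semigroup_sub//; ring.
rewrite (le_trans (ler_normD _ _))// -natr1 mulrDl mul1r addrC lerD//.
  by apply: (le_trans (IHk _ _ eM)); apply: eq_ler; rewrite [(1 + h * C) ^+ k.+1]exprSr; ring.
have H : h ^+ 2 * (C ^+ 2 * M) <= h ^+ 2 * C ^+ 2 * ((1 + h * C) ^+ k.+1 * M).
  rewrite -mulrA ler_wpM2l ?exprn_ge0// ler_wpM2l ?exprn_ge0//.
  by rewrite ler_peMl// exprn_ege1// lerDl mulr_ge0.
apply: semigroup_contraction => //; first exact: continuous_sub.
move=> xi; apply: le_trans H; rewrite /euler opprD addrA.
apply: semigroup_taylor => // xi'.
have := polb_generator T0 (polb_generator T0 fM).
by move=> /(polb_bound xi'); rewrite -/C mulrA -expr2.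
Qed.

(** * Symmetry of the semigroup under an exchange-invariant functional *)

Section reversible.
Variable E : (config -> R) -> R.
Hypothesis E_lin : forall a f g, continuous f -> continuous g ->
  E (fun eta => a * f eta + g eta) = a * E f + E g.
Hypothesis E_bound : forall f (M : R), continuous f -> (forall eta, `|f eta| <= M) -> `|E f| <= M.
Hypothesis E_exchange : forall f x y, local_function f ->
  E (fun eta => f (exchange x y eta)) = E f.

Lemma E_cst0 : E (fun=> 0) = 0.
Proof.
have c0 := @continuous_const R 0.
by apply/eqP; rewrite -normr_le0; apply: E_bound => // eta; rewrite normr0.
Qed.

Lemma E_sum (I : eqType) (s : seq I) (F : I -> config -> R) :
  (forall i, i \in s -> continuous (F i)) ->
  E (fun eta => \sum_(i <- s) F i eta) = \sum_(i <- s) E (F i).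
Proof.
elim: s => [|i s IHs] h.
  by rewrite big_nil (_ : (fun _ => _) = fun=> 0) ?E_cst0//; apply/funext => eta; rewrite big_nil.
rewrite big_cons -IHs; last by move=> k ks; apply: h; rewrite inE ks orbT.
rewrite -[E (F i)]mul1r -E_lin; first by congr E; apply/funext => eta; rewrite big_cons mul1r.
  by apply: h; rewrite mem_head.
by apply: continuous_sum => k ks; apply: h; rewrite inE ks orbT.
Qed.

Lemma E_scale a f : continuous f -> E (fun eta => a * f eta) = a * E f.
Proof.
move=> cf; have := E_lin a cf (@continuous_const R 0); rewrite E_cst0 addr0 => <-.
by congr E; apply/funext => eta; rewrite addr0.
Qed.

Lemma E_sub f g : continuous f -> continuous g -> E (fun eta => f eta - g eta) = E f - E g.
Proof.
move=> cf cg; rewrite (_ : (fun _ => _) = fun eta => (-1) * g eta + f eta).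
  by rewrite E_lin//; ring.
by apply/funext => xi; ring.
Qed.

(** Bond by bond: the exchange is an involution that leaves [E] invariant, so it can be moved from
    one factor to the other. *)
Lemma E_generator f g : local_function f -> local_function g ->
  E (fun eta => f eta * L g eta) = E (fun eta => L f eta * g eta).
Proof.
move=> lf lg; have [n [fn gn]] := local2_box lf lg.
pose t f g x j eta : R := f eta * (g (exchange x (x + unit_vec j) eta) - g eta).
have H f' g' : dep (box n) f' -> dep (box n) g' -> E (fun eta => f' eta * L g' eta) =
    T / 2 * \sum_(j <- enum 'I_2) \sum_(x <- box n.+1) E (t f' g' x j).
  move=> fn' gn'; have lf' := box_local fn'; have lg' := box_local gn'.
  have ct x j : continuous (t f' g' x j).
    apply: local_continuous; apply: (local_op2 (fun a b => a * b)) => //.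
    by apply: (local_op2 (fun a b => a - b)) => //; exact: local_exchange.
  under [X in _ = _ * X]eq_bigr => j _ do rewrite -E_sum//.
  rewrite -E_sum; last first.
    move=> j _; apply: local_continuous; apply: local_sum => x _.
    apply: (local_op2 (fun a b => a * b)) => //.
    by apply: (local_op2 (fun a b => a - b)) => //; exact: local_exchange.
  rewrite -E_scale; last first.
    apply: local_continuous; apply: local_sum => j _; apply: local_sum => x _.
    apply: (local_op2 (fun a b => a * b)) => //.
    by apply: (local_op2 (fun a b => a - b)) => //; exact: local_exchange.
  congr E; apply/funext => eta; rewrite (generator_box T eta gn' (fun=> id)) big_enum/=.
  rewrite mulrCA; congr (_ * _); rewrite mulr_sumr; apply: eq_bigr => j _.
  by rewrite mulr_sumr.
rewrite H// (_ : (fun eta => L f eta * g eta) = fun eta => g eta * L f eta); last first.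
  by apply/funext => eta; rewrite mulrC.
rewrite H//; congr (_ * _); apply: eq_bigr => j _; apply: eq_bigr => x _.
set y := x + unit_vec j.
have lp (u v : config -> R) : local_function u -> local_function v ->
    local_function (fun eta => u eta * v (exchange x y eta)).
  by move=> lu lv; apply: (local_op2 (fun a b => a * b)) => //; exact: local_exchange.
have lp2 (u v : config -> R) : local_function u -> local_function v ->
    local_function (fun eta => u eta * v eta).
  by move=> lu lv; exact: (local_op2 (fun a b => a * b)).
have H2 u v : local_function u -> local_function v ->
    E (t u v x j) = E (fun eta => u eta * v (exchange x y eta)) - E (fun eta => u eta * v eta).
  move=> lu lv; rewrite -E_sub.
  - by congr E; apply/funext => eta; rewrite /t mulrBr.
  - exact/local_continuous/lp.
  - exact/local_continuous/lp2.
rewrite !H2//; congr (_ - _); last by congr E; apply/funext => eta; rewrite mulrC.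
rewrite -(E_exchange x y (lp _ _ lf lg)); congr E; apply/funext => eta.
rewrite mulrC; congr (g _ * _); apply/funext => z.
by rewrite !exchangeE /= swapK.
Qed.

Lemma local_iter_euler k h f : local_function f -> local_function (iter k (euler h) f).
Proof.
move=> lf; elim: k => //= k IHk.
apply: (local_op2 (fun a b => a + b)) => //.
by apply: (local_op1 (fun b => h * b)); exact: local_generator.
Qed.

Lemma E_euler k h f g : local_function f -> local_function g ->
  E (fun eta => f eta * iter k (euler h) g eta) = E (fun eta => iter k (euler h) f eta * g eta).
Proof.
elim: k f g => // k IHk f g lf lg.
have lm (u v : config -> R) : local_function u -> local_function v -> continuous (fun eta => u eta * v eta).
  by move=> lu lv; apply: local_continuous; exact: (local_op2 (fun a b => a * b)).
have lE u : local_function u -> local_function (euler h u) by exact: (@local_iter_euler 1).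
have H u v : local_function u -> local_function v ->
    E (fun eta => u eta * euler h v eta) = E (fun eta => euler h u eta * v eta).
  move=> lu lv; have lLu := local_generator T lu; have lLv := local_generator T lv.
  transitivity (h * E (fun eta => u eta * L v eta) + E (fun eta => u eta * v eta)).
    rewrite -E_lin; [|exact: lm|exact: lm].
    by congr E; apply/funext => eta; rewrite /euler; ring.
  rewrite E_generator// -E_lin; [|exact: lm|exact: lm].
  by congr E; apply/funext => eta; rewrite /euler; ring.
rewrite [in LHS]iterS H//; last exact: local_iter_euler.
by rewrite IHk ?iterSr//; exact: lE.
Qed.

(** Iterates of Euler's step inherit the symmetry of the generator and converge to [S t] at rate 1/k
    on local functions. Symmetry thus follows for any semigroup extending the generator, without
    identifying it with a constructed one. *)
Lemma E_semigroup_local t f g : 0 <= t -> local_function f -> local_function g ->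
  E (fun eta => f eta * S t g eta) = E (fun eta => S t f eta * g eta).
Proof.
move=> t0 lf lg.
have cf := local_continuous lf; have cg := local_continuous lg.
have [n1 [M1 f1]] := local_polb lf; have [n2 [M2 g2]] := local_polb lg.
pose n := maxn n1 n2.
have fn : polb n M1 f by apply: polb_size f1; lia.
have gn : polb n M2 g by apply: polb_size g2; lia.
pose C := 4 * n%:R * T; have C0 : 0 <= C by rewrite !mulr_ge0.
have M10 : 0 <= M1 by rewrite (le_trans _ (polb_bound (fun=> true) fn)).
have M20 : 0 <= M2 by rewrite (le_trans _ (polb_bound (fun=> true) gn)).
pose D := t ^+ 2 * C ^+ 2 * expR (t * C) * M1 * M2.
have D0 : 0 <= D by rewrite !mulr_ge0// ?exprn_ge0// expR_ge0.
have csg := msg_continuous hS t0 cg; have csf := msg_continuous hS t0 cf.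
suff H k : (0 < k)%N -> `|E (fun eta => f eta * S t g eta) - E (fun eta => S t f eta * g eta)| <=
     2 * D / k%:R.
  apply/eqP; rewrite -subr_eq0 -normr_le0; apply/ler_addgt0Pr => e e0; rewrite add0r.
  have := archi_boundP (divr_ge0 (mulr_ge0 (ler0n _ 2) D0) (ltW e0)); set k := Num.bound _ => hk.
  have k0 : (0 < k)%N.
    rewrite lt0n; apply/eqP => k0; move: hk; rewrite k0 ltNge divr_ge0// ?mulr_ge0//; exact: ltW.
  apply: (le_trans (H k k0)).
  by rewrite ler_pdivrMr ?ltr0n// [e * _]mulrC -ler_pdivrMr// ltW.
move=> k0; set h := t / k%:R.
have h0 : 0 <= h by rewrite divr_ge0.
have kh : k%:R * h = t by rewrite /h mulrC divfK ?pnatr_eq0 -?lt0n.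
have err u (M : R) eta : polb n M u -> 0 <= M ->
    `|S t u eta - iter k (euler h) u eta| <= t ^+ 2 * C ^+ 2 * expR (t * C) * M / k%:R.
  move=> uM M0; have := euler_error k eta h0 uM; rewrite kh -/C => /le_trans; apply.
  have -> : k%:R * (h ^+ 2 * C ^+ 2 * ((1 + h * C) ^+ k * M)) =
     t ^+ 2 * C ^+ 2 * (1 + h * C) ^+ k * M / k%:R.
    by rewrite /h; field; rewrite pnatr_eq0 -lt0n.
  rewrite ler_pM2r ?invr_gt0 ?ltr0n// ler_wpM2r// ler_wpM2l ?mulr_ge0 ?exprn_ge0//.
  have -> : t * C = k%:R * (h * C) by rewrite mulrA kh.
  rewrite expRM_natl lerXn2r ?nnegrE ?expR_ge0 ?addr_ge0 ?mulr_ge0//.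
  exact: expR_ge1Dx.
have li u : local_function u -> continuous (iter k (euler h) u).
  by move=> lu; exact/local_continuous/local_iter_euler.
have e1 : `|E (fun eta => f eta * S t g eta) - E (fun eta => f eta * iter k (euler h) g eta)| <= D / k%:R.
  rewrite -E_sub; [|exact: continuous_mul|apply: continuous_mul => //; exact: li].
  apply: E_bound.
    by apply: continuous_sub; apply: continuous_mul => //; exact: li.
  move=> eta; rewrite -mulrBr normrM.
  apply: (le_trans (ler_pM _ _ (polb_bound eta fn) (err _ _ eta gn M20))) => //.
  by rewrite /D le_eqVlt; apply/orP; left; apply/eqP; field; rewrite pnatr_eq0 -lt0n.
have e2 : `|E (fun eta => iter k (euler h) f eta * g eta) - E (fun eta => S t f eta * g eta)| <= D / k%:R.
  rewrite -E_sub; [|apply: continuous_mul => //; exact: li|exact: continuous_mul].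
  apply: E_bound.
    by apply: continuous_sub; apply: continuous_mul => //; exact: li.
  move=> eta; rewrite -mulrBl normrM distrC.
  apply: (le_trans (ler_pM _ _ (err _ _ eta fn M10) (polb_bound eta gn))) => //.
  by rewrite /D le_eqVlt; apply/orP; left; apply/eqP; field; rewrite pnatr_eq0 -lt0n.
rewrite -(subrK (E (fun eta => f eta * iter k (euler h) g eta)) (E (fun eta => f eta * S t g eta))).
rewrite -addrA (le_trans (ler_normD _ _))// mulr2n mulrDl mul1r mulrDl lerD//.
by rewrite E_euler.
Qed.

Lemma E_semigroup t f g : 0 <= t -> continuous f -> continuous g ->
  E (fun eta => f eta * S t g eta) = E (fun eta => S t f eta * g eta).
Proof.
move=> t0 cf cg.
have [F [F0 hF]] := continuous_bounded cf; have [G [G0 hG]] := continuous_bounded cg.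
have csg := msg_continuous hS t0 cg; have csf := msg_continuous hS t0 cf.
apply/eqP; rewrite -subr_eq0 -normr_le0; apply/ler_addgt0Pr => e e0; rewrite add0r.
(* [d <= 1] bounds the approximant of [g] by [G + 1]; the factor 2 stands for the two expectations
   to be replaced. *)
pose d := Num.min 1 (e / (2 * (F + G + 1))).
have K0 : 0 < F + G + 1 by rewrite ltr_pwDr// addr_ge0.
have d0 : 0 < d by rewrite lt_min ltr01 divr_gt0// mulr_gt0.
have d1 : d <= 1 by rewrite ge_min lexx.
have de : 2 * (F + G + 1) * d <= e.
  rewrite mulrC -ler_pdivlMr ?mulr_gt0//; by rewrite ge_min lexx orbT.
have [nf hnf] := continuous_approx cf d0; have [ng hng] := continuous_approx cg d0.
pose f' eta := f (trunc nf eta); pose g' eta := g (trunc ng eta).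
have lf' : local_function f' by exact: trunc_local.
have lg' : local_function g' by exact: trunc_local.
have cf' := local_continuous lf'; have cg' := local_continuous lg'.
have csg' := msg_continuous hS t0 cg'; have csf' := msg_continuous hS t0 cf'.
have H (u v u' v' : config -> R) (U V : R) : continuous u -> continuous v -> continuous u' -> continuous v' ->
   (forall eta, `|u eta - u' eta| <= d) -> (forall eta, `|v eta - v' eta| <= d) ->
   (forall eta, `|u eta| <= U) -> (forall eta, `|v' eta| <= V) -> U + V <= F + G + 1 ->
   `|E (fun eta => u eta * v eta) - E (fun eta => u' eta * v' eta)| <= (F + G + 1) * d.
  move=> cu cv cu' cv' du dv uU vV UV; rewrite -E_sub; [|exact: continuous_mul..].
  apply: E_bound; first by apply: continuous_sub; exact: continuous_mul.
  move=> eta; have -> : u eta * v eta - u' eta * v' eta =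
     u eta * (v eta - v' eta) + (u eta - u' eta) * v' eta by ring.
  rewrite (le_trans (ler_normD _ _))// !normrM.
  apply: (@le_trans _ _ ((U + V) * d)); last by rewrite ler_pM2r.
  by rewrite mulrDl [V * d]mulrC lerD// ler_pM.
have dS (u u' : config -> R) : continuous u -> continuous u' -> (forall eta, `|u eta - u' eta| <= d) ->
    forall eta, `|S t u eta - S t u' eta| <= d.
  move=> cu cu' uu eta; rewrite -semigroup_sub//.
  by apply: semigroup_contraction => //; exact: continuous_sub.
have g'b eta : `|g' eta| <= G + 1.
  rewrite -[g' eta](subrK (g eta)) (le_trans (ler_normD _ _))// addrC lerD//.
  by rewrite distrC (le_trans (hng _)).
have h1 : `|E (fun eta => f eta * S t g eta) - E (fun eta => f' eta * S t g' eta)| <= (F + G + 1) * d.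
  apply: (H _ _ _ _ F (G + 1)) => //; first exact: dS.
    by move=> eta; apply: semigroup_contraction.
  by rewrite addrA.
have h2 : `|E (fun eta => S t f eta * g eta) - E (fun eta => S t f' eta * g' eta)| <= (F + G + 1) * d.
  apply: (H _ _ _ _ F (G + 1)) => //; first exact: dS.
    by move=> eta; apply: semigroup_contraction.
  by rewrite addrA.
rewrite (E_semigroup_local t0 lf' lg') in h1.
rewrite -(subrK (E (fun eta => S t f' eta * g' eta)) (E (fun eta => f eta * S t g eta))).
rewrite -addrA (le_trans (ler_normD _ _))//; apply: le_trans de.
rewrite mulr2n mulrDl mul1r mulrDl lerD//.
by rewrite distrC.
Qed.

Lemma E_invariant t f : 0 <= t -> continuous f -> E (S t f) = E f.
Proof.
move=> t0 cf; have := E_semigroup t0 (@continuous_const R 1) cf.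
rewrite semigroup_cst//.
by under eq_fun do rewrite mul1r; under [in X in _ = X -> _]eq_fun do rewrite mul1r.
Qed.

End reversible.
End semigroup.

(** * Exponential moments of path functionals *)

Section finite_mass.
Context d (X : measurableType d) (R : realType) (mu : {measure set X -> \bar R}) (D : set X).
Hypothesis mD : measurable D.
Variable c : R.
Hypothesis muD : mu D = c%:E.

Definition bmeas (f : X -> R) :=
  measurable_fun D f /\ exists M : R, forall x, D x -> `|f x| <= M.

Local Notation I f := (\int[mu]_(x in D) f x).

Lemma bmeas_integrable f : bmeas f -> mu.-integrable D (EFin \o f).
Proof.
move=> [mf [M hM]]; apply: measurable_bounded_integrable => //.
  by rewrite muD ltry.
exists M; split; first exact: num_real.
by move=> N MN x /= Dx; rewrite (le_trans (hM x Dx))// ltW.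
Qed.

Lemma bmeas_cst (a : R) : bmeas (fun=> a).
Proof. by split; [exact: measurable_cst|exists `|a|]. Qed.

Lemma bmeas_indic (A : set X) : measurable A -> bmeas (\1_A).
Proof.
move=> mA; split; first exact: measurable_indic.
by exists 1 => x _; rewrite indicE; case: (_ \in _); rewrite ?normr1 ?normr0.
Qed.

Lemma bmeas_lin (a : R) f g : bmeas f -> bmeas g -> bmeas (fun x => a * f x + g x).
Proof.
move=> [mf [M hM]] [mg [N hN]]; split.
  by apply: measurable_funD => //; apply: measurable_funM => //; exact: measurable_cst.
exists (`|a| * M + N) => x Dx; rewrite (le_trans (ler_normD _ _))// lerD ?hN// normrM.
by rewrite ler_wpM2l// hM.
Qed.

Lemma bmeas_mul f g : bmeas f -> bmeas g -> bmeas (fun x => f x * g x).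
Proof.
move=> [mf [M hM]] [mg [N hN]]; split; first exact: measurable_funM.
by exists (M * N) => x Dx; rewrite normrM ler_pM// ?hM ?hN.
Qed.

Lemma bmeas_sum (J : eqType) (s : seq J) (F : J -> X -> R) :
  (forall i, i \in s -> bmeas (F i)) -> bmeas (fun x => \sum_(i <- s) F i x).
Proof.
elim: s => [|i s IHs] h.
  by rewrite (_ : (fun _ => _) = fun=> 0); [exact: bmeas_cst|apply/funext => x; rewrite big_nil].
rewrite (_ : (fun _ => _) = fun x => 1 * F i x + \sum_(i <- s) F i x).
  by apply: bmeas_lin; [apply: h; rewrite mem_head|apply: IHs => k ks; apply: h; rewrite inE ks orbT].
by apply/funext => x; rewrite big_cons mul1r.
Qed.

Lemma Int_lin (a : R) f g : bmeas f -> bmeas g -> I (fun x => a * f x + g x) = a * I f + I g.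
Proof.
move=> bf bg; rewrite RintegralD ?RintegralZl//; try exact: bmeas_integrable.
by apply: bmeas_integrable; have := bmeas_lin a bf (bmeas_cst 0); under eq_fun do rewrite addr0.
Qed.

Lemma Int_cst (a : R) : I (fun=> a) = a * c.
Proof. by rewrite Rintegral_cst// muD. Qed.

Lemma Int_scale (a : R) f : bmeas f -> I (fun x => a * f x) = a * I f.
Proof. by move=> bf; rewrite RintegralZl//; exact: bmeas_integrable. Qed.

Lemma Int_sum (J : eqType) (s : seq J) (F : J -> X -> R) :
  (forall i, i \in s -> bmeas (F i)) ->
  I (fun x => \sum_(i <- s) F i x) = \sum_(i <- s) I (F i).
Proof.
elim: s => [|i s IHs] h.
  by rewrite big_nil -[RHS](mul0r c) -Int_cst; apply: eq_Rintegral => x _; rewrite big_nil.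
have hs k : k \in s -> bmeas (F k) by move=> ks; apply: h; rewrite inE ks orbT.
rewrite big_cons -IHs// -[I (F i)]mul1r -Int_lin//; last exact: bmeas_sum.
  by apply: eq_Rintegral => x _; rewrite big_cons mul1r.
by apply: h; rewrite mem_head.
Qed.

Lemma Int_mono f g : bmeas f -> bmeas g -> (forall x, D x -> f x <= g x) -> I f <= I g.
Proof. by move=> bf bg fg; apply: le_Rintegral => //; exact: bmeas_integrable. Qed.

Lemma Int_bound (f : X -> R) (M : R) : measurable_fun D f -> (forall x, D x -> `|f x| <= M) -> `|I f| <= M * c.
Proof.
move=> mf fM; have bf : bmeas f by split=> //; exists M.
rewrite ler_norml; apply/andP; split.
  rewrite -mulNr -(Int_cst (- M)); apply: Int_mono => //; first exact: bmeas_cst.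
  by move=> x Dx; have := fM x Dx; rewrite ler_norml => /andP[].
rewrite -(Int_cst M); apply: Int_mono => //; first exact: bmeas_cst.
by move=> x Dx; have := fM x Dx; rewrite ler_norml => /andP[].
Qed.

Lemma Int_dominated (f_ : nat -> X -> R) (f : X -> R) (M : R) :
  (forall n, measurable_fun D (f_ n)) ->
  (forall n x, D x -> `|f_ n x| <= M) ->
  (forall x, D x -> f_ n x @[n --> \oo] --> f x) ->
  bmeas f /\ (I (f_ n) @[n --> \oo] --> I f).
Proof.
move=> mf bf cf.
have mf' : measurable_fun D f by exact: measurable_realfun.measurable_fun_cvg mf cf.
have bf' x : D x -> `|f x| <= M.
  move=> Dx; have cn : `|f_ n x| @[n --> \oo] --> `|f x| by apply: cvg_norm; exact: cf.
  rewrite -(cvg_lim _ cn)//; apply: limr_le; first by apply/cvg_ex; exists `|f x|.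
  by apply: nearW => n; exact: bf.
split; first by split=> //; exists M.
have iM : mu.-integrable D (EFin \o (fun=> M)) by exact/bmeas_integrable/bmeas_cst.
have := @dominated_cvg _ X R mu D mD (fun n => EFin \o f_ n) (EFin \o f) (EFin \o (fun=> M)).
have -> : (\int[mu]_(x in D) (EFin \o f) x)%E = (I f)%:E.
  rewrite /Rintegral fineK//; apply: integrable_fin_num => //.
  by apply: bmeas_integrable; split=> //; exists M.
move=> h; apply/fine_cvg/h => //.
- by move=> n; apply/measurable_EFinP.
- by move=> x Dx; apply: cvg_EFin; [exact: nearW|exact: cf].
Qed.

End finite_mass.

(** * The law of the process: product measure, stationarity, Markov property *)

Section law.
Variables (R : realType) (T alpha : R) (P : probability (trajectory R) R).
Variable S : R -> (config -> R) -> (config -> R).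
Hypothesis T0 : 0 <= T.
Hypothesis alpha01 : 0 < alpha < 1.
Hypothesis hP : bernoulli_product alpha (fun B => P [set w : trajectory R | B (w 0)]).
Hypothesis hS : markov_semigroup S.
Hypothesis gS : forall f, local_function f -> generator_at S f (exclusion_generator T f).
Hypothesis markovS : forall (s t : R) (f : config -> R) (A : set (trajectory R)),
  0 <= s -> 0 <= t -> continuous f -> past s A ->
  \int[P]_(w in A) f (w (s + t)) = \int[P]_(w in A) S t f (w s).
Implicit Types f g : config -> R.

Let PT : P setT = 1%E. Proof. exact: probability_setT. Qed.
Let mT : measurable [set: trajectory R]. Proof. exact: measurableT. Qed.

Lemma measurable_coord (u : R) (x : site) : 0 <= u -> measurable [set w : trajectory R | w u x].
Proof. by move=> u0; apply: sub_sigma_algebra; exists u, x. Qed.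

Lemma past_measurable s (A : set (trajectory R)) : past s A -> measurable A.
Proof.
apply: smallest_sub; first exact: smallest_sigma_algebra.
by move=> _ [u [x [/= /andP[u0 _] ->]]]; exact: measurable_coord.
Qed.

Lemma pastI s (A B : set (trajectory R)) : past s A -> past s B -> past s (A `&` B).
Proof. exact: (@measurableI _ (g_sigma_algebraType (coordinate_events [set u | 0 <= u <= s]))). Qed.

Lemma pastT s : past s [set: trajectory R].
Proof. exact: (@measurableT _ (g_sigma_algebraType (coordinate_events [set u | 0 <= u <= s]))). Qed.

Lemma mono_indic A u : mono R A \o (fun w : trajectory R => w u) =
  \1_(\big[setI/setT]_(x <- A) [set w : trajectory R | w u x]).
Proof.
elim: A => [|a A IHA].
  by apply/funext => w /=; rewrite /mono !big_nil indicT.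
apply/funext => w; rewrite big_cons indicI -IHA /= /mono big_cons; congr (_ * _).
by rewrite indicE; case: (boolP (w u a)) => h; [rewrite mem_set|rewrite memNset// => h'; rewrite h' in h].
Qed.

Lemma measurable_mono_set A u : 0 <= u ->
  measurable (\big[setI/setT]_(x <- A) [set w : trajectory R | w u x]).
Proof.
move=> u0; elim: A => [|a A IHA]; first by rewrite big_nil.
by rewrite big_cons; apply: measurableI => //; exact: measurable_coord.
Qed.

Lemma past_mono_set A u s : 0 <= u <= s ->
  past s (\big[setI/setT]_(x <- A) [set w : trajectory R | w u x]).
Proof.
move=> us; elim: A => [|a A IHA]; first by rewrite big_nil; exact: pastT.
rewrite big_cons; apply: pastI => //.
by apply: sub_sigma_algebra; exists u, a.
Qed.

Lemma measurable_local f u : 0 <= u -> local_function f ->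
  measurable_fun setT (fun w : trajectory R => f (w u)).
Proof.
move=> u0 /local_polb[n [M [l [_ _ ->]]]]; apply: measurable_sum => p.
apply: measurable_funM; first exact: measurable_cst.
rewrite (_ : (fun _ => _) = mono R p.2 \o (fun w : trajectory R => w u))// mono_indic.
apply: measurable_indic.
exact: measurable_mono_set.
Qed.

Lemma bmeas_continuous f u : 0 <= u -> continuous f ->
  bmeas setT (fun w : trajectory R => f (w u)).
Proof.
move=> u0 cf; split; last by have [M [_ hM]] := continuous_bounded cf; exists M => w _.
have /choice[N hN] : forall n : nat, exists m, forall eta, `|f eta - f (trunc m eta)| <= n.+1%:R^-1.
  by move=> n; apply: continuous_approx => //; rewrite invr_gt0 ltr0n.
apply: (@measurable_fun_cvg _ (trajectory R) R setT (fun n w => f (trunc (N n) (w u))) (fun w => f (w u))).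
  by move=> n; apply: (measurable_local u0 (trunc_local f (N n))).
move=> w _; apply/cvgrPdist_le => e e0; near=> n; apply: (le_trans (hN n _)).
by apply: ltW; near: n; exact: (near_infty_natSinv_lt (PosNum e0)).
Unshelve. all: by end_near.
Qed.

Definition E0 f : R := \int[P]_w f (w 0).

Lemma E0_lin a f g : continuous f -> continuous g ->
  E0 (fun eta => a * f eta + g eta) = a * E0 f + E0 g.
Proof.
by move=> cf cg; rewrite /E0 (Int_lin mT PT)//; exact: bmeas_continuous.
Qed.

Lemma E0_bound f (M : R) : continuous f -> (forall eta, `|f eta| <= M) -> `|E0 f| <= M.
Proof.
by move=> cf fM; rewrite -[M]mulr1; apply: (Int_bound mT PT) => //; have [] := bmeas_continuous (lexx 0) cf.
Qed.

Lemma E0_mono f g : continuous f -> continuous g -> (forall eta, f eta <= g eta) -> E0 f <= E0 g.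
Proof. by move=> cf cg fg; apply: (Int_mono mT PT) => //; exact: bmeas_continuous. Qed.

Lemma E0_cst a : E0 (fun=> a) = a.
Proof. by rewrite /E0 (Int_cst mT PT) mulr1. Qed.

Lemma E0_mono_undup A : E0 (mono R A) = alpha ^+ size (undup A).
Proof.
have -> : mono R A = mono R (undup A).
  apply/funext => eta; rewrite /mono; elim: A => // a A IHA; rewrite /= big_cons; case: ifPn => [aA|aA].
    rewrite -IHA; case ea: (eta a) => /=; first by rewrite mul1r.
    by rewrite mul0r; apply/esym/eqP; rewrite prodf_seq_eq0; apply/hasP; exists a; rewrite //= ea.
  by rewrite big_cons IHA.
have uA := undup_uniq A; move: (undup A) uA => B uB.
rewrite /E0 (_ : (fun w : trajectory R => mono R B (w 0)) =
  mono R B \o (fun w : trajectory R => w 0))// mono_indic /Rintegral.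
rewrite integral_indic//; last exact: measurable_mono_set.
rewrite setIT (_ : \big[setI/setT]_(x <- B) _ =
  [set w : trajectory R | [set eta | {in B, forall x, eta x = (fun=> true) x}] (w 0)]).
  transitivity (fine (\prod_(x <- B) alpha)%:E); first by congr fine; exact: (hP (fun=> true) uB).
  by elim: B {uB} => [|b B IHB]; rewrite ?big_nil ?expr0//= big_cons exprS -IHB.
apply/seteqP; split => w /=.
  elim: B {uB} => [|b B IHB]; first by move=> _ x.
  by rewrite big_cons => -[/= h1 /IHB h2] x; rewrite inE => /orP[/eqP ->|/h2].
elim: B {uB} => [|b B IHB] h; first by rewrite big_nil.
rewrite big_cons; split; first by rewrite /= h// mem_head.
by apply: IHB => x xB; apply: h; rewrite inE xB orbT.
Qed.

(** By linearity monomials suffice; their expectation depends only on the number of distinct sites,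
    which the bijection [swap x y] preserves. *)
Lemma E0_exchange f x y : local_function f -> E0 (fun eta => f (exchange x y eta)) = E0 f.
Proof.
move=> /local_polb[n [M [l [_ _ ->]]]].
have cm A : continuous (mono R A).
  by apply: local_continuous; exists A; exact: dep_mono.
have E0Z a A : E0 (fun eta => a * mono R A eta) = a * E0 (mono R A).
  by apply: (E_scale E0_lin E0_bound).
have czm a A : continuous (fun eta => a * mono R A eta).
  by apply: local_continuous; apply: (local_op1 (fun b => a * b)); exists A; exact: dep_mono.
rewrite (_ : (fun eta => \sum_(p <- l) p.1 * mono R p.2 (exchange x y eta)) =
  fun eta => \sum_(p <- l) p.1 * mono R (map (swap x y) p.2) eta); last first.
  by apply/funext => eta; apply: eq_bigr => p _; rewrite mono_exchange.
rewrite (E_sum E0_lin E0_bound (F := fun p eta => p.1 * mono R (map (swap x y) p.2) eta))//.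
rewrite (E_sum E0_lin E0_bound (F := fun p eta => p.1 * mono R p.2 eta))//.
apply: eq_bigr => p _; rewrite !E0Z !E0_mono_undup undup_map_inj ?size_map//.
exact: can_inj (@swapK x y).
Qed.

Lemma E0_semigroup t f g : 0 <= t -> continuous f -> continuous g ->
  E0 (fun eta => f eta * S t g eta) = E0 (fun eta => S t f eta * g eta).
Proof. exact: (E_semigroup T0 hS gS E0_lin E0_bound E0_exchange). Qed.

Lemma stationary t f : 0 <= t -> continuous f -> \int[P]_w f (w t) = E0 f.
Proof.
move=> t0 cf; have := markovS (lexx 0) t0 cf.
move=> /(_ setT); rewrite add0r => ->.
  exact: (E_invariant T0 hS gS E0_lin E0_bound E0_exchange).
exact: pastT.
Qed.

(** [B] collects the occupation variables met while the product is expanded one factor at a time. *)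
Lemma E0_prod_affine B A (a b : site -> R) : uniq (B ++ A) ->
  E0 (fun eta => mono R B eta * \prod_(x <- A) (a x + b x * (eta x)%:R)) =
  alpha ^+ size B * \prod_(x <- A) (a x + b x * alpha).
Proof.
elim: A B => [|x A IHA] B.
  rewrite cats0 big_nil mulr1 => uB; rewrite -[in RHS](undup_id uB) -E0_mono_undup.
  by congr E0; apply/funext => eta; rewrite big_nil mulr1.
move=> uBA.
have uBA' : uniq (B ++ A) by apply: subseq_uniq uBA; rewrite cat_subseq// subseq_cons.
have uxBA : uniq ((x :: B) ++ A).
  by move: uBA; rewrite -cat1s uniq_catCA.
rewrite big_cons mulrDl mulrDr.
have lpr C : continuous (fun eta => mono R C eta * \prod_(x <- A) (a x + b x * (eta x)%:R)).
  apply: local_continuous; apply: (local_op2 (fun u v => u * v)).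
    by exists C; exact: dep_mono.
  by exists A => eta xi h; apply: eq_big_seq => y yA; rewrite h.
transitivity (a x * E0 (fun eta => mono R B eta * \prod_(x <- A) (a x + b x * (eta x)%:R)) +
   b x * E0 (fun eta => mono R (x :: B) eta * \prod_(x <- A) (a x + b x * (eta x)%:R))).
  rewrite -(E_scale E0_lin E0_bound (b x) (lpr _)) -E0_lin//.
    by congr E0; apply/funext => eta; rewrite big_cons /mono big_cons; ring.
  rewrite (_ : (fun _ => _) = fun eta => b x * (mono R (x :: B) eta *
    \prod_(x <- A) (a x + b x * (eta x)%:R)) + (fun=> 0) eta).
    by apply: continuous_lin => //; exact: continuous_const.
  by apply/funext => eta; rewrite addr0.
by rewrite !IHA//= exprS; ring.
Qed.

(** Independence reduces the bound to one site. There [expR_quad] applies, the linear terms cancel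
    by centring, and the variance alpha (1 - alpha) is at most 1. *)
Lemma E0_exp_linear A (c : site -> R) : uniq A -> (forall x, x \in A -> `|c x| <= 2^-1) ->
  E0 (fun eta => expR (\sum_(x <- A) c x * ((eta x)%:R - alpha))) <=
  expR (2 * \sum_(x <- A) c x ^+ 2).
Proof.
move=> uA c1.
pose a x := expR (c x * (0 - alpha)); pose b x := expR (c x * (1 - alpha)) - a x.
have -> : (fun eta : config => expR (\sum_(x <- A) c x * ((eta x)%:R - alpha))) =
    fun eta => mono R [::] eta * \prod_(x <- A) (a x + b x * (eta x)%:R).
  apply/funext => eta; rewrite expR_sum /mono big_nil mul1r; apply: eq_bigr => x _.
  by rewrite /b; case: (eta x) => /=; rewrite ?mulr1 ?mulr0 ?addr0// [RHS]addrC subrK.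
rewrite E0_prod_affine// expr0 mul1r mulr_sumr expR_sum.
move: alpha01 => /andP[al0 al1].
have ab x : 0 <= a x + b x * alpha.
  have -> : a x + b x * alpha = (1 - alpha) * a x + alpha * expR (c x * (1 - alpha)).
    by rewrite /b; ring.
  by rewrite addr_ge0// mulr_ge0 ?expR_ge0 ?subr_ge0// ltW.
rewrite big_seq [leRHS]big_seq; apply: ler_prod => x xA; rewrite ab/=.
apply: le_trans (expR_ge1Dx _).
have cx := c1 x xA.
have h1 : a x <= 1 + c x * (0 - alpha) + 2 * (c x * (0 - alpha)) ^+ 2.
  apply: expR_quad; rewrite normrM sub0r normrN (gtr0_norm al0) -[leRHS]mulr1.
  by rewrite ler_pM// ltW.
have h2 : expR (c x * (1 - alpha)) <= 1 + c x * (1 - alpha) + 2 * (c x * (1 - alpha)) ^+ 2.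
  apply: expR_quad; rewrite normrM (ger0_norm (_ : 0 <= 1 - alpha)) ?subr_ge0 ?(ltW al1)// -[leRHS]mulr1.
  by rewrite ler_pM// ?subr_ge0 ?(ltW al1)// lerBlDr lerDl ltW.
have -> : a x + b x * alpha = (1 - alpha) * a x + alpha * expR (c x * (1 - alpha)).
  by rewrite /b; ring.
apply: (@le_trans _ _ ((1 - alpha) * (1 + c x * (0 - alpha) + 2 * (c x * (0 - alpha)) ^+ 2) +
   alpha * (1 + c x * (1 - alpha) + 2 * (c x * (1 - alpha)) ^+ 2))).
  by rewrite lerD// ler_wpM2l// ?subr_ge0 ltW.
have -> : ((1 - alpha) * (1 + c x * (0 - alpha) + 2 * (c x * (0 - alpha)) ^+ 2) +
   alpha * (1 + c x * (1 - alpha) + 2 * (c x * (1 - alpha)) ^+ 2)) = 1 + (alpha * (1 - alpha)) * (2 * c x ^+ 2).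
  by ring.
rewrite lerD2l ler_piMl//; first by rewrite pmulr_rge0 ?sqr_ge0.
by rewrite -[leRHS]mulr1 ler_pM// ?subr_ge0 ?(ltW al0) ?(ltW al1)// lerBlDr lerDl ltW.
Qed.

(** The Markov property is given on events of the past. This class, to which it extends by
    linearity, is closed under products and so contains the discretized exponential weights. *)
Definition past_simple (s : R) (Y : trajectory R -> R) :=
  exists l : seq (R * set (trajectory R)), (forall p, p \in l -> past s p.2) /\
    Y = fun w => \sum_(p <- l) p.1 * \1_(p.2) w.

Lemma past_simple_local f u s : 0 <= u <= s -> local_function f ->
  past_simple s (fun w => f (w u)).
Proof.
move=> us /local_polb[n [M [l [_ _ ->]]]].
exists [seq (p.1, \big[setI/setT]_(x <- p.2) [set w : trajectory R | w u x]) | p <- l]; split.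
  by move=> _ /mapP[p _ ->]; exact: past_mono_set.
apply/funext => w; rewrite big_map; apply: eq_bigr => p _ /=.
by rewrite -mono_indic.
Qed.

Lemma past_le s s' (A : set (trajectory R)) : s <= s' -> past s A -> past s' A.
Proof.
move=> ss; apply: smallest_sub; first exact: smallest_sigma_algebra.
move=> _ [u [x [/= /andP[u0 us] ->]]]; apply: sub_sigma_algebra; exists u, x; split=> //=.
by rewrite u0 (le_trans us).
Qed.

Lemma past_simple_le s s' Y : s <= s' -> past_simple s Y -> past_simple s' Y.
Proof. by move=> ss [l [h ->]]; exists l; split=> // p /h; exact: past_le. Qed.

Lemma past_simple_mul s Y Z : past_simple s Y -> past_simple s Z ->
  past_simple s (fun w => Y w * Z w).
Proof.
move=> [l [hl ->]] [k [hk ->]].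
exists [seq (p.1 * q.1, p.2 `&` q.2) | p <- l, q <- k]; split.
  move=> _ /allpairsP[[p q] /= [/hl pl /hk qk ->]] /=.
  exact: pastI.
apply/funext => w; rewrite big_allpairs_dep mulr_suml; apply: eq_bigr => p _.
by rewrite mulr_sumr; apply: eq_bigr => q _ /=; rewrite indicI /=; ring.
Qed.

Lemma markov_simple s t f Y : 0 <= s -> 0 <= t -> continuous f -> past_simple s Y ->
  \int[P]_w (Y w * f (w (s + t))) = \int[P]_w (Y w * S t f (w s)).
Proof.
move=> s0 t0 cf [l [hl ->]].
have H (g : trajectory R -> R) : bmeas setT g ->
   \int[P]_w ((\sum_(p <- l) p.1 * \1_(p.2) w) * g w) = \sum_(p <- l) p.1 * \int[P]_(w in p.2) g w.
  move=> bg.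
  have b1 p : p \in l -> bmeas setT (fun w => \1_(p.2) w * g w).
    move=> pl; apply: bmeas_mul => //.
    by apply: bmeas_indic; exact: past_measurable (hl _ pl).
  have b2 p : p \in l -> bmeas setT (fun w => p.1 * (\1_(p.2) w * g w)).
    by move=> pl; apply: bmeas_mul; [exact: bmeas_cst|exact: b1].
  transitivity (\int[P]_w \sum_(p <- l) p.1 * (\1_(p.2) w * g w)).
    by apply: eq_Rintegral => w _; rewrite mulr_suml; apply: eq_bigr => p _; rewrite mulrA.
  rewrite (Int_sum mT PT (F := fun p w => p.1 * (\1_(p.2) w * g w)))//.
  apply: eq_big_seq => p pl; rewrite (Int_scale mT PT)//; last exact: b1.
  congr (_ * _); rewrite [RHS]Rintegral_mkcond; apply: eq_Rintegral => w _.
  by rewrite patchE indicE; case: ifP => _; rewrite ?mul1r ?mul0r.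
rewrite !H; [|apply: bmeas_continuous => //; exact: (msg_continuous hS)|].
  by apply: eq_big_seq => p /hl hp; congr (_ * _); apply: markovS.
by apply: bmeas_continuous => //; exact: addr_ge0.
Qed.

(** * The Schur test along a time grid *)

Section exponential_bound.
Variables (u : config -> R) (c : R).
Hypothesis lu : local_function u.
Hypothesis c0 : 0 < c.
Hypothesis uc : forall eta, c <= u eta.

Definition potential (eta : config) : R := - (exclusion_generator T u eta / u eta).
Local Notation V := potential.

Lemma local_potential : local_function V.
Proof.
by apply: (local_op2 (fun a b => - (a / b))) => //; exact: local_generator.
Qed.

Let lV := local_potential.

Let half h : config -> R := fun eta => expR (h / 2 * V eta).
Let K h g : config -> R := fun eta => half h eta * S h (fun xi => half h xi * g xi) eta.

Let lhalf h : local_function (half h).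
Proof. exact: (local_op1 (fun a => expR (h / 2 * a))). Qed.

Let cK h g : 0 <= h -> continuous g -> continuous (K h g).
Proof.
move=> h0 cg; apply: continuous_mul; first exact/local_continuous/lhalf.
by apply: (msg_continuous hS) => //; apply: continuous_mul => //; exact/local_continuous/lhalf.
Qed.

(** Cauchy-Schwarz for a positive functional not written as an integral: positivity is applied to (q
    - lam u)^2 / u with the optimal [lam]. *)
Lemma semigroup_schwarz h q : 0 <= h -> continuous q -> forall eta,
  S h q eta ^+ 2 <= S h u eta * S h (fun xi => q xi ^+ 2 / u xi) eta.
Proof.
move=> h0 cq eta.
have cu := local_continuous lu.
have ci : continuous (fun xi => (u xi)^-1).
  by apply: local_continuous; exact: (local_op1 (fun a => a^-1)).
have cr : continuous (fun xi => q xi ^+ 2 / u xi).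
  by apply: continuous_mul => //; exact: continuous_sqr.
have Su : 0 < S h u eta.
  apply: (lt_le_trans c0); rewrite -[c]/((fun _ : config => c) eta) -(semigroup_cst hS c h0).
  by apply: (semigroup_mono hS) => //; exact: continuous_const.
set lam := S h q eta / S h u eta.
have h1 : S h (fun xi => (2 * lam) * q xi + ((- lam ^+ 2) * u xi + (fun=> 0) xi)) eta <=
          S h (fun xi => q xi ^+ 2 / u xi) eta.
  apply: (semigroup_mono hS) => //.
    by apply: continuous_lin => //; apply: continuous_lin => //; exact: continuous_const.
  move=> xi; rewrite addr0 ler_pdivlMr; last exact: lt_le_trans c0 (uc xi).
  rewrite -subr_ge0 (_ : _ - _ = (q xi - lam * u xi) ^+ 2) ?sqr_ge0//; ring.
rewrite (semigroup_lin hS) // in h1; last first.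
  by apply: continuous_lin => //; exact: continuous_const.
rewrite (semigroup_lin hS) // in h1; last exact: continuous_const.
rewrite (semigroup_cst hS) // addr0 in h1.
rewrite mulrC -ler_pdivrMr//; apply: le_trans h1.
apply: eq_ler; rewrite /lam; field; exact: lt0r_neq0.
Qed.

(* Schwarz against the weight [u]: [K h] is symmetric and maps
   [expR (- h / 2 * V) * u] below [1 + h * e] times itself. *)
Lemma schur_step (e : R) : 0 < e -> exists2 h0, 0 < h0 & forall h, 0 < h < h0 ->
  forall g, continuous g -> E0 (fun eta => K h g eta ^+ 2) <= (1 + h * e) ^+ 2 * E0 (fun eta => g eta ^+ 2).
Proof.
move=> e0; have cu := local_continuous lu.
have [B [B0 hB]] := continuous_bounded (local_continuous lV).
have u0 eta : 0 < u eta by exact: lt_le_trans (uc eta).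
(* The accuracy asked of the first-order expansion of [S h u]. Since u >= c and h |V| <= B when h <=
   1, it is at most e u exp (- h V). *)
have e'0 : 0 < e * c * expR (- B) by rewrite !mulr_gt0// expR_gt0.
have [h1 h10 H1] := semigroup_step gS lu e'0.
exists (Num.min 1 h1); first by rewrite lt_min ltr01.
move=> h /andP[hp]; rewrite lt_min => /andP[hl1 hlh1] g cg.
have h0 := ltW hp.
have Su eta : S h u eta <= (1 + h * e) * (u eta * expR (- (h * V eta))).
  have := H1 h _ eta; rewrite hp hlh1 => /(_ isT).
  rewrite ler_norml => /andP[_]; rewrite lerBlDr => Hu.
  have {Hu} : S h u eta <= u eta * (1 - h * V eta) + h * (e * c * expR (- B)).
    rewrite lerBlDr in Hu; apply: (le_trans Hu); apply: eq_ler.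
    by rewrite /potential; field; exact: lt0r_neq0.
  move=> /le_trans; apply.
  rewrite mulrDl mul1r lerD//.
    by rewrite ler_pM2l//; exact: expR_ge1Dx.
  rewrite -[h * e * _]mulrA ler_pM2l// -[e * c * _]mulrA ler_pM2l// ler_pM ?expR_ge0 ?(ltW c0)//.
  rewrite ler_expR lerN2; apply: (le_trans (ler_norm _)); rewrite normrM gtr0_norm//.
  by rewrite -[leRHS]mul1r ler_pM// ltW.
pose r xi := expR (h * V xi) * (g xi ^+ 2 / u xi).
have cr : continuous r.
  apply: continuous_mul.
    by apply: local_continuous; exact: (local_op1 (fun a => expR (h * a))).
  apply: continuous_mul; last by apply: local_continuous; exact: (local_op1 (fun a => a^-1)).
  exact: continuous_sqr.
have r0 xi : 0 <= r xi by rewrite mulr_ge0 ?expR_ge0 ?divr_ge0 ?sqr_ge0 ?(ltW (u0 _)).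
have cg2 : continuous (fun eta => g eta ^+ 2).
  exact: continuous_sqr.
have cKg := cK h0 cg.
have half2 eta : half h eta ^+ 2 = expR (h * V eta).
  by rewrite /half expr2 -expRD; congr expR; field.
have K2 eta : K h g eta ^+ 2 <= (1 + h * e) * (u eta * S h r eta).
  rewrite /K exprMn half2.
  have := semigroup_schwarz h0 (continuous_mul (local_continuous (lhalf h)) cg) eta.
  rewrite (_ : (fun xi => (half h xi * g xi) ^+ 2 / u xi) = r); last first.
    by apply/funext => xi; rewrite exprMn half2 /r; ring.
  move=> hs; apply: (@le_trans _ _ (expR (h * V eta) * (S h u eta * S h r eta))).
    by rewrite ler_pM2l ?expR_gt0.
  have Sr : 0 <= S h r eta by exact: (msg_pos hS).
  rewrite mulrA mulrA ler_wpM2r//.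
  apply: (le_trans (ler_wpM2l (expR_ge0 _) (Su eta))).
  apply: eq_ler; rewrite expRN; field; exact: lt0r_neq0 (expR_gt0 _).
have he0 : 0 <= 1 + h * e by rewrite addr_ge0// mulr_ge0 ?ltW.
apply: (@le_trans _ _ (E0 (fun eta => (1 + h * e) * (u eta * S h r eta)))).
  apply: E0_mono => //.
    exact: continuous_sqr.
  apply: continuous_mul; first exact: continuous_const.
  by apply: continuous_mul => //; exact: (msg_continuous hS).
rewrite (E_scale E0_lin E0_bound); last by apply: continuous_mul => //; exact: (msg_continuous hS).
rewrite E0_semigroup// expr2 -mulrA ler_wpM2l//.
rewrite -(E_scale E0_lin E0_bound)//; apply: E0_mono.
- by apply: continuous_mul => //; exact: (msg_continuous hS).
- by apply: continuous_mul => //; exact: continuous_const.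
move=> eta; apply: (le_trans (ler_wpM2r (r0 eta) (Su eta))).
apply: eq_ler; rewrite /r expRN; field.
by rewrite !lt0r_neq0// expR_gt0.
Qed.

Let Wt h n (w : trajectory R) : R := half h (w 0) * \prod_(k < n) expR (h * V (w (k.+1%:R * h))).

(** Conditioning at the last grid point but one peels off one factor [K h]. Two half weights meet at
    each inner time and only the end times keep a half: this is the trapezoidal rule for the
    integral of V. *)
Lemma path_weight h n g : 0 <= h -> continuous g ->
  \int[P]_w (Wt h n w * (half h (w (n.+1%:R * h)) * g (w (n.+1%:R * h)))) = E0 (iter n.+1 (K h) g).
Proof.
move=> h0.
have kh k : 0 <= k%:R * h by rewrite mulr_ge0.
have sW m : past_simple (m%:R * h) (Wt h m).
  apply: past_simple_mul; first by apply: past_simple_local => //; rewrite lexx kh.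
  elim: m => [|m IHm].
    rewrite (_ : (fun w : trajectory R => \prod_(k < 0) expR (h * V (w (k.+1%:R * h)))) =
      fun w => (fun _ : config => 1) (w 0)); last by apply/funext => w; rewrite big_ord0.
    apply: (@past_simple_local (fun=> 1) 0); rewrite ?lexx ?kh//; exact: local_cst.
  rewrite (_ : (fun w : trajectory R => \prod_(k < m.+1) expR (h * V (w (k.+1%:R * h)))) =
    fun w => (\prod_(k < m) expR (h * V (w (k.+1%:R * h)))) *
     expR (h * V (w (m.+1%:R * h)))); last by apply/funext => w; rewrite big_ord_recr.
  apply: past_simple_mul.
    by apply: past_simple_le IHm; rewrite ler_wpM2r// ler_nat.
  apply: (past_simple_local (f := fun eta => expR (h * V eta))); first by rewrite kh lexx.
  exact: (local_op1 (fun a => expR (h * a))).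
elim: n g => [|n IHn] g cg.
  rewrite mul1r; have := @markov_simple 0 h (fun eta => half h eta * g eta) (Wt h 0) (lexx _) h0.
  rewrite add0r => ->.
  - by apply: eq_Rintegral => w _; rewrite /Wt big_ord0 mulr1.
  - by apply: continuous_mul => //; exact/local_continuous/lhalf.
  - by have := sW 0%N; rewrite mul0r.
have := @markov_simple (n.+1%:R * h) h (fun eta => half h eta * g eta) (Wt h n.+1) (kh _) h0 _ (sW _).
have -> : n.+1%:R * h + h = n.+2%:R * h by rewrite -[in RHS]natr1 mulrDl mul1r.
move=> ->; last by apply: continuous_mul => //; exact/local_continuous/lhalf.
rewrite iterSr -IHn; last exact: cK.
apply: eq_Rintegral => w _; rewrite /Wt big_ord_recr/= /K -!mulrA; congr (_ * (_ * _)).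
rewrite mulrA; congr (_ * _); rewrite /half -expRD; congr expR.
by field.
Qed.

(** Nonnegativity of the variance bounds the mean of [iter n.+1 (K h) 1] by its norm in L^2, which
    is at most (1 + h e)^(n + 1) with h = 1 / (n + 1). *)
Lemma trapezoid_bound (e : R) : 0 < e -> exists N : nat, forall n h, (N <= n)%N -> h = n.+1%:R^-1 ->
  \int[P]_w (Wt h n w * half h (w 1)) <= expR e.
Proof.
move=> e0; have [h0 h00 H] := schur_step e0.
have [N _ HN] := near_infty_natSinv_lt (PosNum h00).
exists N => n h Nn hE; have hp : 0 < h by rewrite hE invr_gt0 ltr0n.
have hh0 : h < h0 by rewrite hE; exact: HN.
have nh : n.+1%:R * h = 1 by rewrite hE mulfV// pnatr_eq0.
have := path_weight n (ltW hp) (@continuous_const R 1); rewrite nh.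
under [X in X = _ -> _]eq_Rintegral do rewrite mulr1.
move=> ->.
have ck k : continuous (iter k (K h) (fun=> 1)).
  by elim: k => [|k IHk]; [exact: continuous_const|apply: cK => //; exact: ltW].
have sq k : continuous (fun eta => iter k (K h) (fun=> 1) eta ^+ 2).
  exact/continuous_sqr/ck.
have E2 k : E0 (fun eta => iter k (K h) (fun=> 1) eta ^+ 2) <= ((1 + h * e) ^+ k) ^+ 2.
  elim: k => [|k IHk]; first by rewrite expr0 expr1n -[leRHS](E0_cst 1); apply: eq_ler;
     congr E0; apply/funext => xi; rewrite /= expr1n.
  rewrite [(1 + h * e) ^+ k.+1]exprS exprMn; apply: (le_trans (H h _ _ (ck k))); first by rewrite hp.
  by rewrite ler_wpM2l// sqr_ge0.
have he0 : 0 <= 1 + h * e by rewrite addr_ge0// mulr_ge0 ?ltW.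
apply: (@le_trans _ _ ((1 + h * e) ^+ n.+1)); last first.
  have -> : expR e = expR (h * e) ^+ n.+1 by rewrite -expRM_natl mulrA nh mul1r.
  by rewrite lerXn2r ?nnegrE ?expR_ge0// expR_ge1Dx.
rewrite -ler_sqr ?nnegrE ?exprn_ge0//; last first.
  rewrite -[X in X <= _](E0_cst 0); apply: E0_mono => //; first exact: continuous_const.
  move=> eta; elim: n.+1 eta => [|k IHk] eta /=; first exact: ler01.
  apply: mulr_ge0; first exact: expR_ge0.
  apply: (msg_pos hS) => //; first exact: ltW.
    by apply: continuous_mul => //; exact/local_continuous/lhalf.
  by move=> xi; rewrite mulr_ge0 ?expR_ge0.
apply: le_trans (E2 n.+1).
set g := iter _ _ _; set m := E0 g.
have : 0 <= E0 (fun eta => (- (2 * m)) * g eta + (g eta ^+ 2 + m ^+ 2)).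
  rewrite -[X in X <= _](E0_cst 0); apply: E0_mono; first exact: continuous_const.
    apply: continuous_lin; first exact: ck.
    rewrite (_ : (fun _ => _) = fun eta => 1 * (g eta ^+ 2) + (fun=> m ^+ 2) eta).
      by apply: continuous_lin; [exact: sq|exact: continuous_const].
    by apply/funext => xi; rewrite mul1r.
  have sqE (a b : R) : - (2 * b) * a + (a ^+ 2 + b ^+ 2) = (a - b) ^+ 2 by ring.
  by move=> eta; rewrite sqE sqr_ge0.
have -> : E0 (fun eta => (- (2 * m)) * g eta + (g eta ^+ 2 + m ^+ 2)) =
   E0 (fun eta => g eta ^+ 2) - m ^+ 2.
  rewrite (_ : (fun eta => (- (2 * m)) * g eta + (g eta ^+ 2 + m ^+ 2)) =
     fun eta => (- (2 * m)) * g eta + (1 * g eta ^+ 2 + (fun=> m ^+ 2) eta)); last first.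
    by apply/funext => eta; rewrite mul1r.
  rewrite E0_lin; [|exact: ck|apply: continuous_lin; [exact: sq|exact: continuous_const]].
  rewrite E0_lin; [|exact: sq|exact: continuous_const].
  rewrite E0_cst -/m; ring.
by rewrite subr_ge0.
Qed.

End exponential_bound.
End law.

Lemma measurable_superlevel d (X : measurableType d) (R : realType) (Y : X -> R) (a : R) :
  measurable_fun setT Y -> measurable [set w | a <= Y w].
Proof.
move=> mY; rewrite (_ : [set w | a <= Y w] = setT `&` Y @^-1` `[a, +oo[%classic).
  by apply: mY => //; exact: measurable_itv.
by rewrite setTI; apply/seteqP; split=> w /=; rewrite in_itv/= andbT.
Qed.

(** * Time integrals as limits of Riemann sums *)

Section time_integral.
Variable R : realType.
Implicit Types (f g : config -> R) (w : trajectory R).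

Let I01 : set R := `[0%R, 1%R[%classic.
Let mI : measurable I01. Proof. exact: measurable_itv. Qed.
Let muI : @lebesgue_measure R I01 = 1%E.
Proof. by rewrite lebesgue_measure_itv/= lte_fin ltr01 sube0. Qed.

Definition tint f w : R := \int[@lebesgue_measure R]_(s in I01) f (w s).

(** Right endpoints, because they approach a given time from the right, where trajectories are
    continuous. *)
Definition rsum f (n : nat) w : R := n.+1%:R^-1 * \sum_(k < n.+1) f (w (k.+1%:R * n.+1%:R^-1)).

Let step f w n (s : R) : R := \sum_(k < n.+1)
  f (w (k.+1%:R * n.+1%:R^-1)) * \1_(`[k%:R * n.+1%:R^-1, k.+1%:R * n.+1%:R^-1[%classic) s.

Lemma indic_itv_trunc n k (s : R) : 0 <= s ->
  \1_(`[k%:R * n.+1%:R^-1, k.+1%:R * n.+1%:R^-1[%classic) s =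
  (Num.truncn (s * n.+1%:R) == k)%:R :> R.
Proof.
move=> s0; rewrite indicE; congr (_%:R); congr nat_of_bool.
rewrite truncn_eq ?mulr_ge0//; apply/idP/idP.
  rewrite inE /= in_itv /= => /andP[h1 h2].
  by rewrite -ler_pdivrMr ?ltr0n// h1/= -ltr_pdivlMr ?ltr0n.
by move=> /andP[h1 h2]; rewrite inE /= in_itv/= ler_pdivrMr ?ltr0n// h1/= ltr_pdivlMr ?ltr0n.
Qed.

Lemma stepE f w n (s : R) : I01 s -> exists k : nat,
  step f w n s = f (w (k.+1%:R * n.+1%:R^-1)) /\ s < k.+1%:R * n.+1%:R^-1 <= s + n.+1%:R^-1.
Proof.
rewrite /I01 /= in_itv /= => /andP[s0 s1].
have kn : (Num.truncn (s * n.+1%:R) < n.+1)%N.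
  rewrite -(ltr_nat R); apply: le_lt_trans (_ : s * n.+1%:R < _).
    by have /andP[] := truncn_itv (mulr_ge0 s0 (ler0n R n.+1)).
  by rewrite gtr_pMl ?ltr0n.
exists (Num.truncn (s * n.+1%:R)); split.
  rewrite /step (bigD1 (Ordinal kn))//= big1 ?addr0; last first.
    by move=> i /negbTE h; rewrite indic_itv_trunc// eq_sym -val_eqE/= in h *; rewrite h mulr0.
  by rewrite indic_itv_trunc// eqxx mulr1.
have /andP[h1 h2] := truncn_itv (mulr_ge0 s0 (ler0n R n.+1)).
rewrite ltr_pdivlMr ?ltr0n// h2/= ler_pdivrMr ?ltr0n// mulrDl mulVf ?pnatr_eq0//.
by rewrite -natr1 lerD2r.
Qed.

(** Step functions converge pointwise by right continuity; dominated convergence gives both the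
    measurability of s |-> f (w s) and the limit of the integrals. *)
Lemma tint_riemann f w : continuous f ->
  bmeas I01 (fun s => f (w s)) /\ (rsum f n w @[n --> \oo] --> tint f w).
Proof.
move=> cf; have [M [M0 hM]] := continuous_bounded cf.
have bi n (k : 'I_n.+1) : bmeas I01 (\1_(`[k%:R * n.+1%:R^-1, k.+1%:R * n.+1%:R^-1[%classic) : R -> R).
  by apply: bmeas_indic => //; exact: measurable_itv.
have rE n : rsum f n w = \int[@lebesgue_measure R]_(s in I01) step f w n s.
  rewrite /step (@Int_sum _ _ R (@lebesgue_measure R) I01 mI _ muI _ _ (fun (k : 'I_n.+1) s => f (w (k.+1%:R * n.+1%:R^-1)) *
    \1_(`[k%:R * n.+1%:R^-1, k.+1%:R * n.+1%:R^-1[%classic) s)); last first.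
    by move=> k _; apply: bmeas_mul; [exact: bmeas_cst|exact: bi].
  rewrite /rsum mulr_sumr; apply: eq_bigr => k _; rewrite (@Int_scale _ _ R (@lebesgue_measure R) I01 mI _ muI); last exact: bi.
  rewrite mulrC; congr (_ * _).
  rewrite /Rintegral integral_indic//.
  rewrite setIidl; last first.
    move=> s /=; rewrite /I01 /= !in_itv /= => /andP[h1 h2]; apply/andP; split.
      by apply: le_trans h1; rewrite mulr_ge0.
    by apply: (lt_le_trans h2); rewrite ler_pdivrMr ?ltr0n// mul1r ler_nat.
  have := @lebesgue_measure_itv R `[k%:R * n.+1%:R^-1, k.+1%:R * n.+1%:R^-1[.
  rewrite /= lte_fin ltr_pM2r ?invr_gt0 ?ltr0n// ltr_nat ltnSn -EFinB => h.
  by rewrite [in RHS]h /= -mulrBl -[k.+1%:R]natr1 addrAC subrr add0r mul1r.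
have [] := @Int_dominated _ _ R (@lebesgue_measure R) I01 mI 1 muI (step f w) (fun s => f (w s)) M.
- move=> n; have [] // : bmeas I01 (step f w n).
  by rewrite /step; apply: bmeas_sum => k _; apply: bmeas_mul; [exact: bmeas_cst|exact: bi].
- by move=> n s Is; have [k [-> _]] := stepE f w n Is; exact: hM.
- move=> s Is; apply/cvgrPdist_le => e e0.
  have cs : f (w u) @[u --> s^'+] --> f (w s).
    by apply: continuous_cvg; [exact: cf|exact: traj_right_continuous].
  move/cvgrPdist_le : cs => /(_ e e0)[d /= d0 hd].
  near=> n; have [k [-> /andP[h1 h2]]] := stepE f w n Is.
  apply: hd => //=; rewrite distrC gtr0_norm ?subr_gt0// ltrBlDl.
  apply: (le_lt_trans h2); rewrite ltrD2l.
  by near: n; exact: (near_infty_natSinv_lt (PosNum d0)).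
move=> h1 h2; split=> //; rewrite (_ : (fun n => rsum f n w) =
  fun n => \int[@lebesgue_measure R]_(s in I01) step f w n s)//.
by apply/funext => n; exact: rE.
Unshelve. all: by end_near.
Qed.

Lemma tint_bmeas f w : continuous f -> bmeas I01 (fun s => f (w s)).
Proof. by move=> /(tint_riemann w)[]. Qed.

Lemma tint_lin a f g w : continuous f -> continuous g ->
  tint (fun eta => a * f eta + g eta) w = a * tint f w + tint g w.
Proof. by move=> cf cg; rewrite /tint (@Int_lin _ _ R (@lebesgue_measure R) I01 mI _ muI)//; exact: tint_bmeas. Qed.

Lemma tint_scale a f w : continuous f -> tint (fun eta => a * f eta) w = a * tint f w.
Proof. by move=> cf; rewrite /tint (@Int_scale _ _ R (@lebesgue_measure R) I01 mI _ muI)//; exact: tint_bmeas. Qed.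

Lemma tint_cst a w : tint (fun=> a) w = a.
Proof. by rewrite /tint (@Int_cst _ _ R (@lebesgue_measure R) I01 mI 1 muI) mulr1. Qed.

Lemma tint_sum (J : eqType) (s : seq J) (F : J -> config -> R) w :
  (forall i, i \in s -> continuous (F i)) ->
  tint (fun eta => \sum_(i <- s) F i eta) w = \sum_(i <- s) tint (F i) w.
Proof.
move=> h; rewrite /tint (@Int_sum _ _ R (@lebesgue_measure R) I01 mI _ muI _ _ (fun i s => F i (w s)))// => i si.
exact/tint_bmeas/h.
Qed.

Lemma tint_mono f g w : continuous f -> continuous g -> (forall eta, f eta <= g eta) ->
  tint f w <= tint g w.
Proof. by move=> cf cg fg; apply: (@Int_mono _ _ R (@lebesgue_measure R) I01 mI _ muI) => //; exact: tint_bmeas. Qed.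

Lemma tint_sqr f w : continuous f -> tint f w ^+ 2 <= tint (fun eta => f eta ^+ 2) w.
Proof.
move=> cf; set m := tint f w; have cf2 := continuous_sqr cf.
have c1 : continuous (fun eta => 1 * f eta ^+ 2 + (fun=> m ^+ 2) eta).
  by apply: continuous_lin => //; exact: continuous_const.
have : 0 <= tint (fun eta => (- (2 * m)) * f eta + (1 * f eta ^+ 2 + (fun=> m ^+ 2) eta)) w.
  rewrite -[X in X <= _](tint_cst 0 w); apply: tint_mono; first exact: continuous_const.
    exact: continuous_lin.
  move=> eta; have -> : - (2 * m) * f eta + (1 * f eta ^+ 2 + m ^+ 2) = (f eta - m) ^+ 2 by ring.
  exact: sqr_ge0.
rewrite tint_lin// tint_lin//; last exact: continuous_const.
rewrite tint_cst -/m -subr_ge0 => h; rewrite -subr_ge0.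
by rewrite (_ : _ - _ = - (2 * m) * m + (1 * tint (fun eta => f eta ^+ 2) w + m ^+ 2) - 0)//; ring.
Qed.

Lemma bmeas_rsum f n : continuous f -> bmeas setT (rsum f n).
Proof.
move=> cf; apply: bmeas_mul; first exact: bmeas_cst.
by apply: bmeas_sum => k _; apply: bmeas_continuous => //; rewrite mulr_ge0// invr_ge0.
Qed.

Lemma rsum_bound f n (M : R) w : (forall eta, `|f eta| <= M) -> `|rsum f n w| <= M.
Proof.
move=> fM; rewrite /rsum normrM ger0_norm ?invr_ge0//.
rewrite mulrC ler_pdivrMr ?ltr0n//; apply: (le_trans (ler_norm_sum _ _ _)).
apply: (le_trans (ler_sum (I := 'I_n.+1) _ (fun k _ => fM _))).
by rewrite sumr_const card_ord [leRHS]mulr_natr.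
Qed.

Section probability.
Variable P : probability (trajectory R) R.
Let PT : P setT = 1%E. Proof. exact: probability_setT. Qed.
Let mT : measurable [set: trajectory R]. Proof. exact: measurableT. Qed.

Lemma bmeas_tint f : continuous f -> bmeas [set: trajectory R] (tint f).
Proof.
move=> cf; have [M [M0 hM]] := continuous_bounded cf.
have [] // := @Int_dominated _ _ R P setT mT 1 PT (rsum f) (tint f) M.
- by move=> n; have [] := bmeas_rsum n cf.
- by move=> n w _; exact: rsum_bound.
- by move=> w _; have [] := tint_riemann w cf.
Qed.

Lemma exp_tint_le f (C : R) : continuous f ->
  (\forall n \near \oo, \int[P]_w expR (rsum f n w) <= C) ->
  bmeas setT (fun w => expR (tint f w)) /\ \int[P]_w expR (tint f w) <= C.
Proof.
move=> cf hC; have [M [M0 hM]] := continuous_bounded cf.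
have [|||b1 b2] := @Int_dominated _ _ R P setT mT 1 PT (fun n w => expR (rsum f n w))
  (fun w => expR (tint f w)) (expR M).
- move=> n; apply: (measurableT_comp (@measurable_expR R)).
  by have [] := bmeas_rsum n cf.
- move=> n w _; rewrite ger0_norm ?expR_ge0// ler_expR (le_trans (ler_norm _))//.
  exact: rsum_bound.
- move=> w _; apply: continuous_cvg; first exact: continuous_expR.
  by have [] := tint_riemann w cf.
split=> //; rewrite -(cvg_lim _ b2)//; apply: limr_le => //.
by apply/cvg_ex; eexists; exact: b2.
Qed.

Lemma chernoff (Y : trajectory R -> R) (a C : R) : measurable_fun setT Y ->
  bmeas setT (fun w => expR (Y w)) -> \int[P]_w expR (Y w) <= C ->
  (P [set w | (a <= Y w)%R] <= (expR (- a) * C)%:E)%E.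
Proof.
move=> mY bY hC.
have mA := measurable_superlevel a mY.
have bA := @bmeas_indic _ _ R setT _ mA.
have h : expR a * fine (P [set w | a <= Y w]) <= C.
  apply: le_trans hC.
  have -> : fine (P [set w | a <= Y w]) = \int[P]_w \1_[set w | a <= Y w] w.
    by rewrite /Rintegral integral_indic// setIT.
  rewrite -(Int_scale mT PT)//; apply: (Int_mono mT PT) => //.
    by apply: bmeas_mul => //; exact: bmeas_cst.
  move=> w _; rewrite indicE; case: (boolP (_ \in _)) => [|_]; last by rewrite mulr0 expR_ge0.
  by rewrite inE /= mulr1 ler_expR.
rewrite -(@fineK _ (P [set w | a <= Y w])) ?fin_num_measure// lee_fin.
by rewrite expRN mulrC ler_pdivlMr ?expR_gt0// mulrC.
Qed.

End probability.
End time_integral.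

(** * Chernoff bounds for the potential and for linear functionals *)

Section law_bounds.
Variables (R : realType) (T alpha : R) (P : probability (trajectory R) R).
Hypothesis T0 : 0 <= T.
Hypothesis alpha01 : 0 < alpha < 1.
Hypothesis lawP : exclusion_law T alpha P.
Let PT : P setT = 1%E. Proof. exact: probability_setT. Qed.
Let mT : measurable [set: trajectory R]. Proof. exact: measurableT. Qed.

Lemma potential_bound u (c a : R) : local_function u -> 0 < c -> (forall eta, c <= u eta) ->
  (P [set w | (a <= tint (potential T u) w)%R] <= (expR (- a))%:E)%E.
Proof.
move=> lu c0 uc; have [hP [S [hS gS hM]]] := lawP.
have lV := local_potential T lu; have cV := local_continuous lV.
have [B [B0 hB]] := continuous_bounded cV.
have H e : 0 < e -> bmeas setT (fun w : trajectory R => expR (tint (potential T u) w)) /\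
    \int[P]_w expR (tint (potential T u) w) <= expR e.
  move=> e0; apply: exp_tint_le => //.
  have e20 : 0 < e / 2 by rewrite divr_gt0.
  have [N HN] := trapezoid_bound T0 hP hS gS hM lu c0 uc e20.
  have d0 : 0 < e / 2 / (B + 1) by rewrite divr_gt0// ltr_wpDl.
  near=> n.
  have Nn : (N <= n)%N by near: n; exact: nbhs_infty_ge.
  have hB2 : n.+1%:R^-1 * B <= e / 2.
    apply: (@le_trans _ _ (n.+1%:R^-1 * (B + 1))); first by rewrite ler_wpM2l ?invr_ge0// lerDl.
    rewrite -ler_pdivlMr ?ltr_wpDl//; apply: ltW.
    by near: n; exact: (near_infty_natSinv_lt (PosNum d0)).
  have := HN n _ Nn erefl; set h := n.+1%:R^-1 in hB2 *; set q := (X in \int[P]_w X w) => hq.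
  have qE w : q w = expR (h / 2 * potential T u (w 0) + \sum_(k < n) h * potential T u (w (k.+1%:R * h))
       + h / 2 * potential T u (w 1)).
    by rewrite /q !expRD expR_sum.
  have -> : expR e = expR (e / 2) * expR (e / 2) by rewrite -expRD; congr expR; field.
  apply: (@le_trans _ _ (expR (e / 2) * \int[P]_w q w)); last by rewrite ler_pM2l ?expR_gt0.
  have bloc s : 0 <= s -> bmeas setT (fun w : trajectory R => potential T u (w s)).
    by move=> s0; exact: bmeas_continuous.
  have h0 : 0 <= h by rewrite invr_ge0.
  have bexp (Y : trajectory R -> R) : bmeas [set: trajectory R] Y -> bmeas setT (fun w => expR (Y w)).
    move=> [mY [M hM']]; split; first exact: (measurableT_comp (@measurable_expR R)).
    by exists (expR M) => w Dw; rewrite ger0_norm ?expR_ge0// ler_expR (le_trans (ler_norm _))// hM'.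
  have bq : bmeas setT q.
    rewrite (_ : q = fun w => expR (h / 2 * potential T u (w 0) + (h / 2 * potential T u (w 1) +
       \sum_(k < n) h * potential T u (w (k.+1%:R * h))))); last first.
      by apply/funext => w; rewrite qE -addrA [X in _ + X]addrC.
    apply: bexp.
    apply: bmeas_lin; first exact: bloc.
    apply: bmeas_lin; first exact: bloc.
    apply: bmeas_sum => k _; apply: bmeas_mul; first exact: bmeas_cst.
    by apply: bloc; rewrite mulr_ge0.
  rewrite -(Int_scale mT PT)//; apply: (Int_mono mT PT).
  - exact/bexp/bmeas_rsum.
  - by apply: bmeas_mul => //; exact: bmeas_cst.
  move=> w _; rewrite qE -expRD ler_expR /rsum -/h big_ord_recr/=.
  have nh : n.+1%:R * h = 1 by rewrite mulfV// pnatr_eq0.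
  rewrite nh mulrDr mulr_sumr.
  (* The right-endpoint sum exceeds the trapezoidal one by h/2 (V (w 1) - V (w 0)), at most h B. *)
  have h1 : h / 2 * potential T u (w 1) - h / 2 * potential T u (w 0) <= e / 2.
    apply: le_trans hB2; have -> : h * B = h / 2 * B + h / 2 * B by field.
    rewrite lerD//; first by rewrite ler_wpM2l ?divr_ge0// (le_trans (ler_norm _)).
    by rewrite -mulrN ler_wpM2l ?divr_ge0// (le_trans (ler_norm _))// normrN.
  rewrite -subr_ge0; rewrite -subr_ge0 in h1; apply: le_trans h1 _; apply: eq_ler; by field.
have b1 := (H 1 ltr01).1.
rewrite -[X in (_ <= X%:E)%E]mulr1; apply: chernoff => //.
  by have [] := bmeas_tint P cV.
(* The moment is at most exp (e') for every e' > 0, hence at most 1; e' = ln (1 + e) puts this in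
   additive form. *)
apply/ler_addgt0Pr => e e0.
have le0 : 0 < ln (1 + e) by rewrite ln_gt0// ltrDl.
have := (H _ le0).2; rewrite lnK// posrE addr_gt0//.
Unshelve. all: by end_near.
Qed.

Lemma linear_bound A (b : site -> R) (a : R) : uniq A -> (forall x, x \in A -> `|b x| <= 2^-1) ->
  (P [set w | (a <= tint (fun eta => \sum_(x <- A) b x * ((eta x)%:R - alpha)) w)%R] <=
   (expR (- a) * expR (2 * \sum_(x <- A) b x ^+ 2))%:E)%E.
Proof.
move=> uA bA; have [hP [S [hS gS hM]]] := lawP.
set X := (fun eta : config => _).
have lX : local_function X.
  apply: local_sum => x _; exact: (local_coord x (fun c => b x * (c%:R - alpha))).
have cX := local_continuous lX.
have leX : local_function (fun eta => expR (X eta)) by exact: (local_op1 (@expR R)).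
have ceX := local_continuous leX.
have [b1 b2] : bmeas setT (fun w : trajectory R => expR (tint X w)) /\
    \int[P]_w expR (tint X w) <= expR (2 * \sum_(x <- A) b x ^+ 2).
  apply: exp_tint_le => //; apply: nearW => n.
  apply: (@le_trans _ _ (\int[P]_w rsum (fun eta => expR (X eta)) n w)).
    apply: (Int_mono mT PT).
    - have [mY _] := bmeas_rsum n cX; have [M [M0 hM']] := continuous_bounded cX.
      split; first exact: (measurableT_comp (@measurable_expR R)).
      exists (expR M) => w _; rewrite ger0_norm ?expR_ge0// ler_expR (le_trans (ler_norm _))//.
      exact: rsum_bound.
    - exact: bmeas_rsum.
    move=> w _; rewrite {2}/rsum; set m := rsum X n w; set h := n.+1%:R^-1.
    (* Jensen's inequality for the mean over the n + 1 times: exp lies above its tangent at the mean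
       [m]. Stationarity then brings each term back to time 0. *)
    apply: (@le_trans _ _ (h * \sum_(k < n.+1) expR m * (1 + (X (w (k.+1%:R * h)) - m)))).
      rewrite -mulr_sumr big_split/= sumr_const card_ord sumrB sumr_const card_ord.
      have -> : \sum_(i < n.+1) X (w (i.+1%:R * h)) = n.+1%:R * m.
        by rewrite /m /rsum -/h mulrA mulfV ?mul1r// pnatr_eq0.
      rewrite -(mulr_natl m) subrr addr0 mulrCA /h mulVf ?pnatr_eq0// mulr1//.
    rewrite ler_wpM2l ?invr_ge0//; apply: ler_sum => k _.
    have -> : X (w (k.+1%:R * h)) = m + (X (w (k.+1%:R * h)) - m) by rewrite addrC subrK.
    by rewrite expRD ler_pM2l ?expR_gt0// [m + _]addrC addrK; exact: expR_ge1Dx.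
  rewrite (Int_scale mT PT); last first.
    by apply: bmeas_sum => k _; apply: (bmeas_continuous _ ceX); rewrite mulr_ge0// invr_ge0.
  rewrite (Int_sum mT PT (F := fun (k : 'I_n.+1) w => expR (X (w (k.+1%:R * n.+1%:R^-1))))); last first.
    by move=> k _; apply: (bmeas_continuous _ ceX); rewrite mulr_ge0// invr_ge0.
  under eq_bigr do rewrite (stationary T0 hP hS gS hM _ ceX) ?mulr_ge0 ?invr_ge0//.
  rewrite sumr_const card_ord -[E0 _ _ *+ _]mulr_natl mulrA mulVf ?pnatr_eq0// mul1r.
  exact: (E0_exp_linear alpha01 hP).
by apply: chernoff => //; have [] := bmeas_tint P cX.
Qed.

End law_bounds.

(** * Lattice sums *)

Section lattice_sums.
Variable R : realType.

Definition nsq (x : site) : R := x.1%:~R ^+ 2 + x.2%:~R ^+ 2.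

Definition zr (n : nat) : seq int := [seq k%:Z - n%:Z | k <- iota 0 (2 * n).+1].

Lemma mem_zr n (i : int) : (i \in zr n) = (`|i| <= n)%N.
Proof.
apply/mapP/idP => [[k]|h]; first by rewrite mem_iota => /andP[_ h] ->; lia.
by exists `|(i + n%:Z)%R|%N; rewrite ?mem_iota; lia.
Qed.

Lemma zr_uniq n : uniq (zr n).
Proof. by rewrite map_inj_uniq ?iota_uniq// => a b; lia. Qed.

Lemma zrS n : perm_eq (zr n.+1) (n.+1%:Z :: - n.+1%:Z :: zr n).
Proof.
have u := zr_uniq n; have m := mem_zr n; apply: uniq_perm; first exact: zr_uniq.
  by move: (zr n) u m => s u m; rewrite !cons_uniq !in_cons !m u; lia.
by move=> i; rewrite mem_zr; move: (zr n) u m => s u m; rewrite !in_cons m; lia.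
Qed.

Lemma sum_zrS (f : int -> R) n : \sum_(i <- zr n.+1) f i =
  f n.+1%:Z + (f (- n.+1%:Z) + \sum_(i <- zr n) f i).
Proof. by rewrite (perm_big _ (zrS n)) !big_cons. Qed.

Lemma sum_zr (g : R -> R) n : \sum_(i <- zr n) g (i%:~R ^+ 2) =
  g 0 + 2 * \sum_(1 <= j < n.+1) g (j%:R ^+ 2).
Proof.
elim: n => [|n IHn].
  by rewrite (_ : zr 0 = [:: 0])// big_seq1 big_geq// mulr0 addr0 mulr0z expr0n.
rewrite sum_zrS IHn [in RHS]big_nat_recr//=.
by rewrite mulrNz sqrrN; ring.
Qed.

Lemma big_box (f : site -> R) n :
  \sum_(x <- box n) f x = \sum_(i <- zr n) \sum_(j <- zr n) f (i, j).
Proof. by rewrite /box big_allpairs_dep. Qed.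

(** For n > 0, the sum of F (|x|^2) over the sites of sup norm n: 4 on the axes, 8 images of each
    (n, j) with 0 < j < n, and 4 corners. *)
Definition shell (F : R -> R) (n : nat) : R :=
  4 * F (n%:R ^+ 2) + 8 * \sum_(1 <= j < n) F (n%:R ^+ 2 + j%:R ^+ 2) + 4 * F (2 * n%:R ^+ 2).

Lemma sum_box_shell (F : R -> R) N :
  \sum_(x <- box N) F (nsq x) = F 0 + \sum_(1 <= n < N.+1) shell F n.
Proof.
elim: N => [|N IHN].
  rewrite big_geq// addr0 /box /= big_seq1 /nsq /= subrr expr0n /=.
  by rewrite addr0.
rewrite [in RHS]big_nat_recr//= addrA -IHN !big_box.
under eq_bigr => i _ do rewrite sum_zrS.
rewrite sum_zrS !big_split/= /nsq /= !mulrNz !sqrrN.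
set m := (N.+1)%:~R : R.
have H1 : \sum_(j <- zr N) F (m ^+ 2 + j%:~R ^+ 2) =
   F (m ^+ 2) + 2 * \sum_(1 <= j < N.+1) F (m ^+ 2 + j%:R ^+ 2).
  by rewrite (sum_zr (fun t => F (m ^+ 2 + t))) addr0.
have H2 : \sum_(j <- zr N) F (j%:~R ^+ 2 + m ^+ 2) =
   F (m ^+ 2) + 2 * \sum_(1 <= j < N.+1) F (m ^+ 2 + j%:R ^+ 2).
  by rewrite -H1; apply: eq_bigr => j _; rewrite addrC.
rewrite H1 H2 /shell -[(N.+1)%:R]/m -mulr2n -[_ *+ 2]mulr_natl; ring.
Qed.

Lemma ler_shell (F G : R -> R) n : (0 < n)%N ->
  (forall s, n%:R ^+ 2 <= s <= 2 * n%:R ^+ 2 -> F s <= G s) -> shell F n <= shell G n.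
Proof.
move=> n0 FG; have n2 : 0 <= n%:R ^+ 2 :> R by exact: sqr_ge0.
rewrite /shell; apply: lerD; first apply: lerD.
- by rewrite ler_wpM2l// FG//; lra.
- rewrite ler_wpM2l//; apply: ler_sum_nat => j /andP[_ jn]; apply: FG.
  rewrite lerDl sqr_ge0/= mulr2n mulrDl mul1r lerD2l.
  by rewrite lerXn2r ?nnegrE// ler_nat ltnW.
- by rewrite ler_wpM2l// FG//; lra.
Qed.

Lemma shell_const (c : R) n : (0 < n)%N -> shell (fun=> c) n = 8 * n%:R * c.
Proof.
case: n => // n _; rewrite /shell sumr_const_nat subSS subn0 -mulr_natl -natr1; ring.
Qed.

(** For n >= 1, 1 / n^2 <= 2 / n - 2 / (n + 1); the maximum in [phi] stops the telescoping sum at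
    [a]. *)
Lemma sum_inv_sqr (a : R) N : 0 < a ->
  \sum_(1 <= n < N.+1) (if a <= n%:R then (n%:R ^+ 2)^-1 else 0) <= 2 / a.
Proof.
move=> a0; pose phi n : R := 2 / Num.max n%:R a.
have p0 n : 0 < Num.max n%:R a by rewrite lt_max a0 orbT.
have H n : (0 < n)%N -> (if a <= n%:R then (n%:R ^+ 2)^-1 else 0) <= phi n - phi n.+1.
  move=> n0; case: (leP a n%:R) => an.
    have nR : 0 < n%:R :> R by rewrite ltr0n.
    have an1 : a <= n.+1%:R by rewrite (le_trans an)// ler_nat.
    rewrite /phi !max_l// -natr1.
    rewrite -subr_ge0 (_ : _ - _ = (n%:R - 1) / (n%:R ^+ 2 * (n%:R + 1))).
      by rewrite divr_ge0 ?subr_ge0 ?ler1n// mulr_ge0 ?sqr_ge0// addr_ge0.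
    by field; rewrite lt0r_neq0//= lt0r_neq0// addr_gt0.
  rewrite subr_ge0 /phi ler_wpM2l// lef_pV2 ?posrE//.
  by rewrite ge_max !le_max lexx orbT ler_nat leqnSn.
apply: (@le_trans _ _ (\sum_(1 <= n < N.+1) (phi n - phi n.+1))).
  by apply: ler_sum_nat => n /andP[n1 _]; exact: H.
have -> : \sum_(1 <= n < N.+1) (phi n - phi n.+1) = phi 1%N - phi N.+1.
  rewrite -[LHS]opprK -sumrN; under eq_bigr do rewrite opprB.
  by rewrite telescope_sumr ?opprB.
apply: (@le_trans _ _ (phi 1%N)); first by rewrite gerBl divr_ge0// ltW.
by rewrite ler_wpM2l// lef_pV2 ?posrE// le_max lexx orbT.
Qed.

(** The n-th shell has 8 n sites, with n <= |x| <= 2 n, and is met only if n >= rho / 2; what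
    remains is a sum of 8 / n^2. *)
Lemma sum_norm_inv3 (rho : R) N : 0 < rho ->
  \sum_(x <- box N) (if rho <= Num.sqrt (nsq x) then (Num.sqrt (nsq x) ^+ 3)^-1 else 0) <= 48 / rho.
Proof.
move=> r0; pose F s : R := if rho <= Num.sqrt s then (Num.sqrt s ^+ 3)^-1 else 0.
have F00 : F 0 = 0 by rewrite /F sqrtr0 ifF//; apply/negbTE; rewrite -ltNge.
rewrite (sum_box_shell F) F00 add0r.
have a0 : 0 < rho / 2 by rewrite divr_gt0.
apply: (@le_trans _ _ (8 * \sum_(1 <= n < N.+1) (if rho / 2 <= n%:R then (n%:R ^+ 2)^-1 else 0))).
  rewrite mulr_sumr; apply: ler_sum_nat => n /andP[n1 _].
  have nR : 0 < n%:R :> R by rewrite ltr0n.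
  apply: (@le_trans _ _ (shell (fun=> if rho / 2 <= n%:R then (n%:R ^+ 3)^-1 else 0) n)).
    apply: ler_shell => // s /andP[s1 s2]; rewrite /F.
    have ns : n%:R <= Num.sqrt s by rewrite -[n%:R]ger0_norm// -sqrtr_sqr ler_wsqrtr.
    case: (leP rho (Num.sqrt s)) => h1; last by case: ifP => // _; rewrite invr_ge0 exprn_ge0.
    have sp : 0 < Num.sqrt s by exact: lt_le_trans h1.
    rewrite ifT.
      by rewrite lef_pV2 ?posrE ?exprn_gt0// lerXn2r ?nnegrE ?(ltW sp).
    rewrite ler_pdivrMr//; apply: (le_trans h1).
    apply: (@le_trans _ _ (Num.sqrt ((n%:R * 2) ^+ 2))); last by rewrite sqrtr_sqr ger0_norm.
    rewrite ler_wsqrtr//; apply: (le_trans s2); rewrite exprMn mulrC ler_wpM2l ?sqr_ge0//.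
    by rewrite expr2; lra.
  rewrite shell_const//; case: ifP => _; last by rewrite !mulr0.
  apply: eq_ler; field; exact: lt0r_neq0.
apply: (le_trans (ler_wpM2l _ (sum_inv_sqr N a0))) => //.
rewrite (_ : 8 * (2 / (rho / 2)) = 32 / rho); last by field; exact: lt0r_neq0.
by rewrite ler_pM2r ?invr_gt0// ler_nat.
Qed.

(** * Sums of 1 / |x|^2 over annuli *)

Lemma mvt_bound (f df : R -> R) (a b M : R) : a <= b ->
  (forall x, a <= x <= b -> is_derive x 1 f (df x)) ->
  (forall x, a <= x <= b -> `|df x| <= M) -> `|f b - f a| <= M * (b - a).
Proof.
move=> ab fd dM.
have [||c cab ->] := @MVT_segment _ f df a b ab.
- by move=> x; rewrite in_itv/= => /andP[h1 h2]; apply: fd; rewrite !ltW.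
- apply: derivable_within_continuous => x; rewrite in_itv/= => xab.
  by have [] := fd x xab.
rewrite normrM (@ger0_norm _ (b - a)) ?subr_ge0// ler_wpM2r ?subr_ge0//.
by apply: dM; rewrite in_itv/= in cab.
Qed.

(** The derivative 1 / (1 + x^2) changes from [a] to x by (x - a)(x + a) / ((1 + x^2)(1 + a^2)) in
    absolute value, and x + a is at most the denominator. *)
Lemma atan_step (a h : R) : 0 <= a -> 0 <= h ->
  `|atan (a + h) - atan a - h / (1 + a ^+ 2)| <= h ^+ 2.
Proof.
move=> a0 h0; pose f x := atan x - (1 + a ^+ 2)^-1 * x.
have p1 (x : R) : 0 < 1 + x ^+ 2 by rewrite ltr_pwDl// sqr_ge0.
have -> : atan (a + h) - atan a - h / (1 + a ^+ 2) = f (a + h) - f a by rewrite /f; ring.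
have -> : h ^+ 2 = h * (a + h - a) by ring.
apply: (@mvt_bound _ (fun x => (1 + x ^+ 2)^-1 - (1 + a ^+ 2)^-1)); first by rewrite lerDl.
  move=> x _; rewrite -[X in is_derive _ _ _ (_ - X)]mulr1.
  apply: is_deriveB.
move=> x /andP[ax xh].
have -> : (1 + x ^+ 2)^-1 - (1 + a ^+ 2)^-1 = - ((x - a) * ((x + a) / ((1 + x ^+ 2) * (1 + a ^+ 2)))).
  by field; rewrite !lt0r_neq0.
have x0 : 0 <= x by exact: le_trans ax.
rewrite normrN normrM ger0_norm ?subr_ge0// -[leRHS]mulr1 ler_pM ?subr_ge0//; first lra.
rewrite ger0_norm; last by rewrite divr_ge0 ?addr_ge0// mulr_ge0// ltW.
rewrite ler_pdivrMr ?mulr_gt0// mul1r.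
have : 0 <= (x - 1) ^+ 2 by exact: sqr_ge0.
have : 0 <= (a - 1) ^+ 2 by exact: sqr_ge0.
have : 0 <= x ^+ 2 * a ^+ 2 by rewrite mulr_ge0 ?sqr_ge0.
rewrite !expr2; nra.
Qed.

(* The integral of 1 / (n^2 + t^2) over one side of the square is pi / (2 n). *)
Lemma shell_inv n : (0 < n)%N -> `|shell GRing.inv n - 2 * pi / n%:R| <= 10 / n%:R ^+ 2.
Proof.
move=> n0; have nR : 0 < n%:R :> R by rewrite ltr0n.
have nn0 : n%:R != 0 :> R by rewrite lt0r_neq0.
pose D := \sum_(0 <= j < n) (n%:R^-1 / (1 + (j%:R / n%:R) ^+ 2)) - pi / 4 : R.
have hD : `|D| <= n%:R^-1.
  have -> : D = - \sum_(0 <= j < n) (atan (j%:R / n%:R + n%:R^-1) - atan (j%:R / n%:R) -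
       n%:R^-1 / (1 + (j%:R / n%:R) ^+ 2)).
    rewrite sumrB opprB /D; congr (_ - _).
    transitivity (\sum_(0 <= j < n) (atan (j.+1%:R / n%:R) - atan (j%:R / n%:R) : R)).
      by rewrite telescope_sumr// mul0r atan0 subr0 mulfV// atan1.
    by apply: eq_bigr => j _; rewrite -[j.+1%:R]natr1 mulrDl mul1r.
  rewrite normrN; apply: (le_trans (ler_norm_sum _ _ _)).
  apply: (@le_trans _ _ (\sum_(0 <= j < n) (n%:R^-1) ^+ 2)).
    by apply: ler_sum => j _; apply: atan_step; rewrite ?divr_ge0 ?invr_ge0.
  by rewrite sumr_const_nat subn0 -[_ ^+ 2 *+ _]mulr_natl expr2 mulrA mulfV// mul1r.
have E : shell GRing.inv n - 2 * pi / n%:R = (8 * D - 2 / n%:R) / n%:R.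
  rewrite /D mulrBr; case: n n0 nR nn0 {D hD} => // m _ nR nn0.
  rewrite /shell [X in _ = (8 * X - _ - _) / _]big_nat_recl//= mul0r expr0n /= addr0 [in LHS]big_add1/=.
  set S1 := \sum_(0 <= i < m) (_ + _)^-1; set S2 := \sum_(0 <= i < m) (_ / _).
  have -> : S2 = m.+1%:R * S1.
    rewrite /S1 /S2 mulr_sumr; apply: eq_bigr => j _.
    have gen (r q : R) : 0 < r -> r^-1 / (1 + (q / r) ^+ 2) = r / (r ^+ 2 + q ^+ 2).
      move=> r0; field; rewrite (lt0r_neq0 r0) andbT lt0r_neq0//.
      by rewrite ltr_pwDl ?sqr_ge0// exprn_gt0.
    exact: gen.
  by field.
rewrite E normrM normfV (gtr0_norm nR) ler_pdivrMr//.
have -> : 10 / n%:R ^+ 2 * n%:R = 8 * n%:R^-1 + 2 / n%:R :> R by field.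
rewrite (le_trans (ler_normB _ _))// lerD//.
  by rewrite normrM ger0_norm// ler_wpM2l.
by rewrite ger0_norm ?divr_ge0.
Qed.

Lemma ln_step n : (0 < n)%N ->
  (n%:R : R)^-1 - ((n%:R : R) ^+ 2)^-1 <= ln (n.+1%:R : R) - ln (n%:R : R) <= (n%:R : R)^-1.
Proof.
move=> n0; have nR : 0 < n%:R :> R by rewrite ltr0n.
have n1 : 0 < n.+1%:R :> R by rewrite ltr0n.
rewrite -lnV ?posrE// -lnM ?posrE ?invr_gt0//; apply/andP; split; last first.
  have -> : n.+1%:R / n%:R = 1 + n%:R^-1 :> R.
    by rewrite -natr1 mulrDl mul1r mulfV// lt0r_neq0.
  by apply: le_ln1Dx; have := invr_ge0 (n%:R : R); rewrite (ltW nR) => h; lra.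
have := @le_ln1Dx R (- n.+1%:R^-1).
have -> : 1 - n.+1%:R^-1 = (n.+1%:R / n%:R)^-1 :> R.
  by rewrite invf_div -natr1; field; rewrite !lt0r_neq0// natr1.
rewrite lnV ?posrE ?divr_gt0// lerN2 => h.
apply: le_trans (h _); last first.
  by rewrite ltrN2 invf_lt1// ltr1n.
rewrite -subr_ge0 -natr1 (_ : _ - _ = (n%:R ^+ 2 * (n%:R + 1))^-1).
  by rewrite invr_ge0 mulr_ge0 ?sqr_ge0// addr_ge0 ?ltW.
have n2 : 0 < n%:R + 1 :> R by rewrite addr_gt0.
by field; rewrite (lt0r_neq0 nR) (lt0r_neq0 n2).
Qed.

Lemma annulus_upper (P Q : R) N : 1 <= P -> P <= Q ->
  \sum_(x <- box N) (if P ^+ 2 <= nsq x <= Q ^+ 2 then (nsq x)^-1 else 0) <=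
  2 * pi * ln (Q / P) + (12 * pi + 40).
Proof.
move=> P1 PQ; have P0 : 0 < P by exact: lt_le_trans P1.
have Q0 : 0 < Q by exact: lt_le_trans PQ.
pose F s : R := if P ^+ 2 <= s <= Q ^+ 2 then s^-1 else 0.
have F00 : F 0 = 0 by rewrite /F invr0; case: ifP.
rewrite (sum_box_shell F) F00 add0r.
pose a := P / 2; have a0 : 0 < a by rewrite divr_gt0.
(* The logarithm clipped to [P/2, Q + 1]. Its increments are nonnegative, and they are those of ln
   for P/2 <= n <= Q, the only shells that can meet the annulus. *)
pose psi n : R := ln (Num.max a (Num.min n%:R (Q + 1))).
pose G n : R := if a <= n%:R then (n%:R ^+ 2)^-1 else 0.
have pi0 : 0 <= pi :> R by exact: pi_ge0.
have H n : (0 < n)%N -> shell F n <= 2 * pi * (psi n.+1 - psi n) + (2 * pi + 10) * G n.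
  move=> n0; have nR : 0 < n%:R :> R by rewrite ltr0n.
  have mono : psi n <= psi n.+1.
    rewrite ler_ln ?posrE ?lt_max ?a0//.
    by rewrite ge_max le_max lexx/= le_max; apply/orP; right;
       rewrite le_min !ge_min lexx orbT ler_nat leqnSn.
  have G0 : 0 <= G n by rewrite /G; case: ifP => // _; rewrite invr_ge0 sqr_ge0.
  case: (boolP (a <= n%:R <= Q)) => [/andP[h1 h2]|h].
    apply: (@le_trans _ _ (shell GRing.inv n)).
      apply: ler_shell => // s /andP[s1 _]; rewrite /F; case: ifP => // _.
      by rewrite invr_ge0 (le_trans _ s1)// sqr_ge0.
    have /ler_normlP[_] := shell_inv n0; rewrite lerBlDl => /le_trans; apply.
    rewrite /G h1 [(2 * pi + 10) * _]mulrDl addrA lerD2r -mulrDr ler_wpM2l ?mulr_ge0//.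
    have -> : psi n = ln n%:R by rewrite /psi min_l ?max_r// (le_trans h2)// lerDl.
    have -> : psi n.+1 = ln n.+1%:R.
      rewrite /psi min_l ?max_r//; first by rewrite (le_trans h1)// ler_nat.
      by rewrite -natr1 lerD2r.
    by have /andP[] := ln_step n0; rewrite lerBlDr.
  rewrite (_ : shell F n = 0).
    by rewrite addr_ge0// mulr_ge0 ?mulr_ge0 ?subr_ge0// addr_ge0// mulr_ge0.
  apply/eqP; rewrite eq_le; apply/andP; split.
    rewrite -(mulr0 (8 * n%:R)) -shell_const//; apply: ler_shell => // s /andP[s1 s2].
    rewrite /F ifF//; apply/negP => /andP[Ps sQ]; move/negP: h; apply.
    apply/andP; split.
      rewrite ler_pdivrMr// -(@ler_pXn2r _ 2)// ?nnegrE ?(ltW P0) ?mulr_ge0//.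
      apply: (le_trans Ps); apply: (le_trans s2); rewrite exprMn mulrC ler_wpM2l ?sqr_ge0//.
      by rewrite expr2; lra.
    by rewrite -(@ler_pXn2r _ 2)// ?nnegrE ?(ltW Q0)//; exact: le_trans sQ.
  rewrite -(mulr0 (8 * n%:R)) -shell_const//; apply: ler_shell => // s /andP[s1 s2].
  by rewrite /F; case: ifP => // _; rewrite invr_ge0 (le_trans _ s1)// sqr_ge0.
apply: (@le_trans _ _ (\sum_(1 <= n < N.+1) (2 * pi * (psi n.+1 - psi n) + (2 * pi + 10) * G n))).
  by apply: ler_sum_nat => n /andP[n1 _]; exact: H.
rewrite big_split/= -!mulr_sumr telescope_sumr//.
have hG : \sum_(1 <= n < N.+1) G n <= 4.
  apply: (le_trans (sum_inv_sqr N a0)); rewrite /a invf_div mulrA ler_pdivrMr//.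
  by rewrite -natrM -[leLHS]mulr1 ler_wpM2l.
have hpsi : psi N.+1 - psi 1%N <= ln (Q / P) + 2 * ln 2.
  have Q2 : Q + 1 <= 2 * Q by have := le_trans P1 PQ; lra.
  have aQ : a <= 2 * Q by rewrite /a ler_pdivrMr//; have := PQ; have := Q0; lra.
  have l2 : 0 < 2 :> R by [].
  apply: (@le_trans _ _ (ln (2 * Q) - ln a)).
    rewrite lerB// ler_ln ?posrE ?mulr_gt0 ?lt_max ?a0//.
      by rewrite ge_max aQ/= (le_trans _ Q2)// ge_min lexx orbT.
    by rewrite le_max lexx.
  rewrite /a lnM ?posrE// !ln_div ?posrE//; apply: eq_ler; ring.
have l2 : ln 2 <= 1 :> R.
  have := @le_ln1Dx R 1; rewrite -natr1 => -> //; by rewrite ltrN10.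
apply: (@le_trans _ _ (2 * pi * (ln (Q / P) + 2 * ln 2) + (2 * pi + 10) * 4)).
  by rewrite lerD// ler_wpM2l// ?addr_ge0// mulr_ge0//.
have := ler_wpM2l pi0 l2; lra.
Qed.

Lemma annulus_lower (P Q : R) N : 1 <= P -> P <= Q -> Q <= N%:R ->
  2 * pi * ln (Q / P) - (12 * pi + 40) <=
  \sum_(x <- box N) (if P ^+ 2 <= nsq x <= Q ^+ 2 then (nsq x)^-1 else 0).
Proof.
move=> P1 PQ QN; have P0 : 0 < P by exact: lt_le_trans P1.
have Q0 : 0 < Q by exact: lt_le_trans PQ.
pose F s : R := if P ^+ 2 <= s <= Q ^+ 2 then s^-1 else 0.
have F00 : F 0 = 0 by rewrite /F invr0; case: ifP.
have Fge s : 0 <= s -> 0 <= F s by rewrite /F; case: ifP => // _; rewrite invr_ge0.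
rewrite (sum_box_shell F) F00 add0r.
have pi0 : 0 <= pi :> R by exact: pi_ge0.
have sF n : (0 < n)%N -> 0 <= shell F n.
  move=> n0; rewrite -(mulr0 (8 * n%:R)) -shell_const//; apply: ler_shell => // s /andP[s1 _].
  by apply: Fge; rewrite (le_trans _ s1)// sqr_ge0.
have l20 : 0 < 2 :> R by [].
have l2 : ln 2 <= 1 :> R.
  have := @le_ln1Dx R 1; rewrite -natr1 => -> //; by rewrite ltrN10.
have l2p := ler_wpM2l pi0 l2.
(* If the annulus is thin, Q / P <= 4 and the left-hand side is not positive. *)
have [PQ2|PQ2] := leP (P + 1) (Q / 2); last first.
  apply: (@le_trans _ _ 0); last by rewrite big_nat; apply: sumr_ge0 => n /andP[n1 _]; exact: sF.
  have h4 : Q / P <= 2 * 2.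
    rewrite ler_pdivrMr//; rewrite ltr_pdivrMr// in PQ2; have := P1; lra.
  have : ln (Q / P) <= ln 2 + ln 2.
    by rewrite -lnM ?posrE// ler_ln ?posrE ?divr_gt0 ?mulr_gt0.
  move=> h5; have := ler_wpM2l pi0 h5; have := pi0; lra.
(* The shells with P <= n <= Q/2 lie inside the annulus; clipping at P + 1 and Q/2 makes the
   increments vanish on all others. *)
pose psi n : R := ln (Num.max (P + 1) (Num.min n%:R (Q / 2))).
pose G n : R := if P <= n%:R then (n%:R ^+ 2)^-1 else 0.
have m0 n : 0 < Num.max (P + 1) (Num.min n%:R (Q / 2)) by rewrite lt_max addr_gt0.
have H n : (0 < n)%N -> 2 * pi * (psi n.+1 - psi n) - 10 * G n <= shell F n.
  move=> n0; have nR : 0 < n%:R :> R by rewrite ltr0n.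
  have n1R : 0 < n.+1%:R :> R by rewrite ltr0n.
  have nn1 : n%:R <= n.+1%:R :> R by rewrite ler_nat.
  have G0 : 0 <= G n by rewrite /G; case: ifP => // _; rewrite invr_ge0 sqr_ge0.
  case: (boolP (P <= n%:R <= Q / 2)) => [/andP[h1 h2]|h].
    apply: (@le_trans _ _ (shell GRing.inv n)).
      have /ler_normlP[+ _] := shell_inv n0; rewrite opprB lerBlDl => hs.
      have /andP[_ h3] := ln_step n0.
      have h4 : psi n.+1 - psi n <= n%:R^-1.
        apply: le_trans h3; rewrite lerB// ler_ln ?posrE//.
          by rewrite ge_max -natr1 lerD2r h1/= ge_min lexx.
        by rewrite le_max le_min lexx h2 orbT.
      have pi20 : 0 <= 2 * pi :> R by rewrite mulr_ge0.
      have := ler_wpM2l pi20 h4; rewrite /G h1; lra.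
    apply: ler_shell => // s /andP[s1 s2]; rewrite /F ifT//; apply/andP; split.
      by apply: le_trans s1; rewrite lerXn2r ?nnegrE// ltW.
    apply: (le_trans s2); apply: (@le_trans _ _ ((2 * n%:R) ^+ 2)).
      by rewrite exprMn ler_wpM2r ?sqr_ge0// expr2; lra.
    by rewrite lerXn2r ?nnegrE ?mulr_ge0 ?(ltW Q0)// mulrC -ler_pdivlMr.
  rewrite (_ : psi n.+1 = psi n).
    by rewrite subrr mulr0 sub0r (le_trans _ (sF n n0))// oppr_le0 mulr_ge0.
  rewrite /psi; congr ln; move: h; rewrite negb_and -!ltNge => /orP[nP|Qn].
    rewrite !max_l// ge_min; first by rewrite ltW// (lt_trans nP)// ltrDl.
    by rewrite -natr1 lerD2r ltW.
  by rewrite !min_r// ltW// (lt_le_trans Qn).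
apply: (@le_trans _ _ (\sum_(1 <= n < N.+1) (2 * pi * (psi n.+1 - psi n) - 10 * G n))); last first.
  by apply: ler_sum_nat => n /andP[n1 _]; exact: H.
rewrite sumrB -!mulr_sumr telescope_sumr//.
have hG : \sum_(1 <= n < N.+1) G n <= 2.
  by apply: (le_trans (sum_inv_sqr N P0)); rewrite ler_pdivrMr// ler_peMr.
have hpsi : ln (Q / P) - 2 * ln 2 <= psi N.+1 - psi 1%N.
  apply: (@le_trans _ _ (ln (Q / 2) - ln (2 * P))).
    rewrite !ln_div ?posrE ?mulr_gt0// lnM ?posrE//; apply: eq_ler; ring.
  have Q20 : 0 < Q / 2 by rewrite divr_gt0.
  have QN2 : Q / 2 <= N.+1%:R.
    by rewrite ler_pdivrMr// (le_trans QN)// -natrM ler_nat; clear; lia.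
  rewrite lerB// ler_ln ?posrE ?mulr_gt0//.
    by rewrite le_max le_min lexx QN2 orbT.
  rewrite ge_max; apply/andP; split; first by have := P1; lra.
  by rewrite ge_min; apply/orP; left; have := P1; lra.
have := ler_wpM2l pi0 hpsi; lra.
Qed.

End lattice_sums.

(** * Polar calculus *)

(* [half_log (ln T) (|x| ^ 2)] is sigma_T(x). *)
Definition half_log (R : realType) (L n : R) : R := ln n / (2 * L).

(* [(a, y)] is a site at distance [s] from the origin, displaced by [(p, q)]. *)
Section polar_calculus.
Variable R : realType.
Implicit Types a y p q D s : R.

Lemma ler_norm_sum3 (x1 x2 x3 m1 m2 m3 : R) : `|x1| <= m1 -> `|x2| <= m2 -> `|x3| <= m3 ->
  `|x1 + x2 + x3| <= m1 + m2 + m3.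
Proof.
move=> h1 h2 h3; rewrite (le_trans (ler_normD _ _))// lerD//.
by rewrite (le_trans (ler_normD _ _))// lerD.
Qed.

Lemma norm_mul_le (x1 x2 m1 m2 : R) : `|x1| <= m1 -> `|x2| <= m2 -> `|x1 * x2| <= m1 * m2.
Proof. by move=> h1 h2; rewrite normrM ler_pM. Qed.

Lemma displaced_nsq a y p q D s : 1 <= D -> 16 * D <= s -> a ^+ 2 + y ^+ 2 = s ^+ 2 ->
  `|p| <= D -> `|q| <= D ->
  `|(a + p) ^+ 2 + (y + q) ^+ 2 - s ^+ 2| <= 5 * s * D /\
  s ^+ 2 / 2 <= (a + p) ^+ 2 + (y + q) ^+ 2 <= 2 * s ^+ 2.
Proof.
move=> D1 Ds E pD qD; have s0 : 0 <= s by lra.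
have as_ : `|a| <= s.
  rewrite -[leRHS]ger0_norm// -ler_sqr ?nnegrE// !real_normK ?num_real// -E.
  by rewrite lerDl sqr_ge0.
have ys : `|y| <= s.
  rewrite -[leRHS]ger0_norm// -ler_sqr ?nnegrE// !real_normK ?num_real// -E.
  by rewrite lerDr sqr_ge0.
have e : (a + p) ^+ 2 + (y + q) ^+ 2 - s ^+ 2 = 2 * (a * p) + 2 * (y * q) + (p * p + q * q).
  by rewrite -E; ring.
have h : `|(a + p) ^+ 2 + (y + q) ^+ 2 - s ^+ 2| <= 5 * s * D.
  rewrite e; apply: (@le_trans _ _ (2 * (s * D) + 2 * (s * D) + (D * D + D * D))).
    apply: ler_norm_sum3.
    - by rewrite normrM ger0_norm// ler_wpM2l// norm_mul_le.
    - by rewrite normrM ger0_norm// ler_wpM2l// norm_mul_le.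
    - by rewrite (le_trans (ler_normD _ _))// lerD// norm_mul_le.
  have : D * D <= s * D / 16.
    by rewrite ler_pdivlMr// -mulrA [D * 16]mulrC mulrA [D * _]mulrC ler_wpM2r//; lra.
  have : 0 <= s * D by rewrite mulr_ge0//; lra.
  lra.
split=> //; move: h; rewrite ler_norml => /andP[h1 h2].
have h3 : 5 * s * D <= s ^+ 2 / 2.
  rewrite ler_pdivlMr// expr2 -mulrA -mulrA [s * _]mulrC mulrA.
  have := ler_wpM2r s0 Ds; have : 0 <= s * D by rewrite mulr_ge0//; lra.
  by rewrite !mulrA; nra.
by apply/andP; split; lra.
Qed.

Lemma displaced_ln a y p q D s : 1 <= D -> 16 * D <= s -> a ^+ 2 + y ^+ 2 = s ^+ 2 ->
  `|p| <= D -> `|q| <= D ->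
  `|ln ((a + p) ^+ 2 + (y + q) ^+ 2) - ln (s ^+ 2)| <= 10 * D / s.
Proof.
move=> D1 Ds E pD qD; have [h1 /andP[h2 h3]] := displaced_nsq D1 Ds E pD qD.
set n := (a + p) ^+ 2 + (y + q) ^+ 2 in h1 h2 h3 *.
have s0 : 0 < s by lra.
have s20 : 0 < s ^+ 2 by rewrite exprn_gt0.
have n0 : 0 < n by apply: lt_le_trans h2; rewrite divr_gt0.
have lnb (u v : R) : 0 < u -> 0 < v -> ln u - ln v <= (u - v) / v.
  move=> u0 v0; rewrite -ln_div ?posrE//.
  have -> : u / v = 1 + (u - v) / v by field; exact: lt0r_neq0.
  apply: le_ln1Dx; rewrite mulrBl mulfV ?lt0r_neq0//.
  have : 0 < u / v by rewrite divr_gt0.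
  by move=> ?; lra.
have b1 : 5 * s * D / s ^+ 2 <= 10 * D / s.
  rewrite ler_pdivrMr// (_ : 10 * D / s * s ^+ 2 = 10 * s * D); last by field; exact: lt0r_neq0.
  by rewrite -!mulrA ler_wpM2r ?mulr_ge0//; lra.
have b2 : 5 * s * D / n <= 10 * D / s.
  rewrite ler_pdivrMr//; apply: (@le_trans _ _ (10 * D / s * (s ^+ 2 / 2))).
    by apply: eq_ler; field; exact: lt0r_neq0.
  by rewrite ler_wpM2l// divr_ge0 ?mulr_ge0 ?(ltW s0)//; lra.
move: h1; rewrite ler_norml => /andP[h4 h5].
rewrite ler_norml; apply/andP; split; last first.
  apply: (le_trans (lnb _ _ n0 s20)); apply: le_trans b1.
  by rewrite ler_pM2r ?invr_gt0.
rewrite -opprB lerN2; apply: (le_trans (lnb _ _ s20 n0)); apply: le_trans b2.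
by rewrite ler_pM2r ?invr_gt0//; lra.
Qed.

(** a / s^2 is the derivative of ln |x| along the axis of [a]. The bounds have the Taylor order in D
    / s; s >= 16 D keeps the displaced site at a distance comparable to s. *)
Lemma displaced_kappa a y p q D s : 1 <= D -> 16 * D <= s -> a ^+ 2 + y ^+ 2 = s ^+ 2 ->
  `|p| <= D -> `|q| <= D -> let n := (a + p) ^+ 2 + (y + q) ^+ 2 in
  `|a / s ^+ 2| <= s^-1 /\ [/\ `|(a + p) / n| <= 2 / s,
   `|(a + p) / n - a / s ^+ 2| <= 12 * D / s ^+ 2,
   `|((a + p) / n) ^+ 2 - (a / s ^+ 2) ^+ 2| <= 36 * D / s ^+ 3,
   (`|n^-1 - (s ^+ 2)^-1| <= 10 * D / s ^+ 3) & (0 <= n^-1 <= 2 / s ^+ 2)].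
Proof.
move=> D1 Ds E pD qD n; have [h1 /andP[h2 h3]] := displaced_nsq D1 Ds E pD qD.
rewrite -/n in h1 h2 h3.
have D0 : 0 < D by lra.
have s0 : 0 < s by lra.
have s20 : 0 < s ^+ 2 by rewrite exprn_gt0.
have n0 : 0 < n by apply: lt_le_trans h2; rewrite divr_gt0.
have sn0 := lt0r_neq0 s0; have nn0 := lt0r_neq0 n0.
have as_ : `|a| <= s.
  rewrite -[leRHS]ger0_norm ?(ltW s0)// -ler_sqr ?nnegrE// !real_normK ?num_real// -E.
  by rewrite lerDl sqr_ge0.
have k0 : `|a / s ^+ 2| <= s^-1.
  rewrite normrM [X in _ * X]ger0_norm ?invr_ge0 ?(ltW s20)// ler_pdivrMr//.
  by rewrite expr2 mulrA mulVf// mul1r.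
have kd : `|(a + p) / n - a / s ^+ 2| <= 12 * D / s ^+ 2.
  have -> : (a + p) / n - a / s ^+ 2 = (p * s ^+ 2 - a * (n - s ^+ 2)) / (n * s ^+ 2).
    by field; rewrite sn0.
  rewrite normrM normfV (@gtr0_norm _ (n * s ^+ 2)) ?mulr_gt0// ler_pdivrMr ?mulr_gt0//.
  apply: (@le_trans _ _ (D * s ^+ 2 + s * (5 * s * D))).
    rewrite (le_trans (ler_normB _ _))// lerD//; last exact: norm_mul_le.
    by rewrite normrM (gtr0_norm s20) ler_wpM2r// ltW.
  apply: (@le_trans _ _ (12 * D * (s ^+ 2 / 2))).
    by apply: eq_ler; field.
  rewrite (_ : 12 * D / s ^+ 2 * (n * s ^+ 2) = 12 * D * n); last by field.
  by rewrite ler_wpM2l// mulr_ge0 ?(ltW D0).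
have k1 : `|(a + p) / n| <= 2 / s.
  rewrite -[(a + p) / n](subrK (a / s ^+ 2)) (le_trans (ler_normD _ _))//.
  apply: (@le_trans _ _ (12 * D / s ^+ 2 + s^-1)); first by rewrite lerD.
  have : 12 * D / s ^+ 2 <= s^-1.
    rewrite ler_pdivrMr// (_ : s^-1 * s ^+ 2 = s); last by field.
    by lra.
  lra.
split=> //; split=> //.
- rewrite subr_sqr (_ : 36 * D / s ^+ 3 = 12 * D / s ^+ 2 * (3 / s)); last by field.
  apply: norm_mul_le => //; rewrite (le_trans (ler_normD _ _))//.
  by apply: (le_trans (lerD k1 k0)); apply: eq_ler; field.
- have -> : n^-1 - (s ^+ 2)^-1 = - ((n - s ^+ 2) / (n * s ^+ 2)) by field; rewrite sn0.
  rewrite normrN normrM normfV (@gtr0_norm _ (n * s ^+ 2)) ?mulr_gt0// ler_pdivrMr ?mulr_gt0//.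
  apply: (le_trans h1); apply: (@le_trans _ _ (10 * D / s ^+ 3 * (s ^+ 2 / 2 * s ^+ 2))).
    by apply: eq_ler; field.
  rewrite ler_wpM2l ?divr_ge0 ?mulr_ge0 ?exprn_ge0 ?(ltW D0) ?(ltW s0)//.
  by rewrite ler_wpM2r// ltW.
- rewrite invr_ge0 (ltW n0)/= -[leRHS]invrK lef_pV2 ?posrE ?invr_gt0 ?divr_gt0//.
  by rewrite invf_div.
Qed.

Lemma derive_add (f g : R -> R) (x u v : R) : is_derive x 1 f u -> is_derive x 1 g v ->
  is_derive x 1 (fun t => f t + g t) (u + v).
Proof. by move=> fd gd; have := is_deriveD fd gd. Qed.

Lemma derive_mul (f g : R -> R) (x u v : R) : is_derive x 1 f u -> is_derive x 1 g v ->
  is_derive x 1 (fun t => f t * g t) (f x * v + g x * u).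
Proof. by move=> fd gd; have := is_deriveM fd gd. Qed.

Lemma derive_inv (f : R -> R) (x u : R) : f x != 0 -> is_derive x 1 f u ->
  is_derive x 1 (fun t => (f t)^-1) (- (u / f x ^+ 2)).
Proof.
move=> f0 fd; have := is_deriveV f0 fd; rewrite scaleNr => h.
by apply: (is_derive_eq h); rewrite [u / _]mulrC.
Qed.

Lemma derive_comp (f g : R -> R) (x u v : R) : is_derive (g x) 1 f u -> is_derive x 1 g v ->
  is_derive x 1 (fun t => f (g t)) (u * v).
Proof. exact: is_derive1_comp. Qed.

Variables (L B : R) (HH H h1 : R -> R).
Hypothesis L1 : 1 <= L.
Hypothesis B0 : 0 <= B.
Hypothesis HHd : forall r : R, is_derive r 1 HH (H r).
Hypothesis Hd : forall r : R, is_derive r 1 H (h1 r).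
Hypothesis HB : forall r, `|H r| <= B.
Hypothesis h1B : forall r, `|h1 r| <= B.

Lemma lipschitz_H r r' : `|H r - H r'| <= B * `|r - r'|.
Proof.
wlog rr : r r' / r' <= r => [hw|].
  by case: (leP r' r) => [|/ltW] /hw //; rewrite distrC [X in _ <= B * X]distrC.
rewrite (@ger0_norm _ (r - r')) ?subr_ge0//.
by apply: (@mvt_bound _ H h1).
Qed.

Local Notation sg := (half_log L).
Let L0 : 0 < L. Proof. exact: lt_le_trans ltr01 L1. Qed.

Lemma displaced_sg a y p q D s : 1 <= D -> 16 * D <= s -> a ^+ 2 + y ^+ 2 = s ^+ 2 ->
  `|p| <= D -> `|q| <= D ->
  `|sg ((a + p) ^+ 2 + (y + q) ^+ 2) - sg (s ^+ 2)| <= 5 * D / (s * L).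
Proof.
move=> D1 Ds E pD qD; have h := displaced_ln D1 Ds E pD qD.
rewrite /half_log -mulrBl normrM [X in _ * X]gtr0_norm ?invr_gt0 ?mulr_gt0 ?L0//.
have s0 : 0 < s by lra.
rewrite ler_pdivrMr ?mulr_gt0 ?L0//; apply: (le_trans h); apply: eq_ler; field.
by rewrite !lt0r_neq0 ?L0.
Qed.

Lemma displaced_H a y p q D s : 1 <= D -> 16 * D <= s -> a ^+ 2 + y ^+ 2 = s ^+ 2 ->
  `|p| <= D -> `|q| <= D ->
  `|H (sg ((a + p) ^+ 2 + (y + q) ^+ 2)) - H (sg (s ^+ 2))| <= B * (5 * D / (s * L)).
Proof.
move=> D1 Ds E pD qD; apply: (le_trans (lipschitz_H _ _)).
by rewrite ler_wpM2l// displaced_sg.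
Qed.

Lemma displaced_weight a y p q D s : 1 <= D -> 16 * D <= s -> a ^+ 2 + y ^+ 2 = s ^+ 2 ->
  `|p| <= D -> `|q| <= D -> forall n, n = (a + p) ^+ 2 + (y + q) ^+ 2 ->
  `|H (sg n) ^+ 2 * ((a + p) / n) ^+ 2 - H (sg (s ^+ 2)) ^+ 2 * (a / s ^+ 2) ^+ 2| <=
   76 * B ^+ 2 * D / s ^+ 3.
Proof.
move=> D1 Ds E pD qD n nE; have [k0 [k1 kd kd2 _ _]] := displaced_kappa D1 Ds E pD qD.
rewrite -nE in k1 kd kd2; have hH := displaced_H D1 Ds E pD qD; rewrite -nE in hH.
have s0 : 0 < s by lra.
set G := H (sg n) in hH *; set G0 := H (sg (s ^+ 2)) in hH *.
set k := (a + p) / n in k1 kd kd2 *; set k' := a / s ^+ 2 in k0 kd kd2 *.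
have -> : G ^+ 2 * k ^+ 2 - G0 ^+ 2 * k' ^+ 2 =
   (G - G0) * (G + G0) * (k * k) + (G0 * G0) * (k ^+ 2 - k' ^+ 2) by ring.
rewrite (le_trans (ler_normD _ _))//.
apply: (@le_trans _ _ (B * (5 * D / (s * L)) * (B + B) * (2 / s * (2 / s)) + B * B * (36 * D / s ^+ 3))).
  rewrite lerD//.
    apply: norm_mul_le; last exact: norm_mul_le.
    by apply: norm_mul_le => //; rewrite (le_trans (ler_normD _ _))// lerD// HB.
  by apply: norm_mul_le => //; apply: norm_mul_le; exact: HB.
apply: (@le_trans _ _ (40 * B ^+ 2 * D / s ^+ 3 / L + 36 * B ^+ 2 * D / s ^+ 3)).
  by apply: eq_ler; field; rewrite !lt0r_neq0 ?L0.
rewrite (_ : 76 * B ^+ 2 * D / s ^+ 3 = 40 * B ^+ 2 * D / s ^+ 3 + 36 * B ^+ 2 * D / s ^+ 3); last by ring.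
rewrite lerD2r ler_pdivrMr ?L0// ler_peMr// divr_ge0 ?exprn_ge0 ?(ltW s0)//.
by rewrite !mulr_ge0 ?sqr_ge0//; lra.
Qed.

Section along_axis.
Variables a y s : R.
Hypothesis s16 : 16 <= s.
Hypothesis E : a ^+ 2 + y ^+ 2 = s ^+ 2.

Let s0 : 0 < s. Proof. by have := s16; lra. Qed.
Let nn (t : R) : R := (a + t) ^+ 2 + (y + 0) ^+ 2.
Let f (t : R) : R := HH (sg (nn t)).
Let f' (t : R) : R := H (sg (nn t)) * ((a + t) / nn t) / L.
Let f'' (t : R) : R := h1 (sg (nn t)) * ((a + t) / nn t) ^+ 2 / L ^+ 2 +
  H (sg (nn t)) * ((nn t)^-1 - 2 * ((a + t) / nn t) ^+ 2) / L.

Let D1 : 1 <= 1 :> R. Proof. by []. Qed.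
Let s16' : 16 * 1 <= s. Proof. by rewrite mulr1. Qed.
Let n01 : `|0 : R| <= 1. Proof. by rewrite normr0. Qed.

Let nn_gt0 t : `|t| <= 1 -> 0 < nn t.
Proof.
move=> t1; have [_ /andP[h _]] := displaced_nsq D1 s16' E t1 n01.
by apply: lt_le_trans h; rewrite divr_gt0// exprn_gt0.
Qed.

Let dnn (t : R) : is_derive t 1 nn (2 * (a + t)).
Proof.
have da : is_derive t 1 (fun t : R => a + t) 1.
  by apply: (is_derive_eq (derive_add (is_derive_cst a t 1) (is_derive_id t 1))); rewrite add0r.
have := derive_add (derive_mul da da) (is_derive_cst ((y + 0) ^+ 2) t 1) => h.
by apply: (is_derive_eq h); ring.
Qed.

Let dka (t : R) : `|t| <= 1 -> is_derive t 1 (fun t : R => (a + t) / nn t) ((nn t)^-1 - 2 * ((a + t) / nn t) ^+ 2).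
Proof.
move=> t1; have n0 := lt0r_neq0 (nn_gt0 t1).
have da : is_derive t 1 (fun t : R => a + t) 1.
  by apply: (is_derive_eq (derive_add (is_derive_cst a t 1) (is_derive_id t 1))); rewrite add0r.
apply: (is_derive_eq (derive_mul da (derive_inv n0 (dnn t)))).
by field.
Qed.

Let dsg (t : R) : `|t| <= 1 -> is_derive t 1 (fun t : R => sg (nn t)) ((a + t) / nn t / L).
Proof.
move=> t1; have n0 := lt0r_neq0 (nn_gt0 t1).
have h := derive_comp (is_derive1_ln (nn_gt0 t1)) (dnn t).
apply: (is_derive_eq (derive_mul h (is_derive_cst ((2 * L)^-1) t 1))).
by rewrite /=; field; rewrite n0 (lt0r_neq0 L0).
Qed.

Let df (t : R) : `|t| <= 1 -> is_derive t 1 f (f' t).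
Proof.
move=> t1; apply: (is_derive_eq (derive_comp (HHd _) (dsg t1))).
by rewrite /f' !mulrA.
Qed.

Let df' (t : R) : `|t| <= 1 -> is_derive t 1 f' (f'' t).
Proof.
move=> t1; have h := derive_comp (Hd _) (dsg t1).
apply: (is_derive_eq (derive_mul (derive_mul h (dka t1)) (is_derive_cst (L^-1) t 1))).
by rewrite /f'' /=; field; rewrite (lt0r_neq0 L0) (lt0r_neq0 (nn_gt0 t1)).
Qed.

Let nn0 : nn 0 = s ^+ 2. Proof. by rewrite /nn !addr0. Qed.

Lemma first_difference t : `|t| = 1 ->
  `|HH (sg ((a + t) ^+ 2 + y ^+ 2)) - HH (sg (s ^+ 2)) - t * (H (sg (s ^+ 2)) * (a / s ^+ 2) / L)|
    <= 22 * B / (s ^+ 2 * L).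
Proof.
move=> t1.
have e1 : HH (sg ((a + t) ^+ 2 + y ^+ 2)) = f t by rewrite /f /nn addr0.
have e2 : HH (sg (s ^+ 2)) = f 0 by rewrite /f nn0.
have e3 : H (sg (s ^+ 2)) * (a / s ^+ 2) / L = f' 0 by rewrite /f' nn0 addr0.
rewrite e1 e2 e3.
have H1 (x : R) : `|x| <= 1 -> `|f' x - f' 0| <= 22 * B / (s ^+ 2 * L).
  move=> x1; have [k0 [k1 kd _ _ _]] := displaced_kappa D1 s16' E x1 n01.
  have hH := displaced_H D1 s16' E x1 n01.
  rewrite -/(nn x) in k1 kd hH.
  rewrite /f' nn0 addr0; set G := H (sg (nn x)) in hH *; set G0 := H (sg (s ^+ 2)) in hH *.
  have -> : G * ((a + x) / nn x) / L - G0 * (a / s ^+ 2) / L =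
    ((G - G0) * ((a + x) / nn x) + G0 * ((a + x) / nn x - a / s ^+ 2)) / L by ring.
  rewrite normrM normfV (gtr0_norm L0) ler_pdivrMr ?L0//.
  apply: (@le_trans _ _ (B * (5 * 1 / (s * L)) * (2 / s) + B * (12 * 1 / s ^+ 2))).
    rewrite (le_trans (ler_normD _ _))// lerD//; first exact: norm_mul_le.
    by apply: norm_mul_le => //; exact: HB.
  apply: (@le_trans _ _ (10 * B / s ^+ 2 / L + 12 * B / s ^+ 2)).
    by apply: eq_ler; field; rewrite (lt0r_neq0 L0) (lt0r_neq0 s0).
  have -> : 22 * B / (s ^+ 2 * L) * L = 10 * B / s ^+ 2 + 12 * B / s ^+ 2.
    by field; rewrite (lt0r_neq0 L0) (lt0r_neq0 s0).
  rewrite lerD2r ler_pdivrMr ?L0// ler_peMr//.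
  by rewrite divr_ge0 ?exprn_ge0 ?mulr_ge0 ?(ltW s0).
have E0 : 0 <= 22 * B / (s ^+ 2 * L) by rewrite (le_trans _ (H1 0 n01)).
have G1 (x : R) : `|x| <= 1 -> is_derive x 1 (fun x : R => f x - x * f' 0) (f' x - f' 0).
  move=> x1; have h := derive_add (df x1) (derive_mul (is_derive_id x 1) (is_derive_cst (- f' 0) x 1)).
  have -> : (fun x : R => f x - x * f' 0) = (fun t : R => f t + id t * cst (- f' 0) t).
    by apply/funext => z; rewrite /= mulrN.
  by apply: (is_derive_eq h); rewrite /= mulr0 add0r mulr1.
case: (lerP 0 t) => t0.
  have tE : t = 1 by rewrite -t1 ger0_norm.
  rewrite tE mul1r.
  have := @mvt_bound _ (fun x : R => f x - x * f' 0) (fun x : R => f' x - f' 0) 0 1 (22 * B / (s ^+ 2 * L)) ler01.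
  rewrite subr0 mulr1 mul1r mul0r subr0 addrAC; apply.
    by move=> x /andP[x0 x1]; apply: G1; rewrite ger0_norm.
  by move=> x /andP[x0 x1]; apply: H1; rewrite ger0_norm.
have tE : t = -1 by rewrite -t1 ltr0_norm// opprK.
rewrite tE mulN1r opprK.
have := @mvt_bound _ (fun x : R => f x - x * f' 0) (fun x : R => f' x - f' 0) (-1) 0 (22 * B / (s ^+ 2 * L)) (lerN10 R).
rewrite sub0r opprK mulr1 mulN1r opprK mul0r subr0 distrC addrAC; apply.
  by move=> x /andP[x0 x1]; apply: G1; rewrite ler0_norm// lerNl.
by move=> x /andP[x0 x1]; apply: H1; rewrite ler0_norm// lerNl.
Qed.

(** [h1] is merely continuous, so its modulus [e] replaces a third derivative. The mean value
    theorem is used twice: for f' on [-x, x], then for f (z) + f (-z) - z^2 f''(0) on [0, 1]. *)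
Lemma second_difference (e : R) :
  (forall r r', `|r - r'| <= 5 / (s * L) -> `|h1 r - h1 r'| <= e) ->
  `|HH (sg ((a + 1) ^+ 2 + y ^+ 2)) + HH (sg ((a - 1) ^+ 2 + y ^+ 2)) - 2 * HH (sg (s ^+ 2)) -
     (h1 (sg (s ^+ 2)) * (a / s ^+ 2) ^+ 2 / L ^+ 2 +
      H (sg (s ^+ 2)) * ((s ^+ 2)^-1 - 2 * (a / s ^+ 2) ^+ 2) / L)|
    <= 2 * (4 * e / (s ^+ 2 * L ^+ 2) + 168 * B / (s ^+ 3 * L)).
Proof.
move=> he.
have e1 t : HH (sg ((a + t) ^+ 2 + y ^+ 2)) = f t by rewrite /f /nn addr0.
have e2 : HH (sg (s ^+ 2)) = f 0 by rewrite /f nn0.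
have e3 : h1 (sg (s ^+ 2)) * (a / s ^+ 2) ^+ 2 / L ^+ 2 +
      H (sg (s ^+ 2)) * ((s ^+ 2)^-1 - 2 * (a / s ^+ 2) ^+ 2) / L = f'' 0.
  by rewrite /f'' nn0 addr0.
rewrite !e1 e2 e3; set C := (X in _ <= 2 * X).
have H2 (x : R) : `|x| <= 1 -> `|f'' x - f'' 0| <= C.
  move=> x1; have [k0 [k1 kd kd2 ki /andP[i0 i1]]] := displaced_kappa D1 s16' E x1 n01.
  have hH := displaced_H D1 s16' E x1 n01.
  have hs := displaced_sg D1 s16' E x1 n01.
  rewrite -/(nn x) in k1 kd kd2 ki i0 i1 hH hs.
  rewrite mulr1 in hs; have h1d := he _ _ hs.
  rewrite /f'' nn0 addr0; set G := H (sg (nn x)) in hH *; set G0 := H (sg (s ^+ 2)) in hH *.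
  set k := (a + x) / nn x in k1 kd kd2 *; set k' := a / s ^+ 2 in k0 kd kd2 *.
  set g := h1 (sg (nn x)) in h1d *; set g0 := h1 (sg (s ^+ 2)) in h1d *.
  have -> : g * k ^+ 2 / L ^+ 2 + G * ((nn x)^-1 - 2 * k ^+ 2) / L -
     (g0 * k' ^+ 2 / L ^+ 2 + G0 * ((s ^+ 2)^-1 - 2 * k' ^+ 2) / L) =
     ((g - g0) * (k * k) + g0 * (k ^+ 2 - k' ^+ 2)) * (L ^+ 2)^-1 +
     ((G - G0) * ((nn x)^-1 - 2 * (k * k)) +
        G0 * ((nn x)^-1 - (s ^+ 2)^-1 - 2 * (k ^+ 2 - k' ^+ 2))) * L^-1 by ring.
  have Li : `|L^-1| <= L^-1 by rewrite ger0_norm ?invr_ge0 ?(ltW L0).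
  have L2i : `|(L ^+ 2)^-1| <= (L ^+ 2)^-1 by rewrite ger0_norm ?invr_ge0 ?exprn_ge0 ?(ltW L0).
  apply: (@le_trans _ _ ((e * (2 / s * (2 / s)) + B * (36 * 1 / s ^+ 3)) * (L ^+ 2)^-1 +
     (B * (5 * 1 / (s * L)) * (2 / s ^+ 2 + 2 * (2 / s * (2 / s))) +
      B * (10 * 1 / s ^+ 3 + 2 * (36 * 1 / s ^+ 3))) * L^-1)).
    rewrite (le_trans (ler_normD _ _))// lerD//; apply: norm_mul_le => //.
      rewrite (le_trans (ler_normD _ _))// lerD//.
        by apply: norm_mul_le => //; exact: norm_mul_le.
      by apply: norm_mul_le => //; exact: h1B.
    rewrite (le_trans (ler_normD _ _))// lerD//.
      apply: norm_mul_le => //; rewrite (le_trans (ler_normB _ _))// lerD//.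
        by rewrite ger0_norm.
      by rewrite normrM ger0_norm// ler_wpM2l// norm_mul_le.
    apply: norm_mul_le; first exact: HB.
    rewrite (le_trans (ler_normB _ _))// lerD//.
    by rewrite normrM ger0_norm// ler_wpM2l.
  rewrite /C.
  apply: (@le_trans _ _ (4 * e / (s ^+ 2 * L ^+ 2) + (86 * B / (s ^+ 3 * L) / L + 82 * B / (s ^+ 3 * L)))).
    by apply: eq_ler; field; rewrite (lt0r_neq0 L0) (lt0r_neq0 s0).
  rewrite lerD2l (_ : 168 * B / (s ^+ 3 * L) = 86 * B / (s ^+ 3 * L) + 82 * B / (s ^+ 3 * L)); last by ring.
  rewrite lerD2r ler_pdivrMr ?L0// ler_peMr//.
  by rewrite divr_ge0 ?mulr_ge0 ?exprn_ge0 ?(ltW s0) ?(ltW L0).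
have C0 : 0 <= C by rewrite (le_trans _ (H2 0 n01)).
have H1 (x : R) : 0 <= x <= 1 -> `|f' x - f' (- x) - 2 * x * f'' 0| <= 2 * C.
  move=> /andP[x0 x1].
  have xx : - x <= x by rewrite (le_trans _ x0)// oppr_le0.
  have := @mvt_bound _ (fun z : R => f' z - z * f'' 0) (fun z : R => f'' z - f'' 0) (- x) x C xx.
  have -> : f' x - x * f'' 0 - (f' (- x) - - x * f'' 0) = f' x - f' (- x) - 2 * x * f'' 0 by ring.
  move=> h; apply: (le_trans (h _ _)).
  - move=> z /andP[z1 z2].
    have z3 : `|z| <= 1 by rewrite ler_norml; apply/andP; split; lra.
    have hz := derive_add (df' z3) (derive_mul (is_derive_id z 1) (is_derive_cst (- f'' 0) z 1)).
    have -> : (fun x : R => f' x - x * f'' 0) = (fun t : R => f' t + id t * cst (- f'' 0) t).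
      by apply/funext => w; rewrite /= mulrN.
    by apply: (is_derive_eq hz); rewrite /= mulr0 add0r mulr1.
  - by move=> z /andP[z1 z2]; apply: H2; rewrite ler_norml; apply/andP; split; lra.
  have := ler_wpM2l C0 x1; lra.
have h := @mvt_bound _ (fun z : R => f z + f (- z) - z * z * f'' 0) (fun z : R => f' z - f' (- z) - 2 * z * f'' 0)
  0 1 (2 * C) ler01.
rewrite subr0 [2 * C * 1]mulr1 in h.
have -> : f 1 + f (-1) - 2 * f 0 - f'' 0 =
   (f 1 + f (- 1) - 1 * 1 * f'' 0) - (f 0 + f (- 0) - 0 * 0 * f'' 0) by rewrite oppr0; ring.
apply: h; last exact: H1.
move=> z /andP[z0 z1].
have z3 : `|z| <= 1 by rewrite ger0_norm.
have z4 : `|- z| <= 1 by rewrite normrN.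
have dN : is_derive z 1 (fun t : R => - t) (-1).
  by have := is_deriveN (is_derive_id z (1 : R)).
have h1' := derive_comp (df z4) dN.
have h2' := derive_mul (derive_mul (is_derive_id z 1) (is_derive_id z 1)) (is_derive_cst (- f'' 0) z 1).
have h3' := derive_add (derive_add (df z3) h1') h2'.
have -> : (fun z : R => f z + f (- z) - z * z * f'' 0) =
   (fun t : R => f t + f (- t) + (id t * id t) * cst (- f'' 0) t).
  by apply/funext => w; rewrite /= mulrN.
by apply: (is_derive_eq h3'); rewrite /=; ring.
Qed.

End along_axis.
End polar_calculus.

(** * Random walk kernels *)

Section random_walk.
Variable R : realType.

Definition east : site := unit_vec ord0.
Definition north : site := unit_vec ord_max.

Definition avg (f : site -> R) (x : site) : R :=
  4^-1 * (f (x + east) + f (x - east) + f (x + north) + f (x - north)).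

(** Half the difference between the second differences in the two directions: it tells apart the
    directions that [avg] treats alike. *)
Definition aniso (f : site -> R) (x : site) : R :=
  2^-1 * (f (x + east) + f (x - east) - f (x + north) - f (x - north)).

Fixpoint walk (n : nat) (i : int) : R :=
  if n is n'.+1 then (walk n' (i - 1) + walk n' (i + 1)) / 2 else (i == 0)%:R.

Definition dwalk n (i : int) : R := walk n (i + 1) - walk n (i - 1).

(* In the coordinates x.1 + x.2 and x.1 - x.2 the planar walk is a pair of
   independent one-dimensional walks. *)
Definition heat n (x : site) : R := walk n (x.1 + x.2) * walk n (x.1 - x.2).

Lemma walk_ge0 n i : 0 <= walk n i.
Proof. by elim: n i => //= n IHn i; rewrite divr_ge0// addr_ge0. Qed.

Lemma walk_sym n i : walk n (- i) = walk n i.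
Proof.
elim: n i => [|n IHn] i /=; first by rewrite oppr_eq0.
by rewrite -IHn -[X in _ + X]IHn !opprD !opprK addrC.
Qed.

Lemma walk_supp n i : (n < `|i|)%N -> walk n i = 0.
Proof.
elim: n i => [|n IHn] i h /=; first by case: eqP h => // ->.
by rewrite !IHn ?addr0 ?mul0r//; lia.
Qed.

Lemma walk_parity n i : odd (n + `|i|) -> walk n i = 0.
Proof.
elim: n i => [|n IHn] i h /=; first by case: eqP h => // ->.
by rewrite !IHn ?addr0 ?mul0r//; lia.
Qed.

(** The ratio of neighbouring binomial coefficients, read off the recursion; the value of [dwalk] at
    1 and the return probabilities come from it. *)
Lemma walk_ratio n i : (n%:R + 2 + i%:~R) * walk n (i + 2) = (n%:R - i%:~R) * walk n i.
Proof.
elim: n i => [|n IHn] i /=.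
  case: (eqVneq i 0) => [->|i0]; first by rewrite !subrr mul0r mulr0.
  case: (eqVneq (i + 2) 0) => [h|h]; last by rewrite !mulr0.
  have -> : i = - 2 by lia.
  by rewrite mulr0 mulrNz; ring.
have h1 := IHn (i + 1); have h2 := IHn (i - 1).
rewrite (_ : i + 1 + 2 = i + 2 + 1) in h1; last by ring.
rewrite (_ : i - 1 + 2 = i + 1) in h2; last by ring.
rewrite (_ : i + 2 - 1 = i + 1); last by ring.
rewrite intrD in h1; rewrite intrB in h2; rewrite -natr1.
set x := walk n (i + 2 + 1) in h1 *; set y := walk n (i + 1) in h1 h2 *.
set z := walk n (i - 1) in h2 *.
have h3 : (n%:R + 1 + 2 + i%:~R) * x = (n%:R - (i%:~R + 1%:~R)) * y by rewrite -h1; ring.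
have h4 : (n%:R + 1 - i%:~R) * z = (n%:R + 2 + (i%:~R - 1%:~R)) * y by rewrite h2; ring.
rewrite !mulrA mulrDr h3 mulrDr h4; congr (_ / _); ring.
Qed.

Lemma walk0S n : walk n.+1 0 = walk n 1.
Proof. by rewrite /= sub0r add0r walk_sym; field. Qed.

Lemma dwalk1 n : dwalk n 1 = - (2 * walk n 0 / (n%:R + 2)).
Proof.
have h := walk_ratio n 0; rewrite addr0 subr0 add0r in h.
have n0 : n%:R + 2 != 0 :> R by rewrite lt0r_neq0// ltr_wpDl.
rewrite /dwalk subrr (_ : 1 + 1 = 2)//.
have -> : walk n 2 = n%:R * walk n 0 / (n%:R + 2) by rewrite -h; field.
by field.
Qed.

Lemma walk_le1 n i : walk n i <= 1.
Proof.
elim: n i => [|n IHn] i /=; first by case: eqP => _; rewrite ?lexx ?ler01.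
by rewrite ler_pdivrMr// mul1r -[2]/(1 + 1) lerD.
Qed.

(** Two more steps multiply the return probability by (a + 1) / (a + 2) with a = 2 m, and (a + 1)(a
    + 3) <= (a + 2)^2. *)
Lemma walk_return m : walk m.*2 0 ^+ 2 <= (m.*2.+1%:R)^-1.
Proof.
elim: m => [|m IHm]; first by rewrite /= expr1n invr1.
have h := dwalk1 m.*2; rewrite /dwalk subrr (_ : 1 + 1 = 2)// in h.
have -> : walk m.+1.*2 0 = walk m.*2 0 * (m.*2%:R + 1) / (m.*2%:R + 2).
  rewrite doubleS walk0S /= subrr (_ : 1 + 1 = 2)//.
  have -> : walk m.*2 2 = walk m.*2 0 - 2 * walk m.*2 0 / (m.*2%:R + 2) by rewrite -h; ring.
  by field; rewrite lt0r_neq0// ltr_wpDl.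
rewrite doubleS; set a : R := m.*2%:R.
have a0 : 0 <= a by rewrite ler0n.
have n1 : m.*2.+1%:R = a + 1 :> R by rewrite -addn1 natrD.
have n3 : m.*2.+3%:R = a + 1 + 1 + 1 :> R by rewrite -addn3 natrD -!addrA.
rewrite n1 in IHm; rewrite n3.
have p1 : 0 < a + 1 by lra. have p2 : 0 < a + 2 by lra. have p3 : 0 < a + 1 + 1 + 1 by lra.
rewrite -mulrA exprMn; apply: (@le_trans _ _ ((a + 1)^-1 * ((a + 1) / (a + 2)) ^+ 2)).
  by rewrite ler_wpM2r// sqr_ge0.
rewrite -subr_ge0.
have -> : (a + 1 + 1 + 1)^-1 - (a + 1)^-1 * ((a + 1) / (a + 2)) ^+ 2 =
  ((a + 2) ^+ 2 - (a + 1) * (a + 3)) / ((a + 1 + 1 + 1) * (a + 2) ^+ 2).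
  by field; rewrite !lt0r_neq0.
by rewrite divr_ge0 ?mulr_ge0 ?sqr_ge0 ?(ltW p3)//; nra.
Qed.

Lemma dwalk_odd n i : dwalk n (- i) = - dwalk n i.
Proof.
rewrite /dwalk (_ : - i + 1 = - (i - 1)); last by ring.
by rewrite (_ : - i - 1 = - (i + 1)) ?walk_sym; ring.
Qed.

Lemma dwalk0 n : dwalk n 0 = 0.
Proof. by have := dwalk_odd n 0; rewrite oppr0; lra. Qed.

Lemma dwalk_le0 n (i : int) : 0 <= i -> dwalk n i <= 0.
Proof.
elim: n i => [|n IHn] i i0.
  rewrite /dwalk /= (_ : (i + 1 == 0) = false); last by apply/eqP; lia.
  by rewrite sub0r oppr_le0.
have -> : dwalk n.+1 i = (dwalk n (i - 1) + dwalk n (i + 1)) / 2.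
  by rewrite /dwalk /= subrK addrK; ring.
case: (eqVneq i 0) => [->|i1].
  by rewrite sub0r add0r dwalk_odd addNr mul0r.
by rewrite pmulr_lle0 ?invr_gt0// -[leRHS]addr0 lerD// IHn; lia.
Qed.

(** [dwalk n] is odd and of constant sign on each side of 0, so its absolute values telescope. *)
Lemma sum_dwalk n M : \sum_(i <- zr M) `|dwalk n i| =
  2 * (walk n 0 + walk n 1) - 2 * (walk n M%:Z + walk n (M%:Z + 1)).
Proof.
elim: M => [|M IHM].
  by rewrite (_ : zr 0 = [:: 0])// big_seq1 dwalk0 normr0 add0r subrr.
rewrite sum_zrS IHM dwalk_odd normrN ler0_norm ?dwalk_le0// /dwalk.
have -> : M.+1%:Z = M%:Z + 1 by lia.
by rewrite addrK; ring.
Qed.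

Lemma sum_dwalk_le m M : \sum_(i <- zr M) `|dwalk m.*2 i| <= 2 * walk m.*2 0.
Proof.
rewrite sum_dwalk (@walk_parity _ 1) ?addr0; last by lia.
by rewrite lerBlDr lerDl mulr_ge0// addr_ge0// walk_ge0.
Qed.

Lemma heat_shift n x : [/\
  heat n (x + east) = walk n (x.1 + x.2 + 1) * walk n (x.1 - x.2 + 1),
  heat n (x - east) = walk n (x.1 + x.2 - 1) * walk n (x.1 - x.2 - 1),
  heat n (x + north) = walk n (x.1 + x.2 + 1) * walk n (x.1 - x.2 - 1) &
  heat n (x - north) = walk n (x.1 + x.2 - 1) * walk n (x.1 - x.2 + 1)].
Proof. by case: x => a b; rewrite /heat; split; congr (walk _ _ * walk _ _) => /=; lia. Qed.

Lemma avg_heat n : avg (heat n) = heat n.+1.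
Proof.
apply/funext => x; rewrite /avg; have [-> -> -> ->] := heat_shift n x.
by rewrite /heat /=; field.
Qed.

(** In the coordinates x.1 + x.2 and x.1 - x.2 the difference of second differences is a mixed
    difference, which factorizes along with the kernel. *)
Lemma aniso_heat n x : aniso (heat n) x = 2^-1 * (dwalk n (x.1 + x.2) * dwalk n (x.1 - x.2)).
Proof.
rewrite /aniso; have [-> -> -> ->] := heat_shift n x.
by rewrite /dwalk; ring.
Qed.

Lemma heat_supp n x : x \notin box n -> heat n x = 0.
Proof.
rewrite mem_box /heat => h.
have [h1|h1] := ltnP n `|x.1 + x.2|; first by rewrite walk_supp ?mul0r.
by rewrite [X in _ * X]walk_supp ?mulr0//; case: x h h1 => a b /=; lia.
Qed.

Lemma heat0 n : heat n 0 = walk n 0 ^+ 2. Proof. by rewrite expr2. Qed.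

Lemma heat_unit n : [/\ heat n east = heat n.+1 0, heat n (- east) = heat n.+1 0,
  heat n north = heat n.+1 0 & heat n (- north) = heat n.+1 0].
Proof.
have h i : i = 1 \/ i = -1 -> walk n i = walk n.+1 0.
  by move=> [->|->]; rewrite walk0S// walk_sym.
by rewrite !heat0 expr2; split; rewrite /heat; congr (_ * _); apply: h; rewrite /=; lia.
Qed.

Lemma aniso_heat_unit n : [/\ aniso (heat n) east = dwalk n 1 ^+ 2 / 2,
  aniso (heat n) (- east) = dwalk n 1 ^+ 2 / 2,
  aniso (heat n) north = - (dwalk n 1 ^+ 2 / 2),
  aniso (heat n) (- north) = - (dwalk n 1 ^+ 2 / 2) &
  aniso (heat n) 0 = 0].
Proof.
have g s t x : x.1 + x.2 = s -> x.1 - x.2 = t ->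
    aniso (heat n) x = 2^-1 * (dwalk n s * dwalk n t).
  by move=> <- <-; exact: aniso_heat.
rewrite (g 1 1 east)// (g (-1) (-1) (- east))// (g 1 (-1) north)// (g (-1) 1 (- north))// (g 0 0 0)//.
by rewrite !dwalk_odd dwalk0; split; ring.
Qed.

Definition kappa N : R := \sum_(n < N) dwalk n 1 ^+ 2 / 2.

(** The terms are at most 2 / (n + 2)^2, compared with a telescoping sum. The bound has to stay
    below 2 because [skew] divides by 8 - 4 kappa. *)
Lemma kappa_bound N : 0 <= kappa N <= 3 / 2.
Proof.
apply/andP; split; first by apply: sumr_ge0 => n _; rewrite divr_ge0// sqr_ge0.
suff : kappa N <= 2 * ((3 / 4 - (N%:R + 1)^-1) * (N != 0%N)%:R).
  move/le_trans; apply.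
  have : 0 <= (N%:R + 1 : R)^-1 by rewrite invr_ge0 addr_ge0.
  by case: (N != 0%N) => /=; lra.
elim: N => [|N IHN]; first by rewrite /kappa big_ord0 eqxx !mulr0.
rewrite /kappa big_ord_recr /= -/(kappa N).
have h : dwalk N 1 ^+ 2 / 2 <= 2 * (N%:R + 2 : R)^-1 ^+ 2.
  rewrite dwalk1 sqrrN -mulrA exprMn.
  have -> : 2 ^+ 2 * (walk N 0 / (N%:R + 2)) ^+ 2 / 2 = 2 * ((N%:R + 2)^-1 ^+ 2 * walk N 0 ^+ 2).
    by rewrite exprMn; field; rewrite lt0r_neq0// ltr_wpDl.
  by rewrite ler_wpM2l// ler_piMr ?sqr_ge0// expr_le1// ?walk_ge0 ?walk_le1.
rewrite mulr1 (le_trans (lerD IHN h))// -mulrDr ler_wpM2l//.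
case: N {IHN h} => [|N] /=; first by rewrite mulr0 !add0r -[1%:R + 1]/(2 : R) expr2; lra.
rewrite !mulr1 -[N.+2%:R]natr1 -[N.+1%:R]natr1; have N0 : 0 <= N%:R :> R by [].
set a : R := N%:R in N0 *.
rewrite -subr_ge0.
have -> : 3 / 4 - (a + 1 + 1 + 1)^-1 - (3 / 4 - (a + 1 + 1)^-1 + (a + 1 + 2)^-1 ^+ 2) =
  ((a + 1 + 1) * (a + 3) ^+ 2)^-1.
  by field; rewrite !lt0r_neq0//; lra.
by rewrite invr_ge0 mulr_ge0 ?sqr_ge0//; lra.
Qed.

Definition kernel N (b : R) (x : site) : R :=
  4^-1 * \sum_(n < N) heat n x + b * \sum_(n < N) aniso (heat n) x.

Lemma avgD f g x : avg (fun y => f y + g y) x = avg f x + avg g x.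
Proof. by rewrite /avg; ring. Qed.

Lemma avgZ a f x : avg (fun y => a * f y) x = a * avg f x.
Proof. by rewrite /avg; ring. Qed.

Lemma avg_sum N (f : nat -> site -> R) x :
  avg (fun y => \sum_(n < N) f n y) x = \sum_(n < N) avg (f n) x.
Proof. by rewrite /avg -!big_split /= -mulr_sumr. Qed.

Lemma avg_aniso f x : avg (aniso f) x = aniso (avg f) x.
Proof. by rewrite /avg /aniso (addrAC x north) (addrAC x (- north)) (addrAC x north (- _)) (addrAC x (- north) (- _)); ring. Qed.

(** Averaging turns [heat n] into [heat n.+1] and commutes with [aniso], so both sums telescope. *)
Lemma kernel_laplacian N b x : avg (kernel N b) x - kernel N b x =
  4^-1 * (heat N x - heat 0 x) + b * (aniso (heat N) x - aniso (heat 0) x).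
Proof.
rewrite /kernel avgD !avgZ (avg_sum _ heat) (avg_sum _ (fun n => aniso (heat n))).
have e1 : \sum_(n < N) avg (heat n) x = \sum_(n < N) heat n x + (heat N x - heat 0 x).
  under eq_bigr do rewrite avg_heat.
  by rewrite -(telescope_sumr (fun n => heat n x) (leq0n N)) big_mkord -big_split /=; apply: eq_bigr => i _; ring.
have e2 : \sum_(n < N) avg (aniso (heat n)) x = \sum_(n < N) aniso (heat n) x + (aniso (heat N) x - aniso (heat 0) x).
  under eq_bigr do rewrite avg_aniso avg_heat.
  by rewrite -(telescope_sumr (fun n => aniso (heat n) x) (leq0n N)) big_mkord -big_split /=; apply: eq_bigr => i _; ring.
by rewrite e1 e2; ring.
Qed.

(** The gaps are the coefficients of the squared gradients in [bond_sum_quad]. For b = 0 they agree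
    in all directions; b kappa shifts weight between the two axes. *)
Lemma kernel_gaps N b : [/\
  kernel N b 0 - kernel N b east = 4^-1 * (1 - heat N 0) - b * kappa N,
  kernel N b 0 - kernel N b (- east) = 4^-1 * (1 - heat N 0) - b * kappa N,
  kernel N b 0 - kernel N b north = 4^-1 * (1 - heat N 0) + b * kappa N &
  kernel N b 0 - kernel N b (- north) = 4^-1 * (1 - heat N 0) + b * kappa N].
Proof.
have h0 : \sum_(n < N) aniso (heat n) 0 = 0.
  by apply: big1 => n _; case: (aniso_heat_unit n).
have t : \sum_(n < N) heat n 0 = \sum_(n < N) heat n.+1 0 + (1 - heat N 0).
  have -> : 1 - heat N 0 = - (heat N 0 - heat 0 0) by rewrite !heat0 /= expr1n opprB.
  rewrite -(telescope_sumr (fun n => heat n 0) (leq0n N)) big_mkord -sumrN -big_split /=; apply: eq_bigr => i _; ring.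
have e1 : \sum_(n < N) heat n east = \sum_(n < N) heat n.+1 0.
  by apply: eq_bigr => n _; case: (heat_unit n).
have e2 : \sum_(n < N) heat n (- east) = \sum_(n < N) heat n.+1 0.
  by apply: eq_bigr => n _; case: (heat_unit n).
have e3 : \sum_(n < N) heat n north = \sum_(n < N) heat n.+1 0.
  by apply: eq_bigr => n _; case: (heat_unit n).
have e4 : \sum_(n < N) heat n (- north) = \sum_(n < N) heat n.+1 0.
  by apply: eq_bigr => n _; case: (heat_unit n).
have a1 : \sum_(n < N) aniso (heat n) east = kappa N.
  by apply: eq_bigr => n _; case: (aniso_heat_unit n).
have a2 : \sum_(n < N) aniso (heat n) (- east) = kappa N.
  by apply: eq_bigr => n _; case: (aniso_heat_unit n).
have a3 : \sum_(n < N) aniso (heat n) north = - kappa N.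
  by rewrite -sumrN; apply: eq_bigr => n _; case: (aniso_heat_unit n).
have a4 : \sum_(n < N) aniso (heat n) (- north) = - kappa N.
  by rewrite -sumrN; apply: eq_bigr => n _; case: (aniso_heat_unit n).
by rewrite /kernel h0 t e1 e2 e3 e4 a1 a2 a3 a4; split; ring.
Qed.

Lemma aniso_heat_supp n x : x \notin box n.+1 -> aniso (heat n) x = 0.
Proof.
move=> h; rewrite /aniso !heat_supp ?addr0 ?subr0 ?mulr0//; apply: contra h;
  rewrite !mem_box /=; lia.
Qed.

Lemma kernel_supp N b x : x \notin box N -> kernel N b x = 0.
Proof.
move=> h; rewrite /kernel !big1 ?mulr0 ?addr0// => n _; [apply: aniso_heat_supp|apply: heat_supp];
  by apply: contra h; apply: sub_box; have := ltn_ord n; lia.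
Qed.

Lemma ler_sum_sub (I : eqType) (s1 s2 : seq I) (F : I -> R) : uniq s1 -> uniq s2 ->
  {subset s1 <= s2} -> (forall x, 0 <= F x) -> \sum_(x <- s1) F x <= \sum_(x <- s2) F x.
Proof.
move=> u1 u2 s12 F0.
have -> : \sum_(x <- s1) F x = \sum_(x <- s2 | x \in s1) F x.
  rewrite -[RHS]big_filter; apply: perm_big; apply: uniq_perm => //; first exact: filter_uniq.
  by move=> x; rewrite mem_filter; case: (boolP (x \in s1)) => // /s12 ->.
by rewrite [leRHS](bigID (mem s1)) /= lerDl sumr_ge0.
Qed.

(** By [aniso_heat] the sum is at most half a product of two total variations, each at most twice
    the return probability in one dimension: as small as the kernel at 0. *)
Lemma aniso_heat_norm m M : \sum_(x <- box M) `|aniso (heat m.*2) x| <= 2 * heat m.*2 0.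
Proof.
have -> : \sum_(x <- box M) `|aniso (heat m.*2) x| =
    2^-1 * \sum_(x <- [seq (x.1 + x.2, x.1 - x.2) | x <- box M]) (`|dwalk m.*2 x.1| * `|dwalk m.*2 x.2|).
  by rewrite big_map mulr_sumr; apply: eq_bigr => x _; rewrite aniso_heat !normrM ger0_norm.
have h : \sum_(x <- [seq (x.1 + x.2, x.1 - x.2) | x <- box M]) (`|dwalk m.*2 x.1| * `|dwalk m.*2 x.2|) <=
   \sum_(x <- box (M + M)) (`|dwalk m.*2 x.1| * `|dwalk m.*2 x.2|).
  apply: ler_sum_sub.
  - rewrite map_inj_uniq ?box_uniq// => -[a b] [c d] /= [h1 h2].
    by congr (_, _); lia.
  - exact: box_uniq.
  - by move=> _ /mapP[[a b] h ->]; move: h; rewrite !mem_box /=; lia.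
  - by move=> x; rewrite mulr_ge0.
apply: (@le_trans _ _ (2^-1 * ((2 * walk m.*2 0) * (2 * walk m.*2 0)))); last first.
  by rewrite heat0; apply: eq_ler; field.
rewrite ler_wpM2l// (le_trans h)// big_box /=.
under eq_bigr do rewrite -mulr_sumr.
rewrite -mulr_suml ler_pM// ?sum_dwalk_le//; exact: sumr_ge0.
Qed.

End random_walk.

(** * Quadratic forms *)

Section convolution.
Variable R : realType.
Implicit Types (f g k w : site -> R) (x y z a : site).
Local Notation avg := (@avg R).
Local Notation aniso := (@aniso R).

Definition supported n f := forall x, x \notin box n -> f x = 0.

Lemma supported_shift n d f a : supported n f -> a \in box d -> supported (n + d) (fun x => f (x + a)).
Proof.
by move=> hf ha x xn; apply: hf; apply: contra xn; move: ha; rewrite !mem_box; case: x a => ? ? [? ?] /=; lia.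
Qed.

Lemma sum_shift n d L f a : supported n f -> a \in box d -> (n + d <= L)%N ->
  \sum_(x <- box L) f (x + a) = \sum_(x <- box L) f x.
Proof.
move=> hf ha hL; rewrite -(big_map (fun x => x + a) xpredT f).
apply: sum_supp; [|exact: box_uniq| |].
- by rewrite map_inj_uniq ?box_uniq//; exact: addIr.
- move=> x xn; apply: hf; apply: contra xn => xn; apply/mapP; exists (x - a); last by rewrite subrK.
  by move: xn ha; rewrite !mem_box; case: x a => ? ? [? ?] /=; lia.
- by move=> x xn; apply: hf; apply: contra xn; apply: sub_box; lia.
Qed.

Lemma sum_delta L f a : (a \notin box L -> f a = 0) -> \sum_(x <- box L) f x * (x == a)%:R = f a.
Proof.
move=> h; case: (boolP (a \in box L)) => aL; last first.
  rewrite h// big1_seq// => x /andP[_ xL]; case: eqP => [xa|]; last by rewrite mulr0.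
  by rewrite -xa xL in aL.
rewrite (bigD1_seq a) ?box_uniq//= eqxx mulr1 big1 ?addr0// => x /negbTE ->.
by rewrite mulr0.
Qed.

Variable M : nat.

Definition conv k f x : R := \sum_(z <- box M) k z * f (x + z).

Lemma conv_shift N k f x a : supported N k -> a \in box 1 -> (N < M)%N ->
  conv (fun z => k (z + a)) f x = conv k f (x - a).
Proof.
move=> hk ha NM; rewrite /conv.
rewrite -(@sum_shift N 1 M (fun z => k z * f (x - a + z)) a)//; last by lia.
  by apply: eq_bigr => z _; rewrite [z + a]addrC addrA subrK.
by move=> z zN; rewrite hk ?mul0r.
Qed.

Lemma convDl k k' f x : conv (fun z => k z + k' z) f x = conv k f x + conv k' f x.
Proof. by rewrite /conv -big_split; apply: eq_bigr => z _; rewrite mulrDl. Qed.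

Lemma convZl c k f x : conv (fun z => c * k z) f x = c * conv k f x.
Proof. by rewrite /conv mulr_sumr; apply: eq_bigr => z _; rewrite mulrA. Qed.

Lemma convDr k f g x : conv k (fun z => f z + g z) x = conv k f x + conv k g x.
Proof. by rewrite /conv -big_split; apply: eq_bigr => z _; rewrite mulrDr. Qed.

Lemma convZr c k f x : conv k (fun z => c * f z) x = c * conv k f x.
Proof. by rewrite /conv mulr_sumr; apply: eq_bigr => z _; rewrite mulrCA. Qed.

Let steps : [/\ east \in box 1, - east \in box 1, north \in box 1 & - north \in box 1].
Proof. by []. Qed.

Lemma conv_avg N k f x : supported N k -> (N < M)%N -> conv (avg k) f x = avg (conv k f) x.
Proof.
move=> hk NM; case: steps => s1 s2 s3 s4.
rewrite /avg convZl (convDl _ (fun z => k (z - north))) (convDl _ (fun z => k (z + north))).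
rewrite (convDl _ (fun z => k (z - east))) !(conv_shift _ _ hk)// !opprK.
by congr (_ * _); ring.
Qed.

Lemma conv_aniso N k f x : supported N k -> (N < M)%N -> conv (aniso k) f x = aniso (conv k f) x.
Proof.
move=> hk NM; case: steps => s1 s2 s3 s4.
have -> : aniso k = fun z => 2^-1 * (k (z + east) + k (z - east) + (-1) * k (z + north) + (-1) * k (z - north)).
  by apply/funext => z; rewrite /aniso !mulN1r.
rewrite convZl (convDl _ (fun z => -1 * k (z - north))) (convDl _ (fun z => -1 * k (z + north))).
rewrite (convDl _ (fun z => k (z - east))) !convZl !(conv_shift _ _ hk)// !opprK /aniso.
by congr (_ * _); ring.
Qed.

Lemma avg_conv k f x : avg (conv k f) x = conv k (avg f) x.
Proof.
rewrite /avg convZr !convDr /conv.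
by do ![congr (_ + _) || congr (_ * _)]; apply: eq_bigr => z _; rewrite addrAC.
Qed.

Lemma conv_heat0 f x : conv (heat R 0) f x = f x.
Proof.
rewrite /conv.
have -> : \sum_(z <- box M) heat R 0 z * f (x + z) = \sum_(z <- box M) f (x + z) * (z == 0)%:R.
  apply: eq_bigr => z _; rewrite mulrC; congr (_ * _).
  rewrite /heat /= -natrM mulnb; congr ((nat_of_bool _)%:R).
  by case: z => a b; apply/andP/eqP => [[/eqP h1 /eqP h2]|[-> ->]]//; congr (_, _); move: h1 h2 => /=; lia.
by rewrite (sum_delta (f := fun z => f (x + z))) ?addr0// mem_box.
Qed.

Lemma conv_heat n f x : (n <= M)%N -> conv (heat R n) f x = iter n avg f x.
Proof.
elim: n x => [|n IHn] x nM; first exact: conv_heat0.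
rewrite -avg_heat (conv_avg (N := n))//; last exact: heat_supp.
by rewrite iterS /avg !IHn//; exact: ltnW.
Qed.

Definition mass k : R := \sum_(z <- box M) `|k z|.

Lemma conv_bound k f x : (forall y, `|f y| <= 1) -> `|conv k f x| <= mass k.
Proof.
move=> f1; rewrite (le_trans (ler_norm_sum _ _ _))//; apply: ler_sum => z _.
by rewrite normrM ler_piMr.
Qed.

Lemma mass_ge0 k : 0 <= mass k. Proof. exact: sumr_ge0. Qed.

Lemma conv_delta k x y : supported M k -> conv k (fun z => (z == x)%:R) y = k (x - y).
Proof.
move=> hk; rewrite /conv -(sum_delta (L := M) (hk (x - y))); apply: eq_bigr => z _.
congr (_ * (nat_of_bool _)%:R); apply/eqP/eqP => [<-|->]; last by rewrite addrC subrK.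
by rewrite [y + z]addrC addrK.
Qed.

End convolution.

(** * Summation by parts against slowly varying weights *)

Section slowly_varying.
Variables (R : realType) (n L : nat) (w osc : site -> R).
Hypothesis nL : (n + 2 <= L)%N.
Hypothesis w_supp : supported n w.
Hypothesis w_osc : forall x z, z \in box 1 -> `|w (x + z) - w x| <= osc x.
Local Notation avg := (@avg R).
Local Notation aniso := (@aniso R).
Local Notation "'S' f" := (\sum_(x <- box L) f x) (at level 10).

Definition total_osc : R := \sum_(x <- box L) osc x.

Lemma osc_ge0 x : 0 <= osc x.
Proof. by rewrite (le_trans _ (@w_osc x 0 _)). Qed.

Lemma total_osc_ge0 : 0 <= total_osc.
Proof. by apply: sumr_ge0 => x _; exact: osc_ge0. Qed.

Let steps : [/\ east \in box 1, - east \in box 1, north \in box 1 & - north \in box 1].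
Proof. by []. Qed.

Lemma sum_by_parts_shift (f g : site -> R) a : a \in box 1 ->
  \sum_(x <- box L) w x * f x * g (x + a) = \sum_(x <- box L) w (x - a) * f (x - a) * g x.
Proof.
move=> ha; rewrite -(@sum_shift _ n.+1 1 L (fun x => w (x - a) * f (x - a) * g x) a)//; last by lia.
  by apply: eq_bigr => x _; rewrite addrK.
move=> x xn; rewrite (@supported_shift _ n 1 w (- a))//; first by rewrite !mul0r.
  by move: ha; rewrite !mem_box; case: a => ? ? /=; lia.
by rewrite addn1.
Qed.

Lemma sum_osc (F : site -> R) c : (forall x, `|F x| <= c * osc x) ->
  `|\sum_(x <- box L) F x| <= c * total_osc.
Proof.
move=> h; rewrite (le_trans (ler_norm_sum _ _ _))// mulr_sumr.
by apply: ler_sum => x _.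
Qed.

(** [avg] is symmetric for counting measure, so only its commutator with multiplication by [w]
    survives, and that is bounded by [osc]. *)
Lemma sum_commute f g c : (forall x, `|f x| <= 1) -> (forall x, `|g x| <= c) ->
  `|\sum_(x <- box L) w x * f x * avg g x - \sum_(x <- box L) w x * avg f x * g x| <= c * total_osc.
Proof.
move=> f1 g1; case: steps => s1 s2 s3 s4.
have e : \sum_(x <- box L) w x * f x * avg g x = \sum_(x <- box L) avg (fun y => w y * f y) x * g x.
  transitivity (4^-1 * (\sum_(x <- box L) w x * f x * g (x + east) + \sum_(x <- box L) w x * f x * g (x - east)
     + \sum_(x <- box L) w x * f x * g (x + north) + \sum_(x <- box L) w x * f x * g (x - north))).
    by rewrite -!big_split /= mulr_sumr; apply: eq_bigr => x _; rewrite /avg; ring.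
  rewrite !sum_by_parts_shift// -!big_split /= mulr_sumr; apply: eq_bigr => x _; rewrite /avg !opprK; ring.
rewrite e -sumrB; apply: sum_osc => x.
rewrite -mulrBl normrM mulrC ler_pM//.
have -> : avg (fun y => w y * f y) x - w x * avg f x = 4^-1 *
  ((w (x + east) - w x) * f (x + east) + (w (x - east) - w x) * f (x - east) +
   (w (x + north) - w x) * f (x + north) + (w (x - north) - w x) * f (x - north)).
  by rewrite /avg; ring.
rewrite normrM ger0_norm// ler_pdivrMl//.
have b z : z \in box 1 -> `|(w (x + z) - w x) * f (x + z)| <= osc x.
  by move=> hz; rewrite normrM (le_trans _ (w_osc x hz))// ler_piMr.
apply: (@le_trans _ _ (osc x + osc x + osc x + osc x)); last by apply: eq_ler; ring.
by do 3?[rewrite (le_trans (ler_normD _ _))// lerD ?b//].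
Qed.

Lemma avg_le1 f : (forall x, `|f x| <= 1) -> forall x, `|avg f x| <= 1.
Proof.
move=> f1 x; rewrite /avg normrM ger0_norm// ler_pdivrMl// mulr1.
have -> : 4 = 1 + 1 + 1 + 1 :> R by ring.
by do 3?[rewrite (le_trans (ler_normD _ _))// lerD ?f1//].
Qed.

Lemma iter_avg_le1 m f : (forall x, `|f x| <= 1) -> forall x, `|iter m avg f x| <= 1.
Proof. by move=> f1; elim: m => //= m IHm; exact: avg_le1. Qed.

Lemma sum_commute_iter m f g : (forall x, `|f x| <= 1) -> (forall x, `|g x| <= 1) ->
  `|\sum_(x <- box L) w x * f x * iter m avg g x -
    \sum_(x <- box L) w x * iter m avg f x * g x| <= m%:R * total_osc.
Proof.
elim: m f g => [|m IHm] f g f1 g1; first by rewrite /= subrr normr0 mul0r.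
have h1 := @sum_commute f (iter m avg g) 1 f1 (iter_avg_le1 m g1).
have h2 := IHm _ _ (avg_le1 f1) g1.
rewrite iterS iterSr; set a := \sum_(x <- box L) _ in h1 *.
set b := \sum_(x <- box L) _ in h1 h2; set c := \sum_(x <- box L) _ in h2 *.
rewrite (_ : a - c = (a - b) + (b - c)); last by ring.
by rewrite (le_trans (ler_normD _ _))// -natr1 mulrDl addrC lerD.
Qed.

Lemma sum_aniso f : (forall x, `|f x| <= 1) ->
  `|\sum_(x <- box L) w x * aniso f x| <= 2 * total_osc.
Proof.
move=> f1; case: steps => s1 s2 s3 s4.
have -> : \sum_(x <- box L) w x * aniso f x =
    \sum_(x <- box L) 2^-1 * (w (x - east) + w (x + east) - w (x - north) - w (x + north)) * f x.
  transitivity (2^-1 * (\sum_(x <- box L) w x * 1 * f (x + east) + \sum_(x <- box L) w x * 1 * f (x - east)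
     - \sum_(x <- box L) w x * 1 * f (x + north) - \sum_(x <- box L) w x * 1 * f (x - north))).
    by rewrite -!big_split -!sumrB /= mulr_sumr; apply: eq_bigr => x _; rewrite /aniso; ring.
  rewrite !(@sum_by_parts_shift (fun=> 1))// -!big_split -!sumrB /= mulr_sumr; apply: eq_bigr => x _; rewrite !opprK; ring.
apply: sum_osc => x; rewrite normrM -[leRHS]mulr1 ler_pM// normrM ger0_norm// ler_pdivrMl//.
rewrite (_ : w _ + _ - _ - _ = (w (x - east) - w x) + (w (x + east) - w x) - (w (x - north) - w x) - (w (x + north) - w x)); last by ring.
apply: (@le_trans _ _ (osc x + osc x + osc x + osc x)); last by apply: eq_ler; ring.
rewrite (le_trans (ler_normB _ _))// lerD ?w_osc// (le_trans (ler_normB _ _))// lerD ?w_osc//.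
by rewrite (le_trans (ler_normD _ _))// lerD ?w_osc.
Qed.

Lemma sum_shift_weight f a : a \in box 1 -> (forall x, 0 <= f x <= 1) ->
  `|\sum_(x <- box L) w (x + a) * f x - \sum_(x <- box L) w x * f x| <= total_osc.
Proof.
move=> ha f1; rewrite -sumrB -[leRHS]mul1r; apply: sum_osc => x; rewrite mul1r -mulrBl normrM.
by have /andP[f0 f2] := f1 x; rewrite (le_trans _ (w_osc x ha))// ler_piMr// ger0_norm.
Qed.

End slowly_varying.

(** The bookkeeping of [quad_lower] with sums as variables: A1, A2 are the squared gradients in the
    two directions, A1', A2' the same with shifted weights. Since b (8 - 4 k) = t, their
    coefficients become (1 + t)/4 and (1 - t)/4, up to p. *)
Lemma quad_arith (R : realType) (X1 X2 X3 X4 Y1 Y2 S3 S5 A1 A1' A2 A2' b k p r W O t mO kO B : R) :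
  `|b| <= 2^-1 -> b * (8 - 4 * k) = t -> t = 1 \/ t = -1 -> 0 <= p -> p <= r -> r <= 1 ->
  0 <= W -> 0 <= O ->
  B = X1 - X2 + 4 * b * (S3 - (2^-1 * S5 - 4^-1 * (A1 + A1' - A2 - A2'))) - 4 * (X3 - X4) +
    (X1 - X2 + 4 * b * (S3 - (2^-1 * S5 - 4^-1 * (A1 + A1' - A2 - A2')))) +
    ((4^-1 * (1 - p) - b * k) * (A1 + A1') + (4^-1 * (1 - p) + b * k) * (A2 + A2')) ->
  `|X1 - Y2| <= mO -> `|Y1 - X2| <= mO -> `|X3 - X4| <= kO ->
  0 <= A1 <= W -> 0 <= A2 <= W -> `|A1' - A1| <= O -> `|A2' - A2| <= O ->
  `|S3| <= W * (2 * p) -> `|S5| <= 2 * O ->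
  (1 + t) / 2 * A1 + (1 - t) / 2 * A2 <= B + 2 * (Y1 - Y2) + 9 * r * W + (4 * mO + 5 * O + 4 * kO).
Proof.
move=> b1 bE tE p0 pr r1 W0 O0 ->.
move=> h1 h2 h3 /andP[a1 a1'] /andP[a2 a2'] h4 h5 s3 s5.
have p1 : p <= 1 by exact: le_trans r1.
have : `|b * S3| <= 2^-1 * (W * (2 * p)) by rewrite normrM ler_pM.
have : `|b * S5| <= 2^-1 * (2 * O) by rewrite normrM ler_pM.
move: h1 h2 h3 h4 h5; rewrite !ler_norml => /andP[h1 h1'] /andP[h2 h2'] /andP[h3 h3'].
move=> /andP[h4 h4'] /andP[h5 h5'] /andP[g1 g1'] /andP[g2 g2'].
have bk : b * k = 2 * b - t / 4 by rewrite -bE; field.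
have e1 : p * A1 <= p * W by rewrite ler_wpM2l.
have e2 : p * A2 <= p * W by rewrite ler_wpM2l.
have e3 : p * A1' <= p * (A1 + O) by rewrite ler_wpM2l//; lra.
have e4 : p * A2' <= p * (A2 + O) by rewrite ler_wpM2l//; lra.
have e5 : p * O <= O by rewrite ler_piMl.
have e6 : p * W <= r * W by rewrite ler_wpM2r.
have -> : 4^-1 * (1 - p) - b * k = 4^-1 * (1 - p) - (2 * b - t / 4) by rewrite bk.
have -> : 4^-1 * (1 - p) + b * k = 4^-1 * (1 - p) + (2 * b - t / 4) by rewrite bk.
by case: tE => ->; lra.
Qed.

(** * The quadratic forms under exchanges *)

Section quadratic_form.
Variables (R : realType) (n M L N m : nat) (w osc : site -> R) (tau : R).
Hypothesis nML : (n + M + 2 <= L)%N.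
Hypothesis w_supp : supported n w.
Hypothesis w_ge0 : forall x, 0 <= w x.
Hypothesis w_osc : forall x z, z \in box 1 -> `|w (x + z) - w x| <= osc x.
Hypothesis NM : (N.+1 <= M)%N.
Hypothesis Nm : N = m.*2.
Hypothesis tau1 : tau = 1 \/ tau = -1.
Local Notation avg := (@avg R).
Local Notation aniso := (@aniso R).
Local Notation cv := (@conv R M).

Definition occ (eta : config) (x : site) : R := (eta x)%:R.

(* With this amount of anisotropy the squared gradients in [bond_sum quad] get the
   coefficients (1 + tau) / 2 and (1 - tau) / 2: one direction drops out. *)
Definition skew : R := tau / (8 - 4 * kappa R N).

Definition ker : site -> R := kernel N skew.

Definition bilin (f g : site -> R) : R := \sum_(y <- box L) w y * f y * cv ker g y.

Definition quad (eta : config) : R := bilin (occ eta) (occ eta).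

Definition bond (x a y : site) : R := (y == x)%:R - (y == x + a)%:R.

Definition grad (eta : config) (a x : site) : R := occ eta (x + a) - occ eta x.

Lemma occ_exchange eta x a y :
  occ (exchange x (x + a) eta) y = occ eta y + grad eta a x * bond x a y.
Proof.
rewrite /occ /exchange /bond /grad /occ; case: (eqVneq y x) => [->|yx].
  case: (eqVneq x (x + a)) => [<-|_] /=; first by rewrite !subrr mul0r addr0.
  by ring.
case: (eqVneq y (x + a)) => [->|ya] /=; last by rewrite subrr mulr0 addr0.
by ring.
Qed.

Lemma bilinDl f f' g : bilin (fun y => f y + f' y) g = bilin f g + bilin f' g.
Proof. by rewrite /bilin -big_split; apply: eq_bigr => y _ /=; ring. Qed.
Lemma bilinDr f g g' : bilin f (fun y => g y + g' y) = bilin f g + bilin f g'.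
Proof. by rewrite /bilin -big_split; apply: eq_bigr => y _ /=; rewrite convDr; ring. Qed.
Lemma bilinZl c f g : bilin (fun y => c * f y) g = c * bilin f g.
Proof. by rewrite /bilin mulr_sumr; apply: eq_bigr => y _ /=; ring. Qed.
Lemma bilinZr c f g : bilin f (fun y => c * g y) = c * bilin f g.
Proof. by rewrite /bilin mulr_sumr; apply: eq_bigr => y _ /=; rewrite convZr; ring. Qed.

Lemma quad_exchange eta x a : quad (exchange x (x + a) eta) - quad eta =
  grad eta a x * (bilin (bond x a) (occ eta) + bilin (occ eta) (bond x a)) +
  grad eta a x ^+ 2 * bilin (bond x a) (bond x a).
Proof.
rewrite /quad (_ : occ (exchange x (x + a) eta) = fun y => occ eta y + grad eta a x * bond x a y).
  rewrite (bilinDl (occ eta) (fun y => grad eta a x * bond x a y)).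
  rewrite !(fun f => bilinDr f (occ eta) (fun y => grad eta a x * bond x a y)).
  by rewrite !(fun g => bilinZl _ (bond x a) g) !(fun f => bilinZr _ f (bond x a)); ring.
by apply/funext => y; exact: occ_exchange.
Qed.

Let kerM : supported M ker.
Proof. by move=> x h; apply: kernel_supp; apply: contra h; apply: sub_box; lia. Qed.

Let w_L a : a \notin box L -> w a = 0.
Proof. by move=> h; apply: w_supp; apply: contra h; apply: sub_box; lia. Qed.

Lemma bilin_bond x a : bilin (bond x a) (bond x a) =
  w x * (ker 0 - ker a) + w (x + a) * (ker 0 - ker (- a)).
Proof.
rewrite /bilin.
have e y : cv ker (bond x a) y = ker (x - y) - ker (x + a - y).
  rewrite -(conv_delta x y kerM) -(conv_delta (x + a) y kerM) -[- conv _ _ _ _]mulN1r -convZr -convDr.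
  by congr (conv _ _ _ _); apply/funext => z; rewrite mulN1r.
under eq_bigr do rewrite e.
transitivity (\sum_(y <- box L) (w y * (ker (x - y) - ker (x + a - y))) * (y == x)%:R -
   \sum_(y <- box L) (w y * (ker (x - y) - ker (x + a - y))) * (y == x + a)%:R).
  by rewrite -sumrB; apply: eq_bigr => y _; rewrite /bond; ring.
rewrite !(@sum_delta R L (fun y => w y * (ker (x - y) - ker (x + a - y)))); try by move/w_L => ->; rewrite mul0r.
have e1 : x + a - x = a by rewrite [x + a]addrC addrK.
have e2 : x - (x + a) = - a by rewrite opprD addrA subrr add0r.
by rewrite e1 e2 !subrr; ring.
Qed.

Lemma bilin_ext f f' g g' : {in box n, f =1 f'} -> {in box (n + M), g =1 g'} ->
  bilin f g = bilin f' g'.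
Proof.
move=> ff gg; apply: eq_bigr => y _; case: (boolP (y \in box n)) => yn; last first.
  by rewrite w_supp ?mul0r.
rewrite ff//; congr (_ * _); apply: eq_big_seq => z zM; congr (_ * _); apply: gg.
by move: yn zM; rewrite !mem_box; case: (y) (z) => ? ? [? ?] /=; lia.
Qed.

Lemma bilin_suml (s : seq site) (c : site -> R) (F : site -> site -> R) g :
  \sum_(x <- s) c x * bilin (F x) g = bilin (fun y => \sum_(x <- s) c x * F x y) g.
Proof.
rewrite /bilin; under eq_bigr do rewrite mulr_sumr.
rewrite exchange_big /=; apply: eq_bigr => y _.
rewrite -mulrA mulr_suml mulr_sumr; apply: eq_bigr => x _; ring.
Qed.

Lemma bilin_sumr (s : seq site) (c : site -> R) (F : site -> site -> R) f :
  \sum_(x <- s) c x * bilin f (F x) = bilin f (fun y => \sum_(x <- s) c x * F x y).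
Proof.
rewrite /bilin; under eq_bigr do rewrite mulr_sumr.
rewrite exchange_big /=; apply: eq_bigr => y _.
have -> : cv ker (fun y => \sum_(x <- s) c x * F x y) y = \sum_(x <- s) c x * cv ker (F x) y.
  rewrite /conv; under eq_bigr do rewrite mulr_sumr.
  rewrite exchange_big /=; apply: eq_bigr => x _; rewrite mulr_sumr; apply: eq_bigr => z _; ring.
rewrite mulr_sumr; apply: eq_bigr => x _; ring.
Qed.

Lemma sum_grad_bond eta a y : a \in box 1 -> y \in box (n + M) ->
  \sum_(x <- box L) grad eta a x * bond x a y = grad eta a y - grad eta a (y - a).
Proof.
move=> ha yn.
transitivity (\sum_(x <- box L) grad eta a x * (x == y)%:R - \sum_(x <- box L) grad eta a x * (x == y - a)%:R).
  rewrite -sumrB; apply: eq_bigr => x _; rewrite /bond mulrBr [y == x]eq_sym.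
  by congr (_ - _ * (nat_of_bool _)%:R); rewrite eq_sym -subr_eq opprK.
by rewrite !sum_delta// => /negP[]; move: ha yn; rewrite !mem_box; case: (y) (a) => ? ? [? ?] /=; lia.
Qed.

Definition bond_sum (f : config -> R) (eta : config) : R :=
  \sum_(x <- box L) (f (exchange x (x + east) eta) - f eta) +
  \sum_(x <- box L) (f (exchange x (x + north) eta) - f eta).

Definition lap (f : site -> R) y : R := 4 * (avg f y - f y).

Lemma lapE eta y : lap (occ eta) y = (grad eta east y - grad eta east (y - east)) +
  (grad eta north y - grad eta north (y - north)).
Proof. by rewrite /lap /avg /grad !subrK; field. Qed.

(** The form is quadratic, so its expansion at each bond is exact. The first-order parts add up to
    the Laplacian of the occupation field; the second-order parts see the kernel only through its
    gaps at 0. *)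
Lemma bond_sum_quad eta : bond_sum quad eta =
  bilin (lap (occ eta)) (occ eta) + bilin (occ eta) (lap (occ eta)) +
  (\sum_(x <- box L) grad eta east x ^+ 2 * (w x * (ker 0 - ker east) + w (x + east) * (ker 0 - ker (- east))) +
   \sum_(x <- box L) grad eta north x ^+ 2 * (w x * (ker 0 - ker north) + w (x + north) * (ker 0 - ker (- north)))).
Proof.
have h a : a \in box 1 -> \sum_(x <- box L) (quad (exchange x (x + a) eta) - quad eta) =
   bilin (fun y => grad eta a y - grad eta a (y - a)) (occ eta) +
   bilin (occ eta) (fun y => grad eta a y - grad eta a (y - a)) +
   \sum_(x <- box L) grad eta a x ^+ 2 * (w x * (ker 0 - ker a) + w (x + a) * (ker 0 - ker (- a))).
  move=> ha; under eq_bigr do rewrite quad_exchange bilin_bond mulrDr.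
  rewrite !big_split /= bilin_suml bilin_sumr; congr (_ + _ + _); apply: bilin_ext => // y yn;
    apply: sum_grad_bond => //.
  by apply: sub_box yn; lia.
rewrite /bond_sum !h//.
have e1 : lap (occ eta) = fun y => (grad eta east y - grad eta east (y - east)) +
  (grad eta north y - grad eta north (y - north)).
  by apply/funext => y; rewrite lapE.
rewrite e1 (bilinDl (fun y => grad eta east y - grad eta east (y - east))).
rewrite (bilinDr _ (fun y => grad eta east y - grad eta east (y - east))).
ring.
Qed.

Lemma occ_le1 eta x : `|occ eta x| <= 1.
Proof. by rewrite /occ; case: (eta x); rewrite ?normr1 ?normr0. Qed.

Lemma occ_sqr eta x : occ eta x * occ eta x = occ eta x.
Proof. by rewrite /occ; case: (eta x); rewrite ?mulr1 ?mulr0. Qed.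

Lemma grad_le1 eta a x : `|grad eta a x| <= 1.
Proof.
rewrite /grad /occ; case: (eta x); case: (eta (x + a)) => /=;
  by rewrite ?subrr ?subr0 ?sub0r ?normrN ?normr0 ?normr1.
Qed.

Lemma grad_sqr eta a x : 0 <= grad eta a x ^+ 2 <= 1.
Proof.
rewrite sqr_ge0 /= -real_normK ?num_real// expr_le1// ?grad_le1//.
Qed.

Lemma bond_le1 x a y : `|bond x a y| <= 1.
Proof.
rewrite /bond; case: (y == x); case: (y == x + a) => /=;
  by rewrite ?subrr ?subr0 ?sub0r ?normrN ?normr0 ?normr1.
Qed.

(** An exchange feels [w] at the two ends of the bond and at their translates by -z with z in the
    range of the kernel, hence the radius M + 1. *)
Lemma quad_exchange_bound eta x a om : a \in box 1 ->
  (forall z, z \in box M.+1 -> w (x + z) <= om) ->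
  `|quad (exchange x (x + a) eta) - quad eta| <= 6 * mass M ker * om.
Proof.
move=> ha hom; have m0 := mass_ge0 M ker.
have om0 : 0 <= om by rewrite (le_trans (w_ge0 (x + 0)))// hom// mem_box.
have wx z : z \in box M.+1 -> `|w (x + z)| <= om by move=> hz; rewrite ger0_norm// hom.
have aM : a \in box M.+1 by apply: sub_box ha.
have w1 : `|w x| <= om by rewrite -[x]addr0 wx// mem_box.
have w2 : `|w (x + a)| <= om by rewrite wx.
have bl g : (forall y, `|g y| <= 1) -> `|bilin (bond x a) g| <= 2 * mass M ker * om.
  move=> g1.
  have -> : bilin (bond x a) g = w x * cv ker g x - w (x + a) * cv ker g (x + a).
    rewrite /bilin -(@sum_delta R L (fun y => w y * cv ker g y) x); last by move/w_L ->; rewrite mul0r.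
    rewrite -(@sum_delta R L (fun y => w y * cv ker g y) (x + a)); last by move/w_L ->; rewrite mul0r.
    by rewrite -sumrB; apply: eq_bigr => y _; rewrite /bond; ring.
  rewrite (le_trans (ler_normB _ _))// (_ : 2 * mass M ker * om = om * mass M ker + om * mass M ker); last by ring.
  by rewrite lerD// normrM ler_pM// conv_bound.
have br f : (forall y, `|f y| <= 1) -> `|bilin f (bond x a)| <= 2 * mass M ker * om.
  move=> f1; rewrite /bilin /conv; under eq_bigr do rewrite mulr_sumr.
  rewrite exchange_big /= (le_trans (ler_norm_sum _ _ _))// mulrAC mulr_sumr.
  rewrite big_seq [leRHS]big_seq; apply: ler_sum => z zM.
  have -> : \sum_(y <- box L) w y * f y * (ker z * bond x a (y + z)) =
     ker z * (w (x - z) * f (x - z) - w (x + a - z) * f (x + a - z)).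
    rewrite -(@sum_delta R L (fun y => w y * f y) (x - z)); last by move/w_L ->; rewrite mul0r.
    rewrite -(@sum_delta R L (fun y => w y * f y) (x + a - z)); last by move/w_L ->; rewrite mul0r.
    rewrite -sumrB mulr_sumr; apply: eq_bigr => y _; rewrite /bond.
    rewrite (_ : (y + z == x) = (y == x - z)); last by rewrite -subr_eq opprK.
    rewrite (_ : (y + z == x + a) = (y == x + a - z)); last by rewrite -[RHS]subr_eq opprK.
    ring.
  rewrite normrM mulrC ler_wpM2r// (le_trans (ler_normB _ _))//.
  rewrite (_ : 2 * om = om + om); last by ring.
  have zM1 : - z \in box M.+1 by move: zM; rewrite !mem_box; case: (z) => ? ? /=; lia.
  have zM2 : a - z \in box M.+1 by move: ha zM; rewrite !mem_box; case: (a) (z) => ? ? [? ?] /=; lia.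
  by rewrite -addrA lerD// normrM -[leRHS]mulr1 ler_pM// wx.
rewrite quad_exchange (le_trans (ler_normD _ _))//.
have -> : 6 * mass M ker * om = 1 * (2 * mass M ker * om + 2 * mass M ker * om) + 1 * (2 * mass M ker * om) by ring.
have /andP[g0 g1] := grad_sqr eta a x.
rewrite lerD// normrM ler_pM ?grad_le1//.
- by rewrite (le_trans (ler_normD _ _))// lerD ?bl ?br//; exact: occ_le1.
- by rewrite ger0_norm.
- by apply: bl; exact: bond_le1.
Qed.

Lemma skew_bounds : `|skew| <= 2^-1 /\ skew * (8 - 4 * kappa R N) = tau.
Proof.
have /andP[k0 k1] := kappa_bound R N.
have h : 2 <= 8 - 4 * kappa R N by lra.
have h0 : 0 < 8 - 4 * kappa R N by lra.
split; last by rewrite /skew divfK// lt0r_neq0.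
rewrite /skew normrM (_ : `|tau| = 1) ?mul1r; last by case: tau1 => ->; rewrite ?normrN normr1.
by rewrite ger0_norm ?invr_ge0 ?(ltW h0)// lef_pV2 ?posrE.
Qed.

Lemma iter_avg1 k : iter k avg (fun=> 1) = fun=> 1.
Proof. by elim: k => //= k ->; apply/funext => x; rewrite /avg; field. Qed.

Lemma heat_return : 0 <= heat R N 0 <= (N.+1%:R)^-1.
Proof. by rewrite heat0 sqr_ge0 /= Nm walk_return. Qed.

Lemma lap_conv_ker eta y : lap (cv ker (occ eta)) y =
  iter N avg (occ eta) y - occ eta y +
  4 * skew * (cv (aniso (heat R N)) (occ eta) y - aniso (occ eta) y).
Proof.
have kN : supported N ker by move=> x; exact: kernel_supp.
rewrite /lap -(conv_avg _ _ kN)//.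
have -> : cv (avg ker) (occ eta) y - cv ker (occ eta) y =
    4^-1 * (cv (heat R N) (occ eta) y - cv (heat R 0) (occ eta) y) +
    skew * (cv (aniso (heat R N)) (occ eta) y - cv (aniso (heat R 0)) (occ eta) y).
  rewrite /conv -!sumrB !mulr_sumr -big_split; apply: eq_bigr => z _ /=.
  by rewrite -mulrBl kernel_laplacian; ring.
rewrite conv_heat; last exact: ltnW.
rewrite conv_heat0 (conv_aniso (N := 0) (k := heat R 0)); last by lia.
  rewrite (_ : conv M (heat R 0) (occ eta) = occ eta); last by apply/funext => z; rewrite conv_heat0.
  by field.
exact: heat_supp.
Qed.

Lemma lap_conv f y : cv ker (lap f) y = lap (cv ker f) y.
Proof.
rewrite /lap avg_conv -mulN1r -convZr -convDr -convZr.
by congr (conv _ _ _ _); apply/funext => z; ring.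
Qed.

Definition Osc := total_osc L osc.
Definition density eta := iter m avg (occ eta).

(** The Laplacian cancels the Green function: N averaging steps minus the identity remain. As
    eta(x)^2 = eta(x), this gives - 2 sum w (eta - eta avg^N eta), and symmetry shares the N = 2 m
    steps equally between the factors, so that [density] appears squared. The errors are the return
    probability, at most 1 / (N + 1), and the oscillation of [w]. *)
Lemma quad_lower eta :
  \sum_(x <- box L) w x * ((1 + tau) / 2 * grad eta east x ^+ 2 + (1 - tau) / 2 * grad eta north x ^+ 2) <=
  bond_sum quad eta + 2 * \sum_(x <- box L) w x * (density eta x - density eta x ^+ 2) +
  9 / N.+1%:R * \sum_(x <- box L) w x + (4 * m%:R + 5 + 4 * mass M ker) * Osc.
Proof.
have nL : (n + 2 <= L)%N by lia.
have o1 := occ_le1 eta; have [b1 bE] := skew_bounds.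
have /andP[p0 p1] := heat_return; have /andP[k0 k1] := kappa_bound R N.
set p := heat R N 0 in p0 p1; set b := skew in b1 bE.
have gk1 x : `|cv ker (occ eta) x| <= mass M ker by exact: conv_bound.
have c1 := sum_commute nL w_supp w_osc o1 gk1; rewrite -/Osc in c1.
have h1 := sum_commute_iter nL w_supp w_osc m o1 (iter_avg_le1 m o1).
have n1 : `|1 : R| <= 1 by rewrite normr1.
have h2 := @sum_commute_iter R n L w osc nL w_supp w_osc m (fun=> 1) (occ eta) (fun=> n1) o1; rewrite -/Osc in h1 h2.
pose W := \sum_(x <- box L) w x.
have W0 : 0 <= W by exact: sumr_ge0.
pose S3 := \sum_(x <- box L) w x * occ eta x * cv (aniso (heat R N)) (occ eta) x.
have s3 : `|S3| <= W * (2 * p).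
  rewrite (le_trans (ler_norm_sum _ _ _))// /W mulr_suml; apply: ler_sum => x _.
  rewrite -mulrA normrM (ger0_norm (w_ge0 x)) ler_wpM2l// -[leRHS]mul1r normrM ler_pM//.
  by rewrite (le_trans (conv_bound _ _ _ _))// /p Nm aniso_heat_norm.
pose Q a := \sum_(x <- box L) w x * grad eta a x ^+ 2.
pose Q' a := \sum_(x <- box L) w (x + a) * grad eta a x ^+ 2.
have qq a : a \in box 1 -> `|Q' a - Q a| <= Osc.
  by move=> ha; apply: (sum_shift_weight L w_osc (f := fun x => grad eta a x ^+ 2)) => //; exact: grad_sqr.
have qW a : 0 <= Q a <= W.
  apply/andP; split; first by apply: sumr_ge0 => x _; rewrite mulr_ge0// sqr_ge0.
  by apply: ler_sum => x _; rewrite ler_piMr//; have /andP[] := grad_sqr eta a x.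
have q'E a : a \in box 1 -> - a \in box 1 -> \sum_(x <- box L) w x * grad eta a (x - a) ^+ 2 = Q' a.
  move=> ha hna; have := @sum_by_parts_shift R n L w nL w_supp (fun=> 1) (fun x => grad eta a x ^+ 2) (- a) hna.
  under eq_bigr do rewrite mulr1; move=> ->.
  by apply: eq_bigr => x _; rewrite mulr1 opprK.
pose S5 := \sum_(x <- box L) w x * aniso (occ eta) x.
have s5 : `|S5| <= 2 * Osc by exact: (sum_aniso nL w_supp w_osc).
(* For occupation numbers 2 eta(x) eta(y) = eta(x) + eta(y) - (eta(y) - eta(x))^2: the anisotropic
   term also produces squared gradients, with opposite signs in the two directions. *)
have s4 : \sum_(x <- box L) w x * occ eta x * aniso (occ eta) x =
   2^-1 * S5 - 4^-1 * (Q east + Q' east - Q north - Q' north).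
  rewrite -q'E// -q'E// -!big_split -!sumrB /= !mulr_sumr -sumrB; apply: eq_bigr => x _.
  rewrite /grad !subrK /aniso /occ.
  by case: (eta x); case: (eta (x + east)); case: (eta (x - east)); case: (eta (x + north)); case: (eta (x - north)); rewrite /=; field.
have bs := bond_sum_quad eta.
have e1 : bilin (occ eta) (lap (occ eta)) = \sum_(x <- box L) w x * occ eta x * iter N avg (occ eta) x -
   \sum_(x <- box L) w x * occ eta x + 4 * b * (S3 - (2^-1 * S5 - 4^-1 * (Q east + Q' east - Q north - Q' north))).
  rewrite -s4 -!sumrB mulr_sumr -big_split /=; apply: eq_bigr => x _.
  rewrite lap_conv lap_conv_ker -/b.
  have := occ_sqr eta x; set o := occ eta x => oo.
  by rewrite mulrDr mulrBr -[w x * o * o]mulrA oo; ring.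
have e2 : bilin (lap (occ eta)) (occ eta) = bilin (occ eta) (lap (occ eta)) -
    4 * (\sum_(x <- box L) w x * occ eta x * avg (cv ker (occ eta)) x - \sum_(x <- box L) w x * avg (occ eta) x * cv ker (occ eta) x).
  rewrite /bilin -sumrB mulr_sumr -sumrB; apply: eq_bigr => x _; rewrite lap_conv /lap; ring.
have [g1 g2 g3 g4] := kernel_gaps N skew.
have key g a : \sum_(x <- box L) grad eta a x ^+ 2 * (w x * g + w (x + a) * g) = g * (Q a + Q' a).
  by rewrite /Q /Q' -big_split mulr_sumr; apply: eq_bigr => x _ /=; ring.
have e3 : \sum_(x <- box L) grad eta east x ^+ 2 * (w x * (ker 0 - ker east) + w (x + east) * (ker 0 - ker (- east))) =
   (4^-1 * (1 - p) - b * kappa R N) * (Q east + Q' east).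
  by rewrite g1 g2 key.
have e4 : \sum_(x <- box L) grad eta north x ^+ 2 * (w x * (ker 0 - ker north) + w (x + north) * (ker 0 - ker (- north))) =
   (4^-1 * (1 - p) + b * kappa R N) * (Q north + Q' north).
  by rewrite g3 g4 key.
rewrite e3 e4 e2 e1 in bs.
have f1 : \sum_(x <- box L) w x * ((1 + tau) / 2 * grad eta east x ^+ 2 + (1 - tau) / 2 * grad eta north x ^+ 2) =
  (1 + tau) / 2 * Q east + (1 - tau) / 2 * Q north.
  by rewrite !mulr_sumr -big_split; apply: eq_bigr => x _ /=; ring.
have f2 : \sum_(x <- box L) w x * (density eta x - density eta x ^+ 2) =
  \sum_(x <- box L) w x * 1 * density eta x - \sum_(x <- box L) w x * density eta x * density eta x.
  by rewrite -sumrB; apply: eq_bigr => x _; ring.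
rewrite iter_avg1 in h2.
have e5 : \sum_(x <- box L) w x * occ eta x * iter N avg (occ eta) x =
  \sum_(x <- box L) w x * occ eta x * iter m avg (density eta) x.
  by apply: eq_bigr => x _; rewrite Nm -addnn iterD.
have e6 : \sum_(x <- box L) w x * occ eta x = \sum_(x <- box L) w x * 1 * occ eta x.
  by apply: eq_bigr => x _; rewrite mulr1.
rewrite e5 e6 in bs; rewrite f1 f2 -/W.
have q1 := qq east isT; have q2 := qq north isT.
have w1 := qW east; have w2 := qW north.
rewrite -/(density eta) in h1 h2.
move: bs h1 h2 c1 w1 w2 q1 q2 s3 s5.
rewrite [(4 * m%:R + 5 + 4 * _) * _](_ : _ = 4 * (m%:R * Osc) + 5 * Osc + 4 * (mass M ker * Osc)); last by ring.
have r1 : (N.+1%:R : R)^-1 <= 1 by rewrite invf_le1// ler1n.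
have Osc0 : 0 <= Osc by exact: (total_osc_ge0 L w_osc).
exact: (quad_arith b1 bE tau1 p0 p1 r1 W0 Osc0).
Qed.

End quadratic_form.

(** * The test field *)

Lemma expR_cubic (R : realType) (y : R) : `|y| <= 2^-1 -> expR y <= 1 + y + y ^+ 2 / 2 + 2 * `|y| ^+ 3.
Proof.
move=> y1.
have q (t : R) : `|t| <= `|y| -> `|expR t - 1 - t| <= 2 * `|y| ^+ 2.
  move=> ty; have h := expR_quad (le_trans ty y1); have h' := expR_ge1Dx t.
  rewrite ger0_norm; last by lra.
  apply: (@le_trans _ _ (2 * t ^+ 2)); first by lra.
  by rewrite ler_wpM2l// -real_normK ?num_real// ler_sqr ?nnegrE.
have d (t : R) : is_derive t 1 (fun t : R => expR t - 1 - t - t ^+ 2 / 2) (expR t - 1 - t).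
  have h := derive_add (derive_add (derive_add (is_derive_expR t) (is_derive_cst (-1 : R) t 1))
     (is_deriveN (is_derive_id t (1 : R)))) (derive_mul (derive_mul (is_derive_id t 1) (is_derive_id t 1)) (is_derive_cst (- 2^-1 : R) t 1)).
  have -> : (fun t : R => expR t - 1 - t - t ^+ 2 / 2) =
     (fun t => expR t + cst (-1) t + (- id) t + (id t * id t) * cst (- 2^-1) t).
    by apply/funext => z /=; rewrite mulrN expr2.
  by apply: (is_derive_eq h); rewrite /=; field.
have z0 : expR 0 - 1 - 0 - 0 ^+ 2 / 2 = 0 :> R by rewrite expR0; ring.
have k : `|expR y - 1 - y - y ^+ 2 / 2| <= 2 * `|y| ^+ 3.
  case: (leP 0 y) => y0.
    have h := mvt_bound y0 (fun x _ => d x) (M := 2 * `|y| ^+ 2).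
    have h2 : `|expR y - 1 - y - y ^+ 2 / 2 - (expR 0 - 1 - 0 - 0 ^+ 2 / 2)| <= 2 * `|y| ^+ 2 * (y - 0).
      by apply: h => x /andP[x0 xy]; apply: q; rewrite !ger0_norm.
    rewrite z0 !subr0 in h2.
    by rewrite (le_trans h2)// [`|y|]ger0_norm//; apply: eq_ler; ring.
  have h := mvt_bound (ltW y0) (fun x _ => d x) (M := 2 * `|y| ^+ 2).
  have h2 : `|expR 0 - 1 - 0 - 0 ^+ 2 / 2 - (expR y - 1 - y - y ^+ 2 / 2)| <= 2 * `|y| ^+ 2 * (0 - y).
    by apply: h => x /andP[x0 xy]; apply: q; rewrite !ler0_norm ?lerN2// ltW.
  rewrite z0 !sub0r normrN in h2.
  by rewrite (le_trans h2)// [`|y|]ltr0_norm//; apply: eq_ler; ring.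
by move: k; rewrite ler_norml => /andP[_]; lra.
Qed.

(** One bond at distance 1/i from the origin, with l = 1/L: [v] is the leading part of the increment
    [dz] of the linear field, [q] the increment of the quadratic forms. Everything but the leading
    square is of order i^3 l^2, hence summable over the lattice. *)
Lemma bond_arith (R : realType) (g dz v q i l B C : R) : 0 <= i <= 16^-1 -> 0 <= l <= 1 -> 0 <= B -> 0 <= C ->
  `|g| <= 1 -> `|v| <= B * i * l -> `|dz - v| <= 22 * B * i ^+ 2 * l -> `|q| <= C * i ^+ 2 * l ^+ 2 ->
  `|2 * (- (g * dz)) - q| <= (6 * B + C) * (i * l) /\
  (2 * (- (g * dz)) - q) ^+ 2 / 2 <= 2 * g ^+ 2 * v ^+ 2 + (150 * B ^+ 2 + 6 * B * C + C ^+ 2) * (i ^+ 3 * l ^+ 2).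
Proof.
move=> /andP[i0 i1] /andP[l0 l1] B0 C0 g1 v1 r1 q1.
set r := dz - v in r1; have dzE : dz = v + r by rewrite /r; ring.
pose t := 2 * (g * r) + q; pose E := (44 * B + C) * (i ^+ 2 * l).
have i20 : 0 <= i ^+ 2 by rewrite sqr_ge0.
have t1 : `|t| <= E.
  rewrite (le_trans (ler_normD _ _))// normrM ger0_norm//.
  have h : `|g * r| <= 22 * B * i ^+ 2 * l by rewrite normrM -[leRHS]mul1r ler_pM.
  have h2 : C * i ^+ 2 * l ^+ 2 <= C * i ^+ 2 * l.
    by rewrite ler_wpM2l ?mulr_ge0// expr2 ler_piMl.
  by rewrite /E; lra.
have E0 : 0 <= E by rewrite (le_trans _ t1).
have il0 : 0 <= i * l by rewrite mulr_ge0.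
have gv : `|g * v| <= B * i * l by rewrite normrM -[leRHS]mul1r ler_pM.
have e1 : 2 * (- (g * dz)) - q = - (2 * (g * v) + t) by rewrite dzE /t; ring.
rewrite e1 normrN sqrrN.
have Ei : E <= (44 * B + C) * (i * l) / 16.
  rewrite /E expr2 -!mulrA ler_wpM2l//; first by rewrite addr_ge0 ?mulr_ge0.
  by rewrite ler_wpM2l// mulrC ler_wpM2l.
split.
  rewrite (le_trans (ler_normD _ _))// normrM ger0_norm//.
  have Bil : 0 <= B * (i * l) by rewrite mulr_ge0.
  have Cil : 0 <= C * (i * l) by rewrite mulr_ge0.
  by lra.
have -> : (2 * (g * v) + t) ^+ 2 / 2 = 2 * g ^+ 2 * v ^+ 2 + (2 * (g * v * t) + t * t / 2) by field.
rewrite lerD2l.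
have h1 : g * v * t <= (B * i * l) * E.
  by rewrite (le_trans (ler_norm _))// normrM ler_pM.
have h2 : t * t <= E * ((44 * B + C) * (i * l) / 16).
  by rewrite (le_trans (ler_norm _))// normrM ler_pM// (le_trans t1).
have h3 : 0 <= B * B * (i ^+ 3 * l ^+ 2) by rewrite !mulr_ge0 ?exprn_ge0.
have h4 : 0 <= B * C * (i ^+ 3 * l ^+ 2) by rewrite !mulr_ge0 ?exprn_ge0.
have h5 : 0 <= C * C * (i ^+ 3 * l ^+ 2) by rewrite !mulr_ge0 ?exprn_ge0.
apply: (@le_trans _ _ (2 * ((B * i * l) * E) + E * ((44 * B + C) * (i * l) / 16) / 2)); first by lra.
rewrite /E -subr_ge0 [X in 0 <= X](_ : _ = 3 / 2 * (B * B * (i ^+ 3 * l ^+ 2)) +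
  5 / 4 * (B * C * (i ^+ 3 * l ^+ 2)) + 31 / 32 * (C * C * (i ^+ 3 * l ^+ 2))); last by field.
move: h3 h4 h5; set a := B * B * _; set c := B * C * _; set d := C * C * _.
by move=> h3 h4 h5; lra.
Qed.

(** * Weights and primitive of H at lattice sites *)

Definition dir (j : bool) : site := if j then north else east.

Section polar_sites.
Variable R : realType.
Implicit Types (x z : site) (j : bool).

Definition rt x : R := Num.sqrt (nsq R x).
Definition xc j x : R := if j then x.2%:~R else x.1%:~R.

Lemma nsq_ge0 x : 0 <= nsq R x. Proof. by rewrite addr_ge0 ?sqr_ge0. Qed.

Lemma rt_sqr x : rt x ^+ 2 = nsq R x. Proof. by rewrite sqr_sqrtr ?nsq_ge0. Qed.

Lemma rt_ge0 x : 0 <= rt x. Proof. exact: sqrtr_ge0. Qed.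

Lemma nsq_xc j x : nsq R x = xc j x ^+ 2 + xc (~~ j) x ^+ 2.
Proof. by case: j; rewrite /nsq /xc //= addrC. Qed.

Lemma xcD j x z : xc j (x + z) = xc j x + xc j z.
Proof. by case: j; rewrite /xc /= intrD. Qed.

Lemma xcN j x : xc j (- x) = - xc j x.
Proof. by case: j; rewrite /xc /= intrN. Qed.

Lemma xc_box j D z : z \in box D -> `|xc j z| <= D%:R.
Proof.
by rewrite mem_box => /andP[h1 h2]; case: j; rewrite /xc -intr_norm -natr_absz ler_nat.
Qed.

Lemma xc_dir j : xc j (dir j) = 1 /\ xc (~~ j) (dir j) = 0.
Proof. by case: j. Qed.

Lemma dir_box j : dir j \in box 1 /\ - dir j \in box 1. Proof. by case: j. Qed.

Lemma sqr_xc j x : xc j x ^+ 2 + xc (~~ j) x ^+ 2 = rt x ^+ 2.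
Proof. by rewrite rt_sqr (nsq_xc j). Qed.

Lemma xc_le j x : `|xc j x| <= rt x.
Proof.
rewrite -[leRHS]ger0_norm ?rt_ge0// -ler_sqr ?nnegrE// !real_normK ?num_real// -(sqr_xc j).
by rewrite lerDl sqr_ge0.
Qed.

Lemma rt_box n x : rt x <= n%:R -> x \in box n.
Proof.
move=> h; rewrite mem_box; have h1 := le_trans (xc_le false x) h; have h2 := le_trans (xc_le true x) h.
by move: h1 h2; rewrite /xc -!intr_norm -!natr_absz !ler_nat => -> ->.
Qed.

Lemma box_rt n x : x \notin box n -> n%:R < rt x.
Proof. by move=> h; rewrite ltNge; apply: contra h; exact: rt_box. Qed.

Lemma displaced_rt D x z : (1 <= D)%N -> 16 * D%:R <= rt x -> z \in box D ->
  rt x / 2 <= rt (x + z) <= 2 * rt x.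
Proof.
move=> D1 Dx zD; have D1' : 1 <= D%:R :> R by rewrite ler1n.
have r0 := rt_ge0 x; have r0' := rt_ge0 (x + z).
have [_ /andP[h1 h2]] := displaced_nsq D1' Dx (sqr_xc false x) (xc_box false zD) (xc_box true zD).
rewrite -!xcD (sqr_xc false (x + z)) in h1 h2.
by apply/andP; split; rewrite -ler_sqr ?nnegrE ?divr_ge0 ?mulr_ge0// exprMn;
   [apply: le_trans h1|apply: le_trans h2 _]; have := sqr_ge0 (rt x); rewrite ?expr2; lra.
Qed.

Lemma near_core D (rho : R) x z : (1 <= D)%N -> 16 * D%:R <= rho -> z \in box D ->
  rho <= rt (x + z) -> rho / 2 <= rt x.
Proof.
move=> D1 Dr zD hr; have zD' : - z \in box D by move: zD; rewrite !mem_box /= !abszN.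
have /andP[h1 _] := displaced_rt D1 (le_trans Dr hr) zD'.
by move: h1; rewrite addrK; lra.
Qed.

Lemma far_core D (Q : R) x z : (1 <= D)%N -> 16 * D%:R <= Q -> z \in box D ->
  2 * Q < rt x -> Q < rt (x + z).
Proof.
move=> D1 DQ zD hr; have h0 : 16 * D%:R <= rt x.
  have : 0 <= D%:R :> R by []. lra.
by have /andP[h1 _] := displaced_rt D1 h0 zD; lra.
Qed.

Variables (L B e0 K : R) (HH H h1 : R -> R).
Hypothesis L1 : 1 <= L.
Hypothesis B0 : 0 <= B.
Hypothesis HHd : forall r : R, is_derive r 1 HH (H r).
Hypothesis Hd : forall r : R, is_derive r 1 H (h1 r).
Hypothesis HB : forall r, `|H r| <= B.
Hypothesis h1B : forall r, `|h1 r| <= B.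
Hypothesis e0_gt0 : 0 < e0.
Hypothesis e0K : e0 <= K.
Hypothesis H_lo : forall r, r < e0 -> [/\ H r = 0, h1 r = 0 & HH r = HH 0].
Hypothesis H_hi : forall r, K < r -> [/\ H r = 0, h1 r = 0 & HH r = 0].

(** For L = ln T, [rho] and [Q0] are T^e0 and T^K, the radii between which sigma_T(x) lies in
    [e0, K]. *)
Definition rho : R := expR (L * e0).
Definition Q0 : R := expR (L * K).
Definition sgm x : R := half_log L (nsq R x).
Definition zeta x : R := HH (sgm x).
Definition wgt j x : R := H (sgm x) ^+ 2 * (xc j x / nsq R x) ^+ 2.
(* The discretization errors: the weights vanish below [rho] and above [Q0], and
   the factors 2 absorb displacements of bounded size. *)
Definition ind3 x : R := if rho / 2 <= rt x then (rt x ^+ 3)^-1 else 0.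
Definition ind2 x : R := if (rho / 2) ^+ 2 <= nsq R x <= (2 * Q0) ^+ 2 then (nsq R x)^-1 else 0.

Let L0 : 0 < L. Proof. exact: lt_le_trans L1. Qed.

Lemma ind3_ge0 x : 0 <= ind3 x.
Proof. by rewrite /ind3; case: ifP => // _; rewrite invr_ge0 exprn_ge0// rt_ge0. Qed.

Lemma ind2_ge0 x : 0 <= ind2 x.
Proof. by rewrite /ind2; case: ifP => // _; rewrite invr_ge0 nsq_ge0. Qed.

Lemma rho_Q0 : rho <= Q0.
Proof. by rewrite ler_expR ler_wpM2l// ltW. Qed.

Lemma core_zero x : rt x < rho -> [/\ H (sgm x) = 0, h1 (sgm x) = 0 & zeta x = HH 0].
Proof.
move=> h; apply: H_lo; rewrite /sgm /half_log ltr_pdivrMr ?mulr_gt0//.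
have [n0|n0] := leP (nsq R x) 0; first by rewrite ln0// !mulr_gt0.
have -> : e0 * (2 * L) = ln (rho ^+ 2).
  by rewrite /rho -expRM_natl expRK; ring.
rewrite ltr_ln ?posrE ?exprn_gt0 ?expR_gt0// -rt_sqr ltr_sqr ?nnegrE ?rt_ge0//.
exact/ltW/expR_gt0.
Qed.

Lemma far_zero x : Q0 < rt x -> [/\ H (sgm x) = 0, h1 (sgm x) = 0 & zeta x = 0].
Proof.
move=> h; apply: H_hi; rewrite /sgm /half_log ltr_pdivlMr ?mulr_gt0//.
have Q00 : 0 < Q0 by exact: expR_gt0.
have -> : K * (2 * L) = ln (Q0 ^+ 2).
  by rewrite /Q0 -expRM_natl expRK; ring.
rewrite ltr_ln ?posrE ?exprn_gt0// -?rt_sqr ?exprn_gt0 ?(lt_trans Q00)// ltr_sqr ?nnegrE ?rt_ge0//.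
exact: ltW.
Qed.

Lemma wgt_ge0 j x : 0 <= wgt j x. Proof. by rewrite mulr_ge0 ?sqr_ge0. Qed.

Lemma wgt_core j x : rt x < rho -> wgt j x = 0.
Proof. by move=> /core_zero[h _ _]; rewrite /wgt h expr2 !mul0r. Qed.

Lemma wgt_far j x : Q0 < rt x -> wgt j x = 0.
Proof. by move=> /far_zero[h _ _]; rewrite /wgt h expr2 !mul0r. Qed.

Variable D : nat.
Hypothesis D1 : (1 <= D)%N.
Hypothesis Drho : 32 * D%:R <= rho.

Let D1' : 1 <= D%:R :> R. Proof. by rewrite ler1n. Qed.
Let rho0 : 0 < rho. Proof. exact: expR_gt0. Qed.

Let rD x : rho / 2 <= rt x -> 16 * D%:R <= rt x.
Proof. by move: Drho; lra. Qed.
Let r1 x : rho / 2 <= rt x -> 16 * 1 <= rt x.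
Proof. by move=> /rD; move: D1'; lra. Qed.

Let box1D z : z \in box 1 -> z \in box D. Proof. exact: sub_box. Qed.

Lemma near_core_zero x z : z \in box D -> ~~ (rho / 2 <= rt x) -> rt (x + z) < rho.
Proof.
move=> zD; rewrite -ltNge => h; rewrite ltNge; apply/negP => h'.
have h2 : 16 * D%:R <= rho by move: Drho D1'; lra.
by have := near_core D1 h2 zD h'; lra.
Qed.

Lemma wgt_osc j x z : z \in box 1 -> `|wgt j (x + z) - wgt j x| <= 76 * B ^+ 2 * ind3 x.
Proof.
move=> z1; rewrite /ind3; case: ifPn => hx; last first.
  have hr : rt x < rho by rewrite -[x]addr0 near_core_zero// mem_box.
  by rewrite (wgt_core j hr) (wgt_core j (near_core_zero (box1D z1) hx)) subrr normr0 mulr0.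
rewrite /wgt xcD (nsq_xc j (x + z)) !xcD -(rt_sqr x).
have := displaced_weight L1 B0 Hd HB h1B (lexx 1) (r1 hx) (sqr_xc j x) (xc_box j z1) (xc_box (~~ j) z1) erefl.
by rewrite mulr1 /sgm (nsq_xc j (x + z)) !xcD -(rt_sqr x).
Qed.

Lemma wgt_bound j x z : z \in box D ->
  wgt j (x + z) <= if rho / 2 <= rt x then 4 * B ^+ 2 / rt x ^+ 2 else 0.
Proof.
move=> zD; case: ifPn => hx; last by rewrite wgt_core// near_core_zero.
have [_ [k1 _ _ _ _]] := displaced_kappa D1' (rD hx) (sqr_xc j x) (xc_box j zD) (xc_box (~~ j) zD).
rewrite -!xcD -(nsq_xc j (x + z)) in k1.
rewrite /wgt (_ : 4 * B ^+ 2 / rt x ^+ 2 = B ^+ 2 * (2 / rt x) ^+ 2); last first.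
  by have := r1 hx => ?; field; rewrite lt0r_neq0//; lra.
rewrite ler_pM ?sqr_ge0//.
  by rewrite -real_normK ?num_real// ler_sqr ?nnegrE.
by rewrite -real_normK ?num_real// ler_sqr ?nnegrE// (le_trans _ k1).
Qed.

Lemma zeta_diff j x : `|zeta (x + dir j) - zeta x - H (sgm x) * (xc j x / nsq R x) / L| <=
  if rho / 2 <= rt x then 22 * B / (rt x ^+ 2 * L) else 0.
Proof.
have [d1 d2] := xc_dir j; have [b1 b2] := dir_box j.
case: ifPn => hx; last first.
  have hr : rt x < rho by rewrite -[x]addr0 near_core_zero// mem_box.
  have [-> _ ->] := core_zero hr; have [_ _ ->] := core_zero (near_core_zero (box1D b1) hx).
  by rewrite mul0r mul0r subrr subr0 normr0.
have h := r1 hx; rewrite mulr1 in h.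
have := first_difference L1 B0 HHd Hd HB h1B h (sqr_xc j x) (normr1 R).
by rewrite mul1r rt_sqr /zeta /sgm (nsq_xc j (x + dir j)) !xcD d1 d2 addr0.
Qed.

(** ln |x| is harmonic in the plane: as x_1^2 + x_2^2 = |x|^2, the first-order terms in [H] of the
    two axes cancel and only the derivative [h1] is left. *)
Lemma zeta_lap (e : R) x : 0 <= e ->
  (forall r r', `|r - r'| <= 10 / (rho * L) -> `|h1 r - h1 r'| <= e) ->
  `|zeta (x + east) + zeta (x - east) + zeta (x + north) + zeta (x - north) - 4 * zeta x
    - h1 (sgm x) / nsq R x / L ^+ 2| <=
  16 * e / L ^+ 2 * ind2 x + 672 * B / L * ind3 x.
Proof.
move=> e_ge0 he.
have a1 : 0 <= 16 * e / L ^+ 2 by apply: divr_ge0 (exprn_ge0 _ (ltW L0)); exact: mulr_ge0 (ler0n _ _) e_ge0.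
have a2 : 0 <= 672 * B / L by apply: divr_ge0 (ltW L0); exact: mulr_ge0 (ler0n _ _) B0.
case: (boolP (rho / 2 <= rt x)) => hx; last first.
  have z z : z \in box 1 -> zeta (x + z) = HH 0.
    by move=> /box1D zD; have [_ _ ->] := core_zero (near_core_zero zD hx).
  have -> : zeta x = HH 0 by rewrite -[x]addr0 z.
  have [_ -> _] : [/\ H (sgm x) = 0, h1 (sgm x) = 0 & zeta x = HH 0].
    by apply: core_zero; rewrite -[x]addr0 near_core_zero// mem_box.
  rewrite !z// !mul0r subr0 (_ : _ - _ = 0); last by ring.
  by rewrite normr0; exact: addr_ge0 (mulr_ge0 a1 (ind2_ge0 x)) (mulr_ge0 a2 (ind3_ge0 x)).
have h := r1 hx; rewrite mulr1 in h.
have s0 : 0 < rt x by lra.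
rewrite /ind3 hx /ind2 -(rt_sqr x) ler_sqr ?nnegrE ?rt_ge0 ?divr_ge0 ?(ltW rho0)// hx /=.
rewrite ler_sqr ?nnegrE ?rt_ge0 ?mulr_ge0 ?(ltW (expR_gt0 _))//.
case: (leP (rt x) (2 * Q0)) => hQ; last first.
  have hf z : z \in box 1 -> zeta (x + z) = 0.
    move=> /box1D zD; have DQ : 16 * D%:R <= Q0.
      by move: rho_Q0 Drho D1'; lra.
    have hq := far_core D1 DQ zD hQ.
    by have [_ _ ->] := far_zero hq.
  have hx0 : Q0 < rt x by have := expR_gt0 (L * K); rewrite -/Q0; lra.
  have [_ -> ->] := far_zero hx0.
  rewrite !hf// !mul0r mulr0 !addr0 !subr0 normr0 mulr0 add0r.
  have i3 : 0 <= (rt x ^+ 3)^-1 by rewrite invr_ge0 exprn_ge0// ltW.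
  exact: (mulr_ge0 a2 i3).
(* At distance at least rho / 2 from the origin, 5 / (|x| L) <= 10 / (rho L). *)
have he' : forall r r' : R, `|r - r'| <= 5 / (rt x * L) -> `|h1 r - h1 r'| <= e.
  move=> r r' hr; apply: he; apply: (le_trans hr).
  rewrite ler_pdivrMr ?mulr_gt0// (_ : 10 / (rho * L) * (rt x * L) = 5 * (2 * rt x / rho)); last first.
    by field; rewrite !lt0r_neq0.
  by rewrite -[leLHS]mulr1 ler_wpM2l// ler_pdivlMr//; lra.
have key j : `|zeta (x + dir j) + zeta (x - dir j) - 2 * zeta x -
   (h1 (sgm x) * (xc j x / rt x ^+ 2) ^+ 2 / L ^+ 2 +
    H (sgm x) * ((rt x ^+ 2)^-1 - 2 * (xc j x / rt x ^+ 2) ^+ 2) / L)| <=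
   2 * (4 * e / (rt x ^+ 2 * L ^+ 2) + 168 * B / (rt x ^+ 3 * L)).
  have [d1 d2] := xc_dir j.
  have := second_difference L1 B0 HHd Hd HB h1B h (sqr_xc j x) he'.
  by rewrite /zeta /sgm (nsq_xc j (x + dir j)) (nsq_xc j (x - dir j)) !xcD !xcN d1 d2 subr0 addr0 -(rt_sqr x).
have := lerD (key false) (key true).
move/(le_trans (ler_normD _ _)) => hk.
have E := sqr_xc false x; rewrite /= in E.
have -> : zeta (x + east) + zeta (x - east) + zeta (x + north) + zeta (x - north) - 4 * zeta x
    - h1 (sgm x) / rt x ^+ 2 / L ^+ 2 =
   zeta (x + dir false) + zeta (x - dir false) - 2 * zeta x -
   (h1 (sgm x) * (xc false x / rt x ^+ 2) ^+ 2 / L ^+ 2 +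
    H (sgm x) * ((rt x ^+ 2)^-1 - 2 * (xc false x / rt x ^+ 2) ^+ 2) / L) +
  (zeta (x + dir true) + zeta (x - dir true) - 2 * zeta x -
   (h1 (sgm x) * (xc true x / rt x ^+ 2) ^+ 2 / L ^+ 2 +
    H (sgm x) * ((rt x ^+ 2)^-1 - 2 * (xc true x / rt x ^+ 2) ^+ 2) / L)).
  have k : (xc false x / rt x ^+ 2) ^+ 2 + (xc true x / rt x ^+ 2) ^+ 2 = (rt x ^+ 2)^-1.
    rewrite !exprMn -mulrDl E; field; exact: lt0r_neq0.
  have k' : (xc true x / rt x ^+ 2) ^+ 2 = (rt x ^+ 2)^-1 - (xc false x / rt x ^+ 2) ^+ 2.
    by apply/eqP; rewrite eq_sym subr_eq addrC k.
  by rewrite k'; ring.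
apply: (le_trans hk); apply: eq_ler; field.
by rewrite !lt0r_neq0.
Qed.

End polar_sites.

Lemma box_sizes n M : [/\ (n <= n + M + 2)%N, (n.+1 + 1 <= n + M + 2)%N, (n + 1 <= n + M + 2)%N,
  (n <= n + M + 1)%N & (n + M <= n + M + 1)%N].
Proof. by split; lia. Qed.

Lemma drift_arith (R : realType) (A0 A1 b0 b1 b2 c e B li s2 s3 c3 Ni r G0 G1 P0 P1 dr : R) :
  A1 + A0 = 2 * b2 - 2 * c * (b1 + b0) ->
  b2 <= dr * c + 16 * e * c * s2 + 672 * B * li * s3 ->
  c * G0 <= c * (b1 + 2 * P0 + 9 * Ni * (B ^+ 2 * s2) + r * (76 * B ^+ 2 * s3)) ->
  c * G1 <= c * (b0 + 2 * P1 + 9 * Ni * (B ^+ 2 * s2) + r * (76 * B ^+ 2 * s3)) ->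
  A1 + 2 * c * G0 + c3 * c * s3 + (A0 + 2 * c * G1 + c3 * c * s3) <=
  2 * (c * (dr + 2 * (P0 + P1))) + ((32 * e + 36 * Ni * B ^+ 2) * c * s2 +
   (1344 * B * li + (304 * r * B ^+ 2 + 2 * c3) * c) * s3).
Proof.
move=> hA.
have k A D : c * (A + 2 * D + 9 * Ni * (B ^+ 2 * s2) + r * (76 * B ^+ 2 * s3)) =
  c * A + 2 * (c * D) + 9 * (Ni * B ^+ 2 * c * s2) + 76 * (r * B ^+ 2 * c * s3) by ring.
rewrite !k.
have -> : (32 * e + 36 * Ni * B ^+ 2) * c * s2 = 32 * (e * c * s2) + 36 * (Ni * B ^+ 2 * c * s2) by ring.
have -> : (1344 * B * li + (304 * r * B ^+ 2 + 2 * c3) * c) * s3 =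
  1344 * (B * li * s3) + 304 * (r * B ^+ 2 * c * s3) + 2 * (c3 * c * s3) by ring.
lra.
Qed.

(** * Pathwise lower bound for the potential *)

Section pathwise.
Variable R : realType.
Variables (T L B e0 K e : R) (HH H h1 : R -> R) (m n : nat).
Hypothesis T0 : 0 <= T.
Hypothesis L1 : 1 <= L.
Hypothesis B0 : 0 <= B.
Hypothesis HHd : forall r : R, is_derive r 1 HH (H r).
Hypothesis Hd : forall r : R, is_derive r 1 H (h1 r).
Hypothesis HB : forall r, `|H r| <= B.
Hypothesis h1B : forall r, `|h1 r| <= B.
Hypothesis e0_gt0 : 0 < e0.
Hypothesis e0K : e0 <= K.
Hypothesis H_lo : forall r, r < e0 -> [/\ H r = 0, h1 r = 0 & HH r = HH 0].
Hypothesis H_hi : forall r, K < r -> [/\ H r = 0, h1 r = 0 & HH r = 0].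
Hypothesis e_ge0 : 0 <= e.
Local Notation rho := (rho L e0).
Local Notation Q0 := (Q0 L K).
Local Notation sgm := (sgm L).
Local Notation zeta := (zeta L HH).
Local Notation wgtH := (wgt L H).
Local Notation ind3L := (ind3 L e0).
Local Notation ind2L := (ind2 L e0 K).
Local Notation rt := (@rt R).
Local Notation occR := (occ R).
Local Notation grad := (grad R).
Hypothesis he : forall r r', `|r - r'| <= 10 / (rho * L) -> `|h1 r - h1 r'| <= e.
Hypothesis Drho : 32 * (m.*2.+2)%:R <= rho.
Hypothesis Qn : Q0 <= n%:R.

Let M := m.*2.+1.
Let N := m.*2.
(* Room for the range of the kernel and for one more bond. *)
Let b := (n + M + 2)%N.
Let D1 : (1 <= m.*2.+2)%N. Proof. by []. Qed.
Let L0 : 0 < L. Proof. exact: lt_le_trans L1. Qed.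
Let rho0 : 0 < rho. Proof. exact: expR_gt0. Qed.
Let rho64 : 64 <= rho.
Proof. by apply: le_trans Drho; rewrite -[m.*2.+2]addn2 natrD; have : 0 <= (m.*2)%:R :> R by []; lra. Qed.

(** In [quad_lower] the sign 1 keeps the east gradients and the sign -1 the north ones. *)
Definition orient (j : bool) : R := if j then -1 else 1.
Definition qform (j : bool) : config -> R := quad M b N (wgtH j) (orient j).
Definition linear_field (eta : config) : R := \sum_(x <- box b) zeta x * occR eta x.
Definition test_field (eta : config) : R :=
  2 * linear_field eta - 2 / L ^+ 2 * (qform false eta + qform true eta).
Definition masses : R := mass M (ker N (orient false)) + mass M (ker N (orient true)).

Let far_out x : x \notin box n -> Q0 < rt x.
Proof. by move=> xn; exact: le_lt_trans Qn (box_rt R xn). Qed.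

Let zeta_supp : supported n zeta.
Proof. by move=> x /far_out xf; have [_ _ ->] := far_zero L1 H_hi xf. Qed.

Let wgt_supp j : supported n (wgtH j).
Proof. by move=> x /far_out xf; exact: (wgt_far L1 H_hi). Qed.

Let nML : (n + M + 2 <= b)%N. Proof. by []. Qed.
Let MN : (N < M)%N. Proof. by []. Qed.

Lemma orient1 j : orient j = 1 \/ orient j = -1.
Proof. by case: j; [right|left]. Qed.

Lemma test_field_dep : dep (box (n + M + 1)) test_field.
Proof.
move=> eta xi h.
have q j : qform j eta = qform j xi.
  rewrite /qform /quad; apply: (@bilin_ext _ n _ _ _ m _ _ nML (wgt_supp j) MN erefl) => x xn; rewrite /occR h//;
    by apply: sub_box xn; case: (box_sizes n M).
rewrite /test_field !q; congr (_ * _ - _); apply: eq_bigr => x _.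
case: (boolP (x \in box n)) => xn; last by rewrite zeta_supp// !mul0r.
by rewrite /occR h//; apply: sub_box xn; case: (box_sizes n M).
Qed.

Lemma linear_field_exchange eta x a :
  linear_field (exchange x (x + a) eta) - linear_field eta = grad eta a x * (zeta x - zeta (x + a)).
Proof.
have zb y : y \notin box b -> zeta y = 0.
  by move=> h; apply: zeta_supp; apply: contra h; apply: sub_box; case: (box_sizes n M).
rewrite /linear_field -sumrB -(@sum_delta R b zeta x) => [|/zb//].
rewrite -(@sum_delta R b zeta (x + a)) => [|/zb//].
rewrite -sumrB mulr_sumr; apply: eq_bigr => y _.
by rewrite occ_exchange /bond; ring.
Qed.

Lemma linear_field_bonds eta : bond_sum b linear_field eta =
  \sum_(x <- box b) occR eta x *
    (zeta (x + east) + zeta (x - east) + zeta (x + north) + zeta (x - north) - 4 * zeta x).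
Proof.
have h (j : bool) : \sum_(x <- box b) (linear_field (exchange x (x + dir j) eta) - linear_field eta) =
   \sum_(x <- box b) occR eta x * (zeta (x + dir j) + zeta (x - dir j) - 2 * zeta x).
  under eq_bigr do rewrite linear_field_exchange.
  have [d1 d2] := dir_box j; have [_ b1 b2 _ _] := box_sizes n M.
  have s1 : \sum_(x <- box b) occR eta (x + dir j) * zeta x = \sum_(x <- box b) occR eta x * zeta (x - dir j).
    rewrite -(@sum_shift _ n.+1 1 b (fun x => occR eta x * zeta (x - dir j)) (dir j) _ d1 b1).
      by apply: eq_bigr => x _; rewrite addrK.
    by move=> x xn; rewrite (@supported_shift _ n 1 zeta (- dir j) zeta_supp d2) ?mulr0// addn1.
  have s2 : \sum_(x <- box b) occR eta (x + dir j) * zeta (x + dir j) = \sum_(x <- box b) occR eta x * zeta x.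
    rewrite (@sum_shift _ n 1 b (fun x => occR eta x * zeta x) (dir j) _ d1 b2)//.
    by move=> x xn; rewrite zeta_supp// mulr0.
  transitivity (\sum_(x <- box b) occR eta (x + dir j) * zeta x - \sum_(x <- box b) occR eta (x + dir j) * zeta (x + dir j)
     - (\sum_(x <- box b) occR eta x * zeta x - \sum_(x <- box b) occR eta x * zeta (x + dir j))).
    by rewrite -!sumrB; apply: eq_bigr => x _; rewrite /grad; ring.
  rewrite s1 s2 -!sumrB; apply: eq_bigr => x _; ring.
have := h false; have := h true; rewrite /dir /bond_sum => -> ->.
by rewrite -big_split; apply: eq_bigr => x _ /=; ring.
Qed.

(** 48 = 2 * 6 * 4: the prefactor 2 / L^2 of the forms, [quad_exchange_bound] and [wgt_bound]. The
    next two constants come from [bond_arith], the last one enlarged by the cubic remainder of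
    exp. *)
Definition quad_const : R := 48 * B ^+ 2 * masses.
Definition exchange_const : R := 6 * B + quad_const.
Definition cubic_const : R := 150 * B ^+ 2 + 6 * B * quad_const + quad_const ^+ 2 + 2 * exchange_const ^+ 3.
Hypothesis C1rho : 4 * exchange_const <= rho.

Lemma masses_ge0 : 0 <= masses. Proof. by rewrite addr_ge0// mass_ge0. Qed.
Lemma quad_const_ge0 : 0 <= quad_const. Proof. by rewrite mulr_ge0 ?masses_ge0// mulr_ge0 ?sqr_ge0. Qed.
Lemma exchange_const_ge0 : 0 <= exchange_const. Proof. by rewrite addr_ge0 ?quad_const_ge0// mulr_ge0. Qed.

Let wgt_bound' j x z := @wgt_bound R L B e0 HH H h1 L1 B0 HB e0_gt0 H_lo (m.*2.+2) D1 Drho j x z.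

Lemma qform_exchange_bound i j eta x :
  `|qform i (exchange x (x + dir j) eta) - qform i eta| <=
  6 * mass M (ker N (orient i)) * (if rho / 2 <= rt x then 4 * B ^+ 2 / rt x ^+ 2 else 0).
Proof.
apply: (quad_exchange_bound _ nML (wgt_supp i) _ MN (m := m)) => //.
- by move=> y; exact: wgt_ge0.
- by have [] := dir_box j.
- by move=> z zM; exact: wgt_bound'.
Qed.

(** Below rho / 2 the exchange does not change the field. Above, [C1rho] makes |y| at most 1/2, so
    [expR_cubic] applies, and [bond_arith] identifies y^2 / 2 with the squared gradient up to
    summable terms. *)
Lemma bond_exp j eta x y : y = test_field (exchange x (x + dir j) eta) - test_field eta ->
  expR y - 1 <= y + 2 / L ^+ 2 * (wgtH j x * grad eta (dir j) x ^+ 2) + cubic_const / L ^+ 2 * ind3L x.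
Proof.
move=> y0.
pose dq := qform false (exchange x (x + dir j) eta) - qform false eta +
  (qform true (exchange x (x + dir j) eta) - qform true eta).
have yE : y = 2 * (- (grad eta (dir j) x * (zeta (x + dir j) - zeta x))) - 2 / L ^+ 2 * dq.
  rewrite y0 /test_field /dq.
  have := linear_field_exchange eta x (dir j) => h.
  have -> : - (grad eta (dir j) x * (zeta (x + dir j) - zeta x)) =
    linear_field (exchange x (x + dir j) eta) - linear_field eta by rewrite h; ring.
  by ring.
have zd := @zeta_diff R L B e0 HH H h1 L1 B0 HHd Hd HB h1B e0_gt0 H_lo (m.*2.+2) D1 Drho j x.
have dqb : `|dq| <= 6 * masses * (if rho / 2 <= rt x then 4 * B ^+ 2 / rt x ^+ 2 else 0).
  rewrite (le_trans (ler_normD _ _))// /masses mulrDr mulrDl lerD//; exact: qform_exchange_bound.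
rewrite /ind3L; case: (boolP (rho / 2 <= rt x)) zd dqb => hx zd dqb; last first.
  have hr : rt x < rho by rewrite -[x]addr0 (near_core_zero D1 Drho)// mem_box.
  have q0 : dq = 0 by apply/eqP; rewrite -normr_le0 (le_trans dqb)// mulr0.
  have [Hz _ zz] := core_zero L1 e0_gt0 H_lo hr.
  have w0 : wgtH j x = 0 by exact: (wgt_core L1 e0_gt0 H_lo).
  have z0 : zeta (x + dir j) - zeta x = 0.
    by apply/eqP; rewrite -normr_le0; move: zd; rewrite Hz !mul0r subr0.
  have y00 : y = 0 by rewrite yE z0 q0; ring.
  by rewrite y00 expR0 w0 mul0r !mulr0 subrr !addr0.
have s32 : 32 <= rt x by move: rho64; lra.
have s0 : 0 < rt x by lra.
have sn0 := lt0r_neq0 s0; have Ln0 := lt0r_neq0 L0.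
pose i := (rt x)^-1; pose l := L^-1.
have i1 : 0 <= i <= 16^-1 by rewrite invr_ge0 (ltW s0)/= lef_pV2 ?posrE//; lra.
have l1 : 0 <= l <= 1 by rewrite invr_ge0 (ltW L0)/= invf_le1.
have v1 : `|H (sgm x) * (xc R j x / nsq R x) / L| <= B * i * l.
  rewrite normrM; apply: ler_pM => //; last by rewrite ger0_norm ?invr_ge0 ?(ltW L0).
  rewrite normrM; apply: ler_pM => //.
  rewrite -rt_sqr /i normrM normfV (ger0_norm (sqr_ge0 _)) ler_pdivrMr ?exprn_gt0//.
  by rewrite expr2 mulrA mulVf// mul1r xc_le.
have r1 : `|zeta (x + dir j) - zeta x - H (sgm x) * (xc R j x / nsq R x) / L| <= 22 * B * i ^+ 2 * l.
  by apply: (le_trans zd); apply: eq_ler; rewrite /i /l; field; rewrite sn0 Ln0.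
have q1 : `|2 / L ^+ 2 * dq| <= quad_const * i ^+ 2 * l ^+ 2.
  rewrite normrM ger0_norm; last by rewrite divr_ge0// exprn_ge0// ltW.
  apply: (@le_trans _ _ (2 / L ^+ 2 * (6 * masses * (4 * B ^+ 2 / rt x ^+ 2)))).
    by rewrite ler_wpM2l// divr_ge0// exprn_ge0// ltW.
  by apply: eq_ler; rewrite /i /l /quad_const; field; rewrite sn0 Ln0.
have [y1 y2] := bond_arith i1 l1 B0 quad_const_ge0 (grad_le1 R eta (dir j) x) v1 r1 q1.
rewrite -yE in y1 y2.
have il0 : 0 <= i * l by move: i1 l1 => /andP[? _] /andP[? _]; rewrite mulr_ge0.
have C10 := exchange_const_ge0.
have ys : `|y| <= 2^-1.
  apply: (le_trans y1); rewrite -/exchange_const mulrA.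
  have ci : exchange_const * i <= 2^-1 by rewrite /i ler_pdivrMr//; move: C1rho; lra.
  have /andP[l0 l1'] := l1.
  by rewrite (le_trans _ ci)// ler_piMr// mulr_ge0//; case/andP: i1.
have := expR_cubic ys.
have y3 : `|y| ^+ 3 <= exchange_const ^+ 3 * (i ^+ 3 * l ^+ 2).
  apply: (@le_trans _ _ ((exchange_const * (i * l)) ^+ 3)); first by apply: lerXn2r => //; rewrite nnegrE ?normr_ge0// mulr_ge0.
  rewrite !exprMn ler_wpM2l ?exprn_ge0// ler_wpM2l ?exprn_ge0//; first by case/andP: i1.
  by have /andP[l0 l1'] := l1; rewrite exprS ler_piMl// exprn_ge0.
have wE : (H (sgm x) * (xc R j x / nsq R x) / L) ^+ 2 = wgtH j x / L ^+ 2.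
  by rewrite /wgt expr_div_n exprMn.
rewrite wE in y2.
have -> : cubic_const / L ^+ 2 * (rt x ^+ 3)^-1 = (150 * B ^+ 2 + 6 * B * quad_const + quad_const ^+ 2) * (i ^+ 3 * l ^+ 2) +
   2 * (exchange_const ^+ 3 * (i ^+ 3 * l ^+ 2)).
  by rewrite /cubic_const /i /l; field; rewrite sn0 Ln0.
have -> : 2 / L ^+ 2 * (wgtH j x * grad eta (dir j) x ^+ 2) = 2 * grad eta (dir j) x ^+ 2 * (wgtH j x / L ^+ 2) by ring.
lra.
Qed.

Definition inv_square_sum : R := \sum_(x <- box b) ind2L x.
Definition inv_cube_sum : R := \sum_(x <- box b) ind3L x.
Definition drift eta : R := \sum_(x <- box b) occR eta x * (h1 (sgm x) / nsq R x).
Definition spread eta : R := \sum_(x <- box b) H (sgm x) ^+ 2 / nsq R x * (density R m eta x - density R m eta x ^+ 2).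

Lemma wgt_sum x : wgtH false x + wgtH true x = H (sgm x) ^+ 2 / nsq R x.
Proof.
have k : xc R false x ^+ 2 + xc R true x ^+ 2 = nsq R x by rewrite (nsq_xc R false).
rewrite /wgt -mulrDr !exprMn -mulrDl k exprVn; congr (_ * _).
have [->|n0] := eqVneq (nsq R x) 0; first by rewrite mul0r invr0.
by field.
Qed.

Lemma wgt_ind2 j x : wgtH j x <= B ^+ 2 * ind2L x.
Proof.
have B20 : 0 <= B ^+ 2 by exact: sqr_ge0.
have [hx|hx] := ltP (rt x) rho.
  by rewrite (wgt_core L1 e0_gt0 H_lo)// mulr_ge0// ind2_ge0.
have [hq|hq] := ltP Q0 (rt x).
  by rewrite (wgt_far L1 H_hi)// mulr_ge0// ind2_ge0.
have Q00 : 0 < Q0 by exact: expR_gt0.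
rewrite /ind2 -rt_sqr !ler_sqr ?nnegrE ?rt_ge0 ?divr_ge0 ?mulr_ge0 ?(ltW rho0) ?(ltW Q00)//.
have -> : rho / 2 <= rt x <= 2 * Q0 by apply/andP; split; have := rho0; lra.
apply: ler_pM; rewrite ?sqr_ge0//.
  by rewrite -real_normK ?num_real// ler_sqr ?nnegrE.
have s0 : 0 < rt x by exact: lt_le_trans hx.
rewrite exprMn -rt_sqr exprVn ler_pdivrMr ?exprn_gt0// mulrC expr2 -mulrA.
rewrite divff ?lt0r_neq0 ?exprn_gt0// mulr1 -expr2 -real_normK ?num_real// ler_sqr ?nnegrE ?rt_ge0//; exact: xc_le.
Qed.

Lemma potential_bonds eta : potential T (fun xi => expR (test_field xi)) eta =
  - (T / 2 * (\sum_(x <- box b) (expR (test_field (exchange x (x + east) eta) - test_field eta) - 1) +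
     \sum_(x <- box b) (expR (test_field (exchange x (x + north) eta) - test_field eta) - 1))).
Proof.
rewrite /potential; congr (- _).
have dT : dep (box (n + M + 1)) (fun xi => expR (test_field xi)).
  by move=> xi xi' /test_field_dep ->.
rewrite (generator_box T eta dT (fun=> id)).
have -> : (n + M + 1).+1 = b by rewrite -addn1 -addnA.
rewrite big_ord_recl big_ord1.
have d x j : (expR (test_field (exchange x (x + unit_vec j) eta)) - expR (test_field eta)) / expR (test_field eta) =
   expR (test_field (exchange x (x + unit_vec j) eta) - test_field eta) - 1.
  by rewrite mulrBl divff ?expR_eq0// expRB.
rewrite -mulrA; congr (_ * _); rewrite mulrDl !mulr_suml.
congr (_ + _); apply: eq_bigr => x _; first exact: d.
rewrite d; do 3 congr (_ _); congr (exchange _ (_ + _) _).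
Qed.

(** [quad_lower] in each direction, multiplied by 2 / L^2, cancels the squared gradients of
    [bond_exp] and leaves 4 / L^2 times [spread]; the linear field gives 2 / L^2 times [drift]. *)
Lemma potential_lower eta : - (T / L ^+ 2 * (drift eta + 2 * spread eta)) -
   T / 2 * ((32 * e + 36 / N.+1%:R * B ^+ 2) / L ^+ 2 * inv_square_sum +
     (1344 * B / L + (304 * (4 * m%:R + 5 + 4 * masses) * B ^+ 2 + 2 * cubic_const) / L ^+ 2) * inv_cube_sum)
  <= potential T (fun xi => expR (test_field xi)) eta.
Proof.
have S20 : 0 <= inv_square_sum by apply: sumr_ge0 => x _; exact: ind2_ge0.
have S30 : 0 <= inv_cube_sum by apply: sumr_ge0 => x _; exact: ind3_ge0.
have B20 : 0 <= B ^+ 2 by exact: sqr_ge0.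
pose GR j := \sum_(x <- box b) wgtH j x * grad eta (dir j) x ^+ 2.
pose SP j := \sum_(x <- box b) wgtH j x * (density R m eta x - density R m eta x ^+ 2).
have sE : SP false + SP true = spread eta.
  by rewrite /SP -big_split; apply: eq_bigr => x _; rewrite /= -mulrDl wgt_sum.
have q j : GR j <= bond_sum b (qform j) eta + 2 * SP j + 9 / N.+1%:R * (B ^+ 2 * inv_square_sum) +
   (4 * m%:R + 5 + 4 * masses) * (76 * B ^+ 2 * inv_cube_sum).
  have wo x z : z \in box 1 -> `|wgtH j (x + z) - wgtH j x| <= 76 * B ^+ 2 * ind3L x.
    by move=> zb; exact: (wgt_osc L1 B0 Hd HB h1B e0_gt0 H_lo D1 Drho).
  have h := quad_lower nML (wgt_supp j) (wgt_ge0 L H j) wo MN erefl (orient1 j) eta.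
  have -> : GR j = \sum_(x <- box b) wgtH j x * ((1 + orient j) / 2 * grad eta east x ^+ 2 +
      (1 - orient j) / 2 * grad eta north x ^+ 2).
    by apply: eq_bigr => x _; congr (_ * _); case: (j); rewrite /orient /dir; field.
  apply: (le_trans h); rewrite -/(qform j) -/(SP j) lerD//.
    rewrite lerD2l ler_wpM2l ?divr_ge0// mulr_sumr; apply: ler_sum => x _; exact: wgt_ind2.
  have -> : Osc b (fun x => 76 * B ^+ 2 * ind3L x) = 76 * B ^+ 2 * inv_cube_sum by rewrite /Osc /total_osc mulr_sumr.
  apply: ler_wpM2r; first by apply: (mulr_ge0 _ S30); exact: (mulr_ge0 (ler0n _ _) B20).
  rewrite lerD2l ler_wpM2l// /masses.
  by case: (j); rewrite ?lerDl ?lerDr mass_ge0.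
have lin : bond_sum b linear_field eta <= drift eta / L ^+ 2 + 16 * e / L ^+ 2 * inv_square_sum + 672 * B / L * inv_cube_sum.
  rewrite linear_field_bonds /drift mulr_suml /inv_square_sum /inv_cube_sum !mulr_sumr -!big_split; apply: ler_sum => x _ /=.
  have h := zeta_lap L1 B0 HHd Hd HB h1B e0_gt0 e0K H_lo H_hi D1 Drho x e_ge0 he.
  move: h; set z := _ - 4 * zeta x; rewrite ler_norml => /andP[_ h].
  have /andP[u0 u1] : 0 <= occR eta x <= 1.
    by rewrite /occ; case: (eta x); rewrite /= ?ler01 ?lexx.
  set E := (X in _ <= X) in h; have E0 : 0 <= E.
    have a1 : 0 <= 16 * e / L ^+ 2 by apply: divr_ge0 (exprn_ge0 _ (ltW L0)); exact: mulr_ge0 (ler0n _ _) e_ge0.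
    have a2 : 0 <= 672 * B / L by apply: divr_ge0 (ltW L0); exact: mulr_ge0 (ler0n _ _) B0.
    exact: addr_ge0 (mulr_ge0 a1 (ind2_ge0 _ _ _ _)) (mulr_ge0 a2 (ind3_ge0 _ _ _)).
  have := ler_wpM2l u0 h; have : occR eta x * E <= E by rewrite ler_piMl.
  rewrite -/E -addrA -/E; lra.
have be j : \sum_(x <- box b) (expR (test_field (exchange x (x + dir j) eta) - test_field eta) - 1) <=
   \sum_(x <- box b) (test_field (exchange x (x + dir j) eta) - test_field eta) + 2 / L ^+ 2 * GR j + cubic_const / L ^+ 2 * inv_cube_sum.
  by rewrite /GR /inv_cube_sum !mulr_sumr -!big_split; apply: ler_sum => x _; exact: bond_exp.
have bsE : \sum_(x <- box b) (test_field (exchange x (x + dir false) eta) - test_field eta) +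
  \sum_(x <- box b) (test_field (exchange x (x + dir true) eta) - test_field eta) =
  2 * bond_sum b linear_field eta - 2 / L ^+ 2 * (bond_sum b (qform false) eta + bond_sum b (qform true) eta).
  have bd j : \sum_(x <- box b) (test_field (exchange x (x + dir j) eta) - test_field eta) =
     2 * (\sum_(x <- box b) (linear_field (exchange x (x + dir j) eta) - linear_field eta)) -
     2 / L ^+ 2 * (\sum_(x <- box b) (qform false (exchange x (x + dir j) eta) - qform false eta) +
       \sum_(x <- box b) (qform true (exchange x (x + dir j) eta) - qform true eta)).
    rewrite -big_split /= !mulr_sumr -sumrB; apply: eq_bigr => x _.
    by rewrite /test_field; ring.
  by rewrite !bd /bond_sum /dir; ring.
rewrite potential_bonds -opprD lerN2.
have b0 := be false; have b1 := be true; rewrite /dir in b0 b1 bsE.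
have q0 := q false; have q1 := q true.
set E0 := \sum_(x <- box b) _; set E1 := \sum_(x <- box b) _.
have Lc : 0 <= (L ^+ 2)^-1 by rewrite invr_ge0 exprn_ge0// ltW.
set Y := _ / L ^+ 2 * inv_square_sum + _.
suff h : E0 + E1 <= 2 * ((L ^+ 2)^-1 * (drift eta + 2 * spread eta)) + Y.
  have T2 : 0 <= T / 2 by rewrite divr_ge0.
  by apply: (le_trans (ler_wpM2l T2 h)); apply: eq_ler; field; exact: lt0r_neq0.
have e01 := lerD b0 b1; rewrite -/E0 -/E1 in e01.
have k0 := ler_wpM2l Lc q0; have k1 := ler_wpM2l Lc q1.
rewrite -sE; apply: (le_trans e01).
rewrite /Y.
exact: drift_arith bsE lin k0 k1.
Qed.

(** Bounds the sum of 1 / |x|^2 over the annulus divided by L; it depends neither on T nor on the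
    size of the box. *)
Definition annulus_const : R := 2 * pi * K + 20 * pi + 40.
Definition rate_const : R := 48 * (1344 * B + (304 * (4 * m%:R + 5 + 4 * masses) * B ^+ 2 + 2 * cubic_const)).

Lemma inv_square_sum_bound : inv_square_sum <= annulus_const * L.
Proof.
have Q00 : 0 < Q0 by exact: expR_gt0.
have rQ := rho_Q0 L1 e0K.
have P1 : 1 <= rho / 2 by move: rho64; lra.
have PQ : rho / 2 <= 2 * Q0 by move: rho0; lra.
have h := annulus_upper b P1 PQ.
apply: (le_trans h).
have K0 : 0 < K by exact: lt_le_trans e0K.
have -> : 2 * Q0 / (rho / 2) = 4 * (Q0 / rho) by field; exact: lt0r_neq0.
rewrite lnM ?posrE ?divr_gt0// ln_div ?posrE// !expRK.
have p0 := pi_gt0 R.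
have l4 : ln (4 : R) <= 3.
  have -> : (4 : R) = 1 + 3 by ring.
  by apply: le_ln1Dx; lra.
have Le : 0 <= L * e0 by rewrite mulr_ge0// ltW.
have e1 : ln 4 + (L * K - L * e0) <= 3 + L * K by lra.
have e2 : 2 * pi * (ln 4 + (L * K - L * e0)) <= 2 * pi * (3 + L * K) by rewrite ler_wpM2l// mulr_ge0// ltW.
apply: (@le_trans _ _ (2 * pi * (3 + L * K) + (12 * pi + 40))); first by lra.
rewrite /annulus_const (_ : (2 * pi * K + 20 * pi + 40) * L = 2 * pi * (L * K) + 20 * pi * L + 40 * L); last by ring.
have e3 : pi <= pi * L by rewrite ler_peMr// ltW.
have -> : 20 * pi * L = 20 * (pi * L) by ring.
rewrite mulrDr; move: (2 * pi * (L * K)) (pi * L) (pi : R) p0 e3 L1 => x y z p0 e3 Lz.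
by lra.
Qed.

Lemma inv_cube_sum_bound : inv_cube_sum <= 96 / rho.
Proof.
have h : 0 < rho / 2 by rewrite divr_gt0.
apply: (le_trans (sum_norm_inv3 b h)); apply: eq_ler; field; exact: lt0r_neq0.
Qed.

Lemma potential_rate eta : 0 < T ->
  - ((drift eta + 2 * spread eta) / L) - ((16 * e + 18 / N.+1%:R * B ^+ 2) * annulus_const + rate_const / rho) <=
  L / T * potential T (fun xi => expR (test_field xi)) eta.
Proof.
move=> Tp; have LT : 0 <= L / T by rewrite divr_ge0// ltW.
apply: le_trans (ler_wpM2l LT (potential_lower eta)).
have Tn0 := lt0r_neq0 Tp; have Ln0 := lt0r_neq0 L0.
set a := 32 * e + _; set X := 304 * _ * _ + _.
have -> : L / T * (- (T / L ^+ 2 * (drift eta + 2 * spread eta)) -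
   T / 2 * (a / L ^+ 2 * inv_square_sum + (1344 * B / L + X / L ^+ 2) * inv_cube_sum)) =
  - ((drift eta + 2 * spread eta) / L) - (a / 2 * (inv_square_sum / L) + (1344 * B / 2 + X / 2 / L) * inv_cube_sum).
  by field; rewrite Tn0 Ln0.
rewrite lerD2l lerN2.
have a0 : 0 <= a.
  apply: addr_ge0; first exact: mulr_ge0 (ler0n _ _) e_ge0.
  by apply: mulr_ge0 (sqr_ge0 _); rewrite divr_ge0.
have C30 : 0 <= cubic_const.
  apply: addr_ge0; last exact: mulr_ge0 (ler0n _ _) (exprn_ge0 _ exchange_const_ge0).
  apply: addr_ge0 (sqr_ge0 _); apply: addr_ge0; first exact: mulr_ge0 (ler0n _ _) (sqr_ge0 _).
  by apply: mulr_ge0 quad_const_ge0; exact: mulr_ge0 (ler0n _ _) B0.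
have X0 : 0 <= X.
  apply: addr_ge0; last exact: mulr_ge0 (ler0n _ _) C30.
  apply: mulr_ge0 (sqr_ge0 _); apply: mulr_ge0 (ler0n _ _) _.
  by apply: addr_ge0; [exact: addr_ge0|exact: mulr_ge0 (ler0n _ _) masses_ge0].
have S30 : 0 <= inv_cube_sum by apply: sumr_ge0 => x _; exact: ind3_ge0.
have h2 : inv_square_sum / L <= annulus_const by rewrite ler_pdivrMr// inv_square_sum_bound.
have h3 := inv_cube_sum_bound.
have Bp : 0 <= 1344 * B by exact: mulr_ge0 (ler0n _ _) B0.
have XL : X / 2 / L <= X / 2 by rewrite ler_pdivrMr// ler_peMr// divr_ge0.
apply: (@le_trans _ _ (a / 2 * annulus_const + (1344 * B / 2 + X / 2) * (96 / rho))).
  apply: lerD; first by rewrite ler_wpM2l// divr_ge0.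
  have p1 : 0 <= 1344 * B / 2 by exact: divr_ge0 Bp (ler0n _ _).
  have p2 : 0 <= X / 2 / L by exact: divr_ge0 (divr_ge0 X0 (ler0n _ _)) (ltW L0).
  have p3 : 1344 * B / 2 + X / 2 / L <= 1344 * B / 2 + X / 2 by rewrite lerD2l.
  exact: ler_pM (addr_ge0 p1 p2) S30 p3 h3.
by apply: eq_ler; rewrite /rate_const -/X /a; field; rewrite lt0r_neq0//= pnatr_eq0.
Qed.

End pathwise.

(** * Extension of the test function to the line *)

Section compact_support.
Variable R : realType.
Implicit Types (f : R -> R) (a b e : R).

Lemma uniform_modulus f a b e : continuous f -> (forall x, x < a \/ b < x -> f x = 0) -> 0 < e ->
  exists2 d, 0 < d & forall x y, `|x - y| <= d -> `|f x - f y| <= e.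
Proof.
move=> cf f0 e0.
have e2 : 0 < e / 2 by rewrite divr_gt0.
(* The interval is enlarged by 1 and d kept at most 1: if x lies outside it, both x and y lie
   outside the support. *)
have /compact_near_coveringP/(_ R (0^'+) (fun d x => forall y, `|x - y| <= d -> `|f x - f y| <= e) _) H :=
  @segment_compact R (a - 1) (b + 1).
have {}H : \forall d \near 0^'+, forall x, a - 1 <= x <= b + 1 -> forall y, `|x - y| <= d -> `|f x - f y| <= e.
  near=> d; move=> x xab.
  suff : (`[(a - 1), (b + 1)]%classic `<=` (fun x => forall y, `|x - y| <= d -> `|f x - f y| <= e)).
    by apply; rewrite /= in_itv.
  near: d; apply: H => x _.
  have /cvgrPdist_lt/(_ _ e2)/nbhs_ballP[r /= r0 hr] := cf x.
  have r2 : 0 < r / 2 by rewrite divr_gt0.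
  near=> x' d.
  move=> y /= xy.
  have xx' : `|x - x'| < r / 2.
    by near: x'; apply/nbhs_ballP; exists (r / 2) => //= z; rewrite /ball/=.
  have dr : d < r / 2 by near: d; exact: nbhs_right_lt.
  have h1 : `|f x - f x'| < e / 2 by apply: hr; rewrite /ball/=; lra.
  have h2 : `|f x - f y| < e / 2.
    apply: hr; rewrite /ball/= (_ : x - y = (x - x') + (x' - y)); last by ring.
    by rewrite (le_lt_trans (ler_normD _ _))//; lra.
  rewrite (_ : f x' - f y = (f x - f y) - (f x - f x')); last by ring.
  by rewrite (le_trans (ler_normB _ _))//; lra.
near (0 : R)^'+ => d.
have d0 : 0 < d by near: d; exact: nbhs_right_gt.
have d1 : d <= 1 by near: d; apply: nbhs_right_le.
exists d => // x y xy.
case: (boolP (a - 1 <= x <= b + 1)) => xab.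
  by move: x xab y xy; near: d.
move: xy; rewrite ler_norml => /andP[h1 h2].
have xo : x < a - 1 \/ b + 1 < x.
  by move: xab; rewrite negb_and -!ltNge => /orP[]; [left|right].
rewrite !f0 ?subrr ?normr0//; first exact: ltW.
  by case: xo => h; [left|right]; lra.
by case: xo => h; [left|right]; lra.
Unshelve. all: by end_near. Qed.

Lemma support_bounded f a b : continuous f -> (forall x, x < a \/ b < x -> f x = 0) ->
  exists2 B, 0 <= B & forall x, `|f x| <= B.
Proof.
move=> cf f0; have [ab|ba] := leP a b; last first.
  exists 0 => // x; rewrite f0 ?normr0//.
  by case: (ltP x a) => [|ax]; [left|right; exact: lt_le_trans ba ax].
have cn : {within `[a, b], continuous (fun x => `|f x|)}.
  apply: continuous_subspaceT => x.
  by apply: continuous_comp; [exact: cf|exact: norm_continuous].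
have [c _ hc] := EVT_max ab cn.
exists `|f c| => // x; case: (boolP (x \in `[a, b])) => [/hc//|].
rewrite in_itv/= negb_and -!ltNge => h.
by rewrite f0 ?normr0//; move/orP: h.
Qed.

(** The support is at positive distance from 0, so extension by 0 stays C^1 on the whole line. [HH]
    is the primitive shifted to vanish above K; below e0 it is therefore constant, in general not
    0. *)
Lemma C1K_extension (H : R -> R) : C1K H -> exists e0 K (HH Hx h1 : R -> R),
  [/\ 0 < e0 <= K, (forall r, 0 < r -> Hx r = H r /\ h1 r = (H^`())%classic r),
      (forall r : R, is_derive r 1 HH (Hx r)) /\ (forall r : R, is_derive r 1 Hx (h1 r)),
      continuous h1 & (forall r, r < e0 -> [/\ Hx r = 0, h1 r = 0 & HH r = HH 0]) /\
      (forall r, K < r -> [/\ Hx r = 0, h1 r = 0 & HH r = 0])].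
Proof.
move=> [dH cH [A [cA A0 HA]]].
have [M hM] : exists M, forall x, A x -> x <= M.
  have [M [_ hM]] := compact_bounded cA.
  exists (M + 1) => x Ax; have := hM (M + 1); rewrite ltrDl => /(_ ltr01 x Ax)/=.
  exact/le_trans/ler_norm.
have [e0 e0_gt0 he0] : exists2 e0, 0 < e0 & forall x, A x -> e0 <= x.
  have [A1|A1] := pselect (A !=set0); last first.
    by exists 1 => // x Ax; case: A1; exists x.
  have cid : {within A, continuous (fun x : R => x)} by apply: continuous_subspaceT => x; exact: cvg_id.
  have [c Ac hc] := compact_EVT_min A1 cA cid.
  exists c; last by move=> x Ax; apply: hc; rewrite inE.
  by rewrite inE in Ac; have := A0 _ Ac; rewrite /= in_itv/= andbT.
pose K := Num.max e0 M.
pose Hx (r : R) : R := if 0 < r then H r else 0.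
pose h1 (r : R) : R := if 0 < r then (H^`())%classic r else 0.
have Hlo r : r < e0 -> Hx r = 0.
  move=> re; rewrite /Hx; case: ltP => // r0; apply: HA => // /he0.
  by rewrite leNgt re.
have Hhi r : K < r -> Hx r = 0.
  move=> re; rewrite /Hx; case: ltP => // r0; apply: HA => // /hM.
  by apply/negP; rewrite -ltNge (le_lt_trans _ re)// le_max lexx orbT.
have nearH (r : R) : 0 < r -> \near r, H r = Hx r.
  by move=> r0; near=> x; rewrite /Hx; have -> : 0 < x by near: x; exact: lt_nbhsr.
have nearlo (r : R) : r < e0 -> \near r, Hx r = 0.
  by move=> r0; near=> x; apply: Hlo; near: x; exact: lt_nbhsl.
have nearhi (r : R) : K < r -> \near r, Hx r = 0.
  by move=> r0; near=> x; apply: Hhi; near: x; exact: lt_nbhsr.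
have zero (r : R) : (\near r, Hx r = 0) -> 0 < r -> (H^`())%classic r = 0.
  move=> h r0; rewrite derive1E (@near_eq_derive R R R H Hx r 1 (nearH r r0)).
  by rewrite (@near_eq_derive R R R Hx (cst 0) r 1 h) derive_cst.
have h1lo r : r < e0 -> h1 r = 0.
  by move=> re; rewrite /h1; case: ltP => // r0; apply: zero => //; exact: nearlo.
have h1hi r : K < r -> h1 r = 0.
  by move=> re; rewrite /h1; case: ltP => // r0; apply: zero => //; exact: nearhi.
have dHx (r : R) : is_derive r 1 Hx (h1 r).
  have [r0|r0] := ltP r e0.
    rewrite h1lo//; have h := is_derive_cst (0 : R) r (1 : R).
    by apply: (near_eq_is_derive _ h); near do apply/esym; exact: nearlo.
  have rp : 0 < r by exact: lt_le_trans r0.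
  rewrite /h1 rp; apply: (near_eq_is_derive (nearH r rp)).
  by rewrite derive1E; apply: DeriveDef => //; exact: dH.
have ch1 : continuous h1.
  move=> r; have [r0|r0] := ltP r e0.
    rewrite /continuous_at (h1lo _ r0); apply: cvg_near_cst; near=> x; rewrite h1lo//.
    by near: x; exact: lt_nbhsl.
  have rp : 0 < r by exact: lt_le_trans r0.
  have c := cH r rp; rewrite /continuous_at in c *.
  rewrite {2}/h1 rp; apply: (cvg_trans _ c).
  apply: near_eq_cvg; near=> x; rewrite /h1.
  by have -> : 0 < x by near: x; exact: lt_nbhsr.
have cHx : continuous Hx.
  move=> r; apply: differentiable_continuous; apply/derivable1_diffP.
  by have [] := dHx r.
pose F (x : R) := \int[@lebesgue_measure R]_(t in `[0%R, x]) Hx t.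
have Flo r : r < e0 -> F r = 0.
  move=> re; rewrite /F /Rintegral (eq_integral (fun=> 0%E)) ?integral0//= => t.
  by rewrite inE/= in_itv/= => /andP[_ tr]; rewrite Hlo// (le_lt_trans tr).
have dF (r : R) : is_derive r 1 F (Hx r).
  have [r0|r0] := ltP r e0.
    rewrite Hlo//; have h := is_derive_cst (0 : R) r (1 : R).
    apply: (near_eq_is_derive _ h); near=> x; rewrite Flo//.
    by near: x; exact: lt_nbhsl.
  have rp : 0 < r by exact: lt_le_trans r0.
  have r1 : r < r + 1 by rewrite ltrDl.
  have [] := @continuous_FTC1_closed R Hx 0 r (r + 1) r1 _ rp (cHx r).
    apply: continuous_compact_integrable; first exact: segment_compact.
    exact: continuous_subspaceT.
  by move=> dd <-; rewrite derive1E; exact: DeriveDef.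
have Fhi r : K < r -> F r = F (K + 1).
  move=> Kr; have K1 : K < K + 1 by rewrite ltrDl.
  have st (x y : R) : K < x -> x <= y -> F y = F x.
    move=> Kx xy; apply/eqP; rewrite -subr_eq0 -normr_le0 -[leRHS](mul0r (y - x)).
    apply: (@mvt_bound _ F Hx) => // z /andP[xz _].
    by rewrite Hhi ?normr0// (lt_le_trans Kx).
  by have [h|/ltW h] := leP (K + 1) r; [exact: st|rewrite (st r (K + 1))].
exists e0, K, (fun r => F r - F (K + 1)), Hx, h1; split => //.
- by rewrite e0_gt0 le_max lexx.
- by move=> r r0; rewrite /Hx /h1 r0.
- split=> // r; have h := derive_add (dF r) (is_derive_cst (- F (K + 1)) r (1 : R)).
  by apply: (is_derive_eq h); rewrite addr0.
- by split=> r hr; [rewrite Hlo// h1lo// (Flo r)// (Flo 0)|rewrite Hhi// h1hi// (Fhi r hr) subrr].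
Unshelve. all: by end_near. Qed.

End compact_support.

(** * The polar empirical measure *)

Section polar_pairing.
Variables (R : realType) (T : R) (w : trajectory R).
Hypothesis T1 : 1 < T.

Definition occupation (x : site) : R := tint (fun eta => (eta x)%:R) w.

Lemma continuous_occ (x : site) : continuous (fun eta : config => (eta x)%:R : R).
Proof. by apply: local_continuous; exact: (local_coord x (fun b => b%:R)). Qed.

Lemma occupation01 x : 0 <= occupation x <= 1.
Proof.
have c := @continuous_occ x; apply/andP; split.
  rewrite -[leLHS](tint_cst 0 w); apply: tint_mono => //; first exact: continuous_const.
rewrite -[leRHS](tint_cst 1 w); apply: tint_mono => //; first exact: continuous_const.
by move=> eta; case: (eta x).
Qed.

(** Numbers that code no site are sent to the origin, whose term vanishes, so sums over sites become
    series. *)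
Let site_of (n : nat) : site := odflt (0 : site) (pickle_inv n).

Let siteK x : site_of (pickle x) = x. Proof. by rewrite /site_of pickleK_inv. Qed.

Lemma esum_sites (a : site -> \bar R) : (forall x, (0 <= a x)%E) -> a 0 = 0%E ->
  (\esum_(x in [set x : site | x != 0%R]) a x = \sum_(n <oo) a (site_of n))%E.
Proof.
move=> a0 a00; rewrite nneseries_esumT; last by move=> n; exact: a0.
have bij : set_bij [set n | site_of n != 0] [set x : site | x != 0] site_of.
  split.
  - by move=> n.
  - move=> n k; rewrite !inE /site_of /=.
    have := @pickle_invK site n; have := @pickle_invK site k.
    case: (pickle_inv n) => [x|]; case: (pickle_inv k) => [y|] //=; rewrite ?eqxx//.
    by move=> <- <- _ _ ->.
  - by move=> x x0; exists (pickle x); [rewrite /mkset siteK|exact: siteK].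
rewrite (reindex_esum _ _ _ a bij) [RHS](esumID [set n | site_of n != 0])//.
rewrite setTI [X in (_ + X)%E]esum1 ?adde0// => n [_ /negP]; rewrite negbK => /eqP ->.
exact: a00.
Qed.

Let C : R := (2 * pi * ln T)^-1.

Let C0 : 0 <= C.
Proof.
rewrite invr_ge0 mulr_ge0 ?mulr_ge0 ?pi_ge0//; apply: ltW.
by rewrite ln_gt0.
Qed.

Let coef (x : site) : R := C * (occupation x / nsq R x).

Let coef0 x : 0 <= coef x.
Proof.
have /andP[h _] := occupation01 x.
by rewrite mulr_ge0// divr_ge0// nsq_ge0.
Qed.

Lemma euclid_rt x : euclid_norm R x = rt R x. Proof. by []. Qed.

Let I01 : set R := `[0%R, 1%R[%classic.
Let mI : measurable I01. Proof. exact: measurable_itv. Qed.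
Let muI : @lebesgue_measure R I01 = 1%:E.
Proof. by rewrite lebesgue_measure_itv /= lte_fin ltr01 oppr0 adde0. Qed.

Lemma integral_occupation (a : R) x :
  (\int[lebesgue_measure]_(s in I01) (a * (w s x)%:R)%:E = (a * occupation x)%:E)%E.
Proof.
have b := tint_bmeas w (@continuous_occ x).
have bi : bmeas I01 (fun s => a * (w s x)%:R).
  rewrite (_ : (fun s => _) = fun s => a * (w s x)%:R + 0); last by apply/funext => s; rewrite addr0.
  by apply: bmeas_lin => //; exact: bmeas_cst.
rewrite /occupation /tint -(@Int_scale _ _ R (@lebesgue_measure R) I01 mI _ muI)//.
rewrite /Rintegral fineK//; apply: integrable_fin_num => //.
exact: (@bmeas_integrable _ _ R (@lebesgue_measure R) I01 mI _ muI _ bi).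
Qed.

Let term A n (s : R) : R := C / nsq R (site_of n) * \1_A (log_radius T (site_of n)) * (w s (site_of n))%:R.

Let polar_term A s : polar_measure T (w s) A = (\sum_(n <oo) (term A n s)%:E)%E.
Proof.
rewrite /polar_measure esum_sites.
- rewrite -nneseriesZl; last by move=> n _; rewrite mule_ge0// lee_fin// divr_ge0// sqr_ge0.
  apply: eq_eseriesr => n _; rewrite /dirac -!EFinM; congr (_%:E).
  by rewrite euclid_rt rt_sqr /term -/C; ring.
- by move=> x; rewrite mule_ge0// lee_fin// divr_ge0// sqr_ge0.
- by rewrite euclid_rt rt_sqr /nsq /= expr0n /= addr0 invr0 mulr0 mul0e.
Qed.

(** Exchanging the series with the time integral exhibits the averaged set function as a countable
    sum of point masses; this is what makes it a measure and its integrals sums. *)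
Lemma mean_polar_measureE A : mean_polar_measure T w A =
  (\sum_(n <oo) (coef (site_of n))%:E * \d_(log_radius T (site_of n)) A)%E.
Proof.
have t0 n s : I01 s -> (0 <= (term A n s)%:E)%E.
  by move=> _; rewrite lee_fin !mulr_ge0// invr_ge0 nsq_ge0.
have mt n : measurable_fun I01 (fun s => (term A n s)%:E).
  apply/measurable_EFinP; rewrite /term; apply: measurable_funM; first exact: measurable_cst.
  by have [] := tint_bmeas w (@continuous_occ (site_of n)).
have mp : measurable_fun I01 (fun s => polar_measure T (w s) A).
  rewrite (_ : (fun s => _) = fun s => (\sum_(n <oo) (term A n s)%:E)%E).
    by apply: ge0_emeasurable_sum => // n s Is _; exact: t0.
  by apply/funext => s; exact: polar_term.
(* The definition integrates over [0, 1], [tint] over [0, 1[. *)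
rewrite /mean_polar_measure -(integral_itv_bndo_bndc mp).
under eq_integral do rewrite polar_term.
etransitivity; first exact: (@integral_nneseries _ _ R (@lebesgue_measure R) I01 mI (fun n s => (term A n s)%:E) mt t0).
apply: eq_eseriesr => n _.
rewrite integral_occupation /dirac -EFinM; congr (_%:E); rewrite /coef; ring.
Qed.

(** The test [0 < log_radius T x] reflects the restriction of the pairing to (0, +oo); the vanishing
    of [f] outside the box makes the series finite. *)
Lemma pairing_sum (f : R -> R) N : continuous f -> (forall r, 0 <= f r) ->
  (forall x, x \notin box N -> f (log_radius T x) = 0) ->
  pairing (mean_polar_measure T w) f =
  \sum_(x <- box N) coef x * (if 0 < log_radius T x then f (log_radius T x) else 0).
Proof.
move=> cf f0 fN.
pose D : set R := `]0, +oo[%classic.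
have mD : measurable D by exact: measurable_itv.
have mf : measurable_fun D (fun u => (f u)%:E).
  by apply/measurable_EFinP; apply: measurable_funTS; exact: continuous_measurable_fun.
pose m_ n : {measure set R -> \bar R} := mscale (NngNum (coef0 (site_of n))) (\d_(log_radius T (site_of n))).
have -> : mean_polar_measure T w = mseries m_ 0 by apply/funext => A; rewrite mean_polar_measureE.
pose g x : R := coef x * (if 0 < log_radius T x then f (log_radius T x) else 0).
have g0 x : 0 <= g x by rewrite mulr_ge0//; case: ifP.
rewrite /pairing -/D ge0_integral_measure_series//; last by move=> t _; rewrite lee_fin.
have -> : (\sum_(n <oo) \int[m_ n]_(u in D) (f u)%:E)%E = (\sum_(n <oo) (g (site_of n))%:E)%E.
  apply: eq_eseriesr => n _.
  rewrite /m_ ge0_integral_mscale//; last by move=> t _; rewrite lee_fin.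
  rewrite integral_dirac// /dirac -!EFinM; congr (_%:E); rewrite /g /= indicE; congr (_ * _).
  by rewrite mem_setE /D /= in_itv /= andbT; case: ifP; rewrite ?mul1r ?mul0r.
have n0 : nsq R 0 = 0 by rewrite /nsq /= expr0n /= addr0.
have g00 : g 0 = 0 by rewrite /g /coef n0 invr0 !mulr0 mul0r.
rewrite -(esum_sites (a := fun x => (g x)%:E)); last 2 first.
- by move=> x; rewrite lee_fin.
- by rewrite g00.
have -> : (\esum_(x in [set x : site | x != 0%R]) (g x)%:E = \esum_(x in [set` box N]) (g x)%:E)%E.
  rewrite esum_mkcond [RHS]esum_mkcond; apply: eq_esum => x _.
  case: ifPn => [_|]; last first.
    by rewrite notin_setE /= => /negP; rewrite negbK => /eqP ->; rewrite g00; case: ifP.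
  case: ifPn => //; rewrite notin_setE /= => /negP h.
  by rewrite /g fN// if_same mulr0.
rewrite (esum_fset (finite_seq (box N))); last by move=> x _; rewrite lee_fin.
by rewrite -fsbig_seq ?box_uniq// sumEFin.
Qed.

End polar_pairing.

(** * Smoothing in the radial variable *)

Section approximate_identity.
Variables (R : realType) (K delta : R) (psi : R -> R).
Hypothesis K0 : 0 < K.
Hypothesis delta01 : 0 < delta < 1.
Hypothesis psi_cut : cutoff delta psi.

(** A set of finite measure in place of (0, +oo): the functions integrated vanish beyond K, and the
    margin 1 holds the window of [psi] around any point up to K. *)
Definition radii : set R := `]0%R, (K + 1)%R]%classic.

Lemma measurable_radii : measurable radii. Proof. exact: measurable_itv. Qed.

Lemma measure_radii : @lebesgue_measure R radii = (K + 1)%:E.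
Proof.
by rewrite lebesgue_measure_itv /= lte_fin addr_gt0// oppr0 adde0.
Qed.

Definition radial (f : R -> R) : R := \int[@lebesgue_measure R]_(r in radii) f r.

Local Notation bm := (@bmeas _ _ R radii).

Lemma bmeas_scale (a : R) f : bm f -> bm (fun r => a * f r).
Proof.
move=> bf; rewrite (_ : (fun r => _) = fun r => a * f r + 0); last by apply/funext => r; rewrite addr0.
by apply: bmeas_lin => //; exact: bmeas_cst.
Qed.

Lemma radial_lin (a : R) f g : bm f -> bm g -> radial (fun r => a * f r + g r) = a * radial f + radial g.
Proof. exact: (@Int_lin _ _ R (@lebesgue_measure R) radii measurable_radii _ measure_radii). Qed.

Lemma radial_scale (a : R) f : bm f -> radial (fun r => a * f r) = a * radial f.
Proof. exact: (@Int_scale _ _ R (@lebesgue_measure R) radii measurable_radii _ measure_radii). Qed.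

Lemma radial_mono f g : bm f -> bm g -> (forall r, 0 < r <= K + 1 -> f r <= g r) -> radial f <= radial g.
Proof.
by move=> bf bg fg; exact: (@Int_mono _ _ R (@lebesgue_measure R) radii measurable_radii _ measure_radii).
Qed.

Lemma radial_sum (J : eqType) (s : seq J) (F : J -> R -> R) : (forall i, i \in s -> bm (F i)) ->
  radial (fun r => \sum_(i <- s) F i r) = \sum_(i <- s) radial (F i).
Proof. exact: (@Int_sum _ _ R (@lebesgue_measure R) radii measurable_radii _ measure_radii). Qed.

Lemma bmeas_cont f (M : R) : continuous f -> (forall x, `|f x| <= M) -> bm f.
Proof.
move=> cf fM; split; last by exists M.
by apply: measurable_funTS; exact: continuous_measurable_fun.
Qed.

Lemma radial_indic (c : R) (A : set R) : measurable A -> 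
  radial (fun r => c * \1_A r) = c * fine (@lebesgue_measure R (A `&` radii)).
Proof.
move=> mA; rewrite radial_scale; last exact: bmeas_indic.
by rewrite /radial /Rintegral integral_indic//; exact: measurable_radii.
Qed.

Lemma radial_itv_le (c x y : R) : 0 <= c -> x <= y -> radial (fun r => c * \1_(`[x, y]%classic) r) <= c * (y - x).
Proof.
move=> c0 xy; rewrite radial_indic; last exact: measurable_itv.
rewrite ler_wpM2l//.
have m1 : measurable (`[x, y]%classic : set R) by exact: measurable_itv.
have h : (@lebesgue_measure R (`[x, y]%classic `&` radii) <= (y - x)%:E)%E.
  apply: (@le_trans _ _ (@lebesgue_measure R `[x, y]%classic)).
    apply: le_measure; rewrite ?inE//.
    by apply: measurableI => //; exact: measurable_radii.
  rewrite lebesgue_measure_itv /= lte_fin; case: ifP => //.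
  by rewrite lee_fin subr_ge0.
rewrite -lee_fin fineK//; rewrite ge0_fin_numE//; exact: (le_lt_trans h (ltry _)).
Qed.

Lemma radial_itv_eq (c x y : R) : 0 < x -> x < y -> y <= K + 1 ->
  radial (fun r => c * \1_(`[x, y]%classic) r) = c * (y - x).
Proof.
move=> x0 xy yK; rewrite radial_indic; last exact: measurable_itv.
rewrite setIidl; last first.
  move=> r /=; rewrite !in_itv /= => /andP[h1 h2]; apply/andP; split.
    exact: lt_le_trans h1.
  exact: le_trans yK.
by rewrite lebesgue_measure_itv /= lte_fin xy -EFinB.
Qed.

Let d0 : 0 < delta. Proof. by case/andP: delta01. Qed.
Let cpsi : continuous psi. Proof. by case: psi_cut. Qed.

Lemma psi_ge0 s : 0 <= psi s. Proof. by case: psi_cut => _ /(_ s)/andP[]. Qed.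
Lemma psi_le s : psi s <= (2 * delta)^-1. Proof. by case: psi_cut => _ /(_ s)/andP[]. Qed.
Lemma psi_out s : 2 * delta < `|s| -> psi s = 0.
Proof.
case: psi_cut => _ _ _ h hs; apply: h; apply: le_lt_trans hs.
case/andP: delta01 => a1 a2; rewrite expr2.
have : delta * delta <= delta by rewrite ler_piMl// ltW.
by lra.
Qed.

Lemma continuous_psi_shift s : continuous (fun r : R => psi (s - r)).
Proof.
move=> r; apply: continuous_comp; last exact: cpsi.
by apply: continuousB; [exact: cst_continuous|exact: cvg_id].
Qed.

Lemma psi_norm s : `|psi s| <= (2 * delta)^-1.
Proof. by rewrite ger0_norm ?psi_ge0// psi_le. Qed.

Lemma bmeas_psi s : bm (fun r => psi (s - r)).
Proof. by apply: (bmeas_cont (@continuous_psi_shift s)) => r; exact: psi_norm. Qed.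

(** The height is at most 1 / (2 delta) and the support has half-length delta + delta^2. The lower
    bound below uses the plateau, of half-length delta - delta^2. *)
Lemma radial_psi_le s : radial (fun r => psi (s - r)) <= 1 + delta.
Proof.
pose x := s - (delta + delta ^+ 2); pose y := s + (delta + delta ^+ 2).
have d2 : 0 <= delta ^+ 2 by rewrite sqr_ge0.
have xy : x <= y by rewrite /x /y; move: d0; lra.
have c0 : 0 <= (2 * delta)^-1 by rewrite invr_ge0 mulr_ge0// ltW.
apply: (@le_trans _ _ ((2 * delta)^-1 * (y - x))); last first.
  by apply: eq_ler; rewrite /x /y; field; exact: lt0r_neq0.
apply: le_trans (radial_itv_le c0 xy).
apply: radial_mono; first exact: bmeas_psi.
  by apply: bmeas_scale; apply: bmeas_indic; exact: measurable_itv.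
move=> r _; rewrite indicE; case: (boolP (r \in _)) => hr; first by rewrite mulr1 psi_le.
rewrite mulr0; case: psi_cut => _ _ _ ->//.
move: hr; rewrite notin_setE /= in_itv /= => /negP; rewrite negb_and -!ltNge /x /y => /orP[h|h].
  by rewrite gtr0_norm; move: d0; lra.
by rewrite ltr0_norm; move: d0; lra.
Qed.

Lemma radial_psi_ge s : delta < s -> s + delta <= K + 1 -> 1 - delta <= radial (fun r => psi (s - r)).
Proof.
move=> ds sK; have /andP[_ d1] := delta01.
pose x := s - (delta - delta ^+ 2); pose y := s + (delta - delta ^+ 2).
have d2 : 0 <= delta ^+ 2 by rewrite sqr_ge0.
have dd : delta ^+ 2 < delta by rewrite expr2 gtr_pMl.
have xy : x < y by rewrite /x /y; move: d0; lra.
apply: (@le_trans _ _ ((2 * delta)^-1 * (y - x))).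
  by apply: eq_ler; rewrite /x /y; field; exact: lt0r_neq0.
rewrite -(radial_itv_eq (2 * delta)^-1 _ xy) /x /y; [|lra|lra].
apply: radial_mono; last first.
  move=> r _; rewrite indicE; case: (boolP (r \in _)) => hr; last by rewrite mulr0 psi_ge0.
  have -> : psi (s - r) = (2 * delta)^-1; last by rewrite mulr1.
  case: psi_cut => _ _ h _; apply: h.
  by move: hr; rewrite inE /= in_itv /= => /andP[h1 h2]; rewrite ler_norml; apply/andP; split; lra.
- exact: bmeas_psi.
by apply: bmeas_scale; apply: bmeas_indic; exact: measurable_itv.
Qed.

Variables (f : R -> R) (e0 F om : R).
Hypothesis cf : continuous f.
Hypothesis e0d : 8 * delta <= e0.
Hypothesis f_out : forall r, r < e0 \/ K < r -> f r = 0.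
Hypothesis fF : forall r, `|f r| <= F.
Hypothesis f_om : forall r r', `|r - r'| <= 2 * delta -> `|f r - f r'| <= om.
Hypothesis delta4 : 4 * delta <= 1.

(** The window around [s] has almost full mass in [radii] only away from the ends of that interval;
    at the other points f s = 0 and the missing mass is harmless. *)
Lemma smoothing_error s : `|f s - radial (fun r => f r * psi (s - r))| <= 2 * om + F * delta.
Proof.
have F0 : 0 <= F by exact: le_trans (normr_ge0 _) (fF 0).
have om0 : 0 <= om by rewrite (le_trans (normr_ge0 _) (@f_om 0 0 _))// subrr normr0 mulr_ge0// ltW.
have bf : bm f by exact: (bmeas_cont cf fF).
have bp := bmeas_psi s.
have bfp : bm (fun r => f r * psi (s - r)) by exact: bmeas_mul.
pose m := radial (fun r => psi (s - r)).
have m1 : m <= 1 + delta by exact: radial_psi_le.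
have bc' : bm (fun r => f s * psi (s - r)) by exact: bmeas_scale.
have e1 : `|f s * m - radial (fun r => f r * psi (s - r))| <= om * (1 + delta).
  have eq1 : f s * m - radial (fun r => f r * psi (s - r)) = radial (fun r => (-1) * (f r * psi (s - r)) + f s * psi (s - r)).
    by rewrite (radial_lin (-1) bfp bc') (radial_scale (f s) bp) -/m; ring.
  have bo : bm (fun r => om * psi (s - r)).
    exact: bmeas_scale.
  have bno : bm (fun r => (- om) * psi (s - r)).
    exact: bmeas_scale.
  have bd : bm (fun r => -1 * (f r * psi (s - r)) + f s * psi (s - r)).
    by exact: bmeas_lin.
  have key r : `|-1 * (f r * psi (s - r)) + f s * psi (s - r)| <= om * psi (s - r).
    have -> : -1 * (f r * psi (s - r)) + f s * psi (s - r) = (f s - f r) * psi (s - r) by ring.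
    have [h|h] := leP `|s - r| (2 * delta); last by rewrite psi_out// !mulr0 normr0.
    by rewrite normrM (ger0_norm (psi_ge0 _)) ler_wpM2r ?psi_ge0// f_om.
  rewrite eq1 ler_norml; apply/andP; split.
    apply: (@le_trans _ _ (radial (fun r => (- om) * psi (s - r)))).
      by rewrite radial_scale// -/m mulNr lerN2 ler_wpM2l.
    by apply: radial_mono => // r _; have := key r; rewrite ler_norml => /andP[h _]; apply: le_trans h; rewrite mulNr.
  apply: (@le_trans _ _ (radial (fun r => om * psi (s - r)))).
    by apply: radial_mono => // r _; have := key r; rewrite ler_norml => /andP[].
  by rewrite radial_scale// -/m ler_wpM2l.
have e2 : `|f s - f s * m| <= F * delta.
  have [h|h] : (s < e0 \/ K < s) \/ (e0 <= s <= K).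
    have [a1|a1] := ltP s e0; first by left; left.
    by have [a2|a2] := ltP K s; [left; right|right].
    by rewrite f_out// mul0r subrr normr0 mulr_ge0// ltW.
  case/andP: h => h1 h2.
  have m2 : 1 - delta <= m by apply: radial_psi_ge; move: d0 e0d delta4; lra.
  rewrite (_ : f s - f s * m = f s * (1 - m)); last by ring.
  by rewrite normrM ler_pM// ler_norml; apply/andP; split; lra.
rewrite (_ : f s - _ = (f s - f s * m) + (f s * m - radial (fun r => f r * psi (s - r)))); last by ring.
rewrite (le_trans (ler_normD _ _))// addrC lerD// (le_trans e1)// mulrC ler_wpM2r//.
by move: delta4 d0; lra.
Qed.

Lemma smoothing_out s : s < e0 / 2 \/ K + 1 < s -> f s = 0 /\ radial (fun r => f r * psi (s - r)) = 0.
Proof.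
move=> hs; split.
  by apply: f_out; case: hs => h; [left|right]; move: e0d d0 delta4; lra.
have -> : (fun r => f r * psi (s - r)) = fun r => 0 * psi (s - r).
  apply/funext => r; rewrite mul0r; have [h|h] := leP `|s - r| (2 * delta); last by rewrite psi_out// mulr0.
  rewrite f_out ?mul0r//; move: h; rewrite ler_norml => /andP[h1 h2].
  by case: hs => h; [left|right]; move: e0d d0 delta4; lra.
by rewrite radial_scale ?mul0r//; exact: bmeas_psi.
Qed.

End approximate_identity.

Lemma log_radius_sgm (R : realType) (T : R) (x : site) : log_radius T x = sgm (ln T) x.
Proof.
rewrite /log_radius /sgm /half_log.
have -> : ln (euclid_norm R x) = ln (nsq R x) / 2.
  have [n0|n0] := leP (nsq R x) 0.
    have -> : nsq R x = 0 by apply/eqP; rewrite eq_le n0 nsq_ge0.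
    have -> : euclid_norm R x = 0 by apply/eqP; rewrite sqrtr_eq0.
    by rewrite ln0// mul0r.
  have s0 : 0 < Num.sqrt (nsq R x) by rewrite sqrtr_gt0.
  have -> : ln (nsq R x) = ln (Num.sqrt (nsq R x)) * 2.
    by rewrite -[in LHS](sqr_sqrtr (ltW n0)) lnXn// mulr_natr.
  by rewrite mulfK.
by rewrite invfM mulrA.
Qed.

(** * Radial averages as weighted sums over sites *)

Section smoothing_weights.
Variables (R : realType) (L e0 K delta d e : R) (psi : R -> R) (m n : nat).
Hypothesis L1 : 1 <= L.
Hypothesis e0_gt0 : 0 < e0.
Hypothesis e0K : e0 <= K.
Hypothesis delta01 : 0 < delta < 1.
Hypothesis delta4 : 4 * delta <= 1.
Hypothesis e0d : 8 * delta <= e0.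
Hypothesis psi_cut : cutoff delta psi.
Local Notation rho := (rho L (e0 / 2)).
Local Notation Q0 := (Q0 L (K + 1)).
Hypothesis Drho : 32 * (m.*2.+2)%:R <= rho.
Hypothesis Qn : Q0 <= n%:R.
Let b := (n + m.*2.+1 + 2)%N.
Let L0 : 0 < L. Proof. exact: lt_le_trans L1. Qed.
Let d0 : 0 < delta. Proof. by case/andP: delta01. Qed.

Definition smooth_wgt (r : R) (x : site) : R := (2 * pi * L * nsq R x)^-1 * psi (sgm L x - r).
Definition smooth_mass (r : R) : R := \sum_(x <- box b) smooth_wgt r x.

Lemma smooth_wgt_ge0 r x : 0 <= smooth_wgt r x.
Proof.
rewrite mulr_ge0 ?(psi_ge0 psi_cut)// invr_ge0 !mulr_ge0 ?pi_ge0 ?nsq_ge0//; exact: ltW.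
Qed.

Lemma sgm_le (x : site) (c : R) : 0 < nsq R x -> (sgm L x <= c) = (nsq R x <= expR (L * c) ^+ 2).
Proof.
move=> n0; rewrite /sgm /half_log ler_pdivrMr ?mulr_gt0//.
have -> : c * (2 * L) = ln (expR (L * c) ^+ 2) by rewrite -expRM_natl expRK; ring.
by rewrite ler_ln ?posrE ?exprn_gt0 ?expR_gt0.
Qed.

Lemma sgm_ge (x : site) (c : R) : 0 < nsq R x -> (c <= sgm L x) = (expR (L * c) ^+ 2 <= nsq R x).
Proof.
move=> n0; rewrite /sgm /half_log ler_pdivlMr ?mulr_gt0//.
have -> : c * (2 * L) = ln (expR (L * c) ^+ 2) by rewrite -expRM_natl expRK; ring.
by rewrite ler_ln ?posrE ?exprn_gt0 ?expR_gt0.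
Qed.

Let band (r c : R) : R := \sum_(x <- box b)
  (if expR (L * (r - c)) ^+ 2 <= nsq R x <= expR (L * (r + c)) ^+ 2 then (nsq R x)^-1 else 0).

Let p0 : 0 < pi :> R. Proof. exact: pi_gt0. Qed.

(** [psi] is squeezed between the indicators of two bands of half-width delta -+ delta^2, times 1 /
    (2 delta). The annulus estimates give 1 -+ delta as main terms, and the lattice error O(1 /
    (delta L)) is at most delta by hypothesis. *)
Lemma smooth_mass_bound r : e0 <= r <= K -> (12 * pi + 40) / (4 * pi * delta) <= delta * L ->
  `|smooth_mass r - 1| <= 2 * delta.
Proof.
move=> /andP[er rK] hL.
have dn0 := lt0r_neq0 d0; have Ln0 := lt0r_neq0 L0; have pn0 := lt0r_neq0 p0.
have d2 : 0 <= delta ^+ 2 by rewrite sqr_ge0.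
have dd : delta ^+ 2 < delta by rewrite expr2 gtr_pMl//; case/andP: delta01.
pose c0 : R := (2 * delta)^-1 / (2 * pi * L).
have c00 : 0 <= c0 by rewrite divr_ge0 ?invr_ge0 ?mulr_ge0// ltW.
have ub : smooth_mass r <= c0 * band r (delta + delta ^+ 2).
  rewrite /smooth_mass /band mulr_sumr; apply: ler_sum => x _; rewrite /smooth_wgt.
  have [n0|n0] := leP (nsq R x) 0.
    have -> : nsq R x = 0 by apply/eqP; rewrite eq_le n0 nsq_ge0.
    by rewrite mulr0 invr0 mul0r; case: ifP; rewrite mulr0.
  have i0 : 0 <= (2 * pi * L * nsq R x)^-1 by rewrite invr_ge0 !mulr_ge0// ltW.
  rewrite -sgm_ge// -sgm_le//; case: ifPn => h.
    apply: (@le_trans _ _ ((2 * pi * L * nsq R x)^-1 * (2 * delta)^-1)).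
      by rewrite ler_wpM2l// (psi_le psi_cut).
    apply: eq_ler; rewrite /c0; move: (pi : R) (nsq R x) pn0 (lt0r_neq0 n0) => p v pn vn.
      by field; rewrite dn0 Ln0 pn vn.
  rewrite mulr0; case: psi_cut => _ _ _ ->; first by rewrite mulr0.
  move: h; rewrite negb_and -!ltNge => /orP[h|h].
    by rewrite ltr0_norm; move: d0; lra.
  by rewrite gtr0_norm; move: d0; lra.
have lb : c0 * band r (delta - delta ^+ 2) <= smooth_mass r.
  rewrite /smooth_mass /band mulr_sumr; apply: ler_sum => x _; rewrite /smooth_wgt.
  case: ifPn => h; last by rewrite mulr0; exact: (smooth_wgt_ge0 r x).
  have n0 : 0 < nsq R x.
    by case/andP: h => h _; apply: lt_le_trans h; rewrite exprn_gt0// expR_gt0.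
  move: h; rewrite -sgm_ge// -sgm_le// => /andP[h1 h2].
  have -> : psi (sgm L x - r) = (2 * delta)^-1.
    by case: psi_cut => _ _ hp _; apply: hp; rewrite ler_norml; apply/andP; split; lra.
  apply: eq_ler; rewrite /c0; move: (pi : R) (nsq R x) pn0 (lt0r_neq0 n0) => p v pn vn.
      by field; rewrite dn0 Ln0 pn vn.
have bu c : 0 <= c -> c <= 2 * delta -> band r c <= 2 * pi * (L * (2 * c)) + (12 * pi + 40).
  move=> c1 c2; have := annulus_upper b (_ : 1 <= expR (L * (r - c))) (_ : expR (L * (r - c)) <= expR (L * (r + c))).
  rewrite ler_expR -{1}expR0 ler_expR ler_wpM2l ?(ltW L0)//; last by lra.
  have -> : 0 <= L * (r - c) by rewrite mulr_ge0 ?(ltW L0)//; move: e0d d0; lra.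
  move=> /(_ isT isT); rewrite -expRN -expRD expRK.
  by rewrite (_ : L * (r + c) + - (L * (r - c)) = L * (2 * c)); last by ring.
have bl c : 0 <= c -> c <= 2 * delta -> 2 * pi * (L * (2 * c)) - (12 * pi + 40) <= band r c.
  move=> c1 c2.
  have q1 : expR (L * (r + c)) <= b%:R.
    apply: (@le_trans _ _ Q0); first by rewrite ler_expR ler_wpM2l ?(ltW L0)//; move: delta4 d0; lra.
    by apply: (le_trans Qn); rewrite ler_nat /b -addnA leq_addr.
  have := annulus_lower (N := b) (_ : 1 <= expR (L * (r - c))) (_ : expR (L * (r - c)) <= expR (L * (r + c))) q1.
  rewrite ler_expR -{1}expR0 ler_expR ler_wpM2l ?(ltW L0)//; last by lra.
  have -> : 0 <= L * (r - c) by rewrite mulr_ge0 ?(ltW L0)//; move: e0d d0; lra.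
  move=> /(_ isT isT); rewrite -expRN -expRD expRK.
  by rewrite (_ : L * (r + c) + - (L * (r - c)) = L * (2 * c)); last by ring.
have ce c : c0 * (2 * pi * (L * (2 * c))) = c / delta.
  by rewrite /c0; move: (pi : R) pn0 => p pn; field; rewrite ?dn0 ?Ln0 ?pn.
have c1 : c0 * (12 * pi + 40) <= delta.
  rewrite /c0 (_ : _ * _ = (12 * pi + 40) / (4 * pi * delta) / L); last by move: (pi : R) pn0 => p pn; field; rewrite dn0 Ln0 pn.
  by rewrite ler_pdivrMr.
rewrite ler_norml; apply/andP; split.
  have := ler_wpM2l c00 (@bl (delta - delta ^+ 2) _ _); rewrite mulrBr ce.
  have -> : (delta - delta ^+ 2) / delta = 1 - delta by field.
  move=> /(_ _ _)/le_trans/(_ lb) h.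
  have : 1 - delta - c0 * (12 * pi + 40) <= smooth_mass r by apply: h; lra.
  lra.
have := ler_wpM2l c00 (@bu (delta + delta ^+ 2) _ _); rewrite mulrDr ce.
have -> : (delta + delta ^+ 2) / delta = 1 + delta by field.
move=> h; have : smooth_mass r <= 1 + delta + c0 * (12 * pi + 40).
  by apply: (le_trans ub); apply: h; lra.
lra.
Qed.

Lemma smooth_core r x : e0 <= r -> rt R x < rho -> smooth_wgt r x = 0.
Proof.
move=> er h; rewrite /smooth_wgt; have [n0|n0] := leP (nsq R x) 0.
  have -> : nsq R x = 0 by apply/eqP; rewrite eq_le n0 nsq_ge0.
  by rewrite mulr0 invr0 mul0r.
rewrite (psi_out delta01 psi_cut) ?mulr0//.
have hs : sgm L x < e0 / 2.
  have q0 : 0 <= expR (L * (e0 / 2)) by exact/ltW/expR_gt0.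
  by rewrite ltNge sgm_ge// -rt_sqr -ltNge ltr_sqr ?nnegrE ?rt_ge0.
by rewrite ltr0_norm; move: d0 e0d; lra.
Qed.

Lemma smooth_far r x : r <= K -> Q0 < rt R x -> smooth_wgt r x = 0.
Proof.
move=> rK h; rewrite /smooth_wgt.
have Q00 : 0 < Q0 by exact: expR_gt0.
have n0 : 0 < nsq R x by rewrite -rt_sqr exprn_gt0// (lt_trans Q00).
rewrite (psi_out delta01 psi_cut) ?mulr0//.
have hs : K + 1 < sgm L x.
  by rewrite ltNge sgm_le// -rt_sqr -ltNge ltr_sqr ?nnegrE ?rt_ge0// ltW.
by rewrite gtr0_norm; move: d0 delta4; lra.
Qed.

Lemma smooth_supported r : r <= K -> supported n (smooth_wgt r).
Proof. by move=> rK x xn; apply: smooth_far => //; exact: le_lt_trans Qn (box_rt R xn). Qed.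

Hypothesis e_ge0 : 0 <= e.
Hypothesis psi_mod : forall s s', `|s - s'| <= 10 / (rho * L) -> `|psi s - psi s'| <= e.

Definition smooth_osc (x : site) : R :=
  (2 * pi * L)^-1 * (5 / delta * ind3 L (e0 / 2) x + e * ind2 L (e0 / 2) (K + 1) x).

Let D1 : (1 <= m.*2.+2)%N. Proof. by []. Qed.
Let rho0 : 0 < rho. Proof. exact: expR_gt0. Qed.
Let rho64 : 64 <= rho.
Proof. by apply: le_trans Drho; rewrite -[m.*2.+2]addn2 natrD; have : 0 <= (m.*2)%:R :> R by []; lra. Qed.
Let e02 : 0 < e0 / 2. Proof. by rewrite divr_gt0. Qed.
Let e0K' : e0 / 2 <= K + 1. Proof. by move: e0K e0_gt0; lra. Qed.
Let pL0 : 0 < 2 * pi * L. Proof. by rewrite !mulr_gt0. Qed.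

Lemma smooth_oscP r x z : e0 <= r <= K -> z \in box 1 ->
  `|smooth_wgt r (x + z) - smooth_wgt r x| <= smooth_osc x.
Proof.
move=> /andP[er rK] z1.
have zD : z \in box m.*2.+2 by apply: sub_box z1.
have o0 : 0 <= smooth_osc x.
  apply: mulr_ge0; first by rewrite invr_ge0 ltW.
  apply: addr_ge0; last by rewrite mulr_ge0// ind2_ge0.
  by rewrite mulr_ge0 ?ind3_ge0// divr_ge0// ltW.
case: (boolP (rho / 2 <= rt R x)) => hx; last first.
  have h1 : rt R x < rho by rewrite -[x]addr0 (near_core_zero D1 Drho)// mem_box.
  have h2 := near_core_zero D1 Drho zD hx.
  by rewrite (smooth_core er h1) (smooth_core er h2) subrr normr0.
have [hQ|hQ] := ltP (2 * Q0) (rt R x).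
  have DQ : 16 * (m.*2.+2)%:R <= Q0.
    have := rho_Q0 L1 e0K'; have := Drho; have : 0 <= (m.*2.+2)%:R :> R by []; lra.
  have h2 := far_core D1 DQ zD hQ.
  have h1 : Q0 < rt R x by have : 0 < Q0 by [exact: expR_gt0]; lra.
  by rewrite (smooth_far rK h1) (smooth_far rK h2) subrr normr0.
have s0 : 0 < rt R x by move: rho64; lra.
have s16 : 16 * 1 <= rt R x by move: rho64; lra.
have n0 : nsq R x != 0 by rewrite -rt_sqr lt0r_neq0// exprn_gt0.
have [_ [_ _ _ ki _]] := displaced_kappa (lexx 1) s16 (sqr_xc R false x) (xc_box R false z1) (xc_box R (~~ false) z1).
rewrite -!xcD -(nsq_xc R false (x + z)) rt_sqr mulr1 in ki.
have hs : `|sgm L (x + z) - sgm L x| <= 10 / (rho * L).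
  have := displaced_sg L1 (lexx 1) s16 (sqr_xc R false x) (xc_box R false z1) (xc_box R (~~ false) z1).
  rewrite -!xcD -(nsq_xc R false (x + z)) rt_sqr mulr1 => /le_trans; apply.
  rewrite ler_pdivrMr ?mulr_gt0// (_ : 10 / (rho * L) * (rt R x * L) = 5 * (2 * rt R x / rho)); last first.
    by field; rewrite !lt0r_neq0.
  by rewrite -[leLHS]mulr1 ler_wpM2l// ler_pdivlMr//; lra.
have hp : `|psi (sgm L (x + z) - r) - psi (sgm L x - r)| <= e.
  by apply: psi_mod; rewrite opprB addrA subrK.
have -> : smooth_wgt r (x + z) - smooth_wgt r x = (2 * pi * L)^-1 *
   (((nsq R (x + z))^-1 - (nsq R x)^-1) * psi (sgm L (x + z) - r) +
    (nsq R x)^-1 * (psi (sgm L (x + z) - r) - psi (sgm L x - r))).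
  by rewrite /smooth_wgt !invfM; ring.
rewrite normrM ger0_norm ?invr_ge0 ?(ltW pL0)// /smooth_osc ler_wpM2l ?invr_ge0 ?(ltW pL0)//.
have i2 : ind2 L (e0 / 2) (K + 1) x = (nsq R x)^-1.
  rewrite /ind2 ifT// -rt_sqr !ler_sqr ?nnegrE ?rt_ge0 ?divr_ge0 ?mulr_ge0 ?(ltW rho0)//; first by rewrite hx.
  exact/ltW/expR_gt0.
rewrite i2 /ind3 hx (le_trans (ler_normD _ _))// lerD//.
  apply: (@le_trans _ _ (10 / rt R x ^+ 3 * (2 * delta)^-1)).
    by rewrite normrM ler_pM// (psi_norm psi_cut).
  by apply: eq_ler; field; rewrite !lt0r_neq0.
by rewrite mulrC normrM ler_pM// ger0_norm// invr_ge0 nsq_ge0.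
Qed.

Definition smooth_err : R := m%:R * (480 / (delta * rho) + e * annulus_const (K + 1)).

(** The pathwise bound contains occupations averaged over m steps, W the occupations themselves; the
    radial weights vary too slowly to tell them apart. *)
Lemma smooth_avg r (f : site -> R) : e0 <= r <= K -> (forall x, `|f x| <= 1) ->
  `|\sum_(x <- box b) smooth_wgt r x * iter m (@avg R) f x - \sum_(x <- box b) smooth_wgt r x * f x| <= smooth_err.
Proof.
move=> er f1.
have nb : (n + 2 <= b)%N by rewrite /b leq_add2r leq_addr.
have rK : r <= K by case/andP: er.
have n1 : `|1 : R| <= 1 by rewrite normr1.
have h := @sum_commute_iter R n b (smooth_wgt r) smooth_osc nb (smooth_supported rK)
  (fun x z => smooth_oscP x er) m (fun=> 1) f (fun=> n1) f1.
rewrite iter_avg1 in h.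
have e1 : \sum_(x <- box b) smooth_wgt r x * 1 * iter m (@avg R) f x = \sum_(x <- box b) smooth_wgt r x * iter m (@avg R) f x.
  by apply: eq_bigr => x _; rewrite mulr1.
have e2 : \sum_(x <- box b) smooth_wgt r x * 1 * f x = \sum_(x <- box b) smooth_wgt r x * f x.
  by apply: eq_bigr => x _; rewrite mulr1.
rewrite e1 e2 in h; apply: (le_trans h); rewrite /smooth_err ler_wpM2l//.
have -> : total_osc b smooth_osc = (2 * pi * L)^-1 * (5 / delta * inv_cube_sum L (e0 / 2) m n + e * inv_square_sum L (e0 / 2) (K + 1) m n).
  by rewrite /total_osc /inv_cube_sum /inv_square_sum !mulr_sumr -big_split mulr_sumr.
have h3 := inv_cube_sum_bound L (e0 / 2) m n.
have h2 := inv_square_sum_bound n L1 e02 e0K' Drho.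
have d5 : 0 <= 5 / delta by rewrite divr_ge0// ltW.
apply: (@le_trans _ _ ((2 * pi * L)^-1 * (5 / delta * (96 / rho) + e * (annulus_const (K + 1) * L)))).
  by rewrite ler_wpM2l ?invr_ge0 ?(ltW pL0)// lerD// ler_wpM2l.
have C40 : 0 <= annulus_const (K + 1).
  have Kp : 0 <= K by move: e0K e0_gt0; lra.
  have a : 0 <= pi * (K + 1) by rewrite mulr_ge0 ?(ltW p0)// addr_ge0.
  by rewrite /annulus_const; move: p0; lra.
have p2 : 2 <= pi :> R by exact: pi_ge2.
rewrite mulrDr lerD//.
  have -> : 5 / delta * (96 / rho) = 480 / (delta * rho) by field; rewrite !lt0r_neq0.
  have h0 : 0 <= 480 / (delta * rho) by exact: divr_ge0 (ler0n _ _) (ltW (mulr_gt0 d0 rho0)).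
  apply: (ler_piMl h0); rewrite invf_le1//.
  have : pi <= pi * L by rewrite ler_peMr// ltW.
  lra.
rewrite ler_pdivrMl// (_ : e * (annulus_const (K + 1) * L) = L * (e * annulus_const (K + 1))); last by ring.
rewrite ler_wpM2r ?mulr_ge0// ler_peMl ?(ltW L0)//; lra.
Qed.

End smoothing_weights.

(** * Mobility inequalities *)

Section weighted_mobility.
Variables (R : realType) (A : seq site) (a h u : site -> R) (d e : R).
Hypothesis a0 : forall x, 0 <= a x.
Hypothesis h01 : forall x, 0 <= h x <= 1.
Hypothesis u01 : forall x, 0 <= u x <= 1.
Hypothesis d01 : 0 <= d <= 8^-1.
Let wsum (f : site -> R) : R := \sum_(x <- A) a x * f x.
Let mass : R := \sum_(x <- A) a x.
Hypothesis mass1 : `|mass - 1| <= 2 * d.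
Hypothesis hu : `|wsum h - wsum u| <= e.

Let massM f : (forall x, 0 <= f x <= 1) -> 0 <= wsum f <= mass.
Proof.
move=> f01; apply/andP; split.
  by apply: sumr_ge0 => x _; rewrite mulr_ge0//; have /andP[] := f01 x.
by apply: ler_sum => x _; rewrite ler_piMr//; have /andP[] := f01 x.
Qed.

Let wsumD f g : wsum (fun x => f x + g x) = wsum f + wsum g.
Proof. by rewrite /wsum -big_split; apply: eq_bigr => x _; rewrite mulrDr. Qed.
Let wsumZ c f : wsum (fun x => c * f x) = c * wsum f.
Proof. by rewrite /wsum mulr_sumr; apply: eq_bigr => x _; rewrite mulrCA. Qed.
Let wsum1 c : wsum (fun=> c) = c * mass.
Proof. by rewrite /wsum mulr_sumr; apply: eq_bigr => x _; rewrite mulrC. Qed.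
Let wsum_le f g : (forall x, f x <= g x) -> wsum f <= wsum g.
Proof. by move=> fg; apply: ler_sum => x _; rewrite ler_wpM2l. Qed.

Lemma weighted_mobility_concave :
  wsum (fun x => h x - h x ^+ 2) <= mobility (wsum u) + 4 * d + 2 * e.
Proof.
have /andP[h0 hM] := massM h01; have /andP[u0 uM] := massM u01.
set p := wsum h in h0 hM *; set q := wsum u in u0 uM *.
move: mass1 hu; rewrite -/p -/q !ler_norml => /andP[M1 M2] /andP[e1 e2].
(* [wsum (h - p) ^ 2 >= 0]; the total mass is only close to 1. *)
have sq : p ^+ 2 * (2 - mass) <= wsum (fun x => h x ^+ 2).
  have : 0 <= wsum (fun x => h x ^+ 2 + ((- (2 * p)) * h x + p ^+ 2)).
    apply: sumr_ge0 => x _; rewrite mulr_ge0//.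
    by rewrite (_ : _ + _ = (h x - p) ^+ 2); [exact: sqr_ge0|ring].
  rewrite !wsumD wsumZ wsum1 -/p => k; rewrite -subr_ge0; apply: (le_trans k).
  by apply: eq_ler; ring.
have -> : wsum (fun x => h x - h x ^+ 2) = p - wsum (fun x => h x ^+ 2).
  by rewrite /p /wsum -sumrB; apply: eq_bigr => x _; rewrite mulrBr.
rewrite /mobility.
have /andP[d0 d8] := d01.
have pp : p ^+ 2 * (mass - 1) <= 4 * d.
  apply: (@le_trans _ _ (2 * (2 * d))); last by lra.
  apply: (@le_trans _ _ (p ^+ 2 * (2 * d))); first by rewrite ler_wpM2l// sqr_ge0.
  rewrite ler_wpM2r ?mulr_ge0// (@le_trans _ _ ((5 / 4) ^+ 2))//; last by lra.
  by rewrite ler_sqr ?nnegrE//; lra.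
have pq : (p - q) * (1 - p - q) <= 2 * e.
  apply: (le_trans (ler_norm _)); rewrite normrM mulrC ler_pM//; rewrite ler_norml; apply/andP; split; lra.
rewrite -subr_ge0; rewrite -subr_ge0 in pp; rewrite -subr_ge0 in pq; rewrite -subr_ge0 in sq.
have := addr_ge0 (addr_ge0 pp pq) sq; move/le_trans; apply.
by apply: eq_ler; ring.
Qed.

Lemma weighted_mobility_tangent (al : R) : 0 < al < 1 ->
  wsum (fun x => h x - h x ^+ 2) <=
  mobility al + (1 - 2 * al) * wsum (fun x => u x - al) + d + e.
Proof.
move=> /andP[al0 al1].
have -> : wsum (fun x => u x - al) = wsum u - al * mass.
  by rewrite -[al * mass]wsum1 /wsum -sumrB; apply: eq_bigr => x _; rewrite mulrBr.
(* The tangent of the mobility at [al]. *)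
have k : wsum (fun x => h x - h x ^+ 2) <= wsum (fun x => (1 - 2 * al) * h x + al ^+ 2).
  apply: wsum_le => x; rewrite -subr_ge0 (_ : _ - _ = (h x - al) ^+ 2); first exact: sqr_ge0.
  by ring.
apply: (le_trans k); rewrite wsumD wsumZ wsum1.
move: mass1 hu; set p := wsum h; set q := wsum u => m1 e1.
have a1 : (1 - 2 * al) * (p - q) <= e.
  apply: (le_trans (ler_norm _)); rewrite normrM -[leRHS]mul1r ler_pM//.
  by rewrite ler_norml; apply/andP; split; lra.
have am : mobility al <= 4^-1.
  rewrite /mobility -subr_ge0 (_ : _ - _ = (al - 2^-1) ^+ 2); first exact: sqr_ge0.
  by field.
have am0 : 0 <= mobility al by rewrite /mobility mulr_ge0//; lra.
have a2 : mobility al * (mass - 1) <= d.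
  apply: (le_trans (ler_norm _)); rewrite normrM ger0_norm//.
  by apply: (@le_trans _ _ (4^-1 * (2 * d))); [rewrite ler_pM|move: d01; lra].
rewrite -subr_ge0; rewrite -subr_ge0 in a1; rewrite -subr_ge0 in a2.
have := addr_ge0 a1 a2; move/le_trans; apply.
by apply: eq_ler; rewrite /mobility; ring.
Qed.

Lemma weighted_mobility_le1 : wsum (fun x => h x - h x ^+ 2) <= 1.
Proof.
apply: (@le_trans _ _ (wsum (fun=> 4^-1))).
  apply: wsum_le => x; rewrite -subr_ge0 (_ : _ - _ = (h x - 2^-1) ^+ 2); first exact: sqr_ge0.
  by field.
by rewrite wsum1; move: mass1 d01; rewrite ler_norml => /andP[]; lra.
Qed.

End weighted_mobility.

(** * Local densities averaged in time *)

Section time_averages.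
Variables (R : realType) (w : trajectory R).

Lemma continuous_density m x : continuous (fun eta : config => density R m eta x).
Proof.
elim: m x => [|m IH] x; first exact: continuous_occ.
rewrite (_ : (fun eta => _) = fun eta => 4^-1 * density R m eta (x + east) + (4^-1 * density R m eta (x - east) +
  (4^-1 * density R m eta (x + north) + (4^-1 * density R m eta (x - north) + (fun=> 0) eta)))); last first.
  by apply/funext => eta; rewrite /density iterS /avg; ring.
by do !apply: continuous_lin => //; exact: continuous_const.
Qed.

Lemma tint_density m x : tint (fun eta => density R m eta x) w = iter m (@avg R) (occupation w) x.
Proof.
elim: m x => [|m IH] x; first by [].
rewrite iterS /avg -!IH.
have c := @continuous_density m; have c0 : continuous (fun _ : config => 0 : R) by exact: continuous_const.
rewrite (_ : (fun eta => density R m.+1 eta x) = fun eta => 4^-1 * density R m eta (x + east) + (4^-1 * density R m eta (x - east) +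
  (4^-1 * density R m eta (x + north) + (4^-1 * density R m eta (x - north) + (fun=> 0) eta)))); last first.
  by apply/funext => eta; rewrite /density iterS /avg; ring.
do 3 (rewrite tint_lin//; last by do ?apply: continuous_lin).
rewrite tint_lin//.
by rewrite tint_cst; ring.
Qed.

Lemma density01 m x : 0 <= iter m (@avg R) (occupation w) x <= 1.
Proof.
elim: m x => [|m IH] x; first exact: occupation01.
rewrite iterS /avg.
have := IH (x + east); have := IH (x - east); have := IH (x + north); have := IH (x - north).
lra.
Qed.

(** Jensen's inequality in time: W contains the mobility of a time average, the potential the time
    average of a mobility. *)
Lemma tint_mobility m x : tint (fun eta => density R m eta x - density R m eta x ^+ 2) w <=
  iter m (@avg R) (occupation w) x - iter m (@avg R) (occupation w) x ^+ 2.
Proof.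
have c := @continuous_density m x; have c2 := continuous_sqr c.
rewrite (_ : (fun eta => _) = fun eta => (-1) * density R m eta x ^+ 2 + density R m eta x); last first.
  by apply/funext => eta; ring.
rewrite tint_lin// tint_density; have := tint_sqr w c; rewrite tint_density; lra.
Qed.

End time_averages.

(** * Lattice sums against integrals of the density profile *)

Section profile.
Variables (R : realType) (L e0 K delta : R) (psi : R -> R) (m n : nat).
Hypothesis L1 : 1 <= L.
Hypothesis e0_gt0 : 0 < e0.
Hypothesis e0K : e0 <= K.
Hypothesis delta01 : 0 < delta < 1.
Hypothesis delta8 : 8 * delta <= 1.
Hypothesis e0d : 8 * delta <= e0.
Hypothesis psi_cut : cutoff delta psi.
Hypothesis Drho : 32 * (m.*2.+2)%:R <= rho L (e0 / 2).
Hypothesis Qn : Q0 L (K + 1) <= n%:R.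
Let b := (n + m.*2.+1 + 2)%N.
Let L0 : 0 < L. Proof. exact: lt_le_trans L1. Qed.
Let d0 : 0 < delta. Proof. by case/andP: delta01. Qed.
Let p0 : 0 < pi :> R. Proof. exact: pi_gt0. Qed.
Let delta4 : 4 * delta <= 1. Proof. by move: delta8 d0; lra. Qed.
Let K0 : 0 < K. Proof. exact: lt_le_trans e0K. Qed.
Local Notation bm := (@bmeas _ _ R (radii K)).
Local Notation "'J' f" := (radial K f) (at level 10, f at level 9).

Definition smooth_avg_of (u : site -> R) (r : R) : R := \sum_(x <- box b) smooth_wgt L psi r x * u x.

Lemma bmeas_smooth_wgt x : bm (fun r => smooth_wgt L psi r x).
Proof. by apply: bmeas_scale; exact: (bmeas_psi K psi_cut). Qed.

Lemma bmeas_smooth u : bm (smooth_avg_of u).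
Proof.
apply: bmeas_sum => x _; apply: bmeas_mul; first exact: bmeas_smooth_wgt.
exact: bmeas_cst.
Qed.

Lemma radial_smooth (f : R -> R) (u : site -> R) : bm f -> J (fun r => f r * smooth_avg_of u r) =
  \sum_(x <- box b) u x / (2 * pi * L * nsq R x) * J (fun r => f r * psi (sgm L x - r)).
Proof.
move=> bf.
have bp x : bm (fun r => f r * psi (sgm L x - r)).
  by apply: bmeas_mul => //; exact: (bmeas_psi K psi_cut).
rewrite (_ : (fun r => _) = fun r => \sum_(x <- box b) u x / (2 * pi * L * nsq R x) * (f r * psi (sgm L x - r))).
  rewrite (radial_sum K0)//; last by move=> x _; apply: bmeas_scale.
  by apply: eq_bigr => x _; rewrite radial_scale.
apply/funext => r; rewrite /smooth_avg_of mulr_sumr; apply: eq_bigr => x _.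
by rewrite /smooth_wgt; ring.
Qed.

Lemma ind2_sgm x : 0 < nsq R x -> e0 / 2 <= sgm L x <= K + 1 -> ind2 L (e0 / 2) (K + 1) x = (nsq R x)^-1.
Proof.
move=> n0; rewrite sgm_ge// sgm_le// => /andP[h1 h2].
rewrite /ind2 ifT//; apply/andP; split.
  apply: le_trans h1; rewrite ler_sqr ?nnegrE ?divr_ge0 ?expR_ge0// ler_pdivrMr// ler_peMr ?expR_ge0//.
  by rewrite ler1n.
apply: (le_trans h2); rewrite ler_sqr ?nnegrE ?mulr_ge0 ?expR_ge0// ler_peMl ?expR_ge0//.
by rewrite ler1n.
Qed.

Let S2b : \sum_(x <- box b) ind2 L (e0 / 2) (K + 1) x <= annulus_const (K + 1) * L.
Proof.
have e02 : 0 < e0 / 2 by rewrite divr_gt0.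
have e0K' : e0 / 2 <= K + 1 by move: e0K e0_gt0; lra.
exact: (inv_square_sum_bound n L1 e02 e0K' Drho).
Qed.

(** Exchanging the integral with the lattice sum replaces [f] by its convolution with [psi]. The
    error is summed against 1 / (L |x|^2) over the annulus, which costs only the factor
    [annulus_const]. *)
Lemma smoothing_sum (f : R -> R) (F om : R) (u : site -> R) : continuous f -> (forall r, r < e0 \/ K < r -> f r = 0) ->
  (forall r, `|f r| <= F) -> (forall r r', `|r - r'| <= 2 * delta -> `|f r - f r'| <= om) ->
  (forall x, `|u x| <= 1) ->
  `|2 * pi * J (fun r => f r * smooth_avg_of u r) - L^-1 * \sum_(x <- box b) f (sgm L x) / nsq R x * u x|
  <= (2 * om + F * delta) * annulus_const (K + 1).
Proof.
move=> cf f_out fF f_om u1.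
have F0 : 0 <= F by exact: le_trans (normr_ge0 _) (fF 0).
have om0 : 0 <= om by rewrite (le_trans (normr_ge0 _) (@f_om 0 0 _))// subrr normr0 mulr_ge0// ltW.
have c0 : 0 <= 2 * om + F * delta by rewrite addr_ge0 ?mulr_ge0// ltW.
have bf : bm f by exact: (bmeas_cont K cf fF).
rewrite radial_smooth// !mulr_sumr -sumrB.
apply: (le_trans (ler_norm_sum _ _ _)).
apply: (@le_trans _ _ (\sum_(x <- box b) L^-1 * (2 * om + F * delta) * ind2 L (e0 / 2) (K + 1) x)).
  apply: ler_sum => x _.
  have i0 : 0 <= L^-1 * (2 * om + F * delta) * ind2 L (e0 / 2) (K + 1) x.
    by rewrite mulr_ge0 ?ind2_ge0// mulr_ge0// invr_ge0 ltW.
  have [n0|n0] := leP (nsq R x) 0.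
    have -> : nsq R x = 0 by apply/eqP; rewrite eq_le n0 nsq_ge0.
    by rewrite mulr0 invr0 !(mulr0, mul0r) subr0 normr0.
  have -> : 2 * pi * (u x / (2 * pi * L * nsq R x) * J (fun r => f r * psi (sgm L x - r))) -
     L^-1 * (f (sgm L x) / nsq R x * u x) =
     L^-1 * (nsq R x)^-1 * (- u x) * (f (sgm L x) - J (fun r => f r * psi (sgm L x - r))).
    set z := J _; move: (f (sgm L x)) z (pi : R) (lt0r_neq0 p0) (nsq R x) (lt0r_neq0 n0) => y z p pn v vn.
    by field; rewrite pn vn lt0r_neq0.
  rewrite normrM normrM normrN.
  have [h|h] : (sgm L x < e0 / 2 \/ K + 1 < sgm L x) \/ e0 / 2 <= sgm L x <= K + 1.
    have [a1|a1] := ltP (sgm L x) (e0 / 2); first by left; left.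
    by have [a2|a2] := ltP (K + 1) (sgm L x); [left; right|right].
    have [-> ->] := smoothing_out K0 delta01 psi_cut e0d f_out delta4 h.
    by rewrite subrr normr0 mulr0.
  rewrite ind2_sgm// (_ : L^-1 * (2 * om + F * delta) * (nsq R x)^-1 = L^-1 * (nsq R x)^-1 * 1 * (2 * om + F * delta)); last by ring.
  have v0 : 0 <= L^-1 * (nsq R x)^-1 by rewrite mulr_ge0 ?invr_ge0 ?(ltW L0) ?(ltW n0).
  rewrite (ger0_norm v0); apply: ler_pM; [exact: mulr_ge0|exact: normr_ge0|exact: ler_wpM2l|].
  exact: (smoothing_error K0 delta01 psi_cut cf e0d f_out fF f_om delta4).
rewrite -mulr_sumr.
apply: (@le_trans _ _ (L^-1 * (2 * om + F * delta) * (annulus_const (K + 1) * L))).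
  by rewrite ler_wpM2l// mulr_ge0// invr_ge0 ltW.
by apply: eq_ler; field; exact: lt0r_neq0.
Qed.

Variables (Hx h1 : R -> R) (B om om1 e alpha : R).
Hypothesis cH : continuous Hx.
Hypothesis ch1 : continuous h1.
Hypothesis H_out : forall r, r < e0 \/ K < r -> Hx r = 0.
Hypothesis h1_out : forall r, r < e0 \/ K < r -> h1 r = 0.
Hypothesis B0 : 0 <= B.
Hypothesis HB : forall r, `|Hx r| <= B.
Hypothesis h1B : forall r, `|h1 r| <= B.
Hypothesis H_om : forall r r', `|r - r'| <= 2 * delta -> `|Hx r ^+ 2 - Hx r' ^+ 2| <= om.
Hypothesis h1_om : forall r r', `|r - r'| <= 2 * delta -> `|h1 r - h1 r'| <= om1.
Hypothesis alpha01 : 0 < alpha < 1.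
Hypothesis e_ge0 : 0 <= e.
Hypothesis psi_mod : forall s s', `|s - s'| <= 10 / (rho L (e0 / 2) * L) -> `|psi s - psi s'| <= e.
Hypothesis hL : (12 * pi + 40) / (4 * pi * delta) <= delta * L.

Let G (r : R) : R := Hx r ^+ 2.
Let top : set R := `[2^-1 + 2 * delta, +oo[%classic.

(* The coefficients of the linear functional left by the tangent at [alpha]; the cut
   at [1/2 + 2 delta] makes them vanish for |x| < sqrt T. *)
Definition tail_coef (x : site) : R := 2 * (1 - 2 * alpha) / (L * nsq R x) *
  J (fun r => G r * \1_top r * psi (sgm L x - r)).

Let cG : continuous G.
Proof.
move=> r; rewrite /G; apply: (@continuous_comp _ _ _ Hx (fun y => y ^+ 2)); first exact: cH.
exact: exprn_continuous.
Qed.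
Let GB r : `|G r| <= B ^+ 2.
Proof. by rewrite /G normrX ler_sqr ?nnegrE. Qed.
Let G0 r : 0 <= G r. Proof. exact: sqr_ge0. Qed.
Let G_out r : r < e0 \/ K < r -> G r = 0.
Proof. by move=> h; rewrite /G H_out// expr0n. Qed.
Let bG : bm G. Proof. exact: (bmeas_cont K cG GB). Qed.
Let bh1 : bm h1. Proof. exact: (bmeas_cont K ch1 h1B). Qed.
Let mtop : measurable top. Proof. exact: measurable_itv. Qed.
Let bGt : bm (fun r => G r * \1_top r).
Proof. by apply: bmeas_mul => //; apply: bmeas_indic. Qed.

Variable u : site -> R.
Hypothesis u01 : forall x, 0 <= u x <= 1.
Let h x : R := iter m (@avg R) u x.
Hypothesis h01 : forall x, 0 <= h x <= 1.
Local Notation pm := (smooth_avg_of u).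
Local Notation se := (smooth_err L e0 K delta e m).

Definition truncated_profile (r : R) : R := mobility (if r < 2^-1 then pm r else alpha).
Local Notation Fm := truncated_profile.

Let bFm : bm Fm.
Proof.
have bmob : bm (fun r => mobility (pm r)).
  rewrite (_ : (fun r => _) = fun r => (-1) * (pm r * pm r) + pm r); last by apply/funext => r; rewrite /mobility; ring.
  have bs := bmeas_smooth u.
  by apply: bmeas_lin => //; exact: bmeas_mul.
rewrite (_ : Fm = fun r => \1_(`]-oo, 2^-1[%classic) r * ((- mobility alpha) * 1 + mobility (pm r)) + mobility alpha * 1).
  rewrite (_ : (fun r => _) = fun r => 1 * (\1_(`]-oo, 2^-1[%classic) r * ((- mobility alpha) * 1 + mobility (pm r))) + mobility alpha * 1);
    last by apply/funext => r; rewrite mul1r.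
  apply: bmeas_lin; last by apply: bmeas_scale; exact: bmeas_cst.
  apply: bmeas_mul; first by apply: bmeas_indic; exact: measurable_itv.
  by apply: bmeas_lin => //; exact: bmeas_cst.
apply/funext => r; rewrite indicE mem_setE.
have -> : (r \in `]-oo, 2^-1[) = (r < 2^-1) by rewrite in_itv.
by rewrite /truncated_profile; case: (r < 2^-1) => /=; ring.
Qed.

(* In the window [[1/2, 1/2 + 2 delta]] the mobility is simply bounded by 1. *)
Lemma profile_pointwise r :
  G r * smooth_avg_of (fun x => h x - h x ^+ 2) r <=
  G r * Fm r + (1 - 2 * alpha) * (G r * \1_top r * smooth_avg_of (fun x => u x - alpha) r) +
  (B ^+ 2 * \1_(`[2^-1, 2^-1 + 2 * delta]%classic) r + B ^+ 2 * (4 * delta + 2 * se)).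
Proof.
have B20 : 0 <= B ^+ 2 by rewrite sqr_ge0.
have GB' : G r <= B ^+ 2 by rewrite (le_trans (ler_norm _)).
have ue1 x : `|u x| <= 1.
  by case/andP: (u01 x) => a0 a1; rewrite ger0_norm.
have i01 : 0 <= \1_(`[2^-1, 2^-1 + 2 * delta]%classic) r :> R by rewrite indicE.
have [hr|hr] : (r < e0 \/ K < r) \/ e0 <= r <= K.
    have [a1|a1] := ltP r e0; first by left; left.
    by have [a2|a2] := ltP K r; [left; right|right].
  have se0 : 0 <= se.
    have er : e0 <= e0 <= K by rewrite lexx e0K.
    by apply: le_trans (normr_ge0 _) (smooth_avg L1 e0_gt0 e0K delta01 delta4 e0d psi_cut Drho Qn e_ge0 psi_mod er ue1).
  rewrite G_out// !mul0r mulr0 !add0r.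
  apply: addr_ge0; first exact: mulr_ge0.
  apply: (mulr_ge0 B20); exact: (addr_ge0 (mulr_ge0 (ler0n _ _) (ltW d0)) (mulr_ge0 (ler0n _ _) se0)).
have se1 := smooth_avg L1 e0_gt0 e0K delta01 delta4 e0d psi_cut Drho Qn e_ge0 psi_mod hr ue1.
have se0 : 0 <= se by exact: le_trans (normr_ge0 _) se1.
have M1 : `|smooth_mass L psi m n r - 1| <= 2 * delta by exact: (smooth_mass_bound m L1 delta01 delta4 e0d psi_cut Qn hr hL).
have a0 x : 0 <= smooth_wgt L psi r x by exact: (smooth_wgt_ge0 L1 psi_cut).
have dd : 0 <= delta <= 8^-1 by apply/andP; split; move: d0 delta8; lra.
have m0 : 0 <= mobility alpha.
  by case/andP: alpha01 => y0 y1; rewrite mulr_ge0//; lra.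
rewrite -/b -/h in se1 M1.
rewrite -mulrA.
have key y z : smooth_avg_of (fun x => h x - h x ^+ 2) r <= y + (4 * delta + 2 * se) + z -> 0 <= z ->
   G r * smooth_avg_of (fun x => h x - h x ^+ 2) r <= G r * y + (B ^+ 2 * z + B ^+ 2 * (4 * delta + 2 * se)).
  move=> q z0; apply: (le_trans (ler_wpM2l (G0 r) q)); rewrite !mulrDr -[G r * y + _ + _]addrA lerD2l addrC lerD//.
    exact: ler_wpM2r.
  rewrite -!mulrDr; apply: ler_wpM2r => //.
  by apply: addr_ge0; [exact: mulr_ge0 (ler0n _ _) (ltW d0)|exact: mulr_ge0 (ler0n _ _) se0].
set I1 := \1_(`[_, _]%classic) r in i01 *.
rewrite [(1 - 2 * alpha) * (G r * _)]mulrCA -[G r * Fm r + _]mulrDr; apply: (key _ I1) => //.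
rewrite /Fm; set q := smooth_avg_of _ r.
have [r2|r2] := ltP r 2^-1.
  have -> : \1_top r = 0 :> R.
    rewrite indicE mem_setE in_itv /= andbT; case: leP => //; move: d0; lra.
  have := weighted_mobility_concave a0 h01 u01 dd M1 se1; rewrite -/(smooth_avg_of u r) -/(smooth_avg_of _ r) -/q.
  rewrite mul0r mulr0 addr0; lra.
have [r3|r3] := ltP r (2^-1 + 2 * delta).
  have -> : \1_top r = 0 :> R by rewrite indicE mem_setE in_itv /= andbT leNgt r3.
  have -> : I1 = 1 by rewrite /I1 indicE mem_setE in_itv /= r2 (ltW r3).
  have := weighted_mobility_le1 h a0 dd M1; rewrite -/(smooth_avg_of _ r) -/q mul0r mulr0 addr0.
  by move: d0 se0 m0; lra.
have -> : \1_top r = 1 :> R by rewrite indicE mem_setE in_itv /= andbT r3.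
have := weighted_mobility_tangent a0 dd M1 se1 alpha01.
rewrite -/(smooth_avg_of _ r) -/(smooth_avg_of _ r) -/q mul1r.
set z := smooth_avg_of _ r; set v := (1 - _) * z; move: d0 se0 i01; lra.
Qed.

Definition profile_err : R :=
  (2 * om1 + B * delta) * annulus_const (K + 1) + 2 * ((2 * om + B ^+ 2 * delta) * annulus_const (K + 1)) +
  4 * pi * (B ^+ 2 * (2 * delta) + B ^+ 2 * (4 * delta + 2 * se) * (K + 1)).

(** [profile_pointwise] integrated over r. The tail is carried to the lattice exactly by
    [radial_smooth]; the other two terms use [smoothing_sum]. *)
Lemma profile_bound :
  - (2 * pi * J (fun r => h1 r * pm r)) - 4 * pi * J (fun r => G r * Fm r) <=
  - (L^-1 * \sum_(x <- box b) h1 (sgm L x) / nsq R x * u x)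
  - 2 * (L^-1 * \sum_(x <- box b) Hx (sgm L x) ^+ 2 / nsq R x * (h x - h x ^+ 2))
  + \sum_(x <- box b) tail_coef x * (u x - alpha) + profile_err.
Proof.
have ue1 x : `|u x| <= 1.
  by case/andP: (u01 x) => a0 a1; rewrite ger0_norm.
have qe1 x : `|h x - h x ^+ 2| <= 1.
  case/andP: (h01 x) => a0 a1; rewrite (_ : h x - h x ^+ 2 = h x * (1 - h x)); last by ring.
  by rewrite ger0_norm ?mulr_ge0 ?subr_ge0// mulr_ile1 ?subr_ge0//; lra.
have d1 := smoothing_sum ch1 h1_out h1B h1_om ue1.
have d2 := smoothing_sum cG G_out GB H_om qe1.
have bs1 := bmeas_smooth (fun x => h x - h x ^+ 2); have bs2 := bmeas_smooth (fun x => u x - alpha).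
have b1 : bm (fun r => G r * Fm r) by exact: bmeas_mul.
have b2 : bm (fun r => G r * \1_top r * smooth_avg_of (fun x => u x - alpha) r) by exact: bmeas_mul.
have bi : bm (\1_(`[2^-1, 2^-1 + 2 * delta]%classic)) by apply: bmeas_indic; exact: measurable_itv.
have b3 : bm (fun r => B ^+ 2 * \1_(`[2^-1, 2^-1 + 2 * delta]%classic) r + B ^+ 2 * (4 * delta + 2 * se)).
  by apply: bmeas_lin => //; exact: bmeas_cst.
have i1 : J (fun r => G r * smooth_avg_of (fun x => h x - h x ^+ 2) r) <= J (fun r => G r * Fm r) +
  ((1 - 2 * alpha) * J (fun r => G r * \1_top r * smooth_avg_of (fun x => u x - alpha) r) +
   (B ^+ 2 * (2 * delta) + B ^+ 2 * (4 * delta + 2 * se) * (K + 1))).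
  have b23 : bm (fun r => (1 - 2 * alpha) * (G r * \1_top r * smooth_avg_of (fun x => u x - alpha) r) +
    (B ^+ 2 * \1_(`[2^-1, 2^-1 + 2 * delta]%classic) r + B ^+ 2 * (4 * delta + 2 * se))) by apply: bmeas_lin.
  apply: (@le_trans _ _ (J (fun r => 1 * (G r * Fm r) + ((1 - 2 * alpha) * (G r * \1_top r * smooth_avg_of (fun x => u x - alpha) r) +
    (B ^+ 2 * \1_(`[2^-1, 2^-1 + 2 * delta]%classic) r + B ^+ 2 * (4 * delta + 2 * se)))))).
    apply: (radial_mono K0) => //; [exact: bmeas_mul|exact: bmeas_lin|].
    by move=> r _; rewrite mul1r addrA; exact: profile_pointwise.
  rewrite (radial_lin K0)// mul1r lerD2l (radial_lin K0)// lerD2l (radial_lin K0)//; last exact: bmeas_cst.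
  have -> : J (fun=> B ^+ 2 * (4 * delta + 2 * se)) = B ^+ 2 * (4 * delta + 2 * se) * (K + 1).
    exact: (@Int_cst _ _ R (@lebesgue_measure R) (radii K) (measurable_radii K) _ (measure_radii K0)).
  rewrite lerD2r ler_wpM2l ?sqr_ge0//.
  have le12 : 2^-1 <= 2^-1 + 2 * delta by rewrite lerDl mulr_ge0// ltW.
  have := radial_itv_le K0 (ler01 : 0 <= 1 :> R) le12.
  rewrite (_ : (fun r => 1 * _) = \1_(`[2^-1, 2^-1 + 2 * delta]%classic)); last by apply/funext => r; rewrite mul1r.
  by move/le_trans; apply; move: d0; lra.
have tl : 4 * pi * ((1 - 2 * alpha) * J (fun r => G r * \1_top r * smooth_avg_of (fun x => u x - alpha) r)) =
  \sum_(x <- box b) tail_coef x * (u x - alpha).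
  rewrite radial_smooth// !mulr_sumr; apply: eq_bigr => x _; rewrite /tail_coef.
  set z := J _; have [n0|n0] := leP (nsq R x) 0.
    have -> : nsq R x = 0 by apply/eqP; rewrite eq_le n0 nsq_ge0.
    by rewrite !mulr0 invr0 !(mulr0, mul0r).
  move: z (pi : R) (lt0r_neq0 p0) (nsq R x) (lt0r_neq0 n0) => z p pn v vn.
  by field; rewrite pn vn lt0r_neq0.
have i2 (p j2 j3 j4 E : R) : 0 <= p -> j2 <= j3 + (j4 + E) -> 2 * (2 * p * j2) <= 4 * p * j3 + 4 * p * j4 + 4 * p * E.
  move=> pp hj; rewrite -!mulrDr -addrA (_ : 2 * (2 * p * j2) = 4 * p * j2); last by ring.
  by rewrite ler_wpM2l// mulr_ge0.
have {i1} := i2 _ _ _ _ _ (ltW p0) i1.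
rewrite -tl /profile_err; move: d1 d2; rewrite !ler_norml => /andP[d1 _] /andP[d2 _].
move: d1 d2.
move: (4 * pi * J (fun r => G r * Fm r)) (4 * pi * (_ * J _)) (4 * pi * (_ + _)) ((2 * om1 + B * delta) * annulus_const (K + 1)) ((2 * om + B ^+ 2 * delta) * annulus_const (K + 1)).
move: (2 * pi * J (fun r => h1 r * pm r)) (2 * pi * J _) (L^-1 * _) (L^-1 * _) => *; lra.
Qed.

Lemma radial_top_psi s : 0 <= J (fun r => G r * \1_top r * psi (s - r)) <= 2 * B ^+ 2.
Proof.
have bp := bmeas_psi K psi_cut s.
have i01 (r : R) : 0 <= (\1_top r : R) <= 1 by rewrite indicE; apply/andP; case: (r \in top).
have g1 r : 0 <= G r * \1_top r <= B ^+ 2.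
  have /andP[a1 a2] := i01 r; apply/andP; split; first exact: mulr_ge0 (G0 r) a1.
  by apply: (le_trans (ler_piMr (G0 r) a2)); exact: le_trans (ler_norm _) (GB r).
have bgp : bm (fun r => G r * \1_top r * psi (s - r)) by exact: bmeas_mul.
have bB : bm (fun r => B ^+ 2 * psi (s - r)) by exact: bmeas_scale.
apply/andP; split.
  have -> : 0 = J (fun r => 0 * psi (s - r)) by rewrite (radial_scale K0)// mul0r.
  apply: (radial_mono K0) => //; first exact: bmeas_scale.
  by move=> r _; rewrite ler_wpM2r ?(psi_ge0 psi_cut)//; case/andP: (g1 r).
apply: (@le_trans _ _ (B ^+ 2 * (1 + delta))); last first.
  by rewrite mulrC ler_wpM2r ?sqr_ge0//; move: delta8 d0; lra.
apply: (@le_trans _ _ (J (fun r => B ^+ 2 * psi (s - r)))).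
  by apply: (radial_mono K0) => // r _; rewrite ler_wpM2r ?(psi_ge0 psi_cut)//; case/andP: (g1 r).
by rewrite (radial_scale K0)// ler_wpM2l ?sqr_ge0//; exact: (radial_psi_le K0 delta01 psi_cut).
Qed.

Lemma tail_coef_bound x : `|tail_coef x| <= 4 * B ^+ 2 / (L * nsq R x).
Proof.
have v0 : 0 <= (L * nsq R x)^-1 by rewrite invr_ge0 mulr_ge0 ?nsq_ge0// ltW.
have /andP[j0 j1] := radial_top_psi (sgm L x).
rewrite /tail_coef normrM (ger0_norm j0).
have -> : 4 * B ^+ 2 / (L * nsq R x) = 2 / (L * nsq R x) * (2 * B ^+ 2) by ring.
apply: ler_pM => //; rewrite normrM (ger0_norm v0) ler_wpM2r// normrM ger0_norm// ler_piMr//.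
by case/andP: alpha01 => a0 a1; rewrite ler_norml; apply/andP; split; lra.
Qed.

Lemma tail_coef_out x : ~~ (2^-1 <= sgm L x <= K + 1) -> tail_coef x = 0.
Proof.
move=> hx; rewrite /tail_coef (_ : (fun r => _) = fun r => 0 * psi (sgm L x - r)).
  by rewrite (radial_scale K0) ?mul0r ?mulr0//; exact: (bmeas_psi K psi_cut).
apply/funext => r; rewrite mul0r indicE mem_setE in_itv /= andbT.
case: (leP (2^-1 + 2 * delta) r) => r1; last by rewrite mulr0 mul0r.
have [r2|r2] := ltP K r; first by rewrite G_out ?mul0r//; right.
rewrite (psi_out delta01 psi_cut) ?mulr0//.
move: hx; rewrite negb_and -!ltNge => /orP[hx|hx].
  by rewrite ltr0_norm; move: d0; lra.
by rewrite gtr0_norm; move: d0 delta8; lra.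
Qed.

(** The coefficients live on |x|^2 >= exp L, which is T when L = ln T. In the square one factor 1 /
    |x|^2 is spent on this and the other kept for the lattice sum. The sum of squares is thus of
    order 1 / (L T), small enough to allow an exponential tilt of order T / L. *)
Lemma tail_coef_le x : `|tail_coef x| <= 4 * B ^+ 2 / (L * expR L) /\
  tail_coef x ^+ 2 <= 16 * B ^+ 4 / (L ^+ 2 * expR L) * ind2 L (e0 / 2) (K + 1) x.
Proof.
have E0 : 0 < expR L by exact: expR_gt0.
have B4 : 0 <= B ^+ 4 by rewrite exprn_ge0.
have c0 : 0 <= 16 * B ^+ 4 / (L ^+ 2 * expR L).
  by rewrite divr_ge0 ?mulr_ge0// ?sqr_ge0// ltW.
have LE0 : 0 <= L * expR L by rewrite mulr_ge0// ltW.
have B2 : 0 <= 4 * B ^+ 2 by exact: mulr_ge0 (ler0n _ _) (sqr_ge0 _).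
have r1 : 0 <= 4 * B ^+ 2 / (L * expR L) by exact: divr_ge0.
have r2 : 0 <= 16 * B ^+ 4 / (L ^+ 2 * expR L) * ind2 L (e0 / 2) (K + 1) x.
  by exact: mulr_ge0 c0 (ind2_ge0 _ _ _ _).
case: (boolP (2^-1 <= sgm L x <= K + 1)) => hx; last first.
  by rewrite tail_coef_out// normr0 expr0n /=; split; [exact: r1|exact: r2].
have tb := tail_coef_bound x.
have [n0|n0] := leP (nsq R x) 0.
  have : tail_coef x = 0.
    have n00 : nsq R x = 0 by apply/eqP; rewrite eq_le n0 nsq_ge0.
    by rewrite /tail_coef n00 mulr0 invr0 mulr0 mul0r.
  by move=> ->; rewrite normr0 expr0n /=; split; [exact: r1|exact: r2].
case/andP: hx => k1 k2.
have nE : expR L <= nsq R x.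
  move: k1; rewrite sgm_ge// -expRM_natl (_ : 2 * (L * 2^-1) = L)//; by field.
have iE : (nsq R x)^-1 <= (expR L)^-1 by rewrite lef_pV2.
have L2 : 0 <= L^-1 by rewrite invr_ge0 ltW.
have i0 : 0 <= (nsq R x)^-1 by rewrite invr_ge0 ltW.
have iE0 : 0 <= (expR L)^-1 by rewrite invr_ge0 ltW.
split.
  by apply: (le_trans tb); rewrite ler_wpM2l// !invfM ler_wpM2l.
have [k3|k3] := leP (e0 / 2) (sgm L x); last first.
  rewrite (_ : tail_coef x = 0) ?expr0n//.
  rewrite /tail_coef (_ : (fun r => _) = fun r => 0 * psi (sgm L x - r)).
    by rewrite (radial_scale K0) ?mul0r ?mulr0//; exact: (bmeas_psi K psi_cut).
  apply/funext => r; rewrite mul0r; have [r3|r3] := ltP r e0; first by rewrite G_out ?mul0r//; left.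
  by rewrite (psi_out delta01 psi_cut) ?mulr0// ltr0_norm; move: d0 e0d; lra.
rewrite ind2_sgm ?k3 ?k2//.
apply: (@le_trans _ _ ((4 * B ^+ 2 / (L * nsq R x)) ^+ 2)).
  rewrite -[tail_coef x ^+ 2]real_normK ?num_real// ler_sqr ?nnegrE//.
  exact: le_trans tb.
have -> : (4 * B ^+ 2 / (L * nsq R x)) ^+ 2 = 16 * B ^+ 4 * (L^-1 ^+ 2) * (nsq R x)^-1 * (nsq R x)^-1.
  by rewrite invfM; ring.
apply: ler_wpM2r => //.
rewrite (_ : 16 * B ^+ 4 / (L ^+ 2 * expR L) = 16 * B ^+ 4 * L^-1 ^+ 2 * (expR L)^-1); last by rewrite invfM exprVn mulrA.
apply: ler_wpM2l => //; exact: mulr_ge0 (mulr_ge0 (ler0n _ _) B4) (sqr_ge0 _).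
Qed.

Lemma tail_coef_sum : \sum_(x <- box b) tail_coef x ^+ 2 <= 16 * B ^+ 4 * annulus_const (K + 1) / (L * expR L).
Proof.
have E0 : 0 < expR L by exact: expR_gt0.
apply: (@le_trans _ _ (\sum_(x <- box b) 16 * B ^+ 4 / (L ^+ 2 * expR L) * ind2 L (e0 / 2) (K + 1) x)).
  by apply: ler_sum => x _; have [] := tail_coef_le x.
rewrite -mulr_sumr.
apply: (@le_trans _ _ (16 * B ^+ 4 / (L ^+ 2 * expR L) * (annulus_const (K + 1) * L))).
  rewrite ler_wpM2l//; apply: divr_ge0; first exact: mulr_ge0 (ler0n _ _) (exprn_ge0 _ B0).
  by rewrite mulr_ge0 ?sqr_ge0// ltW.
by apply: eq_ler; field; rewrite !lt0r_neq0.
Qed.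

End profile.

(** * Deviations of W *)

Section profile_of_trajectory.
Variables (R : realType) (T alpha e0 K delta : R) (psi : R -> R -> R) (H Hx h1 : R -> R) (m n : nat).
Local Notation L := (ln T).
Hypothesis T1 : 1 < T.
Hypothesis L1 : 1 <= L.
Hypothesis e0_gt0 : 0 < e0.
Hypothesis e0K : e0 <= K.
Hypothesis delta01 : 0 < delta < 1.
Hypothesis delta8 : 8 * delta <= 1.
Hypothesis e0d : 8 * delta <= e0.
Hypothesis psi_cut : cutoff delta (psi delta).
Hypothesis Qn : Q0 L (K + 1) <= n%:R.
Hypothesis HE : forall r, 0 < r -> Hx r = H r /\ h1 r = (H^`())%classic r.
Hypothesis H_out : forall r, r < e0 \/ K < r -> Hx r = 0.
Hypothesis h1_out : forall r, r < e0 \/ K < r -> h1 r = 0.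
Local Notation b := (n + m.*2.+1 + 2)%N.
Local Notation sd w := (smoothed_density psi delta T w).
Local Notation pm w := (smooth_avg_of L (psi delta) m n (occupation w)).
Let L0 : 0 < L. Proof. exact: lt_le_trans L1. Qed.
Let d0 : 0 < delta. Proof. by case/andP: delta01. Qed.
Let p0 : 0 < pi :> R. Proof. exact: pi_gt0. Qed.
Let K0 : 0 < K. Proof. exact: lt_le_trans e0K. Qed.
Let delta4 : 4 * delta <= 1. Proof. by move: delta8 d0; lra. Qed.

(** For r >= e0 the window of [psi] stays away from 0, so the restriction of the pairing to (0, +oo)
    is not felt; for r <= K it stays inside the box. *)
Lemma smoothed_densityE w r : e0 <= r <= K -> sd w r = pm w r.
Proof.
move=> /andP[er rK].
have cf : continuous (fun s => psi delta (s - r)).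
  move=> s; apply: continuous_comp; last by case: psi_cut => c _ _ _; exact: c.
  by apply: continuousB; [exact: cvg_id|exact: cst_continuous].
rewrite /smoothed_density (@pairing_sum _ _ w T1 _ b cf); last 2 first.
- by move=> s; exact: (psi_ge0 psi_cut).
- move=> x xb; rewrite log_radius_sgm.
  have xn : x \notin box n by apply: contra xb; apply: sub_box; rewrite -addnA leq_addr.
  have Q00 : 0 < Q0 L (K + 1) by exact: expR_gt0.
  have hx : Q0 L (K + 1) < rt R x by exact: le_lt_trans Qn (box_rt R xn).
  have n0 : 0 < nsq R x by rewrite -rt_sqr exprn_gt0// (lt_trans Q00).
  have := smooth_far L1 delta01 delta4 psi_cut rK hx.
  rewrite /smooth_wgt => /eqP; rewrite mulf_eq0 invr_eq0 => /orP[|/eqP//].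
  by rewrite gt_eqF// !mulr_gt0.
apply: eq_bigr => x _; rewrite log_radius_sgm /smooth_wgt.
case: ltP => hs; last first.
  rewrite (psi_out delta01 psi_cut) ?mulr0 ?mul0r// ltr0_norm; move: d0 e0d e0_gt0; lra.
by rewrite [(2 * pi * L * _)^-1]invfM; ring.
Qed.

Lemma Rintegral_radial (f g : R -> R) : (forall r, 0 < r -> f r = g r) ->
  (forall r, K < r -> g r = 0) ->
  \int[@lebesgue_measure R]_(r in `]0%R, +oo[) f r = radial K g.
Proof.
move=> fg gK; rewrite /radial Rintegral_mkcond [RHS]Rintegral_mkcond.
apply: eq_Rintegral => r _; rewrite /patch !mem_setE !in_itv /= andbT.
case: ltP => r0 //=; rewrite fg//; case: leP => // rK.
by rewrite gK//; move: rK; lra.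
Qed.

Lemma W_radial w : W psi alpha H T delta w =
  - (2 * pi * radial K (fun r => h1 r * pm w r))
  - 4 * pi * radial K (fun r => Hx r ^+ 2 * truncated_profile L (psi delta) m n alpha (occupation w) r).
Proof.
have cases r : (r < e0 \/ K < r) \/ e0 <= r <= K.
  have [a1|a1] := ltP r e0; first by left; left.
  by have [a2|a2] := ltP K r; [left; right|right].
rewrite /W (@Rintegral_radial _ (fun r => h1 r * pm w r)); last 2 first.
- move=> r r0; have [e1 e2] := HE r0; rewrite -e2.
  case: (cases r) => hr; first by rewrite h1_out ?mul0r.
  by rewrite smoothed_densityE.
- by move=> r hr; rewrite h1_out ?mul0r//; right.
rewrite (@Rintegral_radial _ (fun r => Hx r ^+ 2 * truncated_profile L (psi delta) m n alpha (occupation w) r)); last 2 first.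
- move=> r r0; have [e1 e2] := HE r0; rewrite -e1.
  case: (cases r) => hr; first by rewrite H_out// expr0n !mul0r.
  by rewrite /truncated_density smoothed_densityE.
- by move=> r hr; rewrite H_out ?expr0n ?mul0r//; right.
by ring.
Qed.

Variable B : R.
Hypothesis cH : continuous Hx.
Hypothesis ch1 : continuous h1.
Hypothesis HB : forall r, `|Hx r| <= B.
Hypothesis h1B : forall r, `|h1 r| <= B.

(** Serves measurability: W is a quadratic polynomial in finitely many occupation times, each of
    them measurable in the trajectory. *)
Lemma W_polynomial : exists (c0 : R) (c1 : site -> R) (c2 : site -> site -> R), forall w,
  W psi alpha H T delta w = c0 + \sum_(x <- box b) occupation w x * c1 x +
    \sum_(x <- box b) \sum_(y <- box b) occupation w x * occupation w y * c2 x y.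
Proof.
pose G r := Hx r ^+ 2; pose chi : R -> R := \1_(`]-oo, 2^-1[%classic).
pose ps x r := psi delta (sgm L x - r); pose D x := (2 * pi * L * nsq R x)^-1.
have cG : continuous G.
  move=> r; rewrite /G; apply: (@continuous_comp _ _ _ Hx (fun y => y ^+ 2)); first exact: cH.
  exact: exprn_continuous.
have GB r : `|G r| <= B ^+ 2 by rewrite /G normrX lerXn2r ?nnegrE// (le_trans _ (HB r)).
have bG : bmeas (radii K) G by exact: (bmeas_cont K cG GB).
have bh : bmeas (radii K) h1 by exact: (bmeas_cont K ch1 h1B).
have bchi : bmeas (radii K) chi by apply: bmeas_indic; exact: measurable_itv.
have bGc : bmeas (radii K) (fun r => G r * chi r) by exact: bmeas_mul.
have bps x : bmeas (radii K) (ps x) by exact: (bmeas_psi K psi_cut).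
exists (- (4 * pi * (mobility alpha * radial K (fun r => (-1) * (G r * chi r) + G r)))).
exists (fun x => - (2 * pi * (D x * radial K (fun r => h1 r * ps x r))) -
  4 * pi * (D x * radial K (fun r => G r * chi r * ps x r))).
exists (fun x y => 4 * pi * (D x * D y * radial K (fun r => G r * chi r * ps x r * ps y r))) => w.
set u := occupation w; set q := pm w.
have bq : bmeas (radii K) q by exact: (bmeas_smooth L K m n psi_cut).
have sm := radial_smooth L m n e0_gt0 e0K psi_cut u.
have e1 : radial K (fun r => h1 r * q r) = \sum_(x <- box b) u x * (D x * radial K (fun r => h1 r * ps x r)).
  by rewrite sm//; apply: eq_bigr => x _; rewrite -mulrA.
have e2 : radial K (fun r => G r * chi r * q r) = \sum_(x <- box b) u x * (D x * radial K (fun r => G r * chi r * ps x r)).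
  by rewrite sm//; apply: eq_bigr => x _; rewrite -mulrA.
have e3 : radial K (fun r => G r * chi r * q r * q r) = \sum_(x <- box b) \sum_(y <- box b)
    u x * u y * (D x * D y * radial K (fun r => G r * chi r * ps x r * ps y r)).
  rewrite sm; last exact: bmeas_mul.
  apply: eq_bigr => x _.
  have -> : (fun r => G r * chi r * q r * psi delta (sgm L x - r)) = fun r => G r * chi r * ps x r * q r.
    by apply/funext => r; rewrite mulrAC.
  rewrite sm; last exact: bmeas_mul.
  rewrite mulr_sumr; apply: eq_bigr => y _; rewrite -/(D x) -/(D y) -/(ps y); ring.
have e4 : radial K (fun r => Hx r ^+ 2 * truncated_profile L (psi delta) m n alpha u r) =
   1 * radial K (fun r => G r * chi r * q r) + ((-1) * radial K (fun r => G r * chi r * q r * q r) +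
   mobility alpha * radial K (fun r => (-1) * (G r * chi r) + G r)).
  have b1 : bmeas (radii K) (fun r => (-1) * (G r * chi r) + G r) by exact: bmeas_lin.
  have b2 : bmeas (radii K) (fun r => G r * chi r * q r) by exact: bmeas_mul.
  have b3 : bmeas (radii K) (fun r => G r * chi r * q r * q r) by exact: bmeas_mul.
  have b4 : bmeas (radii K) (fun r => mobility alpha * ((-1) * (G r * chi r) + G r)) by exact: bmeas_scale.
  rewrite -(radial_scale K0 _ b1) -(radial_lin K0)// -(radial_lin K0)//; last exact: bmeas_lin.
  congr radial; apply/funext => r; rewrite /truncated_profile -/q -/(G r).
  have -> : chi r = (r < 2^-1)%R%:R by rewrite /chi indicE mem_setE in_itv.
  by rewrite /mobility; case: (r < 2^-1) => /=; ring.
rewrite W_radial -/q -/u e1 e4 e2 e3.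
have -> : \sum_(x <- box b) u x * (- (2 * pi * (D x * radial K (fun r => h1 r * ps x r))) -
     4 * pi * (D x * radial K (fun r => G r * chi r * ps x r))) =
   - (2 * pi * \sum_(x <- box b) u x * (D x * radial K (fun r => h1 r * ps x r))) -
     4 * pi * \sum_(x <- box b) u x * (D x * radial K (fun r => G r * chi r * ps x r)).
  rewrite !mulr_sumr -sumrN -sumrB; apply: eq_bigr => x _; ring.
have -> : \sum_(x <- box b) \sum_(y <- box b) u x * u y *
     (4 * pi * (D x * D y * radial K (fun r => G r * chi r * ps x r * ps y r))) =
   4 * pi * \sum_(x <- box b) \sum_(y <- box b) u x * u y *
     (D x * D y * radial K (fun r => G r * chi r * ps x r * ps y r)).
  rewrite mulr_sumr; apply: eq_bigr => x _; rewrite mulr_sumr; apply: eq_bigr => y _; ring.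
move: (\sum_(x <- _) _) (\sum_(x <- _) _) (\sum_(x <- _) _) (radial K _) (pi : R) => z1 z2 z3 z4 p.
by ring.
Qed.

Lemma W_measurable (P : probability (trajectory R) R) : measurable_fun setT (W psi alpha H T delta).
Proof.
have [c0 [c1 [c2 hW]]] := W_polynomial.
have bo x := bmeas_tint P (@continuous_occ R x).
have bc (a : R) : bmeas [set: trajectory R] (fun=> a) by exact: bmeas_cst.
have [//] : bmeas [set: trajectory R] (W psi alpha H T delta).
rewrite (_ : W _ _ _ _ _ = fun w => 1 * (1 * (\sum_(x <- box b) occupation w x * c1 x) +
    \sum_(x <- box b) \sum_(y <- box b) occupation w x * occupation w y * c2 x y) + c0); last first.
  by apply/funext => w; rewrite hW; ring.
apply: bmeas_lin => //; apply: bmeas_lin.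
  by apply: bmeas_sum => x _; apply: bmeas_mul => //; exact: bo.
apply: bmeas_sum => x _; apply: bmeas_sum => y _; apply: bmeas_mul => //.
by apply: bmeas_mul; exact: bo.
Qed.

End profile_of_trajectory.

(** * Pathwise bound of W and the two deviation events *)

Section upper_bound.
Variables (R : realType) (T alpha e0 K delta : R) (psi : R -> R -> R) (H HH Hx h1 : R -> R) (m n : nat).
Variables (B om om1 e e1 : R).
Local Notation L := (ln T).
Hypothesis T1 : 1 < T.
Hypothesis L1 : 1 <= L.
Hypothesis e0_gt0 : 0 < e0.
Hypothesis e0K : e0 <= K.
Hypothesis delta01 : 0 < delta < 1.
Hypothesis delta8 : 8 * delta <= 1.
Hypothesis e0d : 8 * delta <= e0.
Hypothesis psi_cut : cutoff delta (psi delta).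
Hypothesis Drho : 32 * (m.*2.+2)%:R <= rho L (e0 / 2).
Hypothesis Qn : Q0 L (K + 1) <= n%:R.
Hypothesis HE : forall r, 0 < r -> Hx r = H r /\ h1 r = (H^`())%classic r.
Hypothesis HHd : forall r : R, is_derive r 1 HH (Hx r).
Hypothesis Hd : forall r : R, is_derive r 1 Hx (h1 r).
Hypothesis ch1 : continuous h1.
Hypothesis H_lo : forall r, r < e0 -> [/\ Hx r = 0, h1 r = 0 & HH r = HH 0].
Hypothesis H_hi : forall r, K < r -> [/\ Hx r = 0, h1 r = 0 & HH r = 0].
Hypothesis B0 : 0 <= B.
Hypothesis HB : forall r, `|Hx r| <= B.
Hypothesis h1B : forall r, `|h1 r| <= B.
Hypothesis H_om : forall r r', `|r - r'| <= 2 * delta -> `|Hx r ^+ 2 - Hx r' ^+ 2| <= om.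
Hypothesis h1_om : forall r r', `|r - r'| <= 2 * delta -> `|h1 r - h1 r'| <= om1.
Hypothesis alpha01 : 0 < alpha < 1.
Hypothesis e_ge0 : 0 <= e.
Hypothesis psi_mod : forall s s', `|s - s'| <= 10 / (rho L (e0 / 2) * L) -> `|psi delta s - psi delta s'| <= e.
Hypothesis hL : (12 * pi + 40) / (4 * pi * delta) <= delta * L.
Hypothesis e1_ge0 : 0 <= e1.
Hypothesis h1_mod : forall r r', `|r - r'| <= 10 / (rho L e0 * L) -> `|h1 r - h1 r'| <= e1.
Hypothesis C1rho : 4 * exchange_const B m <= rho L e0.
Local Notation b := (n + m.*2.+1 + 2)%N.
Local Notation tail := (tail_coef L K delta (psi delta) Hx alpha).
Local Notation V := (potential T (fun xi => expR (test_field L HH Hx m n xi))).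
Let L0 : 0 < L. Proof. exact: lt_le_trans L1. Qed.
Let T0 : 0 < T. Proof. exact: lt_trans T1. Qed.
Let rho_le : rho L (e0 / 2) <= rho L e0.
Proof. by rewrite ler_expR ler_wpM2l ?(ltW L0)//; move: e0_gt0; lra. Qed.

Definition rate_err : R := (16 * e1 + 18 / (m.*2.+1)%:R * B ^+ 2) * annulus_const K + rate_const B m / rho L e0.

Let H_out r : r < e0 \/ K < r -> Hx r = 0.
Proof. by case=> [/H_lo[]|/H_hi[]]. Qed.
Let h1_out r : r < e0 \/ K < r -> h1 r = 0.
Proof. by case=> [/H_lo[]|/H_hi[]]. Qed.
Let cH : continuous Hx.
Proof.
move=> r; apply: differentiable_continuous; apply/derivable1_diffP.
by have [] := Hd r.
Qed.

Let Qn' : Q0 L K <= n%:R.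
Proof. by apply: le_trans Qn; rewrite ler_expR ler_wpM2l ?(ltW L0)// lerDl. Qed.

Lemma local_weight : local_function (fun xi => expR (test_field L HH Hx m n xi)).
Proof.
apply: local_op1; apply: box_local; exact: (@test_field_dep R L K HH Hx h1 m n L1 H_hi Qn').
Qed.

Lemma weight_lower : exists2 c, 0 < c & forall eta, c <= expR (test_field L HH Hx m n eta).
Proof.
have lf : local_function (test_field L HH Hx m n).
  by apply: box_local; exact: (@test_field_dep R L K HH Hx h1 m n L1 H_hi Qn').
have [M [_ hM]] := continuous_bounded (local_continuous lf).
exists (expR (- M)); first exact: expR_gt0.
by move=> eta; rewrite ler_expR; have := hM eta; rewrite ler_norml => /andP[].
Qed.

(** [spread] enters [potential_rate] with a minus sign, so the upper bound [tint_mobility] goes in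
    the right direction. *)
Lemma drift_spread_tint w :
  - (L^-1 * \sum_(x <- box b) h1 (sgm L x) / nsq R x * occupation w x)
  - 2 * (L^-1 * \sum_(x <- box b) Hx (sgm L x) ^+ 2 / nsq R x *
      (iter m (@avg R) (occupation w) x - iter m (@avg R) (occupation w) x ^+ 2))
  <= L / T * tint V w + rate_err.
Proof.
have cV : continuous V by apply: local_continuous; apply: local_potential; exact: local_weight.
have c0 (a : R) : continuous (fun _ : config => a) by exact: continuous_const.
have cD : continuous (drift L h1 m n).
  apply: continuous_sum => x _; apply: continuous_mul => //; exact: continuous_occ.
have cq x : continuous (fun eta => density R m eta x - density R m eta x ^+ 2).
  by apply: continuous_sub; [|apply: continuous_sqr]; exact: continuous_density.
have cS : continuous (spread L Hx m n).
  by apply: continuous_sum => x _; apply: continuous_mul.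
have tD : tint (drift L h1 m n) w = \sum_(x <- box b) h1 (sgm L x) / nsq R x * occupation w x.
  rewrite /drift tint_sum; last by move=> x _; apply: continuous_mul => //; exact: continuous_occ.
  apply: eq_bigr => x _; rewrite -tint_scale; last exact: continuous_occ.
  by congr (tint _ w); apply/funext => eta; rewrite /occ mulrC.
have tS : tint (spread L Hx m n) w <= \sum_(x <- box b) Hx (sgm L x) ^+ 2 / nsq R x *
      (iter m (@avg R) (occupation w) x - iter m (@avg R) (occupation w) x ^+ 2).
  rewrite /spread tint_sum; last by move=> x _; apply: continuous_mul.
  apply: ler_sum => x _; rewrite tint_scale//; apply: ler_wpM2l; last exact: tint_mobility.
  by rewrite mulr_ge0 ?sqr_ge0// invr_ge0 nsq_ge0.
have key : tint (fun eta => (- L^-1) * drift L h1 m n eta + ((- (2 * L^-1)) * spread L Hx m n eta + - rate_err)) w <=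
   tint (fun eta => L / T * V eta) w.
  apply: tint_mono; first by do !apply: continuous_lin => //.
    by apply: continuous_mul.
  move=> eta; apply: le_trans (potential_rate (ltW T0) L1 B0 HHd Hd HB h1B e0_gt0 e0K H_lo H_hi e1_ge0 h1_mod
    (le_trans Drho rho_le) Qn' C1rho eta T0).
  by rewrite /rate_err; apply: eq_ler; ring.
move: key; rewrite tint_lin//; last by apply: continuous_lin.
rewrite tint_lin// tint_cst tint_scale// tD.
have := ler_wpM2l (_ : 0 <= 2 * L^-1) tS; rewrite mulr_ge0 ?invr_ge0 ?(ltW L0)// => /(_ isT).
move: (\sum_(x <- _) _) (\sum_(x <- _) _) => x1 x2; lra.
Qed.

Lemma W_bound w : W psi alpha H T delta w <= L / T * tint V w +
  tint (fun eta => \sum_(x <- box b) tail x * ((eta x)%:R - alpha)) w +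
  (profile_err L e0 K delta m B om om1 e + rate_err).
Proof.
rewrite (W_radial alpha m T1 L1 e0_gt0 delta01 delta8 e0d psi_cut Qn HE H_out h1_out).
have -> : tint (fun eta => \sum_(x <- box b) tail x * ((eta x)%:R - alpha)) w =
    \sum_(x <- box b) tail x * (occupation w x - alpha).
  have c x : continuous (fun eta : config => 1 * (eta x)%:R + - alpha : R).
    by apply: continuous_lin; [exact: continuous_occ|exact: continuous_const].
  have c' x : continuous (fun eta : config => (eta x)%:R - alpha : R).
    by rewrite (_ : (fun _ => _) = fun eta : config => 1 * (eta x)%:R + - alpha : R)//; apply/funext => eta; rewrite mul1r.
  rewrite tint_sum; last by move=> x _; apply: continuous_mul => //; exact: continuous_const.
  apply: eq_bigr => x _; rewrite tint_scale//; congr (_ * _).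
  rewrite (_ : (fun _ => _) = fun eta : config => 1 * (eta x)%:R + (fun=> - alpha) eta : R); last by apply/funext => eta; rewrite mul1r.
  rewrite tint_lin; [|exact: continuous_occ|exact: continuous_const].
  by rewrite tint_cst mul1r.
have := profile_bound L1 e0_gt0 e0K delta01 delta8 e0d psi_cut Drho Qn cH ch1 H_out h1_out B0 HB h1B H_om h1_om alpha01
  e_ge0 psi_mod hL (@occupation01 _ w) (density01 w m).
move/le_trans; apply.
have := drift_spread_tint w; lra.
Qed.

Variables (P : probability (trajectory R) R) (ell : R).
Hypothesis lawP : exclusion_law T alpha P.
Hypothesis ell1 : 1 <= ell.
Hypothesis err_small : profile_err L e0 K delta m B om om1 e + rate_err <= 4^-1.
Hypothesis L_big1 : 32 * ell * B ^+ 2 <= L ^+ 2.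
Hypothesis L_big2 : 1024 * ell ^+ 2 * B ^+ 4 * annulus_const (K + 1) <= L ^+ 2.

Lemma W_probability :
  (P [set w | (ell <= W psi alpha H T delta w)%R] <= (expR (- ((ell - 1) * (T / L))))%:E)%E.
Proof.
have C40 : 0 <= annulus_const (K + 1).
  have K0 : 0 <= K + 1 by rewrite addr_ge0// (le_trans (ltW e0_gt0)).
  have := mulr_ge0 (pi_ge0 R) K0; rewrite /annulus_const; have := pi_ge0 R; lra.
have eL : expR L = T by rewrite lnK// posrE.
have l0 : 0 <= ell by exact: le_trans ell1.
pose q := T / L; have q0 : 0 <= q by rewrite divr_ge0// ltW.
(* T = exp L >= (1 + L/2)^2 >= 2 L. At the end exp (q/2) >= 1 + q/2 >= 2 absorbs the union of two
   events. *)
have q2 : 2 <= q.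
  rewrite ler_pdivlMr// -[leRHS]eL (_ : expR L = expR (L / 2) ^+ 2); last first.
    by rewrite -expRM_natl; congr expR; field.
  have h := expR_ge1Dx (L / 2).
  apply: (@le_trans _ _ ((1 + L / 2) ^+ 2)).
    by rewrite -subr_ge0 (_ : _ - _ = (1 - L / 2) ^+ 2); [exact: sqr_ge0|field].
  by rewrite ler_sqr ?nnegrE ?expR_ge0// addr_ge0// divr_ge0// ltW.
(* Chosen so that the level 1/4 of the tail becomes [ell * q]. The exponential moment then costs at
   most q/2, which leaves the exponent (ell - 1/2) q. *)
pose th := 4 * ell * q; have th0 : 0 <= th by exact: mulr_ge0 (mulr_ge0 (ler0n _ _) l0) q0.
pose X := fun eta : config => \sum_(x <- box b) (th * tail x) * ((eta x)%:R - alpha).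
have cX0 : continuous (fun eta : config => \sum_(x <- box b) tail x * ((eta x)%:R - alpha) : R).
  apply: local_continuous; apply: local_sum => x _; exact: (local_coord x (fun c => tail x * (c%:R - alpha))).
have cX : continuous X.
  apply: local_continuous; apply: local_sum => x _; exact: (local_coord x (fun c => th * tail x * (c%:R - alpha))).
have cV : continuous V by apply: local_continuous; apply: local_potential; exact: local_weight.
pose A1 := [set w | ((ell - 2^-1) * q <= tint V w)%R]; pose A2 := [set w | (ell * q <= tint X w)%R].
have mA1 : measurable A1 by apply: measurable_superlevel; have [] := bmeas_tint P cV.
have mA2 : measurable A2 by apply: measurable_superlevel; have [] := bmeas_tint P cX.
have P1 : (P A1 <= (expR (- ((ell - 2^-1) * q)))%:E)%E.
  have [c c0 hc] := weight_lower.
  exact: (potential_bound (ltW T0) lawP ((ell - 2^-1) * q) local_weight c0 hc).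
have tl x := tail_coef_le L1 e0_gt0 e0K delta01 delta8 e0d psi_cut cH H_out B0 HB alpha01 x.
have ts := tail_coef_sum n L1 e0_gt0 e0K delta01 delta8 e0d psi_cut Drho cH H_out B0 HB alpha01.
rewrite eL in ts; have Ln0 := lt0r_neq0 L0; have Tn0 := lt0r_neq0 T0.
have P2 : (P A2 <= (expR (- ((ell - 2^-1) * q)))%:E)%E.
  have hb x : x \in box b -> `|th * tail x| <= 2^-1.
    move=> _; rewrite normrM (ger0_norm th0); have [h _] := tl x; rewrite eL in h.
    apply: (le_trans (ler_wpM2l th0 h)).
    rewrite (_ : th * _ = 32 * ell * B ^+ 2 / L ^+ 2 / 2); last by rewrite /th /q; field; rewrite Ln0 Tn0.
    by rewrite ler_pdivrMr// mulVf// ler_pdivrMr ?mul1r// exprn_gt0.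
  apply: (le_trans (linear_bound (ltW T0) alpha01 lawP (ell * q) (box_uniq _) hb)).
  rewrite lee_fin -expRD ler_expR.
  have -> : \sum_(x <- box b) (th * tail x) ^+ 2 = th ^+ 2 * \sum_(x <- box b) tail x ^+ 2.
    by rewrite mulr_sumr; apply: eq_bigr => x _; rewrite exprMn.
  have h2 := ler_wpM2l (sqr_ge0 th) ts.
  have e2 : th ^+ 2 * (16 * B ^+ 4 * annulus_const (K + 1) / (L * T)) = 1024 * ell ^+ 2 * B ^+ 4 * annulus_const (K + 1) / L ^+ 2 * (q / 4).
    by rewrite /th /q; move: (annulus_const (K + 1)) => c; field; rewrite Ln0 Tn0.
  have h3 : 1024 * ell ^+ 2 * B ^+ 4 * annulus_const (K + 1) / L ^+ 2 * (q / 4) <= q / 4.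
    move: L_big2; move: (1024 * ell ^+ 2 * B ^+ 4 * annulus_const (K + 1)) => Z hZ.
    apply: ler_piMl; first by rewrite divr_ge0.
    by rewrite ler_pdivrMr ?mul1r// exprn_gt0.
  rewrite e2 in h2; move: (le_trans h2 h3).
  move: (_ * \sum_(x <- _) _) => S; lra.
have sub : [set w | (ell <= W psi alpha H T delta w)%R] `<=` A1 `|` A2.
  move=> w /= hw; have hW := W_bound w.
  have tX : tint X w = th * tint (fun eta => \sum_(x <- box b) tail x * ((eta x)%:R - alpha)) w.
    rewrite -tint_scale//; congr (tint _ w); apply/funext => eta; rewrite /X mulr_sumr.
    by apply: eq_bigr => x _; rewrite mulrA.
  case: (leP ((ell - 2^-1) * q) (tint V w)) => hV; [by left|right].
  have hLV : L / T * tint V w <= ell - 2^-1.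
    rewrite (_ : ell - 2^-1 = L / T * ((ell - 2^-1) * q)); last by rewrite /q; field; rewrite Ln0 Tn0.
    by rewrite ler_wpM2l ?(ltW hV)// divr_ge0// ltW.
  rewrite /A2 /= tX /th (_ : ell * q = 4 * ell * q * 4^-1); last by field.
  apply: ler_wpM2l; first exact: th0.
  move: hLV hW hw err_small; move: (L / T * tint V w) (tint _ w) (W _ _ _ _ _ w) (_ + rate_err) => v1 v2 v3 v4; lra.
have mW : measurable [set w | (ell <= W psi alpha H T delta w)%R].
  apply: measurable_superlevel.
  exact: (W_measurable alpha m T1 L1 e0_gt0 e0K delta01 delta8 e0d psi_cut Qn HE H_out h1_out cH ch1 HB h1B P).
apply: (@le_trans _ _ (P (A1 `|` A2))).
  by apply: le_measure; rewrite ?inE//; exact: measurableU.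
apply: (@le_trans _ _ (P A1 + P A2)%E); first exact: measureU2.
apply: (le_trans (leeD P1 P2)); rewrite -EFinD lee_fin.
rewrite (_ : - ((ell - 1) * q) = - ((ell - 2^-1) * q) + q / 2); last by field.
rewrite [leRHS]expRD (_ : _ + _ = expR (- ((ell - 2^-1) * q)) * 2); last by ring.
rewrite ler_wpM2l ?expR_ge0//.
apply: le_trans (expR_ge1Dx _); lra.
Qed.

End upper_bound.

Lemma limf_esup_le (R : realType) (f : R -> \bar R) (F : set_system R) (c : \bar R) :
  (\forall x \near F, (f x <= c)%E) -> (limf_esup f F <= c)%E.
Proof.
move=> h; apply: (@le_trans _ _ (ereal_sup (f @` [set x | (f x <= c)%E]))).
  by apply: ereal_inf_lbound; exists [set x | (f x <= c)%E].
by apply: ge_ereal_sup => _ [x /= hx <-].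
Qed.

(** * Choice of the parameters *)

Section eventually_large.
Variable R : realType.

Lemma ln_large (c : R) : \forall T \near +oo, c <= ln T.
Proof.
near=> T; have hT : expR c <= T by near: T; exact: nbhs_pinfty_ge.
by rewrite -[c]expRK ler_ln// posrE ?expR_gt0// (lt_le_trans (expR_gt0 c)).
Unshelve. all: by end_near. Qed.

Lemma rho_large (a c : R) : 0 < a -> \forall T \near +oo, c <= rho (ln T) a.
Proof.
move=> a0; near=> T; have hT : c / a <= ln T by near: T; exact: ln_large.
apply: (@le_trans _ _ (ln T * a)); first by rewrite -ler_pdivrMr.
by apply: le_trans (expR_ge1Dx _); rewrite lerDr.
Unshelve. all: by end_near. Qed.

Lemma odd_large (c : R) : exists m : nat, c <= 16^-1 * (m.*2.+1)%:R.
Proof.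
exists (Num.truncn (16 * c)).+1; set k := (Num.truncn _).+1.
have h : 16 * c < k%:R by exact: truncnS_gt.
have : k%:R <= (k.*2.+1)%:R :> R by rewrite ler_nat -addnn ltnW// ltnS leq_addr.
lra.
Qed.

Lemma small_multiple (a c : R) : 0 <= a -> 0 < c -> exists2 e, 0 < e & a * e <= c.
Proof.
move=> a0 c0; exists (c / (a + 1)); first by rewrite divr_gt0// ltr_wpDl.
by rewrite mulrA ler_pdivrMr ?ltr_wpDl// mulrC ler_wpM2l ?(ltW c0)// lerDl.
Qed.

Lemma cutoff_modulus (delta e : R) psi : 0 < delta < 1 -> cutoff delta psi -> 0 < e ->
  exists2 d, 0 < d & forall x y, `|x - y| <= d -> `|psi x - psi y| <= e.
Proof.
move=> d01 pc e_gt0; have /andP[delta0 _] := d01.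
apply: (@uniform_modulus _ _ (- (2 * delta)) (2 * delta)) => //; first by case: pc.
by move=> x [hx|hx]; rewrite (psi_out d01 pc)//; [rewrite ltr0_norm|rewrite gtr0_norm]; lra.
Qed.

End eventually_large.

Lemma profile_err_le (R : realType) (L e0 K delta B om om1 e M eta : R) (m : nat) :
  0 <= K + 1 -> 0 <= B -> 0 <= eta -> 0 <= annulus_const (K + 1) ->
  M = 6 * annulus_const (K + 1) + B * annulus_const (K + 1) + 2 * B ^+ 2 * annulus_const (K + 1) + 8 * pi * B ^+ 2 + 24 * pi * (B ^+ 2 * (K + 1)) ->
  om <= eta -> om1 <= eta -> delta <= eta -> smooth_err L e0 K delta e m <= eta ->
  profile_err L e0 K delta m B om om1 e <= M * eta.
Proof.
move=> K1 B0 eta0 C40 -> om_le om1_le d_le se_le; rewrite /profile_err.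
have p0 := pi_ge0 R; have B2 : 0 <= B ^+ 2 by rewrite sqr_ge0.
move: (smooth_err _ _ _ _ _ _) se_le => s sle.
move: (annulus_const (K + 1)) C40 => C C40.
have BC : 0 <= B * C by rewrite mulr_ge0.
have B2C : 0 <= B ^+ 2 * C by rewrite mulr_ge0.
have pB : 0 <= pi * B ^+ 2 by rewrite mulr_ge0.
have pBK : 0 <= pi * (B ^+ 2 * (K + 1)) by rewrite !mulr_ge0.
have h1 := ler_wpM2l C40 om1_le; have h2 := ler_wpM2l C40 om_le.
have h3 := ler_wpM2l BC d_le; have h4 := ler_wpM2l B2C d_le.
have h5 := ler_wpM2l pB d_le; have h6 := ler_wpM2l pBK d_le; have h7 := ler_wpM2l pBK sle.
rewrite -subr_ge0; rewrite -subr_ge0 in h1 h2 h3 h4 h5 h6 h7.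
apply: le_trans (_ : 2 * (C * eta - C * om1) + 4 * (C * eta - C * om) + (B * C * eta - B * C * delta) +
  2 * (B ^+ 2 * C * eta - B ^+ 2 * C * delta) + 8 * (pi * B ^+ 2 * eta - pi * B ^+ 2 * delta) +
  16 * (pi * (B ^+ 2 * (K + 1)) * eta - pi * (B ^+ 2 * (K + 1)) * delta) +
  8 * (pi * (B ^+ 2 * (K + 1)) * eta - pi * (B ^+ 2 * (K + 1)) * s) <= _); last first.
  by apply: eq_ler; move: (pi : R) => p; ring.
lra.
Qed.

Section deviations.
Variables (R : realType) (alpha : R) (P : R -> probability (trajectory R) R) (psi : R -> R -> R) (H : R -> R) (ell : R).
Hypothesis alpha01 : 0 < alpha < 1.
Hypothesis P_law : forall T, 1 < T -> exclusion_law T alpha (P T).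
Hypothesis psi_cutoff : forall delta, 0 < delta < 1 -> cutoff delta (psi delta).
Hypothesis H_C1K : C1K H.
Hypothesis ell1 : 1 <= ell.

Lemma W_deviation : \forall delta \near 0^'+, \forall T \near +oo,
  (P T [set w | (ell <= W psi alpha H T delta w)%R] <= (expR (- ((ell - 1) * (T / ln T))))%:E)%E.
Proof.
have [e0 [K [HH [Hx [h1 [/andP[e0_gt0 e0K] HE [HHd Hd] ch1 [H_lo H_hi]]]]]]] := C1K_extension H_C1K.
have cH : continuous Hx.
  move=> r; apply: differentiable_continuous; apply/derivable1_diffP.
  by have [] := Hd r.
have K0 : 0 < K by exact: lt_le_trans e0K.
have K1 : 0 <= K + 1 by rewrite addr_ge0// ltW.
have H_out r : r < e0 \/ K < r -> Hx r = 0 by case=> [/H_lo[]|/H_hi[]].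
have h1_out r : r < e0 \/ K < r -> h1 r = 0 by case=> [/H_lo[]|/H_hi[]].
have cG : continuous (fun r => Hx r ^+ 2).
  move=> r; apply: (@continuous_comp _ _ _ Hx (fun y => y ^+ 2)); first exact: cH.
  exact: exprn_continuous.
have G_out r : r < e0 \/ K < r -> Hx r ^+ 2 = 0 by move=> h; rewrite H_out// expr0n.
have sum4 (a b c d f : R) : a <= b -> b + c <= 16^-1 -> d <= 16^-1 -> f <= 16^-1 -> a + (c + d + f) <= 4^-1.
  by lra.
have [B1 B10 HB1] := support_bounded cH H_out.
have [B2 B20 HB2] := support_bounded ch1 h1_out.
pose B := B1 + B2; have B0 : 0 <= B by exact: addr_ge0.
have HB r : `|Hx r| <= B by rewrite (le_trans (HB1 r))// lerDl.
have h1B r : `|h1 r| <= B by rewrite (le_trans (HB2 r))// lerDr.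
have annulus_const_ge0 k : 0 <= k -> 0 <= annulus_const k :> R.
  by move=> k0; have := mulr_ge0 (pi_ge0 R) k0; rewrite /annulus_const; have := pi_ge0 R; lra.
have CK := annulus_const_ge0 K (ltW K0); have CK1 := annulus_const_ge0 (K + 1) K1.
pose M := 6 * annulus_const (K + 1) + B * annulus_const (K + 1) + 2 * B ^+ 2 * annulus_const (K + 1) + 8 * pi * B ^+ 2 + 24 * pi * (B ^+ 2 * (K + 1)).
have M0 : 0 <= M.
  have p0 := pi_ge0 R; have BB : 0 <= B ^+ 2 by rewrite sqr_ge0.
  have a1 := mulr_ge0 B0 CK1; have a2 := mulr_ge0 BB CK1; have a3 := mulr_ge0 p0 BB.
  have a4 := mulr_ge0 p0 (mulr_ge0 BB K1); rewrite /M; move: (annulus_const (K + 1)) CK1 a1 a2 => C *; lra.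
(* The common bound for delta, the moduli and [smooth_err]. Their total contribution is at most
   1/16; two more shares of 1/16 go to the error in 1 / (2 m + 1) and to [rate_const / rho]. *)
pose eta := (16 * (M + 16 * annulus_const K + 1))^-1.
have eta0 : 0 < eta by rewrite invr_gt0 mulr_gt0//; move: M0 CK; lra.
have Meta : M * eta + 16 * eta * annulus_const K <= 16^-1.
  rewrite (_ : _ + _ = (M + 16 * annulus_const K) * eta); last by ring.
  rewrite /eta invfM mulrCA ler_piMr// ler_pdivrMr ?mul1r; move: M0 CK; lra.
have [d1 d10 hd1] := uniform_modulus ch1 h1_out eta0.
have [d2 d20 hd2] := uniform_modulus cG G_out eta0.
near=> delta.
have delta0 : 0 < delta by near: delta; exact: nbhs_right_gt.
have delta_eta : delta <= eta by near: delta; exact: nbhs_right_le.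
have delta_1 : delta <= d1 / 2 by near: delta; apply: nbhs_right_le; rewrite divr_gt0.
have delta_2 : delta <= d2 / 2 by near: delta; apply: nbhs_right_le; rewrite divr_gt0.
have delta_e : delta <= e0 / 8 by near: delta; apply: nbhs_right_le; rewrite divr_gt0.
have delta_8 : delta <= 8^-1 by near: delta; apply: nbhs_right_le; rewrite invr_gt0.
have delta01 : 0 < delta < 1 by rewrite delta0 (le_lt_trans delta_8)// invf_lt1// ltr1n.
have delta8 : 8 * delta <= 1 by rewrite mulrC -ler_pdivlMr// div1r.
have e0d : 8 * delta <= e0 by rewrite mulrC -ler_pdivlMr.
have pc := psi_cutoff delta01.
(* The number of averaging steps is fixed before T, then the modulus [e] of [psi delta], which
   [smooth_err] multiplies by m. *)
have [m hm] : exists m : nat, 18 * B ^+ 2 * annulus_const K <= 16^-1 * (m.*2.+1)%:R.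
  exact: odd_large.
have [e e_gt0 me] : exists2 e, 0 < e & m%:R * annulus_const (K + 1) * e <= eta / 2.
  by apply: small_multiple; [exact: mulr_ge0|exact: divr_gt0].
have [dp dp0 hdp] := cutoff_modulus delta01 pc e_gt0.
have delta_1' : 2 * delta <= d1 by rewrite mulrC -ler_pdivlMr.
have delta_2' : 2 * delta <= d2 by rewrite mulrC -ler_pdivlMr.
have e02 : 0 < e0 / 2 by rewrite divr_gt0.
near=> T.
have T1 : 1 < T by near: T; exact: nbhs_pinfty_gt.
have L1 : 1 <= ln T by near: T; exact: ln_large.
have rD : 32 * (m.*2.+2)%:R <= rho (ln T) (e0 / 2) by near: T; exact: rho_large.
have rs : m%:R * (480 / delta) / (eta / 2) <= rho (ln T) (e0 / 2) by near: T; exact: rho_large.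
have rp : 10 / dp <= rho (ln T) (e0 / 2) by near: T; exact: rho_large.
have r1 : 10 / d1 <= rho (ln T) e0 by near: T; exact: rho_large.
have rC : 4 * exchange_const B m <= rho (ln T) e0 by near: T; exact: rho_large.
have rC7 : 16 * rate_const B m <= rho (ln T) e0 by near: T; exact: rho_large.
have hL : (12 * pi + 40) / (4 * pi * delta) / delta <= ln T by near: T; exact: ln_large.
have big1 : 32 * ell * B ^+ 2 <= ln T by near: T; exact: ln_large.
have big2 : 1024 * ell ^+ 2 * B ^+ 4 * annulus_const (K + 1) <= ln T by near: T; exact: ln_large.
have LL : ln T <= ln T ^+ 2 by rewrite expr2 ler_peMl// (le_trans _ L1).
(* The bounds do not depend on the radius of the box, which may therefore grow with T. *)
pose n := (Num.truncn (Q0 (ln T) (K + 1))).+1.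
have Qn : Q0 (ln T) (K + 1) <= n%:R by apply: ltW; exact: truncnS_gt.
have rg a : 0 < rho (ln T) a by exact: expR_gt0.
have mod_le (d a : R) : 0 < d -> 10 / d <= rho (ln T) a -> 10 / (rho (ln T) a * ln T) <= d.
  move=> d_gt0 h; rewrite ler_pdivrMr ?mulr_gt0// ?(lt_le_trans ltr01)//.
  move: h; rewrite ler_pdivrMr// => h; apply: (le_trans h); rewrite mulrC ler_wpM2l ?(ltW d_gt0)//.
  by rewrite ler_peMr// ltW.
have se : smooth_err (ln T) e0 K delta e m <= eta.
  rewrite /smooth_err mulrDr (_ : eta = eta / 2 + eta / 2); last by field.
  apply: lerD; last by rewrite [e * _]mulrC mulrA.
  rewrite (_ : m%:R * _ = m%:R * (480 / delta) / rho (ln T) (e0 / 2)).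
    by rewrite ler_pdivrMr// [eta / 2 * _]mulrC -ler_pdivrMr ?divr_gt0.
  by move: (rho _ _) (rg (e0 / 2)) => r r0; field; rewrite !lt0r_neq0.
have hm' : 18 / (m.*2.+1)%:R * B ^+ 2 * annulus_const K <= 16^-1.
  by rewrite (_ : _ * _ * _ = 18 * B ^+ 2 * annulus_const K / (m.*2.+1)%:R) ?ler_pdivrMr//; ring.
have h7 : rate_const B m / rho (ln T) e0 <= 16^-1.
  by rewrite ler_pdivrMr// -ler_pdivrMl ?invr_gt0// invrK.
apply: (@W_probability R T alpha e0 K delta psi H HH Hx h1 m n B eta eta e eta) => //.
- by move=> r r' hr; apply: hd2; exact: le_trans delta_2'.
- by move=> r r' hr; apply: hd1; exact: le_trans delta_1'.
- exact: ltW.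
- by move=> s s' hs; apply: hdp; apply: (le_trans hs); exact: mod_le.
- by rewrite [delta * _]mulrC -ler_pdivrMr.
- exact: ltW.
- by move=> s s' hs; apply: hd1; apply: (le_trans hs); exact: mod_le.
- exact: P_law.
- have := @profile_err_le R (ln T) e0 K delta B eta eta e M eta m K1 B0 (ltW eta0) CK1 erefl (lexx _) (lexx _) delta_eta se.
  by move=> h; rewrite /rate_err mulrDl; apply: (sum4 _ _ _ _ _ h).
- exact: le_trans big1 LL.
- exact: le_trans big2 LL.
Unshelve. all: by end_near. Qed.

End deviations.

Theorem corollary4p3 (R : realType) (alpha : R)
    (P : R -> probability (trajectory R) R) (psi : R -> R -> R) (H : R -> R)
    (ell : R)
    (alpha01 : 0 < alpha < 1)
    (P_law : forall T, 1 < T -> exclusion_law T alpha (P T))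
    (psi_cutoff : forall delta, 0 < delta < 1 -> cutoff delta (psi delta))
    (H_C1K : C1K H)
    (ell_ge1 : 1 <= ell) :
  (limf_esup (fun delta : R =>
      limf_esup (fun T : R =>
          (ln T / T)%:E *
          lne (P T [set w | (ell <= W psi alpha H T delta w)%R]))
        +oo%R)
    0^'+ <= (- (ell - 1))%:E)%E.
Proof.
apply: limf_esup_le.
apply: filterS (W_deviation alpha01 P_law psi_cutoff H_C1K ell_ge1) => delta hd.
apply: limf_esup_le; near=> T.
have T1 : 1 < T by near: T; exact: nbhs_pinfty_gt.
have L0 : 0 < ln T by rewrite ln_gt0.
have T0 : 0 < T by exact: lt_trans T1.
have : (P T [set w | (ell <= W psi alpha H T delta w)%R] <= (expR (- ((ell - 1) * (T / ln T))))%:E)%E.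
  by near: T.
set p := P T _ => hp.
have p0 : (0 <= p)%E by exact: measure_ge0.
have pe : p = (fine p)%:E by rewrite fineK// ge0_fin_numE// (le_lt_trans hp)// ltry.
rewrite pe; rewrite pe lee_fin in hp; rewrite pe lee_fin in p0.
(* A null event has logarithm -oo. *)
have [p00|p_gt0] := leP (fine p) 0.
  by rewrite le0_lneNy ?lee_fin// gt0_muleNy ?leNye// lte_fin divr_gt0.
rewrite lne_EFin// -EFinM lee_fin.
have h : ln (fine p) <= - ((ell - 1) * (T / ln T)).
  by rewrite -[leRHS]expRK ler_ln// posrE expR_gt0.
apply: (le_trans (ler_wpM2l _ h)); first by rewrite divr_ge0// ltW.
by apply: eq_ler; field; rewrite !lt0r_neq0.
Unshelve. all: by end_near. Qed.
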